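(* There is an algorithm which, given $0<\alpha<1/2$, $d\in\mathbb{Z}_+$, a failure probability $\tau>0$, and a multiset $T$ of $O\big((d!)^2\, n^{4d}\log(1/\tau)/\alpha^7\big)$ points in $\mathbb{R}^n$ of which at least a $2\alpha$-fraction are independent samples from a Gaussian $G\sim N(\mu,I)$ with unknown $\mu\in\mathbb{R}^n$ (the remaining points being arbitrary), runs in time $(n d\log(1/\tau)/\alpha)^{O(d)}$ and returns a list of $O(1/\alpha)$ points in $\mathbb{R}^n$ such that, with probability at least $1-\tau$, the list contains a point $x$ with $$\|x-\mu\|_2=O\Big(\alpha^{-1/(2d)}\sqrt{d}\,(d+\log(1/\alpha))\,\log(2+\log(1/\alpha))^2\Big).$$
   Context: $N(\mu,I)$ denotes the $n$-dimensional Gaussian with mean $\mu$ and identity covariance. The points of $T$ that are not samples from $G$ may be chosen by an adversary who can inspect the good samples. *)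

(* Defs.v *)
From mathcomp Require Export all_boot all_order all_algebra.
From mathcomp Require Export all_classical all_reals all_analysis.

Set Implicit Arguments.
Unset Strict Implicit.
Unset Printing Implicit Defensive.

Export Order.TTheory GRing.Theory Num.Theory.
Export numFieldNormedType.Exports.

Global Open Scope classical_set_scope.
Global Open Scope ring_scope.

(** * A randomized real RAM

    A program is a closed piece of syntax: one program handles all inputs, of
    all dimensions.  The machine has two unbounded memories, one of natural
    numbers and one of exact real numbers, both indirectly addressable.
    The only real constants are the natural numbers, and there is no
    conversion (floor, truncation) from reals to naturals, so real numbers
    influence the control flow only through comparisons.  Natural-number
    arithmetic is limited to addition and truncated subtraction. *)

Inductive nexp : Type :=
| NConst of nat
| NLoad of nexp
| NAdd of nexp & nexp
| NSub of nexp & nexp.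

Inductive rexp : Type :=
| RNat of nexp
| RLoad of nexp
| RAdd of rexp & rexp
| RSub of rexp & rexp
| RMul of rexp & rexp
| RDiv of rexp & rexp.

Inductive bexp : Type :=
| BLtN of nexp & nexp
| BLtR of rexp & rexp
| BNot of bexp
| BAnd of bexp & bexp.

Inductive cmd : Type :=
| Skip
| SetN of nexp & nexp (* SetN a e : store the natural e at address a *)
| SetR of nexp & rexp
| Flip of nexp        (* Flip a : store a fresh fair coin (0 or 1) at address a *)
| Seq of cmd & cmd
| If of bexp & cmd & cmd
| While of bexp & cmd.

Section semantics.
Variable R : realType.

Record state := State {
  nats : nat -> nat;
  reals : nat -> R;
  coins : nat -> bool (* the coins not tossed yet; accessible only to [Flip] *)
}.

Fixpoint neval (s : state) (e : nexp) : nat :=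
  match e with
  | NConst k => k
  | NLoad a => nats s (neval s a)
  | NAdd e1 e2 => (neval s e1 + neval s e2)%N
  | NSub e1 e2 => (neval s e1 - neval s e2)%N
  end.

Fixpoint reval (s : state) (e : rexp) : R :=
  match e with
  | RNat k => (neval s k)%:R
  | RLoad a => reals s (neval s a)
  | RAdd e1 e2 => reval s e1 + reval s e2
  | RSub e1 e2 => reval s e1 - reval s e2
  | RMul e1 e2 => reval s e1 * reval s e2
  | RDiv e1 e2 => reval s e1 / reval s e2
  end.

Fixpoint beval (s : state) (b : bexp) : bool :=
  match b with
  | BLtN e1 e2 => (neval s e1 < neval s e2)%N
  | BLtR e1 e2 => reval s e1 < reval s e2
  | BNot b1 => ~~ beval s b1
  | BAnd b1 b2 => beval s b1 && beval s b2
  end.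

Definition upd (T : Type) (m : nat -> T) (a : nat) (v : T) : nat -> T :=
  fun k => if k == a then v else m k.

(** [exec c s t s'] : from [s], the command [c] halts in [s'] after [t] steps.
    Each elementary command and each evaluation of a test is one step; since
    the expressions of a program have bounded size, this is the number of
    machine operations up to a factor depending only on the program. *)
Inductive exec : cmd -> state -> nat -> state -> Prop :=
| exec_skip s : exec Skip s 1 s
| exec_setn a e s :
    exec (SetN a e) s 1
      (State (upd (nats s) (neval s a) (neval s e)) (reals s) (coins s))
| exec_setr a e s :
    exec (SetR a e) s 1
      (State (nats s) (upd (reals s) (neval s a) (reval s e)) (coins s))
| exec_flip a s :
    exec (Flip a) s 1
      (State (upd (nats s) (neval s a) (nat_of_bool (coins s 0%N))) (reals s)
             (fun k => coins s k.+1))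
| exec_seq c1 c2 s s1 s2 t1 t2 :
    exec c1 s t1 s1 -> exec c2 s1 t2 s2 -> exec (Seq c1 c2) s (t1 + t2)%N s2
| exec_if b c1 c2 s t s' :
    exec (if beval s b then c1 else c2) s t s' -> exec (If b c1 c2) s t.+1 s'
| exec_while_stop b c s :
    ~~ beval s b -> exec (While b c) s 1 s
| exec_while_step b c s s1 s2 t1 t2 :
    beval s b -> exec c s t1 s1 -> exec (While b c) s1 t2 s2 ->
    exec (While b c) s (t1 + t2).+1 s2.

(** The input is [n], [d], the number of points, [alpha], [tau], and the
    coordinates of the points of [T], in the order in which they are listed. *)
Definition input (n d : nat) (alpha tau : R) (T : seq 'rV[R]_n)
    (w : nat -> bool) : state :=
  State (nth 0%N [:: n; d; size T])
        (nth 0 [:: alpha, tau &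
                   flatten [seq [seq x ord0 j | j : 'I_n] | x : 'rV[R]_n <- T]])
        w.

(** The output is a list of points: its length is in the natural-number cell 0,
    and the coordinates of the points are in the first real cells. *)
Definition output (n : nat) (s : state) : seq 'rV[R]_n :=
  [seq \row_(j < n) reals s (i * n + j)%N | i <- iota 0 (nats s 0%N)].

Definition returns (c : cmd) (n d : nat) (alpha tau : R) (T : seq 'rV[R]_n)
    (w : nat -> bool) (t : nat) (L : seq 'rV[R]_n) : Prop :=
  exists2 s, exec c (input d alpha tau T w) t s & L = output n s.

(** Probability, over [b] independent fair coins, that the program halts on the
    given input with an output satisfying [good].  When no run takes more
    than [b] steps, the coins beyond the first [b] are never used. *)
Definition coin_prob (c : cmd) (n d : nat) (alpha tau : R) (T : seq 'rV[R]_n)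
    (b : nat) (good : seq 'rV[R]_n -> Prop) : R :=
  #|[set w : b.-tuple bool |
      `[< exists t L, returns c d alpha tau T (nth false w) t L /\ good L >]]%SET
   |%:R / 2 ^+ b.

End semantics.

Section gaussian.
Variable R : realType.

(* the canonical norm of the library on ['rV_n] is the sup norm *)
Definition norm2 (n : nat) (x : 'rV[R]_n) : R :=
  Num.sqrt (\sum_(j < n) x ord0 j ^+ 2).

Definition borel_rV (n : nat) : set (set 'rV[R]_n) :=
  <<s [set A : set 'rV[R]_n | open A] >>.

Context (dO : measure_display) (Omega : measurableType dO).
Variable P : probability Omega R.

Definition random_vector (n : nat) (Y : Omega -> 'rV[R]_n) : Prop :=
  forall A, borel_rV A -> measurable (Y @^-1` A).

(** [Y ~ N(mu, I)] : the law of [Y] is the product of the laws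
    [N(mu_j, 1)]; it is determined by its values on boxes.
    The second parameter of [normal_prob] is the standard deviation. *)
Definition gaussian_id (n : nat) (mu : 'rV[R]_n) (Y : Omega -> 'rV[R]_n) : Prop :=
  random_vector Y /\
  forall A : 'I_n -> set R, (forall j, measurable (A j)) ->
    P [set w | forall j, A j (Y w ord0 j)] =
    (\prod_(j < n) normal_prob (mu ord0 j) 1 (A j))%E.

Definition mutually_independent (n m : nat) (X : 'I_m -> Omega -> 'rV[R]_n) : Prop :=
  forall (J : {set 'I_m}) (B : 'I_m -> set 'rV[R]_n),
    (forall i, i \in J -> borel_rV (B i)) ->
    P [set w | forall i, i \in J -> B i (X i w)] =
    (\prod_(i in J) P (X i @^-1` B i))%E.

Definition gaussian_samples (n m : nat) (mu : 'rV[R]_n)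
    (X : 'I_m -> Omega -> 'rV[R]_n) : Prop :=
  (forall i, gaussian_id mu (X i)) /\ mutually_independent X.

End gaussian.

Section bounds.
Variable R : realType.

(** [log(1/tau)], which as usual in asymptotic bounds is understood to be
    bounded away from 0: it is [ln (1/tau)] for [tau <= 1/2] and [ln 2] for
    larger [tau]. *)
Definition log_inv (tau : R) : R := ln (Num.max 2 tau^-1).

Definition sample_scale (n d : nat) (alpha tau : R) : R :=
  (d`!)%:R ^+ 2 * n%:R ^+ (4 * d) * log_inv tau / alpha ^+ 7.

Definition time_base (n d : nat) (alpha tau : R) : R :=
  n%:R * d%:R * log_inv tau / alpha.

Definition error_scale (d : nat) (alpha : R) : R :=
  alpha `^ (- (2 * d%:R)^-1) * Num.sqrt d%:R * (d%:R + ln alpha^-1)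
  * ln (2 + ln alpha^-1) ^+ 2.

End bounds.

(* Submission.v *)
(** The algorithm is deterministic.  Write [D = 2d] and call a symmetric tensor
    [L] of order [2D] valid if its trace is at most 2 and the associated
    quadratic form on tensors of order [D] is at least [-n^-D].  Then
    [q_L(x) = <L, x^(2D)> + 2 n^-D |x|^(2D)] is nonnegative and
    [Q_L(x,y) = q_L(x-y)] satisfies a triangle inequality up to the factor
    [16^D]; by integration by parts, the mean of [q_L(x - mu)] over a set of
    samples is at most [(68 D)^D] as soon as the moment tensor of order [2D] of
    these samples is close to that of the Gaussian.

    A cluster is a weight [w] on the input points.  A relaxation (perceptron)
    method on [L] either certifies that the moment
    [sum w(x) w(y) <v, x-y>^(2D)] is small for every unit vector [v], or
    produces a valid [L] for which the mean of [Q_L] is large.  In the first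
    case the mean of the cluster is a candidate, since a subset of
    relative weight [alpha/8] has its mean at distance [O(alpha^(-1/2D))], up
    to the other factors, from that of the cluster.  In the second case, one
    looks at the masses of the balls of geometrically growing radii around a
    dense point: some radius allows either to split the cluster into two
    overlapping clusters, with [a^p + b^p <= m^p] for their masses, or to
    filter, that is, to lower the weights of far points; in both cases
    some branch keeps almost all the good samples.  The potential
    [sum (mass^p * support)] decreases, which bounds the running time.

    The good samples are cut into about [log(1/tau)] blocks.  With
    probability at least [1 - tau] most blocks have nearly Gaussian moment
    tensors, and the union of these blocks is the set of good samples that the
    deterministic analysis needs. *)

Require Import Defs.
From mathcomp Require Import finmap measurable_realfun.
From mathcomp Require Import zify ring lra.

Set Implicit Arguments.
Unset Strict Implicit.
Unset Printing Implicit Defensive.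

(** * A high-level language and its compilation to the machine *)

Arguments upd : simpl never.

(** The final rate dictates the constants. The analysis bounds the [2 D]-th power of the distance by
    [al ^ -2 (lam + 5) ^ (2 D) (C D) ^ D], where [lam] is about [log (1 / al)]; since [D = 2 d], the
    root turns [al ^ -2] into [alpha ^ (-1 / (2 d))]. Each use of the triangle inequality costs
    [Th = 16 ^ D] and [K = 2 kap + 1] radii are needed, so [(Th * Th) ^ K] must stay below a power
    [O(D)] of [lam]. Hence [kap] has to be a small multiple of [log lam], which is achieved by an
    exponent [p] of the potential as large as [16 ^ 3]; the running time pays only a constant power
    of [1 / al] for it. The machine is exact but has neither roots nor eigenvalues. Thanks to the
    slack [eps = n ^ -D] in the positivity of [L], each violated constraint yields a correction that
    brings [L] closer, by at least [eps ^ 2] in squared distance, to [v ^ (2 D)] for every unit [v]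
    of large moment. The initial squared distance is 1, so no such [v] survives [n ^ (2 D) + 1]
    rounds. The same slack is why the quasi-metric contains a multiple of the Euclidean one. *)

Inductive rop := ROadd | ROsub | ROmul | ROdiv.

(** The Boolean is the sort, [true] for reals and [false] for naturals. Bounded sums, products and
    searches are expressions, so that mathematical formulas can be programmed verbatim; every loop
    has a bound, so that termination and running time can be read off the syntax. *)
Inductive ex : bool -> Type :=
| NC (k : nat) : ex false
| NV (v : nat) : ex false
| NO (o : bool) (e1 e2 : ex false) : ex false
| NM (e1 e2 : ex false) : ex false
| NFind (v : nat) (b e : ex false) : ex false
| LtN (e1 e2 : ex false) : ex false
| LtR (e1 e2 : ex true) : ex false
| RN (e : ex false) : ex true
| RG (a : 'I_15) (e : ex false) : ex true
| RO (o : rop) (e1 e2 : ex true) : ex true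
| RBig (o : bool) (v : nat) (b : ex false) (e : ex true) : ex true
| Ite s (c : ex false) (e1 e2 : ex s) : ex s.

Inductive hc :=
| HN (v : nat) (e : ex false)
| HR (a : 'I_15) (i : ex false) (e : ex true)
| HSeq (c1 c2 : hc)
| HIf (e : ex false) (c1 c2 : hc)
| HFor (v : nat) (b : ex false) (c : hc).

Section highlevel.
Variable R : realType.

Record hst := HS { nv : nat -> nat; ra : 'I_15 -> nat -> R }.

Definition den (s : bool) : Type := if s then (R : Type) else nat.

Definition updv (s : hst) v x := HS (upd (nv s) v x) (ra s).
Definition upda (s : hst) (a : 'I_15) (i : nat) (x : R) :=
  HS (nv s) (fun a' i' => if (a' == a) && (i' == i) then x else ra s a' i').

Definition rev_op (o : rop) (x y : R) : R :=
  match o with ROadd => x + y | ROsub => x - y | ROmul => x * y | ROdiv => x / y end.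

Fixpoint ev s (e : ex s) (st : hst) : den s :=
  match e in ex s return den s with
  | NC k => k
  | NV v => nv st v
  | NO o e1 e2 => if o then (ev e1 st + ev e2 st)%N else (ev e1 st - ev e2 st)%N
  | NM e1 e2 => (ev e1 st * ev e2 st)%N
  | NFind v b e => find (fun i => ev e (updv st v i) != 0%N) (iota 0 (ev b st))
  | LtN e1 e2 => nat_of_bool (ev e1 st < ev e2 st)%N
  | LtR e1 e2 => nat_of_bool ((ev e1 st : R) < ev e2 st)
  | RN e => (ev e st)%:R
  | RG a e => ra st a (ev e st)
  | RO o e1 e2 => rev_op o (ev e1 st) (ev e2 st)
  | RBig o v b e =>
      if o then \prod_(i < ev b st) (ev e (updv st v i) : R)
      else \sum_(i < ev b st) (ev e (updv st v i) : R)
  | Ite s c e1 e2 => if ev c st != 0%N then ev e1 st else ev e2 st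
  end.

Fixpoint run (c : hc) (st : hst) : hst :=
  match c with
  | HN v e => updv st v (ev e st)
  | HR a i e => upda st a (ev i st) (ev e st)
  | HSeq c1 c2 => run c2 (run c1 st)
  | HIf e c1 c2 => if ev e st != 0%N then run c1 st else run c2 st
  | HFor v b c => foldl (fun st i => run c (updv st v i)) st (iota 0 (ev b st))
  end.

(* Memory layout of the compiled code: cell 0 holds the base of the arrays;
   even cells hold the variables and odd cells the temporaries; the arrays and
   a stack of real temporaries are interleaved with period 16 above the base. *)
Definition tN k := NConst k.*2.+1.
Definition vN v := NConst v.*2.+2.
Definition rA k := NAdd (NLoad (NConst 0)) (NConst (k * 16 + 15)).
Definition aA k (a : nat) := NAdd (NLoad (NConst 0)) (NAdd (NLoad (tN k)) (NConst a)).
Definition dbl_cmd k := SetN (tN k) (NAdd (NLoad (tN k)) (NLoad (tN k))).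
Definition mul16 k := Seq (dbl_cmd k) (Seq (dbl_cmd k) (Seq (dbl_cmd k) (dbl_cmd k))).
Definition rexp_op o := match o with
  ROadd => RAdd | ROsub => RSub | ROmul => RMul | ROdiv => RDiv end.

(** The value ends in temporary [k], and temporaries below [k] are preserved. A bound variable is
    saved before its loop and restored after it. The machine cannot multiply naturals: [NM] is a
    loop of additions, which is why its second factor is treated as a loop bound. *)
Fixpoint comp (k : nat) s (e : ex s) : cmd :=
  match e with
  | NC c => SetN (tN k) (NConst c)
  | NV v => SetN (tN k) (NLoad (vN v))
  | NO o e1 e2 => Seq (comp k e1) (Seq (comp k.+1 e2)
      (SetN (tN k) ((if o then NAdd else NSub) (NLoad (tN k)) (NLoad (tN k.+1)))))
  | NM e1 e2 => Seq (comp k e1) (Seq (comp k.+1 e2)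
      (Seq (SetN (tN k.+2) (NConst 0)) (Seq (SetN (tN k.+3) (NConst 0))
      (Seq (While (BLtN (NLoad (tN k.+2)) (NLoad (tN k.+1)))
         (Seq (SetN (tN k.+3) (NAdd (NLoad (tN k.+3)) (NLoad (tN k))))
              (SetN (tN k.+2) (NAdd (NLoad (tN k.+2)) (NConst 1)))))
       (SetN (tN k) (NLoad (tN k.+3)))))))
  | NFind v b e => Seq (comp k b) (Seq (SetN (tN k.+1) (NLoad (vN v)))
      (Seq (SetN (vN v) (NConst 0)) (Seq (SetN (tN k.+2) (NConst 0))
      (Seq (While (BLtN (NLoad (vN v)) (NLoad (tN k)))
         (Seq (comp k.+3 e)
         (Seq (If (BAnd (BNot (BLtN (NLoad (tN k.+2)) (NLoad (vN v))))
                       (BNot (BLtN (NConst 0) (NLoad (tN k.+3)))))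
               (SetN (tN k.+2) (NAdd (NLoad (tN k.+2)) (NConst 1))) Skip)
              (SetN (vN v) (NAdd (NLoad (vN v)) (NConst 1))))))
       (Seq (SetN (vN v) (NLoad (tN k.+1))) (SetN (tN k) (NLoad (tN k.+2))))))))
  | LtN e1 e2 => Seq (comp k e1) (Seq (comp k.+1 e2)
      (If (BLtN (NLoad (tN k)) (NLoad (tN k.+1)))
          (SetN (tN k) (NConst 1)) (SetN (tN k) (NConst 0))))
  | LtR e1 e2 => Seq (comp k e1) (Seq (comp k.+1 e2)
      (If (BLtR (RLoad (rA k)) (RLoad (rA k.+1)))
          (SetN (tN k) (NConst 1)) (SetN (tN k) (NConst 0))))
  | RN e => Seq (comp k e) (SetR (rA k) (RNat (NLoad (tN k))))
  | RG a e => Seq (comp k e) (Seq (mul16 k) (SetR (rA k) (RLoad (aA k a))))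
  | RO o e1 e2 => Seq (comp k e1) (Seq (comp k.+1 e2)
      (SetR (rA k) (rexp_op o (RLoad (rA k)) (RLoad (rA k.+1)))))
  | RBig o v b e => Seq (comp k b) (Seq (SetN (tN k.+1) (NLoad (vN v)))
      (Seq (SetN (vN v) (NConst 0)) (Seq (SetR (rA k) (RNat (NConst o)))
      (Seq (While (BLtN (NLoad (vN v)) (NLoad (tN k)))
         (Seq (comp k.+2 e)
         (Seq (SetR (rA k) ((if o then RMul else RAdd) (RLoad (rA k)) (RLoad (rA k.+2))))
              (SetN (vN v) (NAdd (NLoad (vN v)) (NConst 1))))))
       (SetN (vN v) (NLoad (tN k.+1)))))))
  | Ite s c e1 e2 => Seq (comp k c)
      (If (BLtN (NConst 0) (NLoad (tN k))) (comp k e1) (comp k e2))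
  end.

Fixpoint compc (k : nat) (c : hc) : cmd :=
  match c with
  | HN v e => Seq (comp k e) (SetN (vN v) (NLoad (tN k)))
  | HR a i e => Seq (comp k i) (Seq (mul16 k) (Seq (comp k.+1 e)
      (SetR (aA k a) (RLoad (rA k.+1)))))
  | HSeq c1 c2 => Seq (compc k c1) (compc k c2)
  | HIf e c1 c2 => Seq (comp k e)
      (If (BLtN (NConst 0) (NLoad (tN k))) (compc k c1) (compc k c2))
  | HFor v b c => Seq (comp k b) (Seq (SetN (tN k.+1) (NConst 0))
      (While (BLtN (NLoad (tN k.+1)) (NLoad (tN k)))
         (Seq (SetN (vN v) (NLoad (tN k.+1))) (Seq (compc k.+2 c)
              (SetN (tN k.+1) (NAdd (NLoad (tN k.+1)) (NConst 1)))))))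
  end.

(* Bound on the running time when all the loop bounds are at most [X]. *)
Fixpoint tex (X : nat) s (e : ex s) : nat :=
  match e with
  | NC _ | NV _ => 1
  | NO _ e1 e2 | RO _ e1 e2 => tex X e1 + tex X e2 + 1
  | LtN e1 e2 => tex X e1 + tex X e2 + 2
  | LtR e1 e2 => tex X e1 + tex X e2 + 2
  | NM e1 e2 => tex X e1 + tex X e2 + (X * 3 + 4)
  | NFind _ b e => tex X b + (X * (tex X e + 4) + 6)
  | RN e => tex X e + 1
  | RG _ e => tex X e + 5
  | RBig _ _ b e => tex X b + (X * (tex X e + 3) + 5)
  | Ite s c e1 e2 => tex X c + (tex X e1 + tex X e2) + 1
  end.

Fixpoint thc (X : nat) (c : hc) : nat :=
  match c with
  | HN _ e => tex X e + 1
  | HR _ i e => tex X i + tex X e + 5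
  | HSeq c1 c2 => thc X c1 + thc X c2
  | HIf e c1 c2 => tex X e + (thc X c1 + thc X c2) + 1
  | HFor _ b c => tex X b + (X * (thc X c + 3) + 2)
  end.

(* [P] selects the variables that may serve as loop bounds and are never
   assigned. *)
Definition isP (P : pred nat) s (e : ex s) : bool :=
  if e is NV p then P p else false.

Fixpoint okex (P : pred nat) s (e : ex s) : bool :=
  match e with
  | NC _ | NV _ => true
  | NO _ e1 e2 | RO _ e1 e2 | LtN e1 e2 => okex P e1 && okex P e2
  | LtR e1 e2 => okex P e1 && okex P e2
  | NM e1 e2 => [&& okex P e1, okex P e2 & isP P e2]
  | NFind v b e => [&& ~~ P v, isP P b & okex P e]
  | RN e => okex P e
  | RG _ e => okex P e
  | RBig _ v b e => [&& ~~ P v, isP P b & okex P e]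
  | Ite s c e1 e2 => [&& okex P c, okex P e1 & okex P e2]
  end.

Fixpoint okhc (P : pred nat) (c : hc) : bool :=
  match c with
  | HN v e => ~~ P v && okex P e
  | HR _ i e => okex P i && okex P e
  | HSeq c1 c2 => okhc P c1 && okhc P c2
  | HIf e c1 c2 => [&& okex P e, okhc P c1 & okhc P c2]
  | HFor v b c => [&& ~~ P v, isP P b & okhc P c]
  end.

Notation state := (state R).

Record rel (B : nat) (s : hst) (st : state) : Prop := Rel {
  rel_base : nats st 0 = B;
  rel_var : forall v, nats st v.*2.+2 = nv s v;
  rel_arr : forall (a : 'I_15) i, reals st (B + (i * 16 + a)) = ra s a i }.

Definition keep B k (st st' : state) := forall j, (j < k)%N ->
  nats st' j.*2.+1 = nats st j.*2.+1 /\
  reals st' (B + (j * 16 + 15)) = reals st (B + (j * 16 + 15)).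

Definition setT' (st : state) k x := State (upd (nats st) k.*2.+1 x) (reals st) (coins st).
Definition setV' (st : state) v x := State (upd (nats st) v.*2.+2 x) (reals st) (coins st).
Definition setR' (st : state) p x := State (nats st) (upd (reals st) p x) (coins st).

Lemma updE T (m : nat -> T) a v k : upd m a v k = if k == a then v else m k.
Proof. by []. Qed.

Lemma upd_eq T (m : nat -> T) a v : upd m a v a = v.
Proof. by rewrite /upd eqxx. Qed.

Lemma upd_neq T (m : nat -> T) a v k : k != a -> upd m a v k = m k.
Proof. by rewrite /upd => /negbTE ->. Qed.

Lemma rel_setT B s st k x : rel B s st -> rel B s (setT' st k x).
Proof.
case=> b v a; split=> //=.
by move=> w; rewrite upd_neq //; lia.
Qed.

Lemma rel_setR B s st k x : rel B s st -> rel B s (setR' st (B + (k * 16 + 15)) x).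
Proof.
case=> b v a; split=> //= c i; rewrite upd_neq //; apply/eqP.
have := ltn_ord c; lia.
Qed.

Lemma rel_setV B s st v x : rel B s st -> rel B (updv s v x) (setV' st v x).
Proof.
case=> b w a; split=> //= u.
rewrite !updE; have -> : (u.*2.+2 == v.*2.+2) = (u == v) by apply/eqP/eqP; lia.
by case: ifP.
Qed.

Lemma rel_setA B s st (a : 'I_15) i x :
  rel B s st -> rel B (upda s a i x) (setR' st (B + (i * 16 + a)) x).
Proof.
case=> b w r; split=> //= c j; rewrite updE.
have -> : (B + (j * 16 + c) == B + (i * 16 + a)) = ((c == a) && (j == i)).
  have ha := ltn_ord a; have hc := ltn_ord c.
  by rewrite -val_eqE /=; apply/eqP/andP => [H|[/eqP -> /eqP ->] //]; split; apply/eqP; lia.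
by case: ifP.
Qed.

Lemma rel_nv B s s' st : nv s =1 nv s' -> (forall a, ra s a =1 ra s' a) ->
  rel B s st -> rel B s' st.
Proof. by move=> h1 h2 [b v a]; split=> // *; rewrite (v, a) ?h1 ?h2. Qed.

Lemma keep_trans B k st1 st2 st3 : keep B k st1 st2 -> keep B k st2 st3 -> keep B k st1 st3.
Proof. by move=> h1 h2 j /[dup] /h1 [<- <-] /h2. Qed.
Lemma keep_le B k k' st1 st2 : (k <= k')%N -> keep B k' st1 st2 -> keep B k st1 st2.
Proof. by move=> h1 h2 j hj; apply: h2; lia. Qed.
Lemma keep_setT B k k' st x : (k <= k')%N -> keep B k st (setT' st k' x).
Proof. by move=> h j hj; split=> //=; rewrite upd_neq //; lia. Qed.
Lemma keep_setV B k v st x : keep B k st (setV' st v x).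
Proof. by move=> j hj; split=> //=; rewrite upd_neq //; lia. Qed.
Lemma keep_setR B k k' st x : (k <= k')%N -> keep B k st (setR' st (B + (k' * 16 + 15)) x).
Proof. by move=> h j hj; split=> //=; rewrite upd_neq //; lia. Qed.
Lemma keep_setA B k (a : 'I_15) i st x : keep B k st (setR' st (B + (i * 16 + a)) x).
Proof. by move=> j hj; split=> //=; rewrite upd_neq //; have := ltn_ord a; lia. Qed.

Lemma setT_val st k x : nats (setT' st k x) k.*2.+1 = x.
Proof. by rewrite /= upd_eq. Qed.

Definition halts (T : nat) c (st : state) (Q : state -> Prop) :=
  exists t st', [/\ exec c st t st', (t <= T)%N & Q st'].

Lemma halts_weak T T' c st (Q Q' : state -> Prop) :
  (T <= T')%N -> (forall s, Q s -> Q' s) -> halts T c st Q -> halts T' c st Q'.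
Proof. by move=> h hq [t [s [e le q]]]; exists t, s; split=> //; [lia|exact: hq]. Qed.

Lemma halts_seq T1 T2 c1 c2 st Q :
  halts T1 c1 st (fun s => halts T2 c2 s Q) -> halts (T1 + T2) (Seq c1 c2) st Q.
Proof.
case=> t1 [s1 [e1 l1 [t2 [s2 [e2 l2 q]]]]].
by exists (t1 + t2)%N, s2; split=> //; [exact: exec_seq e1 e2|lia].
Qed.

Lemma halts_setn a e st (Q : state -> Prop) :
  Q (State (upd (nats st) (neval st a) (neval st e)) (reals st) (coins st)) ->
  halts 1 (SetN a e) st Q.
Proof. by move=> q; exists 1%N; eexists; split; [exact: exec_setn| |]. Qed.

Lemma halts_setr a e st (Q : state -> Prop) :
  Q (State (nats st) (upd (reals st) (neval st a) (reval st e)) (coins st)) ->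
  halts 1 (SetR a e) st Q.
Proof. by move=> q; exists 1%N; eexists; split; [exact: exec_setr| |]. Qed.

Lemma halts_skip st (Q : state -> Prop) : Q st -> halts 1 Skip st Q.
Proof. by move=> q; exists 1%N; eexists; split; [exact: exec_skip| |]. Qed.

Lemma halts_if T b c1 c2 st Q :
  halts T (if beval st b then c1 else c2) st Q -> halts T.+1 (If b c1 c2) st Q.
Proof. by move=> [t [s [e l q]]]; exists t.+1, s; split=> //; exact: exec_if. Qed.

Lemma halts_while T b c (m : nat) (I : nat -> state -> Prop) st :
  (forall i s, (i < m)%N -> I i s -> beval s b /\ halts T c s (I i.+1)) ->
  (forall s, I m s -> ~~ beval s b) -> I 0 st ->
  halts (m * T.+1 + 1) (While b c) st (I m).
Proof.
move=> hs he h0.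
suff H j : forall st', (j <= m)%N -> I (m - j)%N st' ->
    halts (j * T.+1 + 1) (While b c) st' (I m).
  by apply: H => //; rewrite subnn.
elim: j => [|j IH] st' jm i0.
  rewrite subn0 in i0; exists 1%N, st'; split=> //.
  by apply: exec_while_stop; exact: he i0.
have [bt [t1 [s1 [e1 l1 i1]]]] := hs (m - j.+1)%N st' ltac:(lia) i0.
have [||t2 [s2 [e2 l2 i2]]] := IH s1; first lia.
  by move: i1; have -> : (m - j.+1).+1 = (m - j)%N by lia.
exists (t1 + t2).+1, s2; split=> //; first exact: exec_while_step bt e1 e2.
by rewrite mulSn; lia.
Qed.

End highlevel.

(** * Correctness and cost of compiled expressions *)

Section compile.
Variable R : realType.
Notation state := (state R).
Notation hst := (hst R).
Implicit Types (h : hst) (st : state).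

Definition res B k s st : den R s -> Prop :=
  match s return den R s -> Prop with
  | true => fun v => reals st (B + (k * 16 + 15)) = v
  | false => fun v => nats st k.*2.+1 = v
  end.

Lemma lkT st k x j : nats (setT' st k x) j.*2.+1 = if j == k then x else nats st j.*2.+1.
Proof.
rewrite /= updE; have -> // : (j.*2.+1 == k.*2.+1) = (j == k).
by rewrite eqSS; apply/eqP/eqP => [/double_inj|->].
Qed.

Lemma lkTv st k x v : nats (setT' st k x) v.*2.+2 = nats st v.*2.+2.
Proof. by rewrite /= upd_neq //; lia. Qed.

Lemma lkVv st w x v : nats (setV' st w x) v.*2.+2 = if v == w then x else nats st v.*2.+2.
Proof.
rewrite /= updE; have -> // : (v.*2.+2 == w.*2.+2) = (v == w).
by rewrite !eqSS; apply/eqP/eqP => [/double_inj|->].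
Qed.

Lemma lkV st v x j : nats (setV' st v x) j.*2.+1 = nats st j.*2.+1.
Proof. by rewrite /= upd_neq //; lia. Qed.

Lemma lkR st p x j : nats (setR' st p x) j = nats st j.
Proof. by []. Qed.

Lemma evT st k : neval st (NLoad (tN k)) = nats st k.*2.+1. Proof. by []. Qed.
Lemma evV st v : neval st (NLoad (vN v)) = nats st v.*2.+2. Proof. by []. Qed.
Lemma evA st e1 e2 : neval st (NAdd e1 e2) = (neval st e1 + neval st e2)%N. Proof. by []. Qed.
Lemma evC st c : neval st (NConst c) = c. Proof. by []. Qed.
Definition lk := (lkT, lkTv, lkVv, lkV, lkR, evT, evV, evA, evC).

Lemma halts_tN T k e st (Q : state -> Prop) : (0 < T)%N ->
  Q (setT' st k (neval st e)) -> halts T (SetN (tN k) e) st Q.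
Proof. by move=> hT q; apply: (@halts_weak _ 1 T _ _ Q) => //; exact: halts_setn. Qed.

Lemma halts_vN T v e st (Q : state -> Prop) : (0 < T)%N ->
  Q (setV' st v (neval st e)) -> halts T (SetN (vN v) e) st Q.
Proof. by move=> hT q; apply: (@halts_weak _ 1 T _ _ Q) => //; exact: halts_setn. Qed.

Lemma halts_rA T B k e st (Q : state -> Prop) : (0 < T)%N -> nats st 0 = B ->
  Q (setR' st (B + (k * 16 + 15)) (reval st e)) -> halts T (SetR (rA k) e) st Q.
Proof.
move=> hT hB q; apply: (@halts_weak _ 1 T _ _ Q) => //; apply: halts_setr.
by rewrite /= hB.
Qed.

Definition done' B k h st s (v : den R s) st' :=
  [/\ rel B h st', keep B k st st' & res B k st' v].

Lemma res_keep B k k' s st st' (v : den R s) : (k < k')%N ->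
  keep B k' st st' -> res B k st v -> res B k st' v.
Proof. by move=> hk /(_ k hk) [h1 h2]; case: s v => v /=; rewrite ?h1 ?h2. Qed.

Lemma res_setT B k st x : res (s := false) B k (setT' st k x) x.
Proof. by rewrite /res setT_val. Qed.

Lemma mul16_ok B k h st : rel B h st ->
  halts 4 (mul16 k) st (fun st' => done' B k h st (s := false) (nats st k.*2.+1 * 16)%N st').
Proof.
move=> r.
have D1 st1 n : done' B k h st (s := false) n st1 ->
   halts 1 (dbl_cmd k) st1 (done' B k h st (s := false) (n + n)%N).
  case=> r1 k1 v1; apply: halts_tN => //; split.
  - exact: rel_setT.
  - exact: keep_trans k1 (keep_setT _ _ _ _).
  - by rewrite /= !upd_eq; rewrite /= in v1; rewrite v1.
have st0 : done' B k h st (s := false) (nats st k.*2.+1) st by split.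
apply: (@halts_seq _ 1 3); apply: halts_weak (D1 _ _ st0) => // s1 h1.
apply: (@halts_seq _ 1 2); apply: halts_weak (D1 _ _ h1) => // s2 h2.
apply: (@halts_seq _ 1 1); apply: halts_weak (D1 _ _ h2) => // s3 h3.
apply: halts_weak (D1 _ _ h3) => // s4; set a := (X in done' B k h st X s4 -> _).
by set b := (X in _ -> done' B k h st X s4); have -> : a = b by rewrite /a /b /=; lia.
Qed.

Lemma rel_restore B h st v x : rel B (updv (updv h v x) v (nv h v)) st -> rel B h st.
Proof.
apply: rel_nv => // w /=; rewrite /upd; case: eqP => [->|] //.
Qed.

Lemma rel_updv2 B h st v x y : rel B (updv (updv h v x) v y) st -> rel B (updv h v y) st.
Proof. by apply: rel_nv => // w /=; rewrite /upd; case: eqP. Qed.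

Lemma rel_incV B h st v i x : x = i.+1 -> rel B (updv h v i) st ->
  rel B (updv h v i.+1) (setV' st v x).
Proof. by move=> -> r; apply: (@rel_updv2 B h _ v i); exact: rel_setV. Qed.

Lemma isP_ev P X s (e : ex s) h : isP P e -> (forall v, P v -> nv h v <= X)%N ->
  exists2 p, P p & forall h', (nv h' p = nv h p) ->
    (match s return ex s -> Prop with true => fun=> False
     | false => fun e : ex false => ev e h' = nv h p end e).
Proof. by case: e => //= p hp _; exists p. Qed.

Lemma okP_bound P X (e : ex false) h : isP P e -> (forall v, P v -> nv h v <= X)%N ->
  (ev e h <= X)%N.
Proof. by move=> he hX; have [p hp /(_ h erefl) ->] := isP_ev he hX; exact: hX. Qed.

Lemma updv_le P X h v i : ~~ P v -> (forall v, P v -> nv h v <= X)%N ->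
  forall w, P w -> (nv (updv h v i) w <= X)%N.
Proof. by move=> hv hX w hw /=; rewrite upd_neq ?hX //; apply: contra hv => /eqP <-. Qed.

Lemma find_iotaS (a : pred nat) i :
  find a (iota 0 i.+1) =
  if (find a (iota 0 i) < i)%N then find a (iota 0 i) else if a i then i else i.+1.
Proof.
rewrite -addn1 iotaD add0n find_cat has_find size_iota /=.
case: ltnP => //; have := find_size a (iota 0 i); rewrite size_iota => h1 h2.
by case: (a i); lia.
Qed.

Theorem comp_ok s (e : ex s) P X : okex P e -> forall B k h st,
  (forall v, P v -> nv h v <= X)%N -> rel B h st ->
  halts (tex X e) (comp k e) st (done' B k h st (ev e h)).
Proof.
elim: e => {s} [c|v|o e1 IH1 e2 IH2|e1 IH1 e2 IH2|v b IHb e IH|e1 IH1 e2 IH2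
    |e1 IH1 e2 IH2|e IH|a e IH|o e1 IH1 e2 IH2|o v b IHb e IH|s c IHc e1 IH1 e2 IH2].
- move=> _ B k h st hX r; apply: halts_tN => //.
  by split; [exact: rel_setT|exact: keep_setT|exact: res_setT].
- move=> _ B k h st hX r; apply: halts_tN => //=; rewrite (rel_var r).
  by split; [exact: rel_setT|exact: keep_setT|exact: res_setT].
- move=> /= /andP[h1 h2] B k h st hX r; rewrite -addnA.
  apply: halts_seq; apply: halts_weak (IH1 h1 B k h st hX r) => // s1 [r1 k1 v1].
  apply: halts_seq; apply: halts_weak (IH2 h2 B k.+1 h s1 hX r1) => // s2 [r2 k2 v2].
  apply: halts_tN => //; split; [exact: rel_setT| |].
    by apply: keep_trans (keep_setT _ _ _ _) => //; apply: keep_trans k1 (keep_le _ k2).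
  have {}v1 := res_keep (ltnSn k) k2 v1.
  by rewrite /= in v1 v2 *; rewrite !upd_eq; case: o; rewrite /= v1 v2.
- move=> /= /and3P[h1 h2 p2] B k h st hX r; rewrite -addnA.
  apply: halts_seq; apply: halts_weak (IH1 h1 B k h st hX r) => // s1 [r1 k1 v1].
  apply: halts_seq; apply: halts_weak (IH2 h2 B k.+1 h s1 hX r1) => // s2 [r2 k2 v2].
  have {}v1 := res_keep (ltnSn k) k2 v1.
  have kk : keep B k st s2 by apply: keep_trans k1 (keep_le _ k2).
  have -> : (X * 3 + 4 = 1 + (1 + ((X * 3 + 1) + 1)))%N by lia.
  apply: halts_seq; apply: halts_tN => //; apply: halts_seq; apply: halts_tN => //=.
  have bX := okP_bound p2 hX.
  apply: halts_seq.
  pose I i st' := [/\ rel B h st', keep B k st st' &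
     [/\ nats st' k.*2.+1 = ev e1 h, nats st' k.+1.*2.+1 = ev e2 h,
     nats st' k.+2.*2.+1 = i & nats st' k.+3.*2.+1 = (ev e1 h * i)%N]].
  apply: (@halts_weak _ (ev e2 h * 3 + 1) _ _ _ (I (ev e2 h))); first lia.
    move=> s3 [r3 k3 [a1 a2 a3 a4]]; apply: halts_tN => //.
    split; [exact: rel_setT|exact: keep_trans k3 (keep_setT _ _ _ _)|].
    by rewrite /= upd_eq a4.
  apply: halts_while => [i s3 hi [r3 k3 [a1 a2 a3 a4]]|s3 [r3 k3 [a1 a2 a3 a4]]|].
  - split; first by rewrite /= in a2 a3 *; rewrite a2 a3.
    apply: (@halts_seq _ 1 1); apply: halts_tN => //; apply: halts_tN => //.
    split; first by do 2 apply: rel_setT.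
      apply: keep_trans k3 (keep_trans (keep_setT _ _ _ _) (keep_setT _ _ _ _)) => //; lia.
    rewrite !lk !eqxx; do ! (case: eqP => ?; first lia).
    by rewrite a1 a2 a3 a4; split=> //; lia.
  - by rewrite /= in a2 a3 *; rewrite a2 a3 ltnn.
  - split; first by do 2 apply: rel_setT.
      apply: keep_trans kk (keep_trans (keep_setT _ _ _ _) (keep_setT _ _ _ _)) => //; lia.
    rewrite !lk !eqxx; do ! (case: eqP => ?; first lia).
    by rewrite /= in v1 v2; rewrite v1 v2 muln0.
- move=> /= /and3P[nv pb oe] B k h st hX r.
  have ob : okex P b by case: (b) pb.
  apply: halts_seq; apply: halts_weak (IHb ob B k h st hX r) => // s1 [r1 k1 v1].
  have -> : (X * (tex X e + 4) + 6 = 1 + (1 + (1 + ((X * (tex X e + 4) + 1) + (1 + 1)))))%N by lia.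
  apply: halts_seq; apply: halts_tN => //; apply: halts_seq; apply: halts_vN => //.
  apply: halts_seq; apply: halts_tN => //; apply: halts_seq.
  have bX := okP_bound pb hX.
  pose F i := find (fun i => ev e (updv h v i) != 0%N) (iota 0 i).
  pose I i st' := [/\ rel B (updv h v i) st', keep B k st st' &
     [/\ nats st' k.*2.+1 = ev b h, nats st' k.+1.*2.+1 = Submission.nv h v &
     nats st' k.+2.*2.+1 = F i]].
  apply: (@halts_weak _ (ev b h * (tex X e + 4) + 1) _ _ _ (I (ev b h))).
  - by rewrite leq_add2r leq_mul2r bX orbT.
  - move=> s3 [r3 k3 [a1 a2 a3]]; apply: halts_seq; apply: halts_vN => //; apply: halts_tN => //.
    split.
    + apply: rel_setT; apply: (@rel_restore B h _ v (ev b h)).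
      by rewrite /= in a2 *; rewrite a2; apply: rel_setV.
    + by apply: keep_trans k3 (keep_trans (keep_setV _ _ _ _) (keep_setT _ _ _ _)).
    + by rewrite /= in a3 *; rewrite upd_eq upd_neq ?a3 //; lia.
  - rewrite [X in halts (_ * X + 1)]addnS; apply: halts_while.
    + move=> i s3 hi [r3 k3 [a1 a2 a3]]; have vi := rel_var r3 v; rewrite /= upd_eq in vi.
      split; first by rewrite /= in a1 *; rewrite a1 vi.
      apply: halts_seq; apply: halts_weak (IH oe B k.+3 _ s3 (updv_le i nv hX) r3) => // s4 [r4 k4 v4].
      have c1 := res_keep (s := false) (v := ev b h) (ltac:(lia) : (k < k.+3)%N) k4 a1.
      have c2 := res_keep (s := false) (v := Submission.nv h v) (ltac:(lia) : (k.+1 < k.+3)%N) k4 a2.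
      have c3 := res_keep (s := false) (v := F i) (ltac:(lia) : (k.+2 < k.+3)%N) k4 a3.
      have k34 : keep B k st s4 by apply: keep_trans k3 (keep_le _ k4); lia.
      have v4i := rel_var r4 v; rewrite /= upd_eq in v4i.
      (* Temporary [k.+2] holds the result of the search among the indices below [i]. It equals [i]
         exactly when nothing has been found, and only in that case may it advance to [i.+1]. *)
      have FS : F i.+1 = if (F i < i)%N then F i else if ev e (updv h v i) != 0%N then i else i.+1.
        by rewrite /F find_iotaS.
      have Fi : (F i <= i)%N by have := find_size (fun i => ev e (updv h v i) != 0%N) (iota 0 i); rewrite size_iota.
      rewrite /= in c1 c2 c3 v4.
      apply: (@halts_seq _ 2 1); apply: halts_if.
      have -> : beval s4 (BAnd (BNot (BLtN (NLoad (tN k.+2)) (NLoad (vN v))))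
            (BNot (BLtN (NConst 0) (NLoad (tN k.+3))))) = (F i == i) && (ev e (updv h v i) == 0%N).
        by rewrite /= c3 v4i v4; apply/andP/andP => -[? ?]; split; lia.
      case: ifP => [/andP[/eqP f1 /eqP f2]|f1].
      * apply: halts_tN => //; apply: halts_vN => //; split.
        -- apply: rel_incV (rel_setT _ _ r4).
           by rewrite /= upd_neq ?v4i ?addn1 //; lia.
        -- apply: keep_trans k34 (keep_trans (keep_setT _ _ _ _) (keep_setV _ _ _ _)); lia.
        -- rewrite !lk !eqxx FS f1 ltnn f2 /=.
           do ! (case: eqP => ?; first lia).
           by rewrite c1 c2 c3 f1; split=> //; lia.
      * apply: halts_skip; apply: halts_vN => //; split.
        -- by apply: rel_incV r4; rewrite /= v4i addn1.
        -- exact: keep_trans k34 (keep_setV _ _ _ _).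
        -- rewrite !lk FS c1 c2 c3; split=> //.
           move: f1; case: ltnP => // f2; have -> : F i = i by lia.
           by rewrite eqxx /= => ->.
    + move=> s3 [r3 k3 [a1 a2 a3]]; have vi := rel_var r3 v; rewrite /= upd_eq in vi.
      by rewrite /= in a1 *; rewrite a1 vi ltnn.
    + split.
      * by apply: rel_setT; apply: rel_setV; apply: rel_setT.
      * apply: keep_trans k1 (keep_trans (keep_setT _ _ _ _) (keep_trans (keep_setV _ _ _ _) (keep_setT _ _ _ _))); lia.
      * rewrite !lk !eqxx; do ! (case: eqP => ?; first lia).
        by rewrite (rel_var r1); rewrite /= in v1; rewrite v1.
- move=> /= /andP[h1 h2] B k h st hX r; rewrite -addnA.
  apply: halts_seq; apply: halts_weak (IH1 h1 B k h st hX r) => // s1 [r1 k1 v1].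
  apply: halts_seq; apply: halts_weak (IH2 h2 B k.+1 h s1 hX r1) => // s2 [r2 k2 v2].
  have kk : keep B k st s2 by apply: keep_trans k1 (keep_le _ k2).
  have {}v1 := res_keep (ltnSn k) k2 v1.
  rewrite /= in v1 v2.
  apply: halts_if; rewrite /= v1 v2; case: ifP => _; apply: halts_tN => //;
    by split; [exact: rel_setT|exact: keep_trans kk (keep_setT _ _ _ _)|rewrite /= upd_eq].
- move=> /= /andP[h1 h2] B k h st hX r; rewrite -addnA.
  apply: halts_seq; apply: halts_weak (IH1 h1 B k h st hX r) => // s1 [r1 k1 v1].
  apply: halts_seq; apply: halts_weak (IH2 h2 B k.+1 h s1 hX r1) => // s2 [r2 k2 v2].
  have kk : keep B k st s2 by apply: keep_trans k1 (keep_le _ k2).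
  have {}v1 := res_keep (ltnSn k) k2 v1.
  rewrite /= in v1 v2.
  apply: halts_if; rewrite /= (rel_base r2) v1 v2; case: ifP => _; apply: halts_tN => //;
    by split; [exact: rel_setT|exact: keep_trans kk (keep_setT _ _ _ _)|rewrite /= upd_eq].
- move=> /= oe B k h st hX r.
  apply: halts_seq; apply: halts_weak (IH oe B k h st hX r) => // s1 [r1 k1 v1].
  apply: (halts_rA _ (rel_base r1)) => //; split.
  + exact: rel_setR.
  + exact: keep_trans k1 (keep_setR _ _ _ _).
  + by rewrite /= in v1 *; rewrite upd_eq v1.
- move=> /= oe B k h st hX r.
  apply: halts_seq; apply: halts_weak (IH oe B k h st hX r) => // s1 [r1 k1 v1].
  apply: (@halts_seq _ 4 1); apply: halts_weak (mul16_ok k r1) => // s2 [r2 k2 v2].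
  apply: (halts_rA _ (rel_base r2)) => //; split.
  + exact: rel_setR.
  + exact: keep_trans k1 (keep_trans k2 (keep_setR _ _ _ _)).
  + rewrite /= in v1 v2 *; rewrite upd_eq v2 v1 (rel_base r2).
    by rewrite (rel_arr r2).
- move=> /= /andP[h1 h2] B k h st hX r; rewrite -addnA.
  apply: halts_seq; apply: halts_weak (IH1 h1 B k h st hX r) => // s1 [r1 k1 v1].
  apply: halts_seq; apply: halts_weak (IH2 h2 B k.+1 h s1 hX r1) => // s2 [r2 k2 v2].
  have kk : keep B k st s2 by apply: keep_trans k1 (keep_le _ k2).
  have {}v1 := res_keep (ltnSn k) k2 v1.
  apply: (halts_rA _ (rel_base r2)) => //; split.
  + exact: rel_setR.
  + exact: keep_trans kk (keep_setR _ _ _ _).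
  + rewrite /= in v1 v2 *; rewrite upd_eq.
    by case: o; rewrite /= (rel_base r2) v1 v2.
- move=> /= /and3P[nv pb oe] B k h st hX r.
  have ob : okex P b by case: (b) pb.
  apply: halts_seq; apply: halts_weak (IHb ob B k h st hX r) => // s1 [r1 k1 v1].
  have -> : (X * (tex X e + 3) + 5 = 1 + (1 + (1 + ((X * (tex X e + 3) + 1) + 1))))%N by lia.
  apply: halts_seq; apply: halts_tN => //; apply: halts_seq; apply: halts_vN => //.
  apply: halts_seq; apply: (@halts_rA _ B) => //.
    by apply: rel_base; apply: rel_setV; exact: rel_setT r1.
  apply: halts_seq.
  have bX := okP_bound pb hX.
  pose F i : R := if o then \prod_(j < i) (ev e (updv h v j) : R)
      else \sum_(j < i) (ev e (updv h v j) : R).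
  pose I i st' := [/\ rel B (updv h v i) st', keep B k st st' &
     [/\ nats st' k.*2.+1 = ev b h, nats st' k.+1.*2.+1 = Submission.nv h v &
     reals st' (B + (k * 16 + 15)) = F i]].
  apply: (@halts_weak _ (ev b h * (tex X e + 3) + 1) _ _ _ (I (ev b h))).
  - by rewrite leq_add2r leq_mul2r bX orbT.
  - move=> s3 [r3 k3 [a1 a2 a3]]; apply: halts_vN => //.
    split.
    + apply: (@rel_restore B h _ v (ev b h)).
      by rewrite /= in a2 *; rewrite a2; apply: rel_setV.
    + by apply: keep_trans k3 (keep_setV _ _ _ _).
    + by rewrite /= a3 /F.
  - rewrite [X in halts (_ * X + 1)]addnS; apply: halts_while.
    + move=> i s3 hi [r3 k3 [a1 a2 a3]]; have vi := rel_var r3 v; rewrite /= upd_eq in vi.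
      split; first by rewrite /= in a1 *; rewrite a1 vi.
      apply: halts_seq; apply: halts_weak (IH oe B k.+2 _ s3 (updv_le i nv hX) r3) => // s4 [r4 k4 v4].
      have c1 := res_keep (s := false) (v := ev b h) (ltac:(lia) : (k < k.+2)%N) k4 a1.
      have c2 := res_keep (s := false) (v := Submission.nv h v) (ltac:(lia) : (k.+1 < k.+2)%N) k4 a2.
      have c3 := res_keep (s := true) (v := F i) (ltac:(lia) : (k < k.+2)%N) k4 a3.
      have k34 : keep B k st s4 by apply: keep_trans k3 (keep_le _ k4); lia.
      have v4i := rel_var r4 v; rewrite /= upd_eq in v4i.
      rewrite /= in c1 c2 c3 v4.
      apply: (@halts_seq _ 1 1); apply: (halts_rA _ (rel_base r4)) => //.
      apply: halts_vN => //; split.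
      * by apply: rel_incV (rel_setR _ _ r4); rewrite /= v4i addn1.
      * exact: keep_trans k34 (keep_trans (keep_setR _ _ _ _) (keep_setV _ _ _ _)).
      * rewrite !lk c1 c2 /= upd_eq; split=> //.
        have -> : reval s4 ((if o then RMul else RAdd) (RLoad (rA k)) (RLoad (rA k.+2)))
           = (if o then F i * ev e (updv h v i) else F i + ev e (updv h v i)).
          by case: (o); rewrite /= (rel_base r4) c3 v4.
        by rewrite /F; case: (o); rewrite big_ord_recr.
    + move=> s3 [r3 k3 [a1 a2 a3]]; have vi := rel_var r3 v; rewrite /= upd_eq in vi.
      by rewrite /= in a1 *; rewrite a1 vi ltnn.
    + split.
      * by apply: rel_setR; apply: rel_setV; apply: rel_setT.
      * apply: keep_trans k1 (keep_trans (keep_setT _ _ _ _) (keep_trans (keep_setV _ _ _ _) (keep_setR _ _ _ _))) => //; lia.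
      * rewrite !lk !eqxx; do ! (case: eqP => ?; first lia).
        rewrite (rel_var r1); rewrite /= in v1; rewrite v1 /= upd_eq /F.
        by split=> //; case: (o); rewrite big_ord0.
- move=> /= /and3P[hc h1 h2] B k h st hX r.
  rewrite -addnA; apply: halts_seq; apply: halts_weak (IHc hc B k h st hX r) => // s1 [r1 k1 v1].
  rewrite addn1; apply: halts_if.
  have -> : beval s1 (BLtN (NConst 0) (NLoad (tN k))) = (ev c h != 0%N).
    by rewrite /= in v1 *; rewrite v1 lt0n.
  case: ifP => _.
  + apply: halts_weak (IH1 h1 B k h s1 hX r1); first lia.
    by move=> s2 [r2 k2 v2]; split=> //; exact: keep_trans k1 k2.
  + apply: halts_weak (IH2 h2 B k h s1 hX r1); first lia.
    by move=> s2 [r2 k2 v2]; split=> //; exact: keep_trans k1 k2.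
Qed.

End compile.

(** * Compiled commands, input and output *)

Section program.
Variable R : realType.
Notation state := (state R).
Notation hst := (hst R).
Implicit Types (h : hst) (st : state).

Lemma run_nv_P P c h v : okhc P c -> P v -> nv (run c h) v = nv h v.
Proof.
elim: c h => [w e|a i e|c1 IH1 c2 IH2|e c1 IH1 c2 IH2|w b c IH] h /=.
- by move=> /andP[/negP hw _] hv; rewrite upd_neq //; apply/eqP => E; apply: hw; rewrite -E.
- by [].
- by move=> /andP[h1 h2] hv; rewrite IH2 // IH1.
- by move=> /and3P[_ h1 h2] hv; case: ifP => _; rewrite ?IH1 ?IH2.
- move=> /and3P[hw _ hc] hv; move: (iota _ _) => l; elim: l h => //= i l IHl h.
  rewrite IHl IH //= upd_neq //; apply: contra hw => /eqP <- //.
Qed.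

Definition post B k h st st' := rel B h st' /\ keep B k st st'.

Theorem compc_ok c P X : okhc P c -> forall B k h st,
  (forall v, P v -> nv h v <= X)%N -> rel B h st ->
  halts (thc X c) (compc k c) st (post B k (run c h) st).
Proof.
elim: c => [v e|a i e|c1 IH1 c2 IH2|e c1 IH1 c2 IH2|v b c IH].
- move=> /= /andP[_ oe] B k h st hX r.
  apply: halts_seq; apply: halts_weak (comp_ok oe k hX r) => // s1 [r1 k1 v1].
  apply: halts_vN => //; split; last exact: keep_trans k1 (keep_setV _ _ _ _).
  by rewrite evT; rewrite /= in v1; rewrite v1; exact: rel_setV.
- move=> /= /andP[oi oe] B k h st hX r; rewrite -addnA.
  apply: halts_seq; apply: halts_weak (comp_ok oi k hX r) => // s1 [r1 k1 v1].
  have -> : (tex X e + 5 = 4 + (tex X e + 1))%N by lia.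
  apply: halts_seq; apply: halts_weak (mul16_ok k r1) => // s2 [r2 k2 v2].
  apply: halts_seq; apply: halts_weak (comp_ok oe k.+1 hX r2) => // s3 [r3 k3 v3].
  have {}v2 := res_keep (ltnSn k) k3 v2.
  apply: halts_setr; split.
  + rewrite /= in v1 v2 v3 *; rewrite (rel_base r3) v2 v1 v3.
    exact: rel_setA.
  + rewrite /= in v1 v2 v3 *; rewrite (rel_base r3) v2 v1 v3.
    apply: (keep_trans k1); apply: (keep_trans k2); apply: (keep_trans (keep_le (leqnSn k) k3)).
    exact: keep_setA.
- move=> /= /andP[h1 h2] B k h st hX r.
  apply: halts_seq; apply: halts_weak (IH1 h1 B k h st hX r) => // s1 [r1 k1].
  apply: halts_weak (IH2 h2 B k _ s1 _ r1) => // [s2 [r2 k2]|v hv].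
    by split=> //; exact: keep_trans k1 k2.
  by rewrite (run_nv_P _ h1) // hX.
- move=> /= /and3P[oe h1 h2] B k h st hX r; rewrite -addnA.
  apply: halts_seq; apply: halts_weak (comp_ok oe k hX r) => // s1 [r1 k1 v1].
  rewrite addn1; apply: halts_if.
  have -> : beval s1 (BLtN (NConst 0) (NLoad (tN k))) = (ev e h != 0%N).
    by rewrite /= in v1 *; rewrite v1 lt0n.
  case: ifP => _.
  + apply: halts_weak (IH1 h1 B k h s1 hX r1); first lia.
    by move=> s2 [r2 k2]; split=> //; exact: keep_trans k1 k2.
  + apply: halts_weak (IH2 h2 B k h s1 hX r1); first lia.
    by move=> s2 [r2 k2]; split=> //; exact: keep_trans k1 k2.
- move=> /= /and3P[hv pb oc] B k h st hX r.
  have ob : okex P b by case: (b) pb.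
  apply: halts_seq; apply: halts_weak (comp_ok ob k hX r) => // s1 [r1 k1 v1].
  have -> : (X * (thc X c + 3) + 2 = 1 + (X * (thc X c + 3) + 1))%N by lia.
  apply: halts_seq; apply: halts_tN => //.
  have bX := okP_bound pb hX.
  pose F i := foldl (fun g j => run c (updv g v j)) h (iota 0 i).
  have FX i w : P w -> (nv (F i) w <= X)%N.
    move=> hw; suff -> : nv (F i) w = nv h w by exact: hX.
    rewrite /F; elim: (iota _ _) (h) => //= j l IHs h'.
    rewrite IHs (run_nv_P _ oc) //= upd_neq //; apply: contra hv => /eqP <- //.
  pose I i st' := [/\ rel B (F i) st', keep B k st st' &
     nats st' k.*2.+1 = ev b h /\ nats st' k.+1.*2.+1 = i].
  apply: (@halts_weak _ (ev b h * (thc X c + 3) + 1) _ _ _ (I (ev b h))).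
  + by rewrite leq_add2r leq_mul2r bX orbT.
  + by move=> s2 [r2 k2 _]; split.
  + rewrite [X in halts (_ * X + 1)]addnS; apply: halts_while.
    * move=> i s2 hi [r2 k2 [a1 a2]]; split; first by rewrite /= in a1 a2 *; rewrite a1 a2.
      have -> : (thc X c + 2 = 1 + (thc X c + 1))%N by lia.
      apply: halts_seq; apply: halts_vN => //; rewrite evT a2.
      apply: halts_seq; apply: halts_weak (IH oc B k.+2 _ _ _ (rel_setV v i r2)) => //.
        move=> s3 [r3 k3]; apply: halts_tN => //.
        have c1 := res_keep (s := false) (v := ev b h) (ltac:(lia) : (k < k.+2)%N) k3.
        have c2 := res_keep (s := false) (v := i) (ltac:(lia) : (k.+1 < k.+2)%N) k3.
        split.
        -- apply: rel_setT; suff -> : F i.+1 = run c (updv (F i) v i) by [].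
           by rewrite /F -addn1 iotaD foldl_cat.
        -- have kk : keep B k s2 s3.
             apply: (@keep_trans _ B k s2 (setV' s2 v i) s3); first exact: keep_setV.
             by apply: (keep_le _ k3); lia.
           by apply: (keep_trans k2); apply: (keep_trans kk); apply: keep_setT; lia.
        -- rewrite !lk eqxx; case: eqP => ?; first lia.
           rewrite /= in c1 c2; rewrite c1 ?c2 ?addn1 //; last by rewrite upd_neq //; lia.
           by rewrite upd_neq //; lia.
      by move=> w hw; exact: (updv_le i hv (FX i)).
    * by move=> s2 [r2 k2 [a1 a2]]; rewrite /= in a1 a2 *; rewrite a1 a2 ltnn.
    * split; first exact: rel_setT.
        by apply: keep_trans k1 (keep_setT _ _ _ _).
      rewrite !lk eqxx; case: eqP => ?; first lia.
      by rewrite /= in v1; rewrite v1.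
Qed.

(** The program computes its own loop bounds, so no single set of protected variables covers it. It
    is cut into pieces whose bounds are fixed when they start; [safe] is the notion that composes
    along the pieces, while [okhc] only certifies one of them. *)
Definition safe X c h := forall B k st, rel B h st ->
  halts (thc X c) (compc k c) st (post B k (run c h) st).

Lemma safe_static P X c h : okhc P c -> (forall v, P v -> nv h v <= X)%N -> safe X c h.
Proof. by move=> hc hX B k st; exact: compc_ok hc B k h st hX. Qed.

Lemma safe_seq X c1 c2 h : safe X c1 h -> safe X c2 (run c1 h) -> safe X (HSeq c1 c2) h.
Proof.
move=> h1 h2 B k st /= /h1 H; apply: halts_seq; apply: halts_weak (H k) => // s1 [r1 k1].
apply: halts_weak (h2 B k s1 r1) => // s2 [r2 k2].
by split=> //; exact: keep_trans k1 k2.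
Qed.

Notation C := NConst.
Notation ld k := (NLoad (NConst k)).
Definition inc k a := SetN (C k) (NAdd (ld k) a).

(** The naturals of cells 0, 1, 2 move to the cells 2, 4, 6 of variables 0, 1, 2, the last one first
    so that nothing is lost. The base is set to [2 + N n], just past the input reals, so spreading
    these with period 16 above the base never overwrites one that is still to be read. *)
Definition prelude : cmd :=
  Seq (SetN (C 6) (ld 2)) (Seq (SetN (C 4) (ld 1)) (Seq (SetN (C 2) (ld 0))
  (Seq (SetN (C 3) (C 0)) (Seq (SetN (C 5) (C 2))
  (Seq (While (BLtN (ld 3) (ld 6)) (Seq (inc 5 (ld 2)) (inc 3 (C 1))))
  (Seq (SetN (C 0) (ld 5)) (Seq (SetN (C 3) (C 0)) (Seq (SetN (C 7) (ld 0))
  (While (BLtN (ld 3) (ld 0))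
     (Seq (SetR (ld 7) (RLoad (ld 3))) (Seq (inc 7 (C 16)) (inc 3 (C 1))))))))))))).

Definition input_hst (n d N : nat) (inp : nat -> R) : hst :=
  HS (nth 0%N [:: n; d; N]) (fun a i => if a == ord0 then inp i else 0).

Lemma prelude_ok n d N (inp : nat -> R) w : (forall i, (2 + N * n <= i)%N -> inp i = 0) ->
  halts (10 * (N * n + N + 3)) prelude (State (nth 0%N [:: n; d; N]) inp w)
    (rel (2 + N * n) (input_hst n d N inp)).
Proof.
move=> hinp.
apply: (@halts_weak _ (1 + (1 + (1 + (1 + (1 + ((N * 3 + 1) + (1 + (1 + (1 + ((2 + N * n) * 4 + 1)))))))))) _ _ _
   (rel (2 + N * n) (input_hst n d N inp))) => //; first lia.
apply: halts_seq; apply: halts_setn; rewrite /=.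
apply: halts_seq; apply: halts_setn; rewrite /=.
apply: halts_seq; apply: halts_setn; rewrite /=.
apply: halts_seq; apply: halts_setn; rewrite /=.
apply: halts_seq; apply: halts_setn; rewrite /=.
pose vars (st : state) := forall k, nats st k.*2.+2 = nth 0%N [:: n; d; N] k.
pose I i st := [/\ vars st, reals st = inp, nats st 3 = i & nats st 5 = (2 + i * n)%N].
apply: halts_seq.
apply: (@halts_weak _ (N * 3 + 1) _ _ _ (I N)) => //; last first.
  apply: (@halts_while _ 2) => [i s hi [v r a1 a2]|s [v r a1 a2]|].
  - have v2 := v 2%N; have v0 := v 0%N; rewrite /= in v2 v0.
    split; first by rewrite /= a1 v2.
    apply: (@halts_seq _ 1 1); apply: halts_setn; apply: halts_setn; split=> //=.
    + by move=> k; rewrite /= !upd_neq //; lia.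
    + by rewrite upd_eq upd_neq // a1 addn1.
    + rewrite upd_neq // upd_eq a2 v0; lia.
  - by have v2 := v 2%N; rewrite /= in v2; rewrite /= a1 v2 ltnn.
  - split=> //=; move=> [|[|[|k]]]; [by rewrite /= !updE|by rewrite /= !updE|by rewrite /= !updE|].
    by rewrite /= !upd_neq ?nth_default //=; lia.
move=> s1 [v1 r1 a1 a2].
apply: halts_seq; apply: halts_setn; apply: halts_seq; apply: halts_setn.
apply: halts_seq; apply: halts_setn.
pose B := (2 + N * n)%N.
pose J i st := [/\ vars st, nats st 0 = B, nats st 3 = i, nats st 7 = (B + i * 16)%N &
   forall p, reals st p = if (B <= p)%N then
       (if ((p - B) %% 16 == 0)%N && ((p - B) %/ 16 < i)%N then inp ((p - B) %/ 16)%N else 0) else inp p].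
apply: (@halts_weak _ (B * 4 + 1) _ _ _ (J B)) => //.
  move=> s2 [v2 b2 a3 a4 r2]; split=> //= a i.
  rewrite r2 leq_addr addKn divnMDl // divn_small ?ltnS; last by have := ltn_ord a; lia.
  rewrite modnMDl modn_small; last by have := ltn_ord a; lia.
  rewrite addn0 -val_eqE /=; case: eqP => //= _; case: ltnP => // hi.
  by rewrite hinp.
apply: (@halts_while _ 3) => [i s hi [v b a3 a4 r]|s [v b a3 a4 r]|].
- split; first by rewrite /= a3 b.
  apply: (@halts_seq _ 1 2); apply: halts_setr; apply: (@halts_seq _ 1 1); apply: halts_setn; apply: halts_setn.
  split=> //=.
  + by move=> k; rewrite /= !upd_neq //; lia.
  + by rewrite !updE /= a3 addn1.
  + rewrite !updE /= a4; lia.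
  + move=> p; rewrite updE a4 a3; case: eqP => [->|hp].
      rewrite leq_addr addKn mulnK // modnMl eqxx ltnSn /= r.
      by rewrite leqNgt hi.
    rewrite r; case hB: (B <= p)%N => //; case: eqP => //= hm.
    have hd := divn_eq (p - B) 16; rewrite hm addn0 in hd.
    by congr (if _ then _ else _); apply/idP/idP; lia.
- by rewrite /= a3 b ltnn.
- split=> //=.
  + by move=> k; rewrite /= !upd_neq //; lia.
  + by rewrite !updE /= a2 mul0n addn0.
  + move=> p; rewrite r1 ltn0 andbF; case: leqP => // hp; exact: hinp.
Qed.

(* [vc] is the variable holding the number of returned points, stored in array 1. *)
Definition epilogue (vc : nat) : cmd :=
  Seq (SetN (C 3) (C 0)) (Seq (SetN (C 5) (C 0))
  (Seq (While (BLtN (ld 3) (ld vc.*2.+2)) (Seq (inc 5 (ld 2)) (inc 3 (C 1))))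
  (Seq (SetN (C 3) (C 0)) (Seq (SetN (C 7) (NAdd (ld 0) (C 1)))
  (Seq (While (BLtN (ld 3) (ld 5))
     (Seq (SetR (ld 3) (RLoad (ld 7))) (Seq (inc 7 (C 16)) (inc 3 (C 1)))))
  (SetN (C 0) (ld vc.*2.+2))))))).

(** The output cells must lie below the base [B]: writing them then leaves array 1, which is being
    copied, intact. *)
Lemma epilogue_ok vc B h st n : rel B h st -> nv h 0 = n -> (nv h vc * n <= B)%N ->
  halts (10 * (nv h vc * n + nv h vc + 3)) (epilogue vc) st (fun st' =>
    output n st' = [seq \row_(j < n) ra h (inord 1) (i * n + j)%N | i <- iota 0 (nv h vc)]).
Proof.
move=> [rb rv rA] hn hB; set m := nv h vc in hB *.
apply: (@halts_weak _ (1 + (1 + ((m * 3 + 1) + (1 + (1 + ((m * n * 4 + 1) + 1)))))) _ _ _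
  (fun st' => output n st' = [seq \row_(j < n) ra h (inord 1) (i * n + j)%N | i <- iota 0 m])) => //; first lia.
apply: halts_seq; apply: halts_setn; apply: halts_seq; apply: halts_setn; rewrite /=.
pose vars (st : state) := nats st 0 = B /\ forall k, nats st k.*2.+2 = nv h k.
have h2 s : vars s -> nats s 2 = n by case=> _ /(_ 0%N) /= ->.
pose I i s := [/\ vars s, reals s = reals st, nats s 3 = i & nats s 5 = (i * n)%N].
apply: halts_seq.
apply: (@halts_weak _ (m * 3 + 1) _ _ _ (I m)) => //; last first.
  apply: (@halts_while _ 2) => [i s hi [v r a1 a2]|s [v r a1 a2]|].
  - split; first by rewrite /= a1 v.2.
    apply: (@halts_seq _ 1 1); apply: halts_setn; apply: halts_setn; split=> //=.
    + by split=> [|k]; rewrite /= !upd_neq ?v.1 ?v.2 //; lia.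
    + by rewrite upd_eq upd_neq // a1 addn1.
    + rewrite upd_neq // upd_eq a2 h2 //; lia.
  - by rewrite /= a1 v.2 ltnn.
  - split=> //=; split=> [|k]; rewrite /= !upd_neq //; lia.
move=> s1 [v1 r1 a1 a2].
apply: halts_seq; apply: halts_setn; apply: halts_seq; apply: halts_setn; rewrite /=.
pose J i s := [/\ vars s, nats s 5 = (m * n)%N, nats s 3 = i, nats s 7 = (B + 1 + i * 16)%N &
   forall p, reals s p = if (p < i)%N then ra h (inord 1) p else reals st p].
have hr i : reals st (B + 1 + i * 16)%N = ra h (inord 1) i.
  by rewrite -rA inordK //; congr (reals st _); lia.
apply: halts_seq.
apply: (@halts_weak _ (m * n * 4 + 1) _ _ _ (J (m * n)%N)) => //; last first.
  apply: (@halts_while _ 3) => [i s hi [v b a3 a4 r]|s [v b a3 a4 r]|].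
  - split; first by rewrite /= a3 b.
    apply: (@halts_seq _ 1 2); apply: halts_setr; apply: (@halts_seq _ 1 1); apply: halts_setn; apply: halts_setn.
    split=> //=.
    + by split=> [|k]; rewrite /= !upd_neq ?v.1 ?v.2 //; lia.
    + by rewrite !updE /= a3 addn1.
    + rewrite !updE /= a4; lia.
    + move=> p; rewrite updE a4 a3; case: eqP => [->|hp].
        rewrite ltnSn r ltnNge; have -> : (i <= B + 1 + i * 16)%N by lia.
        by rewrite /= hr.
      by rewrite r; have -> : (p < i.+1)%N = (p < i)%N by apply/idP/idP; lia.
  - by rewrite /= a3 b ltnn.
  - split=> //=; last by rewrite r1.
    + by split=> [|k]; rewrite /= !upd_neq ?v1.1 ?v1.2 //; lia.
    + by rewrite !updE /= v1.1 mul0n addn0.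
move=> s2 [v2 b2 a3 a4 r2]; apply: halts_setn; rewrite /output /= upd_eq v2.2.
apply/eq_in_map => i; rewrite mem_iota add0n => /andP[_ hi].
apply/rowP => j; rewrite !mxE r2; have -> // : (i * n + j < m * n)%N.
have := ltn_ord j; have : (i.+1 * n <= m * n)%N by rewrite leq_mul2r hi orbT.
by rewrite mulSn; lia.
Qed.

Definition program vc c := Seq prelude (Seq (compc 0 c) (epilogue vc)).

Theorem program_ok vc c (n d : nat) (alpha tau : R) (T : seq 'rV[R]_n) w X :
  let h0 := input_hst n d (size T) (reals (input d alpha tau T w)) in
  let h := run c h0 in
  safe X c h0 -> nv h 0 = n -> (nv h vc * n <= 2 + size T * n)%N ->
  exists t L, [/\ returns (program vc c) d alpha tau T w t L,
     (t <= thc X c + 40 * (size T * n + size T + nv h vc + 3))%N &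
     L = [seq \row_(j < n) ra h (inord 1) (i * n + j)%N | i <- iota 0 (nv h vc)]].
Proof.
move=> h0 h hs hn hL.
have sz : size (flatten [seq [seq x ord0 j | j : 'I_n] | x : 'rV[R]_n <- T]) = (size T * n)%N.
  rewrite size_flatten /shape -map_comp sumnE big_map.
  under eq_bigr do rewrite /= size_map size_enum_ord.
  by rewrite big_const_seq count_predT iter_addn_0 mulnC.
have hp : halts (10 * (size T * n + size T + 3)) prelude (input d alpha tau T w)
    (rel (2 + size T * n) h0).
  apply: prelude_ok => i hi; rewrite /input /= nth_default //= sz; lia.
have [] : halts (10 * (size T * n + size T + 3) + (thc X c +
    10 * (nv h vc * n + nv h vc + 3))) (program vc c) (input d alpha tau T w)
    (fun st' => output n st' = [seq \row_(j < n) ra h (inord 1) (i * n + j)%N | i <- iota 0 (nv h vc)]).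
  apply: halts_seq; apply: halts_weak hp => // s1 r1.
  apply: halts_seq; apply: halts_weak (hs _ 0%N _ r1) => // s2 [r2 _].
  exact: epilogue_ok r2 hn hL.
move=> t [s [e le q]]; exists t, (output n s); split=> //; first by exists s.
by rewrite (leq_trans le) //; lia.
Qed.

End program.

(** * Digits, moments and tensors *)

Section digits.
Variables (R : realType) (n : nat).
Hypothesis n0 : (0 < n)%N.
Implicit Types (F G : seq nat -> R) (x y z v : nat -> R).

(** A tensor of order [K] is a function on the integers below [n ^ K]; the base-[n] digits of an
    index, least significant first, are its [K] coordinates. *)
Fixpoint ds K I : seq nat := if K is K'.+1 then (I %% n)%N :: ds K' (I %/ n)%N else [::].

Lemma size_ds K I : size (ds K I) = K.
Proof. by elim: K I => //= K IH I; rewrite IH. Qed.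

Lemma all_ds K I : all (fun c => c < n)%N (ds K I).
Proof. by elim: K I => //= K IH I; rewrite ltn_pmod // IH. Qed.

Lemma nth_ds K I k : (k < K)%N -> nth 0%N (ds K I) k = (I %/ n ^ k %% n)%N.
Proof.
elim: K I k => //= K IH I [|k] hk; first by rewrite expn0 divn1.
by rewrite /= IH // expnS divnMA.
Qed.

Definition undig (s : seq nat) : nat := foldr (fun c a => c + n * a)%N 0%N s.

Lemma undigK s : all (fun c => c < n)%N s -> ds (size s) (undig s) = s.
Proof.
elim: s => //= c s IH /andP[hc hs].
rewrite mulnC addnC modnMDl modn_small // divnMDl // divn_small // addn0.
by rewrite IH.
Qed.

Lemma undig_lt s : all (fun c => c < n)%N s -> (undig s < n ^ size s)%N.
Proof.
elim: s => //= c s IH /andP[hc hs]; have := IH hs.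
rewrite expnS; set u := undig s; set p := (n ^ _)%N => hu.
have : (n * u.+1 <= n * p)%N by rewrite leq_mul2l hu orbT.
by rewrite mulnS; lia.
Qed.

Lemma ds_cat K1 K2 a b : (b < n ^ K1)%N -> ds (K1 + K2) (a * n ^ K1 + b) = ds K1 b ++ ds K2 a.
Proof.
elim: K1 b => [|K1 IH] b.
  by rewrite expn0 ltnS leqn0 => /eqP -> /=; rewrite add0n muln1 addn0.
rewrite expnS => hb /=; rewrite mulnA [(a * n)%N]mulnC -mulnA mulnC.
rewrite modnMDl divnMDl // IH // ltn_divLR // mulnC //.
Qed.

Lemma big_split_mul (m : nat) (F : nat -> R) p :
  \sum_(I < m * p) F I = \sum_(i < m) \sum_(c < p) F (i * p + c)%N.
Proof.
elim: m => [|m IH]; first by rewrite mul0n !big_ord0.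
rewrite big_ord_recr -IH /= mulSn addnC.
rewrite -(big_mkord predT F) (@big_cat_nat _ _ _ (m * p)) ?leq_addr //=.
rewrite big_mkord; congr (_ + _).
rewrite -{1}[(m * p)%N]add0n big_addn addKn big_mkord.
by apply: eq_bigr => i _; rewrite addnC.
Qed.

Lemma sum_pair K (F : nat -> R) :
  \sum_(I < n ^ (K + K)) F I = \sum_(a < n ^ K) \sum_(b < n ^ K) F (a * n ^ K + b)%N.
Proof. by rewrite expnD big_split_mul. Qed.

Definition bs K G := \sum_(I < n ^ K) G (ds K I).

Lemma bs0 G : bs 0 G = G [::].
Proof. by rewrite /bs expn0 big_ord1. Qed.

Lemma bsS K G : bs K.+1 G = \sum_(c < n) bs K (fun s => G ((c : nat) :: s)).
Proof.
rewrite /bs expnS mulnC (@big_split_mul (n ^ K) (fun I => G (ds K.+1 I)) n).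
rewrite exchange_big /=; apply: eq_bigr => c _; apply: eq_bigr => i _.
by rewrite modnMDl modn_small // divnMDl // divn_small // addn0.
Qed.

Lemma eq_bs K G G' : (forall s, size s = K -> all (fun c => c < n)%N s -> G s = G' s) ->
  bs K G = bs K G'.
Proof. by move=> h; apply: eq_bigr => I _; apply: h; rewrite ?size_ds ?all_ds. Qed.

Lemma bsZ K a G : bs K (fun s => a * G s) = a * bs K G.
Proof. by rewrite /bs mulr_sumr. Qed.

Definition permF F := forall s t, perm_eq s t -> F s = F t.

Lemma permF_cons F c : permF F -> permF (fun s => F (c :: s)).
Proof. by move=> hF s t h; apply: hF; rewrite perm_cons. Qed.

(** The count of [a] is a sum over the [K.+1] positions, and since [G] ignores the order of the
    letters, each position contributes the same sum as the first. *)
Lemma bs_count K a G : (a < n)%N -> permF G ->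
  bs K.+1 (fun s => (count_mem a s)%:R * G s) = K.+1%:R * bs K (fun s => G (a :: s)).
Proof.
move=> ha; elim: K G => [|K IH] G hG.
  rewrite bsS bs0 mul1r (bigD1 (Ordinal ha)) //= big1 => [|c hc].
    by rewrite bs0 /= eqxx addn0 mul1r addr0.
  rewrite bs0 /=; have -> : ((c : nat) == a) = false by apply: contraNF hc => /eqP H; apply/eqP/val_inj.
  by rewrite mul0r.
rewrite bsS.
have E (c : 'I_n) : bs K.+1 (fun s => (count_mem a ((c : nat) :: s))%:R * G ((c : nat) :: s)) =
   ((c : nat) == a)%:R * bs K.+1 (fun s => G ((c : nat) :: s)) +
   K.+1%:R * bs K (fun s => G (a :: (c : nat) :: s)).
  rewrite -bsZ -[K.+1%:R * _](_ : bs K.+1 (fun s => (count_mem a s)%:R * G ((c : nat) :: s)) = _); last first.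
    rewrite (IH (fun s => G ((c : nat) :: s))) //; last exact: permF_cons.
    congr (_ * _); apply: eq_bs => s _ _; apply: hG.
    by apply/permP => P /=; rewrite addnCA.
  by rewrite /bs -big_split /=; apply: eq_bigr => I _; rewrite natrD mulrDl.
rewrite (eq_bigr _ (fun c _ => E c)) big_split /= -mulr_sumr -(bsS K (fun t => G (a :: t))).
rewrite (bigD1 (Ordinal ha)) //= eqxx mul1r big1 => [|c hc]; last first.
  have -> : ((c : nat) == a) = false by apply: contraNF hc => /eqP H; apply/eqP/val_inj.
  by rewrite mul0r.
by rewrite addr0 -[K.+2]add1n natrD mulrDl mul1r.
Qed.

(* Moments of the standard Gaussian. *)
Fixpoint mu1 (k : nat) : R := match k with 0 => 1 | 1 => 0 | k'.+2 => k'.+1%:R * mu1 k' end.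
Definition mom (s : seq nat) : R := \prod_(c < n) mu1 (count_mem (c : nat) s).

Fixpoint dbl (s : seq nat) := if s is c :: s' then [:: c, c & dbl s'] else [::].
Fixpoint dfact (k : nat) : R := if k is k'.+1 then (k'.*2.+1)%:R * dfact k' else 1.

Lemma perm_dbl s : perm_eq (s ++ s) (dbl s).
Proof.
elim: s => //= c s IH; rewrite perm_cons.
apply: (@perm_trans _ (c :: s ++ s)); last by rewrite perm_cons.
by apply/permP => P /=; rewrite !count_cat /= addnCA.
Qed.

(* Gaussian integration by parts, at the level of the moment tensors. *)
Lemma bs_mom D F : permF F ->
  bs D.*2 (fun s => F s * mom s) = dfact D * bs D (fun s => F (dbl s)).
Proof.
elim: D F => [|D IH] F hF.
  by rewrite !bs0 mul1r /mom big1 ?mulr1.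
rewrite doubleS bsS.
(* By the recurrence of [mu1] in the coordinate [a], [mom (a :: s)] is the number of [a] in [s]
   times this product; [bs_count] then trades that number for a second letter [a]. *)
pose mR a (s : seq nat) : R := mu1 (count_mem a s).-1 * \prod_(c < n | (c : nat) != a) mu1 (count_mem (c : nat) s).
have mE (a : 'I_n) s : mom ((a : nat) :: s) = (count_mem (a : nat) s)%:R * mR a s.
  rewrite /mom /mR (bigD1 a) //= eqxx mulrA; congr (_ * _).
    by rewrite add1n; case: (count_mem _ s) => [|k] /=; rewrite ?mul0r.
  by apply: eq_bigr => c hc; rewrite eq_sym (negbTE hc : ((c : nat) == a) = false).
have E (a : 'I_n) : bs D.*2.+1 (fun s => F ((a : nat) :: s) * mom ((a : nat) :: s)) =
    D.*2.+1%:R * (dfact D * bs D (fun s => F [:: (a : nat), (a : nat) & dbl s])).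
  rewrite -(IH (fun s => F [:: (a : nat), (a : nat) & s])); last exact: (@permF_cons (fun s => F ((a : nat) :: s)) a (@permF_cons F a hF)).
  have -> : bs D.*2 (fun s => F [:: (a : nat), (a : nat) & s] * mom s) =
      bs D.*2 (fun s => F [:: (a : nat), (a : nat) & s] * mR a ((a : nat) :: s)).
    apply: eq_bs => s _ _; congr (_ * _); rewrite /mom /mR (bigD1 a) //= eqxx add1n /=.
    by congr (_ * _); apply: eq_bigr => c hc; rewrite eq_sym (negbTE hc : ((c : nat) == a) = false).
  rewrite -(bs_count _ (ltn_ord a) (G := fun s => F ((a : nat) :: s) * mR a s)).
    by apply: eq_bs => s _ _; rewrite mE mulrCA.
  move=> s t h; congr (_ * _); first exact: (@permF_cons F a hF).
  rewrite /mR (permP h); congr (_ * _); apply: eq_bigr => c _.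
  by rewrite (permP h).
rewrite (eq_bigr _ (fun a _ => E a)) -!mulr_sumr bsS /= -mulrA.
by congr (_ * (_ * _)); apply: eq_bigr.
Qed.

Lemma dfact_ge0 D : 0 <= dfact D.
Proof. by elim: D => //= D IH; rewrite mulr_ge0. Qed.

Lemma dfact_le D : dfact D <= (D.*2)%:R ^+ D.
Proof.
suff H m : (D <= m)%N -> dfact D <= (m.*2)%:R ^+ D by exact: H.
elim: D => [|D IH] hm /=; first by rewrite expr0.
rewrite exprS ler_pM ?dfact_ge0 ?ler_nat //; last by apply: IH; lia.
lia.
Qed.

Lemma mu1_ge0 k : 0 <= mu1 k.
Proof.
suff: 0 <= mu1 k /\ 0 <= mu1 k.+1 by case.
elim: k => [|k [h1 h2]]; first by rewrite /= ler01 lexx.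
split=> //.
by rewrite /= mulr_ge0.
Qed.

Lemma mu1_le m k : (k <= m)%N -> mu1 k ^+ 2 <= m%:R ^+ k.
Proof.
suff: ((k <= m)%N -> mu1 k ^+ 2 <= m%:R ^+ k) /\ ((k.+1 <= m)%N -> mu1 k.+1 ^+ 2 <= m%:R ^+ k.+1) by case.
elim: k => [|k [h1 h2]]; first by split=> [_|h] /=; rewrite ?expr1n ?expr0 // expr0n /= expr1 ler0n.
split=> // hm; rewrite /= exprMn -[k.+2]addn2 exprD mulrC.
apply: ler_pM; rewrite ?exprn_ge0 ?mu1_ge0 ?ler0n //; first by apply: h1; lia.
by apply: lerXn2r; rewrite ?nnegrE ?ler0n // ler_nat; lia.
Qed.

Lemma sum_count (s : seq nat) : all (fun c => c < n)%N s -> (\sum_(c < n) count_mem (c : nat) s = size s)%N.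
Proof.
elim: s => [|a s IH] /=; first by rewrite big1.
move=> /andP[ha /IH hs]; rewrite big_split /= hs (bigD1 (Ordinal ha)) //= eqxx big1 //.
by move=> c hc; rewrite eq_sym; apply/eqP; rewrite eqb0; exact: hc.
Qed.

Lemma mom_ge0 s : 0 <= mom s.
Proof. by apply: prodr_ge0 => c _; exact: mu1_ge0. Qed.

Lemma mom_le s : all (fun c => c < n)%N s -> mom s ^+ 2 <= (size s)%:R ^+ size s.
Proof.
move=> hs; rewrite /mom -prodrXl -{2}(sum_count hs) expr_sum.
apply: ler_prod => c _; rewrite sqr_ge0 /=; apply: mu1_le; exact: count_size.
Qed.

End digits.

(** * Symmetric tensors and the approximate triangle inequality *)

Section tensors.
Variables (R : realType) (n : nat).
Hypothesis n0 : (0 < n)%N.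
Implicit Types (F G : seq nat -> R) (x y z v : nat -> R) (zs : seq (nat -> R)).

Definition sq v : R := \sum_(c < n) v c * v c.
Definition dot x y : R := \sum_(c < n) x c * y c.
Definition pw K v (I : nat) : R := \prod_(k < K) v (I %/ n ^ k %% n)%N.

Fixpoint tz zs (I : nat) : R := if zs is z :: zs' then z (I %% n)%N * tz zs' (I %/ n)%N else 1.

Lemma pw_tz K v I : pw K v I = tz (nseq K v) I.
Proof.
rewrite /pw; elim: K I => [|K IH] I /=; first by rewrite big_ord0.
rewrite big_ord_recl expn0 divn1 -IH; congr (_ * _); apply: eq_bigr => k _.
by rewrite /= expnS divnMA.
Qed.

Lemma tz_cat zs1 zs2 a b : (b < n ^ size zs1)%N ->
  tz (zs1 ++ zs2) (a * n ^ size zs1 + b) = tz zs1 b * tz zs2 a.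
Proof.
elim: zs1 b => [|z zs1 IH] b /=.
  by rewrite expn0 ltnS leqn0 => /eqP ->; rewrite muln1 addn0 mul1r.
rewrite expnS => hb; rewrite mulnA [(a * n)%N]mulnC -mulnA mulnC.
rewrite modnMDl divnMDl // IH ?mulrA // ltn_divLR // mulnC //.
Qed.

Lemma sum_tz zs zs' : size zs = size zs' ->
  \sum_(I < n ^ size zs) tz zs I * tz zs' I = \prod_(p <- zip zs zs') dot p.1 p.2.
Proof.
elim: zs zs' => [|z zs IH] [|z' zs'] //=; first by rewrite expn0 big_ord1 big_nil mulr1.
move=> [/IH {}IH]; rewrite expnS mulnC big_cons -IH /= mulr_sumr.
rewrite (big_split_mul (n ^ size zs)%N (fun I => z (I %% n)%N * tz zs (I %/ n)%N * (z' (I %% n)%N * tz zs' (I %/ n)%N))).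
apply: eq_bigr => i _; rewrite /dot mulr_suml; apply: eq_bigr => c _.
by rewrite modnMDl modn_small // divnMDl // divn_small // addn0; ring.
Qed.

Lemma sum_pw K x y : \sum_(I < n ^ K) pw K x I * pw K y I = dot x y ^+ K.
Proof.
have := @sum_tz (nseq K x) (nseq K y); rewrite !size_nseq => /(_ erefl) H.
under eq_bigr do rewrite !pw_tz.
rewrite H.
by elim: K {H} => [|K IH] /=; rewrite ?big_nil ?expr0 // big_cons IH exprS.
Qed.

(** The contraction of a tensor, given as a function of words, with the vectors [zs]. The recursion
    on [zs] makes multilinearity and the exchange of arguments easy, unlike the sum over encoded
    indices ([mctE]). *)
Fixpoint mct zs F : R :=
  if zs is z :: zs' then \sum_(c < n) z c * mct zs' (fun s => F ((c : nat) :: s)) else F [::].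

Lemma mctE zs F : \sum_(I < n ^ size zs) F (ds n (size zs) I) * tz zs I = mct zs F.
Proof.
elim: zs F => [|z zs IH] F /=; first by rewrite expn0 big_ord1 mulr1.
rewrite expnS mulnC (big_split_mul (n ^ size zs)%N (fun I => F ((I %% n)%N :: ds n (size zs) (I %/ n)) * (z (I %% n)%N * tz zs (I %/ n)%N))).
rewrite exchange_big; apply: eq_bigr => c _; rewrite -IH mulr_sumr.
apply: eq_bigr => i _.
by rewrite modnMDl modn_small // divnMDl // divn_small // addn0; ring.
Qed.

Lemma mct_eq zs F G : (forall s, F s = G s) -> mct zs F = mct zs G.
Proof.
elim: zs F G => [|z zs IH] F G h //=; apply: eq_bigr => c _; congr (_ * _); exact: IH.
Qed.

Lemma mct_swap z z' zs F : permF F -> mct [:: z, z' & zs] F = mct [:: z', z & zs] F.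
Proof.
move=> hF /=; under eq_bigr do rewrite mulr_sumr.
rewrite exchange_big; apply: eq_bigr => c _; rewrite mulr_sumr; apply: eq_bigr => c' _.
rewrite mulrCA; congr (_ * (_ * _)); apply: mct_eq => s; apply: hF.
by apply/permP => P /=; rewrite addnCA.
Qed.

Lemma mct_insert z zs1 zs2 F : permF F -> mct (zs1 ++ z :: zs2) F = mct (z :: zs1 ++ zs2) F.
Proof.
elim: zs1 F => [|z1 zs1 IH] F hF //.
rewrite [RHS]mct_swap //= ; apply: eq_bigr => c _; congr (_ * _).
exact: IH (permF_cons _ hF).
Qed.

Definition pick x y (b : bool) := if b then x else y.

Lemma mct_perm x y (bs bs' : seq bool) F : permF F -> perm_eq bs bs' ->
  mct (map (pick x y) bs) F = mct (map (pick x y) bs') F.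
Proof.
elim: bs bs' F => [|b bs IH] bs' F hF; first by rewrite perm_sym => /perm_nilP ->.
move=> h; have hb : b \in bs' by rewrite -(perm_mem h) mem_head.
move: h; case/path.splitPr: hb => l1 l2 h.
rewrite map_cat /= mct_insert //=; apply: eq_bigr => c _; congr (_ * _).
rewrite -map_cat; apply: IH; first exact: permF_cons.
rewrite -(perm_cons b); apply: (perm_trans h).
by apply/permP => P /=; rewrite !count_cat /= addnCA.
Qed.

Lemma mct_add z1 z2 zs zs' F :
  mct (zs ++ (fun c => z1 c + z2 c) :: zs') F = mct (zs ++ z1 :: zs') F + mct (zs ++ z2 :: zs') F.
Proof.
elim: zs F => [|z zs IH] F /=; rewrite -big_split /=; apply: eq_bigr => c _.
  by rewrite mulrDl.
by rewrite IH mulrDr.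
Qed.

Lemma mct_add_le K x y F M :
  (forall bs, size bs = K -> `|mct (map (pick x y) bs) F| <= M) ->
  `|mct (nseq K (fun c => x c + y c)) F| <= 2 ^+ K * M.
Proof.
move=> h; suff H k : forall bs, (size bs + k)%N = K ->
   `|mct (map (pick x y) bs ++ nseq k (fun c => x c + y c)) F| <= 2 ^+ k * M.
  exact: (H K [::]).
elim: k => [|k IH] bs hs; first by rewrite cats0 mul1r h //; lia.
rewrite mct_add (le_trans (ler_normD _ _)) // exprS -mulrA mulr_natl mulr2n.
have E b : map (pick x y) bs ++ pick x y b :: nseq k (fun c => x c + y c) =
  map (pick x y) (rcons bs b) ++ nseq k (fun c => x c + y c).
  by rewrite map_rcons cat_rcons.
by rewrite (E true) (E false); apply: lerD; apply: IH; rewrite size_rcons; lia.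
Qed.

Variable D : nat.
Notation K2 := (D + D)%N.
Notation ND := (n ^ D)%N.
Implicit Types (L : nat -> R).

Definition eps : R := ND%:R^-1.
Definition ip (A B : nat -> R) : R := \sum_(I < n ^ K2) A I * B I.
Definition tr L : R := \sum_(a < ND) L (a * ND + a)%N.
Definition sim (I J : nat) := perm_eq (ds n K2 I) (ds n K2 J).
Definition symm L := forall I J, (I < n ^ K2)%N -> (J < n ^ K2)%N -> sim I J -> L I = L J.
Definition psd L := forall c : nat -> R,
  0 <= \sum_(a < ND) \sum_(b < ND) c a * c b * L (a * ND + b)%N + eps * \sum_(a < ND) c a * c a.
Definition valid L := [/\ symm L, tr L <= 2 & psd L].

Lemma ND_gt0 : 0 < ND%:R :> R.
Proof. by rewrite ltr0n expn_gt0 n0. Qed.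
Lemma eps_gt0 : 0 < eps. Proof. by rewrite invr_gt0 ND_gt0. Qed.

(** Reading the entry at the sorted word gives a permutation-invariant function for any [L]; it
    agrees with [L] as soon as [L] is symmetric ([FLE]). *)
Definition FL L (s : seq nat) : R := L (undig n (sort leq s)).

Lemma permF_FL L : permF (FL L).
Proof. by move=> s t /(perm_sortP leq_total leq_trans anti_leq) h; rewrite /FL h. Qed.

Lemma FLE L I : symm L -> (I < n ^ K2)%N -> FL L (ds n K2 I) = L I.
Proof.
move=> hL hI; have hp : perm_eq (sort leq (ds n K2 I)) (ds n K2 I) by rewrite perm_sort.
have hs : size (sort leq (ds n K2 I)) = K2 by rewrite size_sort size_ds.
have ha : all (fun c => c < n)%N (sort leq (ds n K2 I)).
  by rewrite (perm_all _ hp) all_ds.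
apply: hL => //; first by have := undig_lt n0 ha; rewrite hs.
rewrite /sim; have := undigK n0 ha; rewrite hs => ->.
exact: hp.
Qed.

Lemma ip_tz L zs : symm L -> size zs = K2 -> ip L (tz zs) = mct zs (FL L).
Proof.
move=> hL hs; rewrite -mctE hs; apply: eq_bigr => I _; by rewrite FLE.
Qed.

Lemma ip_pw L v : symm L -> ip L (pw K2 v) = mct (nseq K2 v) (FL L).
Proof.
move=> hL; rewrite -ip_tz ?size_nseq //; by apply: eq_bigr => I _; rewrite pw_tz.
Qed.

(* The value of [L + eps I] on a pair of products of [x]'s and [y]'s. *)
Lemma bil_tz L x y bs1 bs2 : symm L -> size bs1 = D -> size bs2 = D ->
  \sum_(a < ND) \sum_(b < ND) tz (map (pick x y) bs1) a * tz (map (pick x y) bs2) b * L (a * ND + b)%N =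
  mct (map (pick x y) (bs2 ++ bs1)) (FL L).
Proof.
move=> hL h1 h2; rewrite -ip_tz //; last by rewrite size_map size_cat h1 h2.
rewrite /ip (sum_pair n D (fun I => L I * tz (map (pick x y) (bs2 ++ bs1)) I)).
apply: eq_bigr => a _; apply: eq_bigr => b _.
rewrite map_cat; have := @tz_cat (map (pick x y) bs2) (map (pick x y) bs1) a b.
by rewrite !size_map h2 => -> //; ring.
Qed.

Lemma sq_ge0 v : 0 <= sq v.
Proof. by apply: sumr_ge0 => c _; rewrite -expr2 sqr_ge0. Qed.

Lemma sq_add x y : sq (fun c => x c + y c) <= 2 * sq x + 2 * sq y.
Proof.
rewrite /sq !mulr_sumr -big_split; apply: ler_sum => c _ /=.
have := sqr_ge0 (x c - y c); nra.
Qed.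

Lemma norm_tz x y bs M : size bs = D -> sq x <= M -> sq y <= M ->
  \sum_(a < ND) tz (map (pick x y) bs) a * tz (map (pick x y) bs) a <= M ^+ D.
Proof.
move=> hs hx hy; have := @sum_tz (map (pick x y) bs) (map (pick x y) bs) erefl.
rewrite size_map hs => ->; rewrite -hs.
suff: 0 <= \prod_(p <- zip (map (pick x y) bs) (map (pick x y) bs)) dot p.1 p.2 <= M ^+ size bs by case/andP.
elim: bs {hs} => [|b bs /andP[IH1 IH2]] /=; first by rewrite big_nil expr0 ler01 lexx.
have h0 : 0 <= sq (pick x y b) by exact: sq_ge0.
have h1 : sq (pick x y b) <= M by case: (b).
by rewrite big_cons exprS /= mulr_ge0 //= ler_pM.
Qed.

(* Since [L + eps I] is positive on the products of [x]'s and [y]'s, the mixed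
   moments of [L] are discretely convex up to an error [O(M)]. *)
Lemma discrete_max (f : nat -> R) (M : R) m : f 0 <= M -> f m <= M ->
  (forall i, (0 < i < m)%N -> f i <= (f i.-1 + f i.+1) / 2) ->
  forall i, (i <= m)%N -> f i <= M.
Proof.
move=> h0 hm hc.
pose i0 := [arg max_(i > (ord0 : 'I_m.+1)) f i]%O.
have i0max (j : 'I_m.+1) : f j <= f i0 by rewrite /i0; case: arg_maxP => // i _ /(_ j isT).
have ex : exists i, (i <= m)%N && (f i == f i0) by exists i0; rewrite -ltnS ltn_ord eqxx.
have [i /andP[im /eqP fi] imin] := ex_minnP ex.
suff H : f i <= M.
  move=> j jm; apply: le_trans H; rewrite fi; have jm' : (j < m.+1)%N by [].
  exact: (i0max (Ordinal jm')).
case: (posnP i) => [->//|ipos]; case: (eqVneq i m) => [->//|inm].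
have := hc i ltac:(lia).
have h1 : f i.-1 <= f i by rewrite fi; exact: (i0max (Ordinal (leq_trans (leq_pred i) im : i.-1 < m.+1)%N)).
have im' : (i.+1 < m.+1)%N by rewrite ltnS ltn_neqAle inm.
have h2 : f i.+1 <= f i by rewrite fi; exact: (i0max (Ordinal im')).
have h3 : f i.-1 != f i.
  apply/negP => /eqP E; have := imin i.-1; rewrite E fi eqxx andbT.
  by move=> /(_ ltac:(lia)); lia.
by move: h3; rewrite neq_lt => /orP[] h3; lra.
Qed.

(** The second difference of [j (m - j)] is -2, so subtracting a multiple of this parabola absorbs a
    constant error in a convexity inequality without changing the end values. *)
Lemma parabola_convex (m j : nat) : (0 < j < m)%N ->
  (j.-1 * (m - j.-1) + j.+1 * (m - j.+1) + 2 = 2 * (j * (m - j)))%N.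
Proof.
case: j => // j /andP[_ hj]; rewrite [j.+1.-1]/=.
have -> : (m - j = (m - j.+2).+2)%N by lia.
have -> : (m - j.+1 = (m - j.+2).+1)%N by lia.
by move: (m - j.+2)%N => r; lia.
Qed.

Lemma parabola_le (m i : nat) : (i <= m)%N -> (i * (m - i) * 4 <= m * m)%N.
Proof.
move=> hi; have := nat_AGM2 i (m - i); rewrite subnKC // => h.
by rewrite mulnC -[(m * m)%N]/(m ^ 2)%N; exact: h.
Qed.

Lemma quad_le_exp4 (m : nat) : (2 <= m)%N -> (8 + m * m <= 2 * 4 ^ m)%N.
Proof.
move=> hm; rewrite -(subnKC hm) expnD; elim: (m - 2)%N => // k.
by rewrite -[(4 ^ 2)%N]/16%N expnS; move: (4 ^ k)%N => p; nia.
Qed.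

Definition bits m i := nseq i true ++ nseq (m - i) false.

Lemma size_bits m i : (i <= m)%N -> size (bits m i) = m.
Proof. by move=> h; rewrite size_cat !size_nseq subnKC. Qed.

(** A mixed moment depends only on the number of its arguments equal to [x]; any word can thus be
    rearranged into two halves [bits m i] and [bits m j], to which positivity applies. *)
Lemma perm_bits m i j (s : seq bool) : (i <= m)%N -> (j <= m)%N ->
  size s = (m + m)%N -> count_mem true s = (i + j)%N -> perm_eq s (bits m i ++ bits m j).
Proof.
move=> hi hj hs hk; apply/permP => P; rewrite !count_cat !count_nseq.
have hc : (count_mem true s + count_mem false s = m + m)%N.
  by rewrite -hs -(count_predC (pred1 true)); congr (_ + _)%N; apply: eq_count; case.
have -> : count P s = (P true * count_mem true s + P false * count_mem false s)%N.
  elim: s {hs hk hc} => [|b l IHl] /=; first by rewrite !muln0.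
  by rewrite IHl; case: b => /=; lia.
by case: (P true); case: (P false); rewrite ?mul1n ?mul0n ?addn0; lia.
Qed.

Lemma split_double m k : (k <= m + m)%N ->
  exists i j, [/\ (i <= m)%N, (j <= m)%N & k = (i + j)%N].
Proof.
move=> hk; case: (leqP k m) => h; first by exists k, 0%N; split=> //; lia.
by exists m, (k - m)%N; split; lia.
Qed.

Definition qf L v : R := ip L (pw K2 v) + 2 * eps * sq v ^+ D.

Definition blin L (f g : nat -> R) : R :=
  \sum_(a < ND) \sum_(b < ND) f a * g b * L (a * ND + b)%N + eps * \sum_(a < ND) f a * g a.

(** Expand the nonnegative values of the form at [c + c'] and [c - c']. *)
Lemma psd_pair L (c c' : nat -> R) : symm L -> psd L ->
  `|blin L c c'| <= (blin L c c + blin L c' c') / 2.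
Proof.
move=> hs hp; pose B := blin L; rewrite -/B.
have sL (a b : 'I_ND) : L (a * ND + b)%N = L (b * ND + a)%N.
  have lt (u w : 'I_ND) : (u * ND + w < n ^ K2)%N.
    have := ltn_ord w; have : (u.+1 * ND <= ND * ND)%N by rewrite leq_mul2r ltn_ord orbT.
    by rewrite expnD mulSn; lia.
  apply: hs => //; rewrite /sim !ds_cat //; by rewrite perm_catC.
have BC (f g : nat -> R) : B f g = B g f.
  congr (_ + _ * _); last by apply: eq_bigr => a _; rewrite mulrC.
  rewrite exchange_big; apply: eq_bigr => a _; apply: eq_bigr => b _ /=.
  by rewrite sL [g _ * _]mulrC.
have E (t : R) : B (fun a => c a + t * c' a) (fun a => c a + t * c' a) = B c c + 2 * t * B c c' + t * t * B c' c'.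
  suff : B (fun a => c a + t * c' a) (fun a => c a + t * c' a) = B c c + t * B c c' + t * B c' c + t * t * B c' c'.
    by move=> ->; rewrite (BC c' c); ring.
  rewrite /B /blin; set s1 := (X in X + eps * _); set s2 := (X in s1 + eps * X).
  rewrite (_ : s1 = \sum_(a < ND) \sum_(b < ND) c a * c b * L (a * ND + b)%N
     + t * (\sum_(a < ND) \sum_(b < ND) c a * c' b * L (a * ND + b)%N)
     + t * (\sum_(a < ND) \sum_(b < ND) c' a * c b * L (a * ND + b)%N)
     + t * t * (\sum_(a < ND) \sum_(b < ND) c' a * c' b * L (a * ND + b)%N)); last first.
    rewrite !mulr_sumr -!big_split; apply: eq_bigr => a _ /=.
    rewrite !mulr_sumr -!big_split; apply: eq_bigr => b _ /=; ring.
  rewrite (_ : s2 = \sum_(a < ND) c a * c a + t * (\sum_(a < ND) c a * c' a)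
     + t * (\sum_(a < ND) c' a * c a) + t * t * (\sum_(a < ND) c' a * c' a)); last first.
    by rewrite !mulr_sumr -!big_split; apply: eq_bigr => a _ /=; ring.
  ring.
have h1 : 0 <= B (fun a => c a + 1 * c' a) (fun a => c a + 1 * c' a) by exact: hp.
have h2 : 0 <= B (fun a => c a + (-1) * c' a) (fun a => c a + (-1) * c' a) by exact: hp.
by move: h1 h2; rewrite !E ler_norml => h1 h2; apply/andP; split; lra.
Qed.

Lemma qf_parts L v : symm L -> psd L ->
  0 <= ip L (pw K2 v) + eps * sq v ^+ D.
Proof.
move=> hs hp; have := hp (tz (map (pick v v) (nseq D true))).
rewrite (bil_tz v v hs) ?size_nseq // -nseqD.
have -> : map (pick v v) (nseq (D + D) true) = nseq K2 v by rewrite map_nseq.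
rewrite -ip_pw //; have := @sum_tz (map (pick v v) (nseq D true)) (map (pick v v) (nseq D true)) erefl.
rewrite size_map size_nseq => ->.
suff -> : \prod_(p <- zip (map (pick v v) (nseq D true)) (map (pick v v) (nseq D true))) dot p.1 p.2 = sq v ^+ D by [].
by rewrite map_nseq /=; elim: D {hs hp} => [|k IH] /=; rewrite ?big_nil ?expr0 // big_cons IH exprS.
Qed.

Lemma qf_ge0 L v : symm L -> psd L -> 0 <= qf L v.
Proof.
move=> hs hp; have := qf_parts v hs hp; rewrite /qf => h.
have : 0 <= eps * sq v ^+ D by rewrite mulr_ge0 ?exprn_ge0 ?sq_ge0 // ltW ?eps_gt0.
lra.
Qed.

Hypothesis D2 : (2 <= D)%N.

(** Expanding at [x + y] gives [4 ^ D] mixed moments. Let [e i] be the form [L + eps] at the product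
    of [i] factors [x] and [D - i] factors [y]. The ends [e 0] and [e D] are at most [M], and [e] is
    convex up to [2 M]; after subtraction of [2 M i (D - i)] it is bounded by its ends, whence
    [e i <= M (1 + D ^ 2 / 2)]. By [psd_pair] all mixed moments are at most [M (2 + D ^ 2 / 2)], and
    the total stays below [16 ^ D * M] because [4 + D ^ 2 / 2 <= 4 ^ D] for [D >= 2]. *)
Lemma qf_triangle L x y M : symm L -> psd L -> qf L x <= M -> qf L y <= M ->
  qf L (fun c => x c + y c) <= 16 ^+ D * M.
Proof.
move=> hs hp hx hy.
wlog hxy : x y hx hy / sq x <= sq y.
  move=> W; case/orP: (le_total (sq x) (sq y)) => h; first exact: W.
  have := W y x hy hx h; suff -> : qf L (fun c => y c + x c) = qf L (fun c => x c + y c) by [].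
  by congr (qf L _); apply/funext => c; rewrite addrC.
have e0 := eps_gt0.
have px := qf_parts x hs hp; have py := qf_parts y hs hp.
have sx0 : 0 <= sq x ^+ D by rewrite exprn_ge0 ?sq_ge0.
have sy0 : 0 <= sq y ^+ D by rewrite exprn_ge0 ?sq_ge0.
have M0 : 0 <= M by apply: le_trans hx; exact: qf_ge0.
have eyM : eps * sq y ^+ D <= M by rewrite /qf in hy; lra.
pose bb := bits D; have sbb i : (i <= D)%N -> size (bb i) = D by exact: size_bits.
pose C i := tz (map (pick x y) (bb i)).
pose B := blin L.
pose m bs := mct (map (pick x y) bs) (FL L).
pose e i := B (C i) (C i).
have nrm i : (i <= D)%N -> 0 <= eps * \sum_(a < ND) C i a * C i a <= M.
  move=> h; rewrite mulr_ge0 /=; last 2 first.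
  - exact: ltW.
  - by apply: sumr_ge0 => a _; rewrite -expr2 sqr_ge0.
  apply: le_trans eyM; rewrite ler_pM2l //; exact: norm_tz (sbb _ h) hxy (lexx _).
have crs i j : (i <= D)%N -> (j <= D)%N -> `|eps * \sum_(a < ND) C i a * C j a| <= M.
  move=> hi hj; have := nrm i hi; have := nrm j hj => /andP[_ nj] /andP[_ ni].
  rewrite normrM gtr0_norm //.
  have : `|\sum_(a < ND) C i a * C j a| <= (\sum_(a < ND) C i a * C i a + \sum_(a < ND) C j a * C j a) / 2.
    rewrite (le_trans (ler_norm_sum _ _ _)) // -big_split /= mulr_suml; apply: ler_sum => a _.
    rewrite ler_norml; have := sqr_ge0 (C i a - C j a); have := sqr_ge0 (C i a + C j a) => u w.
    by apply/andP; split; nra.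
  by nra.
have mB i j : (i <= D)%N -> (j <= D)%N -> B (C i) (C j) = m (bb j ++ bb i) + eps * \sum_(a < ND) C i a * C j a.
  by move=> hi hj; rewrite /B /blin bil_tz ?sbb.
have mP bs bs' : perm_eq bs bs' -> m bs = m bs' by exact: mct_perm (permF_FL L).
have cbb i : (i <= D)%N -> count_mem true (bb i) = i.
  by move=> h; rewrite count_cat !count_nseq /= mul1n mul0n addn0.
have bbP i j k l : (i <= D)%N -> (j <= D)%N -> (k <= D)%N -> (l <= D)%N -> (i + j = k + l)%N ->
    perm_eq (bb i ++ bb j) (bb k ++ bb l).
  move=> hi hj hk hl E; apply: perm_bits => //; first by rewrite size_cat !sbb.
  by rewrite count_cat !cbb.
have mle i j : (i <= D)%N -> (j <= D)%N -> `|m (bb j ++ bb i)| <= (e i + e j) / 2 + M.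
  move=> hi hj; have := psd_pair (C i) (C j) hs hp; rewrite -/B mB //.
  have := crs i j hi hj; rewrite -/(e i) -/(e j).
  by rewrite !ler_norml => /andP[u1 u2] /andP[w1 w2]; apply/andP; split; lra.
have eD : e D <= M.
  have := nrm D (leqnn _) => /andP[_].
  rewrite /e mB // => h.
  suff : m (bb D ++ bb D) + eps * sq x ^+ D <= M /\ eps * \sum_(a < ND) C D a * C D a = eps * sq x ^+ D by lra.
  have -> : bb D ++ bb D = nseq K2 true by rewrite /bb /bits subnn cats0 -nseqD.
  split.
    rewrite /m map_nseq -ip_pw //; rewrite /qf in hx; have : 0 <= eps * sq x ^+ D by rewrite mulr_ge0 // ltW.
    lra.
  congr (_ * _); rewrite /C /bb /bits subnn cats0; have := @sum_tz (map (pick x y) (nseq D true)) (map (pick x y) (nseq D true)) erefl.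
  rewrite size_map size_nseq => ->.
  by rewrite map_nseq /=; elim: (D) => [|k IH] /=; rewrite ?big_nil ?expr0 // big_cons IH exprS.
have e0' : e 0 <= M.
  rewrite /e mB //.
  suff : m (bb 0 ++ bb 0) + eps * sq y ^+ D <= M /\ eps * \sum_(a < ND) C 0 a * C 0 a = eps * sq y ^+ D by lra.
  have -> : bb 0 ++ bb 0 = nseq K2 false by rewrite /bb /bits subn0 -nseqD.
  split.
    rewrite /m map_nseq -ip_pw //; rewrite /qf in hy; have : 0 <= eps * sq y ^+ D by rewrite mulr_ge0 // ltW.
    lra.
  congr (_ * _); rewrite /C /bb /bits subn0; have := @sum_tz (map (pick x y) (nseq D false)) (map (pick x y) (nseq D false)) erefl.
  rewrite size_map size_nseq => ->.
  by rewrite map_nseq /=; elim: (D) => [|k IH] /=; rewrite ?big_nil ?expr0 // big_cons IH exprS.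
(* By symmetry of [L], the mixed moment pairing [i.-1] with [i.+1] is the one pairing [i] with
   itself; only the Euclidean terms differ, and each is at most [M]. *)
have econv i : (0 < i < D)%N -> e i <= (e i.-1 + e i.+1) / 2 + 2 * M.
  move=> /andP[hi0 i2]; have iD : (i <= D)%N := ltnW i2.
  have i1 : (i.-1 <= D)%N := leq_trans (leq_pred i) iD.
  have ei : e i = m (bb i ++ bb i) + eps * \sum_(a < ND) C i a * C i a := mB i i iD iD.
  have hb : perm_eq (bb i.+1 ++ bb i.-1) (bb i ++ bb i) by apply: bbP => //; rewrite addSnnS prednK.
  have := mle i.-1 i.+1 i1 i2; rewrite (mP _ _ hb).
  have /andP[_ u] := nrm i iD; move=> /(le_trans (ler_norm _)) w; rewrite ei; lra.
pose g i : R := 2 * M * (i * (D - i))%N%:R.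
have fM i : (i <= D)%N -> e i - g i <= M.
  apply: (discrete_max (f := fun i => e i - g i) (m := D)) => [||j hj].
  - by rewrite /g mul0n mulr0 subr0.
  - by rewrite /g subnn muln0 mulr0 subr0.
  - have := econv j hj; rewrite /g.
    have E : (j.-1 * (D - j.-1))%N%:R + (j.+1 * (D - j.+1))%N%:R + 2 = 2 * (j * (D - j))%N%:R :> R.
      by rewrite -!natrD -natrM parabola_convex.
    by nra.
have eM i : (i <= D)%N -> e i <= M * (1 + (D * D)%N%:R / 2).
  move=> hi; have := fM i hi; rewrite /g.
  have : (i * (D - i))%N%:R * 4 <= (D * D)%N%:R :> R by rewrite -natrM ler_nat parabola_le.
  nra.
have mM bs : size bs = K2 -> `|m bs| <= M * (2 + (D * D)%N%:R / 2).
  move=> hb; set k := count_mem true bs.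
  have hk : (k <= K2)%N by rewrite -hb count_size.
  have [j [i [hj hi hij]]] := split_double hk.
  rewrite (mP _ (bb j ++ bb i)); last exact: perm_bits.
  apply: le_trans (mle i j hi hj) _; have := eM i hi; have := eM j hj; lra.
have main : `|ip L (pw K2 (fun c => x c + y c))| <= 2 ^+ K2 * (M * (2 + (D * D)%N%:R / 2)).
  by rewrite ip_pw //; apply: mct_add_le => bs; exact: mM.
have sxy : eps * sq (fun c => x c + y c) ^+ D <= 4 ^+ D * M.
  apply: (@le_trans _ _ (eps * (4 * sq y) ^+ D)); last by rewrite exprMn mulrCA ler_pM2l ?exprn_gt0.
  rewrite ler_pM2l //; apply: lerXn2r; rewrite ?nnegrE ?sq_ge0 ?mulr_ge0 ?sq_ge0 //.
  have := sq_add x y; lra.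
have pD : 4 + (D * D)%N%:R / 2 <= 4 ^+ D :> R.
  have := quad_le_exp4 D2; rewrite -(ler_nat R) !natrD natrM natrX; lra.
have := le_trans (ler_norm _) main; rewrite /qf exprD -exprMn.
have -> : (2 * 2 : R) = 4 by ring.
have -> : (16 : R) = 4 * 4 by ring.
rewrite exprMn; move: sxy pD; set p := 4 ^+ D; set q := (D * D)%N%:R / 2.
have p0 : 0 < p by rewrite exprn_gt0.
have q0 : 0 <= q by rewrite divr_ge0.
set s := eps * _; move=> h1 h2 h3.
have h4 : p * (M * (2 + q)) + 2 * (p * M) <= p * (p * M).
  rewrite (_ : p * (M * (2 + q)) + 2 * (p * M) = p * (M * (4 + q))); last by ring.
  by rewrite ler_pM2l // mulrC ler_wpM2r.
have -> : 2 * eps * sq (fun c => x c + y c) ^+ D = 2 * s by rewrite /s mulrA.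
by rewrite -mulrA; lra.
Qed.

End tensors.

(** * Progress of the relaxation method *)

Section relaxation.
Variables (R : realType) (n D : nat).
Hypothesis n0 : (0 < n)%N.
Notation K2 := (D + D)%N.
Notation ND := (n ^ D)%N.
Notation M := (n ^ K2)%N.
Notation ip := (@ip R n D).
Notation sim := (sim n D).
Notation eps := (@eps R n D).
Implicit Types (L G A B : nat -> R).

(** Averaging over the indices with the same digits up to order is the orthogonal projection onto
    symmetric tensors; [ip_Sym] and [ip_Sym_le] are the two properties of a projection that are
    needed. *)
Definition Sym G I : R :=
  (\sum_(J < M) if sim I J then G J else 0) / (\sum_(J < M) if sim I J then 1 else 0).

Lemma sim_refl I : sim I I. Proof. exact: perm_refl. Qed.
Lemma sim_sym I J : sim I J = sim J I. Proof. exact: perm_sym. Qed.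
Lemma sim_l I J K : sim I J -> sim I K = sim J K.
Proof. by move=> h; apply/idP/idP => h'; [apply: perm_trans h'; rewrite perm_sym|apply: perm_trans h']. Qed.

Definition sz I : R := \sum_(J < M) if sim I J then 1 else 0.

Lemma sz_gt0 I : (I < M)%N -> 0 < sz I.
Proof.
move=> hI; rewrite /sz (bigD1 (Ordinal hI)) //= sim_refl ltr_pwDl //.
by apply: sumr_ge0 => J _; case: ifP.
Qed.

Lemma symm_Sym G : symm n D (Sym G).
Proof.
move=> I J hI hJ h; rewrite /Sym; congr (_ / _); apply: eq_bigr => K _; by rewrite (sim_l _ h).
Qed.

Lemma ip_sumE L G : ip L G = \sum_(I < M) L I * G I. Proof. by []. Qed.

Lemma ip_Sym L G : symm n D L -> ip L (Sym G) = ip L G.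
Proof.
move=> hL; rewrite /Submission.ip /Sym.
under eq_bigr => I _ do rewrite mulrA mulr_sumr mulr_suml.
rewrite exchange_big; apply: eq_bigr => J _ /=.
have -> : \sum_(I < M) (L I * (if sim I J then G J else 0) / \sum_(K < M) if sim I K then 1 else 0) =
  \sum_(I < M) (if sim J I then 1 else 0) * (L J * G J / sz J).
  apply: eq_bigr => I _; rewrite (sim_sym J I); case: ifP => h; last by rewrite mulr0 !mul0r.
  rewrite mul1r (hL I J) // /sz; congr (_ / _); apply: eq_bigr => K _; by rewrite (sim_l _ h).
rewrite -mulr_suml -/(sz J) mulrC divfK // gt_eqF // sz_gt0 //.
Qed.

Lemma ipC A B : ip A B = ip B A.
Proof. by apply: eq_bigr => I _; rewrite mulrC. Qed.

Lemma ip_ge0 A : 0 <= ip A A.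
Proof. by apply: sumr_ge0 => I _; rewrite -expr2 sqr_ge0. Qed.

Lemma ipDl A B C : ip (fun I => A I + B I) C = ip A C + ip B C.
Proof. by rewrite -big_split; apply: eq_bigr => I _; rewrite mulrDl. Qed.
Lemma ipBl A B C : ip (fun I => A I - B I) C = ip A C - ip B C.
Proof. by rewrite /Submission.ip -sumrB; apply: eq_bigr => I _; rewrite mulrBl. Qed.
Lemma ipZl a A B : ip (fun I => a * A I) B = a * ip A B.
Proof. by rewrite /Submission.ip mulr_sumr; apply: eq_bigr => I _; rewrite mulrA. Qed.

Lemma ip_Sym_le G : ip (Sym G) (Sym G) <= ip G G.
Proof.
have := ip_ge0 (fun I => G I - Sym G I).
rewrite ipBl [ip G _]ipC [ip (Sym G) (fun I => _)]ipC !ipBl.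
by rewrite [ip G (Sym G)]ipC (ip_Sym G (symm_Sym G)); lra.
Qed.

Lemma symmD A B : symm n D A -> symm n D B -> symm n D (fun I => A I + B I).
Proof. by move=> hA hB I J hI hJ h; rewrite (hA I J) // (hB I J). Qed.

(** Perceptron estimate: the squared distance to [V] changes by [2 <L - V, G> + |G|^2] when [G] is
    added. Replacing [G] by its projection keeps the first term, since [L] and [V] are symmetric,
    and can only decrease the second. *)
Lemma relax_progress L V G delta : symm n D L -> symm n D V ->
  2 * (ip L G - ip V G) + ip G G <= - delta ->
  ip (fun I => L I + Sym G I - V I) (fun I => L I + Sym G I - V I) <=
  ip (fun I => L I - V I) (fun I => L I - V I) - delta.
Proof.
move=> hL hV hG; have := ip_Sym_le G.
have hLG := ip_Sym G hL; have hVG := ip_Sym G hV.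
rewrite !ipBl ![ip _ (fun I => _ - _)]ipC !ipBl !ipDl ![ip _ (fun I => _ + _)]ipC !ipDl.
rewrite [ip (Sym G) L]ipC hLG [ip (Sym G) V]ipC hVG [ip V L]ipC; lra.
Qed.

Lemma symm_pw (v : nat -> R) : symm n D (pw n K2 v).
Proof.
move=> I J hI hJ h.
have E K : pw n K2 v K = \prod_(c <- ds n K2 K) v c.
  rewrite pw_tz; elim: (K2) K => [|k IH] K /=; first by rewrite big_nil.
  by rewrite big_cons IH.
by rewrite !E; apply: perm_big.
Qed.

Lemma ip_pw_pw (x y : nat -> R) : ip (pw n K2 x) (pw n K2 y) = dot n x y ^+ K2.
Proof. exact: sum_pw. Qed.

Lemma pw_split (v : nat -> R) a b : (b < ND)%N -> pw n K2 v (a * ND + b)%N = pw n D v a * pw n D v b.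
Proof.
move=> hb; rewrite !pw_tz nseqD; have := @tz_cat _ _ n0 (nseq D v) (nseq D v) a b.
by rewrite size_nseq => -> //; rewrite mulrC.
Qed.

Lemma tr_pw (v : nat -> R) : tr n D (pw n K2 v) = sq n v ^+ D.
Proof.
rewrite /tr -[sq n v]/(dot n v v) -(sum_pw n0); apply: eq_bigr => a _.
by rewrite pw_split.
Qed.

Definition diagT I : R := if (I %/ ND == I %% ND)%N then 1 else 0.

Lemma divmod_pair (a b : 'I_ND) : ((a * ND + b) %/ ND = a /\ (a * ND + b) %% ND = b)%N.
Proof.
by rewrite divnMDl ?(divn_small (ltn_ord b)) ?addn0 ?modnMDl ?modn_small // (leq_ltn_trans _ (ltn_ord a)).
Qed.

Lemma ip_diag L : ip L diagT = tr n D L.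
Proof.
rewrite ip_sumE (sum_pair n D (fun I => L I * diagT I)); apply: eq_bigr => a _.
rewrite (bigD1 a) //= big1 => [|b hb]; rewrite /diagT.
  by have [-> ->] := divmod_pair a a; rewrite eqxx mulr1 addr0.
by have [-> ->] := divmod_pair a b; rewrite eq_sym (negbTE hb : ((b : nat) == a) = false) mulr0.
Qed.

Lemma tr_diag : tr n D diagT = ND%:R.
Proof.
rewrite /tr (eq_bigr (fun => 1)) ?sumr_const ?card_ord // => a _.
by rewrite /diagT; have [-> ->] := divmod_pair a a; rewrite eqxx.
Qed.

Definition outer (u : nat -> R) I : R := u (I %/ ND)%N * u (I %% ND)%N.

Lemma ip_outer L u : ip L (outer u) = \sum_(a < ND) \sum_(b < ND) u a * u b * L (a * ND + b)%N.
Proof.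
rewrite ip_sumE (sum_pair n D (fun I => L I * outer u I)); apply: eq_bigr => a _.
by apply: eq_bigr => b _; rewrite /outer; have [-> ->] := divmod_pair a b; rewrite mulrC.
Qed.

Lemma outer_norm u : ip (outer u) (outer u) = (\sum_(a < ND) u a * u a) ^+ 2.
Proof.
rewrite ip_outer expr2 mulr_suml; apply: eq_bigr => a _; rewrite mulr_sumr.
by apply: eq_bigr => b _; rewrite /outer; have [-> ->] := divmod_pair a b; ring.
Qed.

Lemma pw_pos v u : 0 <= ip (pw n K2 v) (outer u).
Proof.
rewrite ip_outer; set S := \sum_(a < ND) _.
have -> : S = (\sum_(a < ND) u a * pw n D v a) ^+ 2.
  rewrite expr2 mulr_suml; apply: eq_bigr => a _; rewrite mulr_sumr.
  by apply: eq_bigr => b _; rewrite pw_split //; ring.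
exact: sqr_ge0.
Qed.

Lemma ND0 : 0 < ND%:R :> R. Proof. exact: ND_gt0. Qed.

(* The three updates of the relaxation method bring [L] closer to [pw v]. *)
Lemma progress_trace L v : symm n D L -> sq n v = 1 -> 2 < tr n D L ->
  let G := fun I => - eps * diagT I in
  ip (fun I => L I + Sym G I - pw n K2 v I) (fun I => L I + Sym G I - pw n K2 v I) <=
  ip (fun I => L I - pw n K2 v I) (fun I => L I - pw n K2 v I) - eps ^+ 2.
Proof.
move=> hL hv ht; cbv zeta; apply: relax_progress => //; first exact: symm_pw.
rewrite ![ip _ (fun I => _ * _)]ipC !ipZl [ip diagT (fun I => _ * _)]ipC ipZl.
rewrite [ip diagT L]ipC [ip diagT (pw _ _ _)]ipC !ip_diag tr_diag tr_pw hv expr1n.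
have e0 : 0 < eps by exact: eps_gt0.
have eN : eps * ND%:R = 1 by rewrite mulVf // gt_eqF ?ND0.
have e1 : eps <= 1.
  rewrite invr_le1 ?unitfE ?gt_eqF ?ND0 // -[1]/(1%:R) ler_nat expn_gt0 n0 //.
rewrite (_ : - eps * (- eps * ND%:R) = eps * (eps * ND%:R)); last by ring.
rewrite eN mulr1; nra.
Qed.

(** Since [L] pairs with [A] below [t] and the target above [2 t], a step of length [t / |A|^2]
    along [A] gains [t^2 / |A|^2]. The bound on [|A|] makes this at least [4 eps ^ 2]. *)
Lemma progress_moment L A v t : symm n D L -> sq n v = 1 -> 0 < t ->
  ip L A < t -> 2 * t <= ip (pw n K2 v) A -> ip A A <= (t * ND%:R / 2) ^+ 2 ->
  let G := fun I => (t / ip A A) * A I in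
  ip (fun I => L I + Sym G I - pw n K2 v I) (fun I => L I + Sym G I - pw n K2 v I) <=
  ip (fun I => L I - pw n K2 v I) (fun I => L I - pw n K2 v I) - eps ^+ 2.
Proof.
move=> hL hv ht h1 h2 h3; cbv zeta; apply: relax_progress => //; first exact: symm_pw.
rewrite ![ip _ (fun I => _ * _)]ipC !ipZl [ip A (fun I => _ * _)]ipC ipZl.
rewrite [ip A L]ipC [ip A (pw _ _ _)]ipC; set s := ip A A.
have s0 : 0 < s.
  rewrite lt_def ip_ge0 andbT; apply/negP => /eqP hs.
  have hz (I : 'I_M) : A I = 0.
    have : \sum_(I < M) A I * A I = 0 by exact: hs.
    move/eqP; rewrite psumr_eq0 => [/allP /(_ I)|J _]; last by rewrite -expr2 sqr_ge0.
    by rewrite mem_index_enum => /(_ isT) /=; rewrite mulf_eq0 orbb => /eqP.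
  move: h2; rewrite /Submission.ip big1 => [|I _]; [lra|by rewrite hz mulr0].
have ts : 0 < t / s by rewrite divr_gt0.
rewrite (_ : t / s * (t / s * s) = t / s * t); last by rewrite divfK // gt_eqF.
have : eps ^+ 2 <= t / s * t.
  rewrite exprVn -mulrA [s^-1 * t]mulrC mulrA -expr2 ler_pdivlMr // mulrC.
  rewrite ler_pdivrMr ?exprn_gt0 ?ND0 // (le_trans h3) // exprMn exprMn.
  rewrite -[X in _ <= X]mulr1 ler_wpM2l ?mulr_ge0 ?sqr_ge0 //; lra.
nra.
Qed.

Lemma progress_psd L v (u : nat -> R) : symm n D L -> sq n v = 1 ->
  0 < \sum_(a < ND) u a * u a ->
  \sum_(a < ND) \sum_(b < ND) u a * u b * L (a * ND + b)%N + eps * \sum_(a < ND) u a * u a <= 0 ->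
  let G := fun I => (eps / \sum_(a < ND) u a * u a) * outer u I in
  ip (fun I => L I + Sym G I - pw n K2 v I) (fun I => L I + Sym G I - pw n K2 v I) <=
  ip (fun I => L I - pw n K2 v I) (fun I => L I - pw n K2 v I) - eps ^+ 2.
Proof.
move=> hL hv hu hn; cbv zeta; apply: relax_progress => //; first exact: symm_pw.
rewrite ![ip _ (fun I => _ * _)]ipC !ipZl [ip (outer u) (fun I => _ * _)]ipC ipZl.
rewrite [ip (outer u) L]ipC [ip (outer u) (pw _ _ _)]ipC outer_norm.
have := pw_pos v u; move: hn; rewrite -ip_outer; set S := \sum_(a < ND) _ in hu *.
have e0 : 0 < eps by exact: eps_gt0.
move=> h1 h2; have eS : 0 < eps / S by rewrite divr_gt0.
have hS : eps / S * S = eps by rewrite divfK // gt_eqF.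
rewrite (_ : eps / S * (eps / S * S ^+ 2) = (eps / S * S) ^+ 2); last by ring.
rewrite hS.
have : eps / S * (ip L (outer u) - ip (pw n K2 v) (outer u)) <= eps / S * (- (eps * S)).
  by rewrite ler_pM2l //; lra.
rewrite mulrN mulrCA hS -expr2; lra.
Qed.

End relaxation.

(** * Exact positivity test by orthogonalization *)

Section gram_schmidt.
Variables (R : realType) (m : nat) (A : nat -> nat -> R) (U : nat -> nat -> R).
Hypothesis symA : forall a b, (a < m)%N -> (b < m)%N -> A a b = A b a.
Definition qA (f g : nat -> R) : R := \sum_(a < m) \sum_(b < m) f a * g b * A a b.
Hypothesis U_def : forall k b, (k < m)%N -> (b < m)%N ->
  U k b = (if k == b then 1 else 0) -
    \sum_(j < m) if (j < k)%N then (\sum_(c < m) A k c * U j c) / qA (U j) (U j) * U j b else 0.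

Lemma qA_sym f g : qA f g = qA g f.
Proof.
rewrite /qA exchange_big; apply: eq_bigr => a _; apply: eq_bigr => b _ /=.
by rewrite symA // [g _ * _]mulrC.
Qed.

Lemma qA_add a b f g h :
  qA (fun x => a * f x + b * g x) h = a * qA f h + b * qA g h.
Proof.
rewrite /qA !mulr_sumr -big_split; apply: eq_bigr => x _ /=.
rewrite !mulr_sumr -big_split; apply: eq_bigr => y _ /=; ring.
Qed.

Lemma qA_ext f f' g : (forall a, (a < m)%N -> f a = f' a) -> qA f g = qA f' g.
Proof. by move=> h; apply: eq_bigr => a _; apply: eq_bigr => b _; rewrite h. Qed.

Lemma qA_sum J (c : 'I_J -> R) (f : 'I_J -> nat -> R) g :
  qA (fun x => \sum_j c j * f j x) g = \sum_j c j * qA (f j) g.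
Proof.
rewrite /qA; under [RHS]eq_bigr do rewrite mulr_sumr.
rewrite [RHS]exchange_big; apply: eq_bigr => x _ /=.
under [RHS]eq_bigr do rewrite mulr_sumr.
rewrite [RHS]exchange_big; apply: eq_bigr => y _ /=.
by rewrite !mulr_suml; apply: eq_bigr => j _; ring.
Qed.

Lemma qA_delta k g : (k < m)%N -> qA (fun x => if k == x then 1 else 0) g = \sum_(c < m) A k c * g c.
Proof.
move=> hk; rewrite /qA (bigD1 (Ordinal hk)) //= [X in _ + X]big1 => [|a ha].
  by rewrite addr0; apply: eq_bigr => b _; rewrite eqxx mul1r mulrC.
apply: big1 => b _; have -> : (k == a) = false by apply: contraNF ha => /eqP h; apply/eqP/val_inj.
by rewrite !mul0r.
Qed.

Lemma U_supp k b : (k < m)%N -> (b < m)%N -> (k <= b)%N -> U k b = if k == b then 1 else 0.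
Proof.
elim/ltn_ind: k b => k IH b hk hb kb; rewrite U_def // big1 ?subr0 // => j _.
case: ifP => // hj; rewrite IH //; [|exact: leq_trans (ltnW hj) kb].
by rewrite (ltn_eqF (leq_trans hj kb)) mulr0.
Qed.

Lemma U_norm k : (k < m)%N -> 0 < \sum_(b < m) U k b * U k b.
Proof.
move=> hk; rewrite (bigD1 (Ordinal hk)) //= U_supp // eqxx mulr1 ltr_pwDl //.
by apply: sumr_ge0 => b _; rewrite -expr2 sqr_ge0.
Qed.

(** Orthogonalization without normalization needs no square root. The rows [U k] form a triangular
    system with unit diagonal, hence a basis; positive values of the form on pairwise orthogonal
    rows give positivity everywhere. Conversely a row with nonpositive value is itself a violating
    direction, nonzero by [U_norm]. *)
Lemma gs_psd : (forall k, (k < m)%N -> 0 < qA (U k) (U k)) -> forall c, 0 <= qA c c.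
Proof.
move=> hpos.
have orth k j : (k < m)%N -> (j < k)%N -> qA (U k) (U j) = 0.
  elim/ltn_ind: k j => k IH j hk hj; have hjm := ltn_trans hj hk.
  pose c (i : 'I_m) : R := if (i < k)%N then (\sum_(c < m) A k c * U i c) / qA (U i) (U i) else 0.
  rewrite (@qA_ext _ (fun x => 1 * (if k == x then 1 else 0) + (-1) * \sum_(i < m) c i * U i x)); last first.
    move=> a ha; rewrite U_def // mul1r mulN1r; congr (_ - _); apply: eq_bigr => i _.
    by rewrite /c; case: ifP => //; rewrite mul0r.
  rewrite qA_add qA_sum qA_delta // mul1r mulN1r [X in _ - X](bigD1 (Ordinal hjm)) //= [X in _ - (_ + X)]big1 => [|i hi].
    rewrite addr0 /c /= hj divfK ?subrr // gt_eqF // hpos //.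
  rewrite /c; case: ifP => hik; last by rewrite mul0r.
  have ij : (i : nat) != j by apply: contra hi => /eqP h; apply/eqP/val_inj.
  suff z : qA (fun x => U i x) (U j) = 0 by rewrite z mulr0.
  have [h|h|h] := ltngtP i j.
  - by rewrite qA_sym; apply: IH.
  - by apply: IH.
  - by rewrite h eqxx in ij.
(* Vectors supported on the first [k] coordinates are handled by induction: the last coordinate is
   removed by subtracting [c k] times the row [U k], whose entry there is 1, and the remainder is
   orthogonal to that row. *)
have span k c : (k <= m)%N -> (forall a, (a < m)%N -> (k <= a)%N -> c a = 0) ->
    (forall j, (k <= j)%N -> (j < m)%N -> qA (U j) c = 0) /\ 0 <= qA c c.
  elim: k c => [|k IH] c hk hc.
    have E g : qA g c = 0.
      by rewrite qA_sym /qA big1 // => a _; rewrite big1 // => b _; rewrite hc // !mul0r.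
    by split=> [j _ _|]; rewrite E.
  pose c' a := c a - c k * U k a.
  have hc' a : (a < m)%N -> (k <= a)%N -> c' a = 0.
    move=> ha ka; rewrite /c' U_supp //; case: eqP => [->|hne]; first by rewrite mulr1 subrr.
    by rewrite mulr0 subr0 hc // ltn_neqAle ka andbT; apply/eqP.
  have [r1 p1] := IH c' (ltnW hk) hc'.
  have cE : forall g, qA c g = c k * qA (U k) g + 1 * qA c' g.
    move=> g; rewrite -qA_add; apply: qA_ext => a _; rewrite /c'; ring.
  split=> [j kj jm|].
    by rewrite qA_sym cE qA_sym orth // mulr0 add0r mul1r qA_sym r1 // ltnW.
  rewrite cE qA_sym cE [qA c' c]qA_sym cE [qA c' (U k)]qA_sym r1 // !mulr0 !mul1r addr0 add0r mulrA -expr2.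
  by rewrite addr_ge0 // mulr_ge0 ?sqr_ge0 // ltW // hpos.
move=> c; have [] // := span m c (leqnn m).
by move=> a h1 h2; rewrite ltnNge h2 in h1.
Qed.

End gram_schmidt.

(** * The moment bound *)

Section moment_bound.
Variables (R : realType) (n D : nat).
Hypothesis n0 : (0 < n)%N.
Hypothesis D0 : (0 < D)%N.
Notation K2 := (D + D)%N.
Notation ND := (n ^ D)%N.
Notation M := (n ^ K2)%N.
Notation ip := (@ip R n D).
Notation eps := (@eps R n D).
Implicit Types (L A B : nat -> R).

Definition momT (I : nat) : R := mom R n (ds n K2 I).
(** [dev] dominates [dfact D] and the Gaussian moments of order [2 D], and its square those of order
    [4 D], hence the variance of an entry. In [sigma], 68 is [4 * 17]: the final bound adds up 13
    and 4 multiples of [dev], and [17 <= 17 ^ D]. *)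
Definition dev : R := (4 * D)%:R ^+ D.
Definition sigma : R := (68 * D)%:R ^+ D.

Lemma discriminant (p q r : R) : (forall t, 0 <= p + 2 * t * q + t * t * r) -> q ^+ 2 <= p * r.
Proof.
move=> h; have p0 : 0 <= p by have := h 0; rewrite mulr0 !mul0r !addr0.
case: (eqVneq r 0) => [r0|r0].
  case: (eqVneq q 0) => [->|q0]; first by rewrite expr0n r0 mulr0.
  have := h (- (p + 1) / (2 * q)); rewrite r0 mulr0 addr0.
  have -> : 2 * (- (p + 1) / (2 * q)) * q = - (p + 1) by field; rewrite q0.
  lra.
have r1 : 0 < r.
  rewrite lt_def r0 /=; rewrite leNgt; apply/negP => rn.
  pose t := (`|p| + 2 * `|q| + 1) / - r + 1.
  have nr : 0 < - r by lra.
  have n1 := normr_ge0 p; have n2 := normr_ge0 q.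
  have t1 : 1 <= t by rewrite /t lerDr divr_ge0 //; lra.
  have tr : t * - r >= `|p| + 2 * `|q| + 1 by rewrite (_ : t * - r = `|p| + 2 * `|q| + 1 - r); [lra|by rewrite /t; field; rewrite ?oppr_eq0 ?r0].
  have := h t; have := ler_norm p; have := ler_norm q.
  have : t * (t * - r) >= t * (`|p| + 2 * `|q| + 1) by rewrite ler_pM2l //; lra.
  nra.
have := h (- q / r); have -> : p + 2 * (- q / r) * q + - q / r * (- q / r) * r = (p * r - q ^+ 2) / r by field; rewrite r0.
by rewrite pmulr_lge0 ?invr_gt0 // subr_ge0.
Qed.

Definition entry L (u w : nat) : R := L (u * ND + w)%N + eps * (u == w)%:R.

Lemma psd_entry L (a b : 'I_ND) : symm n D L -> psd n D L ->
  entry L a b ^+ 2 <= entry L a a * entry L b b.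
Proof.
move=> hs hp; apply: discriminant => t.
have sL : L (a * ND + b)%N = L (b * ND + a)%N.
  have lt (u w : 'I_ND) : (u * ND + w < M)%N.
    have := ltn_ord w; have : (u.+1 * ND <= ND * ND)%N by rewrite leq_mul2r ltn_ord orbT.
    by rewrite expnD mulSn; lia.
  apply: hs => //; rewrite /sim !ds_cat //; by rewrite perm_catC.
pose dl (a : nat) (x : nat) : R := (x == a)%:R.
have sum1 (u : 'I_ND) (f : nat -> R) : \sum_(x < ND) dl u x * f x = f u.
  rewrite (bigD1 u) //= /dl eqxx /= mulr1n mul1r big1 ?addr0 // => x hx.
  by rewrite (negbTE hx : ((x : nat) == u) = false) mul0r.
have := hp (fun x => dl a x + t * dl b x).
have -> : \sum_(x < ND) \sum_(y < ND) (dl a x + t * dl b x) * (dl a y + t * dl b y) * L (x * ND + y)%N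
   = L (a * ND + a)%N + t * L (a * ND + b)%N + t * L (b * ND + a)%N + t * t * L (b * ND + b)%N.
  transitivity (\sum_(x < ND) (dl a x + t * dl b x) * (L (x * ND + a)%N + t * L (x * ND + b)%N)).
    apply: eq_bigr => x _; transitivity ((dl a x + t * dl b x) *
      (\sum_(y < ND) dl a y * L (x * ND + y)%N + t * \sum_(y < ND) dl b y * L (x * ND + y)%N)).
      by rewrite mulr_sumr -big_split mulr_sumr; apply: eq_bigr => y _ /=; ring.
    by rewrite (sum1 a (fun y => L (x * ND + y)%N)) (sum1 b (fun y => L (x * ND + y)%N)).
  transitivity (\sum_(x < ND) dl a x * (L (x * ND + a)%N + t * L (x * ND + b)%N)
     + t * \sum_(x < ND) dl b x * (L (x * ND + a)%N + t * L (x * ND + b)%N)).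
    by rewrite mulr_sumr -big_split; apply: eq_bigr => y _ /=; ring.
  rewrite (sum1 a (fun x => L (x * ND + a)%N + t * L (x * ND + b)%N)).
  rewrite (sum1 b (fun x => L (x * ND + a)%N + t * L (x * ND + b)%N)); ring.
have -> : \sum_(x < ND) (dl a x + t * dl b x) * (dl a x + t * dl b x) =
   1 + 2 * t * (a == b)%:R + t * t.
  transitivity (\sum_(x < ND) dl a x * dl a x + t * \sum_(x < ND) dl a x * dl b x
     + t * \sum_(x < ND) dl b x * dl a x + t * t * \sum_(x < ND) dl b x * dl b x).
    by rewrite !mulr_sumr -!big_split; apply: eq_bigr => y _ /=; ring.
  rewrite (sum1 a (dl a)) (sum1 a (dl b)) (sum1 b (dl a)) (sum1 b (dl b)).
  by rewrite /dl !eqxx [(b : nat) == a]eq_sym -[(a : nat) == b]/(a == b) /= mulr1n; ring.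
rewrite /entry !eqxx sL -[(a : nat) == b]/(a == b) => h; apply: le_trans h _.
by rewrite le_eqVlt; apply/orP; left; apply/eqP; rewrite /= mulr1n; ring.
Qed.

(** The matrix [A = L + eps] has nonnegative 2 by 2 minors, so the sum of its squared entries is at
    most the square of its trace, [(2 + 1) ^ 2]. Removing the diagonal gives
    [2 * 9 + 2 eps <= 20]. *)
Lemma valid_norm L : valid n D L -> ip L L <= 20.
Proof.
move=> [hs ht hp].
pose A := entry L.
have e0 : 0 < eps by exact: eps_gt0.
have N0 : 0 < ND%:R :> R by exact: ND_gt0.
have eN : eps * ND%:R = 1 by rewrite mulVf // gt_eqF.
have e1 : eps <= 1.
  by rewrite invr_le1 ?unitfE ?gt_eqF // -[1]/(1%:R) ler_nat expn_gt0 n0.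
have trA : \sum_(a < ND) A a a = tr n D L + 1.
  rewrite big_split /=; congr (_ + _); transitivity (\sum_(a < ND) eps).
    by apply: eq_bigr => a _; rewrite eqxx /= mulr1n mulr1.
  by rewrite sumr_const card_ord -mulr_natr.
have A0 (a : 'I_ND) : 0 <= A a a.
  have := hp (fun x => (x == a)%:R).
  have -> : \sum_(x < ND) \sum_(y < ND) (x == a :> nat)%:R * (y == a :> nat)%:R * L (x * ND + y)%N = L (a * ND + a)%N.
    rewrite (bigD1 a) //= [X in _ + X]big1 ?addr0 => [|x hx].
      rewrite (bigD1 a) //= [X in _ + X]big1 ?addr0 => [|y hy]; first by rewrite eqxx /= mulr1n !mul1r.
      by rewrite (negbTE hy : ((y : nat) == a) = false) mulr0 mul0r.
    by rewrite big1 // => y _; rewrite (negbTE hx : ((x : nat) == a) = false) !mul0r.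
  have -> : \sum_(x < ND) (x == a :> nat)%:R * (x == a :> nat)%:R = 1 :> R.
    rewrite (bigD1 a) //= [X in _ + X]big1 ?addr0 ?eqxx /= ?mulr1n ?mul1r // => x hx.
    by rewrite (negbTE hx : ((x : nat) == a) = false) mulr0.
  by rewrite /A /entry eqxx /= mulr1n mulr1.
have sA : \sum_(a < ND) \sum_(b < ND) A a b ^+ 2 <= 9.
  apply: (@le_trans _ _ (\sum_(a < ND) \sum_(b < ND) A a a * A b b)).
    by apply: ler_sum => a _; apply: ler_sum => b _; exact: psd_entry.
  have -> : \sum_(a < ND) \sum_(b < ND) A a a * A b b = (\sum_(a < ND) A a a) ^+ 2.
    by rewrite expr2 mulr_suml; apply: eq_bigr => a _; rewrite mulr_sumr.
  have h : 0 <= \sum_(a < ND) A a a by apply: sumr_ge0 => a _; exact: A0.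
  by rewrite trA in h *; nra.
rewrite ip_sumE (sum_pair n D (fun I => L I * L I)).
apply: (@le_trans _ _ (\sum_(a < ND) \sum_(b < ND) (2 * A a b ^+ 2 + 2 * eps ^+ 2 * (a == b)%:R))).
  apply: ler_sum => a _; apply: ler_sum => b _; rewrite /A /entry -[(a : nat) == b]/(a == b).
  case: (a == b); rewrite /= ?mulr1n ?mulr0n ?mulr1 ?mulr0 ?addr0; last by have := sqr_ge0 (L (a * ND + b)%N); rewrite expr2; lra.
  have := sqr_ge0 (L (a * ND + b)%N + 2 * eps); nra.
under eq_bigr do rewrite big_split -mulr_sumr /=.
rewrite big_split -mulr_sumr /=.
have -> : \sum_(a < ND) \sum_(b < ND) 2 * eps ^+ 2 * (a == b)%:R = 2 * eps.
  transitivity (\sum_(a < ND) 2 * eps ^+ 2).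
    apply: eq_bigr => a _; rewrite (bigD1 a) //= eqxx /= mulr1n mulr1 big1 ?addr0 // => b hb.
    by rewrite eq_sym (negbTE hb) mulr0.
  rewrite sumr_const card_ord -[_ *+ ND]mulr_natr.
  by rewrite (_ : 2 * eps ^+ 2 * ND%:R = 2 * eps * (eps * ND%:R)); [rewrite eN mulr1|ring].
lra.
Qed.

Lemma ip_mom L : symm n D L -> ip L momT = dfact R D * tr n D L.
Proof.
move=> hs; have := bs_mom n0 D (permF_FL n L); rewrite -addnn => h.
have -> : ip L momT = bs n K2 (fun s => FL n L s * mom R n s).
  by apply: eq_bigr => I _; rewrite (FLE n0 hs (ltn_ord I)).
rewrite h; congr (_ * _); apply: eq_bigr => a _.
rewrite -(permF_FL _ _ (perm_dbl _)).
have lt : (a * ND + a < M)%N.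
  have := ltn_ord a; have : (a.+1 * ND <= ND * ND)%N by rewrite leq_mul2r ltn_ord orbT.
  by rewrite expnD mulSn; lia.
by rewrite -(FLE n0 hs lt) ds_cat.
Qed.

Lemma two_mul_le A B (t : R) : 0 < t -> ip B B <= t ^+ 2 -> 2 * ip A B <= t * ip A A + t.
Proof.
move=> t0 hB.
have h : 0 <= ip (fun I => t * A I - B I) (fun I => t * A I - B I) by exact: ip_ge0.
have E : ip (fun I => t * A I - B I) (fun I => t * A I - B I) =
    t * t * ip A A - 2 * t * ip A B + ip B B.
  by rewrite !ip_sumE !mulr_sumr -sumrB -big_split; apply: eq_bigr => I _ /=; ring.
rewrite E in h.
have : 0 <= t * (t * ip A A - 2 * ip A B + t) by nra.
by rewrite pmulr_rge0 //; lra.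
Qed.

Lemma dev_gt0 : 0 < dev.
Proof. by rewrite exprn_gt0 // ltr0n muln_gt0. Qed.

Lemma momT_le I : momT I <= dev.
Proof.
have := mom_le R n0 (all_ds n0 K2 I); rewrite size_ds -/(momT I) => h.
rewrite -(@ler_pXn2r _ 2) ?nnegrE ?mom_ge0 ?(ltW dev_gt0) //.
apply: (le_trans h); rewrite /dev -exprM muln2 -addnn.
by apply: lerXn2r; rewrite ?nnegrE ?ler0n // ler_nat; lia.
Qed.

(* [avg] is meant to be the empirical moment tensor of the good samples. *)
Theorem valid_moment L (avg : nat -> R) : valid n D L ->
  \sum_(I < M) (avg I - momT I) ^+ 2 <= dev ^+ 2 ->
  ip L avg + 2 * eps * tr n D avg <= sigma.
Proof.
move=> hv havg; have [hs ht hp] := hv; have d0 := dev_gt0.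
pose De I := avg I - momT I.
have hD : ip De De <= dev ^+ 2 by apply: le_trans havg; apply: ler_sum => I _; rewrite expr2.
have E B : ip B avg = ip B momT + ip B De.
  by rewrite [ip B De]ipC ipBl [ip avg B]ipC [ip momT B]ipC; ring.
have e0 : 0 < eps by exact: eps_gt0.
have N0 : 0 < ND%:R :> R by exact: ND_gt0.
have eN : eps * ND%:R = 1 by rewrite mulVf // gt_eqF.
have N1 : 1 <= ND%:R :> R by rewrite -[1]/(1%:R) ler_nat expn_gt0 n0.
have dl : dfact R D <= dev.
  have h := dfact_le R n0 D; apply: (le_trans h); rewrite /dev; apply: lerXn2r; rewrite ?nnegrE ?ler0n // ler_nat -muln2; lia.
(* The Gaussian tensor contributes [dfact D * tr L <= 2 dev], and the deviation at most
   [(20 + 1) / 2] times [dev] by [valid_norm]. *)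
have h1 : ip L avg <= 13 * dev.
  have := two_mul_le L d0 hD; have := valid_norm hv; rewrite E ip_mom // => u1 u2.
  have : dfact R D * tr n D L <= dfact R D * 2 by rewrite ler_wpM2l ?dfact_ge0.
  nra.
have h2 : tr n D avg <= 2 * ND%:R * dev.
  rewrite -ip_diag ipC E [ip (@diagT R n D) momT]ipC ip_diag.
  have := two_mul_le (@diagT R n D) d0 hD; rewrite ip_diag // tr_diag // => u.
  have : tr n D momT <= \sum_(a < ND) dev by apply: ler_sum => a _; exact: momT_le.
  rewrite sumr_const card_ord -[_ *+ ND]mulr_natr => w; nra.
have h3 : 2 * eps * tr n D avg <= 4 * dev.
  rewrite (_ : 4 * dev = 2 * eps * (2 * ND%:R * dev)); last first.
    by transitivity (4 * (eps * ND%:R) * dev); [rewrite eN; ring|ring].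
  by rewrite ler_wpM2l // mulr_ge0 // ltW.
apply: le_trans (lerD h1 h3) _.
have hs17 : sigma = 17%:R ^+ D * dev by rewrite /sigma /dev -exprMn -natrM mulnA.
have h17 : 17 <= 17%:R ^+ D :> R by rewrite -natrX ler_nat -{1}[17%N]expn1 leq_exp2l.
rewrite hs17; nra.
Qed.

End moment_bound.

(** * Splitting and filtering *)

Section powers.
Variable R : realType.

Lemma pow_tangent k (a t : R) : 0 <= a -> 0 <= t ->
  k%:R * a ^+ k.-1 * t <= (k%:R - 1) * a ^+ k + t ^+ k.
Proof.
move=> a0 t0; case: k => [|k]; first by rewrite !mul0r expr0; lra.
rewrite /=; elim: k => [|k IH]; first by rewrite expr0 expr1; lra.
have h : 0 <= (t - a) * (t ^+ k.+1 - a ^+ k.+1).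
  case: (leP a t) => h.
    by apply: mulr_ge0; rewrite subr_ge0 // lerXn2r.
  rewrite -mulrNN; apply: mulr_ge0; rewrite oppr_ge0 subr_le0 ?lerXn2r //; exact: ltW.
have : a * (k.+1%:R * a ^+ k * t) <= a * ((k.+1%:R - 1) * a ^+ k.+1 + t ^+ k.+1) by rewrite ler_wpM2l.
move: h; rewrite !exprS -[in k.+2%:R]addn1 natrD => h1 h2.
set A := a ^+ k in h1 h2 *; set T := t ^+ k in h1 h2 *; nra.
Qed.

(** Sum the tangent inequality of the power at [a], the weighted mean of the [|f i|]; the exponent
    is even, so the absolute values are harmless. *)
Lemma jensen (I : finType) (P : pred I) (w f : I -> R) k :
  (forall i, P i -> 0 <= w i) -> 0 < \sum_(i | P i) w i ->
  ((\sum_(i | P i) w i * f i) / \sum_(i | P i) w i) ^+ (k + k) <=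
  (\sum_(i | P i) w i * f i ^+ (k + k)) / \sum_(i | P i) w i.
Proof.
move=> w0; set W := \sum_(i | P i) w i => W0.
set a := (\sum_(i | P i) w i * `|f i|) / W.
have a0 : 0 <= a by rewrite divr_ge0 ?(ltW W0) //; apply: sumr_ge0 => i hi; rewrite mulr_ge0 // w0.
have ev (x : R) : x ^+ (k + k) = `|x| ^+ (k + k).
  by rewrite addnn -mul2n !exprM real_normK ?num_real.
apply: (@le_trans _ _ (a ^+ (k + k))).
  rewrite ev; apply: lerXn2r; rewrite ?nnegrE //.
  rewrite /a normrM (ger0_norm (x := W^-1)); last by rewrite invr_ge0 ltW.
  rewrite ler_pM2r ?invr_gt0 //.
  rewrite (le_trans (ler_norm_sum _ _ _)) //; apply: ler_sum => i hi.
  by rewrite normrM ger0_norm // w0.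
rewrite ler_pdivlMr //; set K := (k + k)%N.
have : \sum_(i | P i) w i * (K%:R * a ^+ K.-1 * `|f i|) <=
       \sum_(i | P i) w i * ((K%:R - 1) * a ^+ K + f i ^+ K).
  apply: ler_sum => i hi; have evf : f i ^+ K = `|f i| ^+ K := ev (f i).
  by rewrite ler_wpM2l ?w0 // evf; exact: pow_tangent.
have -> : \sum_(i | P i) w i * (K%:R * a ^+ K.-1 * `|f i|) = K%:R * a ^+ K.-1 * (a * W).
  rewrite /a divfK ?gt_eqF // mulr_sumr; apply: eq_bigr => i _; ring.
have -> : \sum_(i | P i) w i * ((K%:R - 1) * a ^+ K + f i ^+ K) =
   (K%:R - 1) * a ^+ K * W + \sum_(i | P i) w i * f i ^+ K.
  by rewrite mulr_sumr -big_split; apply: eq_bigr => i _ /=; ring.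
rewrite /K; case: k {ev K} => [|k]; first by rewrite addn0 mul0r mul0r expr0; lra.
rewrite addSn /= exprS; set A := a ^+ _; nra.
Qed.

Lemma pow_add_le (x y : R) k : (x + y) ^+ (k + k) <= 4 ^+ k * (x ^+ (k + k) + y ^+ (k + k)).
Proof.
have E (z : R) : z ^+ (k + k) = (z * z) ^+ k by rewrite exprMn exprD.
rewrite !E.
wlog h : x y / x * x <= y * y.
  move=> W; case/orP: (le_total (x * x) (y * y)) => h; first exact: W.
  by have := W y x h; rewrite [y + x]addrC [X in _ <= _ * X]addrC.
apply: (@le_trans _ _ ((4 * (y * y)) ^+ k)).
  apply: lerXn2r; rewrite ?nnegrE; [by rewrite -expr2 sqr_ge0| |].
    by rewrite mulr_ge0 // -expr2 sqr_ge0.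
  have := sqr_ge0 (x - y); nra.
rewrite exprMn ler_pM2l ?exprn_gt0 // lerDr exprn_ge0 //.
by rewrite -expr2 sqr_ge0.
Qed.

Lemma bern_le (x : R) p : (0 < p)%N -> 0 <= x <= 1 -> x ^+ p <= x.
Proof.
move=> p0 /andP[x0 x1]; case: p p0 => // p _; rewrite exprS.
by rewrite ler_piMr // exprn_ile1.
Qed.

End powers.

(** * One cluster: radii, potential and survival of the good points *)

Section node.
Variables (R : realType) (N : nat) (Q : nat -> nat -> R) (al Th H Bd Lc : R) (K p lam kap : nat).
Hypothesis N0 : (0 < N)%N.
Hypothesis al0 : 0 < al. Hypothesis al1 : al < 1.
Hypothesis Th1 : 1 <= Th.
Hypothesis p0 : (0 < p)%N.
Hypothesis lam_al : 1 <= 2 ^+ lam * al.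
Hypothesis kap_p : (lam + 5 <= p ^ kap)%N.
Hypothesis K_def : K = (2 * kap + 1)%N.
Hypothesis Lc_def : Lc = (2 * lam + 6)%:R.
Hypothesis H_def : H = 16 * Lc / al.
Hypothesis Bd_def : Bd = 4 * (Th * Th) ^+ K * Th ^+ 4 * H.
Implicit Types (w : nat -> R).

Definition mass w : R := \sum_(x < N) w x.
Definition ball w y t : R := \sum_(x < N) if Q x y <= t then w x else 0.
(** Good points with [qm <= H] are within [Th * H = tau 0] of each other. Consecutive radii differ
    by [Th * Th], one factor for each of two triangle inequalities: if the centre is at distance at
    most [Th * tau j] from the true mean, all these points lie inside radius [tau j.+1]; otherwise
    they all lie outside radius [tau j]. *)
Definition tau (j : nat) : R := (Th * Th) ^+ j * Th * H.
Definition thr : R := al * N%:R / 8.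
Definition chA w y j x : R := if Q x y <= tau j.+1 then w x else 0.
Definition chB w y j x : R := if tau j < Q x y then w x else 0.
(** The score vanishes off the support, so its maximum, when positive, is attained at a point of
    positive weight; [chF] then removes that point altogether, which decreases the support. *)
Definition fsc w y j x : R :=
  if (0 < w x) && (Th * Th * tau j.+1 < Q x y) then Q x y else 0.
Definition chF w y j i x : R := w x * (1 - fsc w y j x / fsc w y j i).
Definition isw w := forall x, (x < N)%N -> 0 <= w x <= 1.

Definition stopA w y j : bool := (1 - al / 16) * mass w < ball w y (tau j.+1).
Definition stopB w y j : bool := ball w y (tau j.+1) ^+ p + (mass w - ball w y (tau j)) ^+ p <= mass w ^+ p.

Hypothesis Qsym : forall x y, (x < N)%N -> (y < N)%N -> Q x y = Q y x.
Hypothesis Q0 : forall x y, (x < N)%N -> (y < N)%N -> 0 <= Q x y.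
Hypothesis Qtri : forall x y z t, (x < N)%N -> (y < N)%N -> (z < N)%N ->
  Q x y <= t -> Q y z <= t -> Q x z <= Th * t.

Lemma N0R : 0 < N%:R :> R. Proof. by rewrite ltr0n. Qed.
Lemma thr0 : 0 < thr. Proof. by rewrite /thr divr_gt0 // mulr_gt0 // N0R. Qed.
Lemma Lc6 : 6 <= Lc. Proof. by rewrite Lc_def ler_nat; lia. Qed.
Lemma Lc_H : Lc <= H.
Proof.
have L6 := Lc6; rewrite H_def ler_pdivlMr //.
have h : Lc * al <= Lc * 1 by rewrite ler_wpM2l //; [lra|exact: ltW].
lra.
Qed.
Lemma H0 : 0 < H. Proof. by apply: lt_le_trans Lc_H; have := Lc6; lra. Qed.
Lemma TT1 : 1 <= Th * Th. Proof. by have := Th1; nra. Qed.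
Lemma tau0 j : 0 < tau j.
Proof. by have := TT1; have := Th1; have := H0; rewrite /tau => *; rewrite !mulr_gt0 ?exprn_gt0 //; lra. Qed.
Lemma tauS j : tau j.+1 = Th * Th * tau j. Proof. by rewrite /tau exprS !mulrA. Qed.
Lemma tau_le i j : (i <= j)%N -> tau i <= tau j.
Proof.
move=> h; rewrite /tau ler_pM2r ?H0 // ler_pM2r; last by have := Th1; lra.
by rewrite ler_weXn2l // TT1.
Qed.

Lemma mass_le w : isw w -> mass w <= N%:R.
Proof.
move=> hw; rewrite -[N in N%:R]card_ord -sumr_const; apply: ler_sum => x _.
by case/andP: (hw x (ltn_ord x)).
Qed.

Lemma mass_ge0 w : isw w -> 0 <= mass w.
Proof. by move=> hw; apply: sumr_ge0 => x _; case/andP: (hw x (ltn_ord x)). Qed.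

Lemma ball_le w y s t : isw w -> s <= t -> ball w y s <= ball w y t.
Proof.
move=> hw hst; apply: ler_sum => x _; have /andP[w0 _] := hw x (ltn_ord x).
case: ifP => h; last by case: ifP.
by rewrite (le_trans h hst).
Qed.

Lemma ball_mass w y t : isw w -> ball w y t <= mass w.
Proof.
by move=> hw; apply: ler_sum => x _; have /andP[w0 _] := hw x (ltn_ord x); case: ifP.
Qed.

Lemma ball_ge0 w y t : isw w -> 0 <= ball w y t.
Proof.
by move=> hw; apply: sumr_ge0 => x _; have /andP[w0 _] := hw x (ltn_ord x); case: ifP.
Qed.

(* As long as no radius is suitable, either the fraction of mass inside the ball
   or the fraction outside is raised to the power [1 / p] or [p]. *)
Lemma growth w y : isw w -> thr <= mass w -> thr <= ball w y (tau 0) ->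
  exists2 j, (j < K)%N & stopA w y j || stopB w y j.
Proof.
move=> hw hm hb; apply: contrapT => hno.
have m0 : 0 < mass w by apply: lt_le_trans hm; exact: thr0.
pose be j := ball w y (tau j) / mass w.
have be01 j : 0 <= be j <= 1.
  by rewrite /be divr_ge0 ?ball_ge0 ?(ltW m0) //= ler_pdivrMr // mul1r ball_mass.
have h1 j : (j < K)%N -> be j.+1 <= 1 - al / 16.
  move=> hj; rewrite /be ler_pdivrMr // leNgt; apply/negP => h; apply: hno; exists j => //.
  by rewrite /stopA h.
have h2 j : (j < K)%N -> 1 < be j.+1 ^+ p + (1 - be j) ^+ p.
  move=> hj; rewrite ltNge; apply/negP => h; apply: hno; exists j => //; apply/orP; right.
  rewrite /stopB; have e1 : ball w y (tau j.+1) = be j.+1 * mass w by rewrite /be divfK // gt_eqF.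
  have e2 : mass w - ball w y (tau j) = (1 - be j) * mass w.
    by rewrite /be mulrBl divfK ?gt_eqF // mul1r.
  rewrite e1 e2; move: h; move: (be j.+1) (be j) => b1 b0 h.
  rewrite !exprMn -mulrDl; apply: ler_piMl => //.
  by rewrite exprn_ge0 // ltW.
have s1 j : (j <= K)%N -> al / 8 <= be j ^+ (p ^ j).
  elim: j => [|j IH] hj.
    rewrite expn0 expr1 /be ler_pdivlMr // (le_trans _ hb) // /thr.
    by have := mass_le hw; have := al0; nra.
  rewrite expnS exprM (le_trans (IH (ltnW hj))) //; apply: lerXn2r; rewrite ?nnegrE ?exprn_ge0 //.
  - by case/andP: (be01 j).
  - by case/andP: (be01 j.+1).
  - have := h2 j hj; have : (1 - be j) ^+ p <= 1 - be j.
      by apply: bern_le => //; have := be01 j; case/andP; lra.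
    lra.
have kK : (kap <= K)%N by rewrite K_def; lia.
have p2 : 2^-1 ^+ (p ^ kap) <= al / 32 :> R.
  apply: (@le_trans _ _ (2^-1 ^+ (lam + 5))).
    by rewrite ler_wiXn2l // ?invr_ge0 // invf_le1 //; lra.
  rewrite exprD !exprVn; have := lam_al; set q := 2 ^+ lam => lq.
  have q0 : 0 < q by rewrite exprn_gt0.
  have : q^-1 <= al by rewrite -[_^-1]mul1r ler_pdivrMr // mulrC.
  have -> : (2 ^+ 5)^-1 = 32^-1 :> R by congr (_^-1); ring.
  lra.
(* After [kap] levels the ball holds half of the mass, since otherwise
   [al / 8 <= 2 ^ -(lam + 5) <= al / 32]. In the next [kap + 1] levels the outer fraction falls to
   [al / 32], below the [al / 16] left by the failure of [stopA]; hence [K = 2 kap + 1]. *)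
have hk : 1 - be kap <= 2^-1.
  rewrite leNgt; apply/negP => h; have := s1 kap kK; rewrite leNgt => /negP; apply.
  apply: (@le_lt_trans _ _ (2^-1 ^+ (p ^ kap))).
    apply: lerXn2r; rewrite ?nnegrE ?invr_ge0 //; first by case/andP: (be01 kap).
    lra.
  by apply: le_lt_trans p2 _; have := al0; lra.
have s2 i : (kap + i <= K)%N -> 1 - be (kap + i)%N <= 2^-1 ^+ (p ^ i).
  elim: i => [|i IH] hi; first by rewrite addn0 expn0 expr1.
  rewrite addnS in hi *; have {}IH := IH (ltnW hi).
  have /andP[b0 b1] := be01 (kap + i)%N; have /andP[c0 c1] := be01 (kap + i).+1.
  have := h2 _ hi; have : be (kap + i).+1 ^+ p <= be (kap + i).+1 by apply: bern_le => //; apply/andP.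
  have : (1 - be (kap + i)%N) ^+ p <= 2^-1 ^+ (p ^ i.+1).
    by rewrite expnSr exprM; apply: lerXn2r; rewrite ?nnegrE ?exprn_ge0 ?invr_ge0 //; lra.
  lra.
have hK : (kap + kap.+1 = K)%N by rewrite K_def mul2n -addnn addnS addn1.
have := s2 kap.+1; rewrite hK => /(_ (leqnn _)) hlast.
have : 2^-1 ^+ (p ^ kap.+1) <= 2^-1 ^+ (p ^ kap) :> R.
  rewrite ler_wiXn2l ?invr_ge0 // ?invf_le1 //; first lra.
  by rewrite expnS leq_pmull.
have hj : (kap + kap < K)%N by rewrite -hK ltn_add2l.
have := h1 _ hj; have -> : (kap + kap).+1 = K by rewrite -hK addnS.
by have := p2; have := al0; lra.
Qed.

Definition supp w : nat := (\sum_(x < N) (w x != 0%R))%N.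
(** Every cluster on the stack, even a light one, costs a round: this is the summand 1. The factor 3
    lets the loss of one support point, weighted by a power that is at least 1, pay for the summands
    of two children and for the round itself. *)
Definition pot w : R := 1 + 3 * (mass w / thr) ^+ p * (supp w)%:R.

Lemma supp_lt w w' i : (i < N)%N -> (forall x, (x < N)%N -> w x = 0 -> w' x = 0) ->
  w i != 0 -> w' i = 0 -> (supp w' < supp w)%N.
Proof.
move=> hi h1 h2 h3; rewrite /supp (bigD1 (Ordinal hi)) //= [X in (_ < X)%N](bigD1 (Ordinal hi)) //=.
rewrite h3 h2 eqxx add0n add1n ltnS; apply: leq_sum => x _.
case: (eqVneq (w x) 0) => [/h1 -> //|_]; rewrite ?eqxx //.
by case: (w' x == 0).
Qed.

Lemma pot_ge1 w : isw w -> 1 <= pot w.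
Proof.
by move=> hw; rewrite lerDl !mulr_ge0 // exprn_ge0 // divr_ge0 ?mass_ge0 // ltW ?thr0.
Qed.

Lemma isw_A w y j : isw w -> isw (chA w y j).
Proof. by move=> hw x hx; rewrite /chA; have := hw x hx; case: ifP => // _ _; rewrite lexx ler01. Qed.
Lemma isw_B w y j : isw w -> isw (chB w y j).
Proof. by move=> hw x hx; rewrite /chB; have := hw x hx; case: ifP => // _ _; rewrite lexx ler01. Qed.

Lemma mass_A w y j : mass (chA w y j) = ball w y (tau j.+1). Proof. by []. Qed.
Lemma mass_B w y j : mass (chB w y j) = mass w - ball w y (tau j).
Proof.
rewrite /mass /ball -sumrB; apply: eq_bigr => x _; rewrite /chB.
by case: leP => _; rewrite ?subr0 ?subrr.
Qed.

Lemma sum_pos_ex (f : nat -> R) : 0 < \sum_(x < N) f x -> exists2 x, (x < N)%N & 0 < f x.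
Proof.
move=> h; apply: contrapT => hn; move: h; rewrite ltNge => /negP; apply.
apply: sumr_le0 => x _; rewrite leNgt; apply/negP => h; apply: hn; by exists x.
Qed.

(** [stopB] bounds the sum of the powers of the two masses. Each child loses a point: [chA] because
    its mass is smaller by the failure of [stopA], [chB] because the inner ball is nonempty. *)
Lemma pot_split w y j : isw w -> thr <= mass w -> thr <= ball w y (tau 0) ->
  ~~ stopA w y j -> stopB w y j ->
  pot (chA w y j) + pot (chB w y j) <= pot w - 1.
Proof.
move=> hw hm hb hA hB; have t0 := thr0; have m0 := lt_le_trans t0 hm.
have bj : 0 < ball w y (tau j).
  by apply: lt_le_trans (ball_le y hw (tau_le (leq0n j))); apply: lt_le_trans hb.
have sA : (supp (chA w y j) < supp w)%N.
  have : 0 < \sum_(x < N) (w x - chA w y j x).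
    rewrite sumrB -/(mass w) -/(mass (chA w y j)) mass_A.
    by move: hA; rewrite /stopA -leNgt => h; have := al0; nra.
  move/(@sum_pos_ex (fun x => w x - chA w y j x)) => [x hx].
  rewrite /chA; case: ifP => hq; rewrite ?subrr ?ltxx // subr0 => wx.
  apply: (@supp_lt _ _ x) => // [z hz wz||]; [by case: ifP|by rewrite gt_eqF|by rewrite hq].
have sB : (supp (chB w y j) < supp w)%N.
  move: bj => /(@sum_pos_ex (fun x => if Q x y <= tau j then w x else 0)) [x hx].
  case: ifP => hq; rewrite ?ltxx // => wx.
  apply: (@supp_lt _ _ x) => // [z hz wz||]; [by rewrite /chB; case: ifP|by rewrite gt_eqF|by rewrite /chB ltNge hq].
have hp : (mass (chA w y j) / thr) ^+ p + (mass (chB w y j) / thr) ^+ p <= (mass w / thr) ^+ p.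
  have ti : 0 < thr ^- p by rewrite invr_gt0 exprn_gt0.
  have E a : (a / thr) ^+ p = a ^+ p * thr ^- p by rewrite exprMn exprVn.
  by rewrite mass_A mass_B !E -mulrDl ler_pM2r.
have pA : 0 <= (mass (chA w y j) / thr) ^+ p.
  by rewrite exprn_ge0 // divr_ge0 ?mass_ge0 ?ltW //; exact: isw_A.
have pB : 0 <= (mass (chB w y j) / thr) ^+ p.
  by rewrite exprn_ge0 // divr_ge0 ?mass_ge0 ?ltW //; exact: isw_B.
have p1 : 1 <= (mass w / thr) ^+ p by rewrite exprn_ege1 // ler_pdivlMr // mul1r.
have {}sA : (supp (chA w y j))%:R + 1 <= (supp w)%:R :> R by rewrite natr1 ler_nat.
have {}sB : (supp (chB w y j))%:R + 1 <= (supp w)%:R :> R by rewrite natr1 ler_nat.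
have s0 : 0 <= (supp w)%:R :> R by [].
rewrite /pot; move: hp pA pB p1 sA sB s0.
set a := (mass (chA w y j) / thr) ^+ p; set b := (mass (chB w y j) / thr) ^+ p.
set c := (mass w / thr) ^+ p; set u := (supp (chA w y j))%:R.
set v := (supp (chB w y j))%:R; set s := (supp w)%:R => hp pA pB p1 sA sB s0.
have : a * u <= a * (s - 1) by rewrite ler_wpM2l //; lra.
have : b * v <= b * (s - 1) by rewrite ler_wpM2l //; lra.
have : (a + b) * (s - 1) <= c * (s - 1).
  case: (leP 0 (s - 1)) => h; first by rewrite ler_wpM2r.
  have hu : 0 <= u by []. lra.
nra.
Qed.

(** The triangle inequality through [y] bounds the mean over pairs by [2 Th] times the mean of
    [Q x y]. Points with score 0 contribute at most [Th * Th * tau j.+1] to the latter; [Bd] is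
    large enough for the others to keep a mean of [Th * Lc]. *)
Lemma fsc_sum w y j : isw w -> (y < N)%N -> (j < K)%N ->
  Bd * mass w ^+ 2 <= \sum_(x < N) \sum_(z < N) w x * w z * Q x z -> 0 < mass w ->
  Th * Lc * mass w <= \sum_(x < N) w x * fsc w y j x.
Proof.
move=> hw hy hj hB m0.
have h1 : \sum_(x < N) \sum_(z < N) w x * w z * Q x z <= 2 * Th * mass w * \sum_(x < N) w x * Q x y.
  apply: (@le_trans _ _ (\sum_(x < N) \sum_(z < N) w x * w z * (Th * (Q x y + Q z y)))).
    apply: ler_sum => x _; apply: ler_sum => z _.
    have /andP[wx _] := hw x (ltn_ord x); have /andP[wz _] := hw z (ltn_ord z).
    rewrite ler_wpM2l ?mulr_ge0 //; apply: (Qtri (y := y)) => //.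
      by rewrite lerDl Q0.
    by rewrite Qsym // lerDr Q0.
  rewrite le_eqVlt; apply/orP; left; apply/eqP.
  transitivity (\sum_(x < N) (Th * mass w * (w x * Q x y) + Th * w x * \sum_(z < N) w z * Q z y)).
    apply: eq_bigr => x _; rewrite /mass mulr_sumr [X in _ = X + _]mulr_suml mulr_sumr -big_split /=.
    by apply: eq_bigr => z _; ring.
  rewrite big_split /= -mulr_sumr -mulr_suml -mulr_sumr -/(mass w); ring.
have h2 : \sum_(x < N) w x * Q x y <= \sum_(x < N) w x * fsc w y j x + Th * Th * tau j.+1 * mass w.
  rewrite /mass mulr_sumr -big_split; apply: ler_sum => x _ /=.
  have /andP[wx _] := hw x (ltn_ord x); rewrite /fsc.
  case: (ltP 0 (w x)) => w1 /=; last first.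
    have -> : w x = 0 by lra. by rewrite !mul0r mulr0 addr0.
  case: ltP => hq.
    have T0 : 0 <= Th by have := Th1; lra.
    have tj := tau0 j.+1; rewrite lerDl; apply: mulr_ge0 => //.
    by apply: mulr_ge0; [exact: mulr_ge0|exact: ltW].
  by rewrite mulr0 add0r mulrC ler_wpM2r.
have tK : tau j.+1 <= tau K by exact: tau_le.
have hBd : 2 * Th * (Th * Th * tau K + Th * Lc) <= Bd.
  rewrite Bd_def /tau; set P := (Th * Th) ^+ K.
  have P1 : 1 <= P by rewrite exprn_ege1 // TT1.
  have T1 := Th1; have LH := Lc_H; have h0 := H0.
  have : Th * Th * Lc <= P * Th ^+ 4 * H.
    have T4 : Th * Th <= Th ^+ 4 by rewrite (_ : Th ^+ 4 = Th * Th * (Th * Th)); [have := TT1; nra|ring].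
    have a1 : Th * Th * Lc <= Th ^+ 4 * H by apply: ler_pM => //; [have := TT1; lra|have := Lc6; lra].
    have a2 : 0 <= Th ^+ 4 * H by rewrite mulr_ge0 ?exprn_ge0 ?ltW //; lra.
    rewrite -mulrA; nra.
  have -> : 2 * Th * (Th * Th * (P * Th * H) + Th * Lc) = 2 * (P * Th ^+ 4 * H) + 2 * (Th * Th * Lc) by ring.
  have -> : 4 * P * Th ^+ 4 * H = 4 * (P * Th ^+ 4 * H) by ring.
  lra.
set S := \sum_(x < N) w x * fsc w y j x in h2 *; set S1 := \sum_(x < N) w x * Q x y in h1 h2.
have T0 : 0 < Th by have := Th1; lra.
have hc : Bd * mass w <= 2 * Th * S1.
  have := le_trans hB h1; rewrite expr2 mulrA [2 * Th * _ * _]mulrAC.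
  by rewrite ler_pM2r.
have hd : 2 * Th * (Th * Th * tau K + Th * Lc) * mass w <= 2 * Th * (S + Th * Th * tau j.+1 * mass w).
  apply: (@le_trans _ _ (Bd * mass w)); first by rewrite ler_wpM2r // ltW.
  by apply: (le_trans hc); rewrite ler_pM2l // mulr_gt0.
rewrite -mulrA ler_pM2l ?mulr_gt0 // in hd.
have : Th * Th * tau j.+1 * mass w <= Th * Th * tau K * mass w.
  rewrite ler_pM2r // ler_pM2l //; by rewrite mulr_gt0.
lra.
Qed.

Definition argmax (g : nat -> R) i := (i < N)%N /\ forall z, (z < N)%N -> g z <= g i.

Lemma fsc_max_gt0 w y j i : isw w -> (y < N)%N -> (j < K)%N ->
  Bd * mass w ^+ 2 <= \sum_(x < N) \sum_(z < N) w x * w z * Q x z -> 0 < mass w ->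
  argmax (fsc w y j) i -> 0 < fsc w y j i.
Proof.
move=> hw hy hj hB m0 [hi hmax].
have h := fsc_sum hw hy hj hB m0.
have : 0 < \sum_(x < N) w x * fsc w y j x.
  by apply: lt_le_trans h; rewrite !mulr_gt0 //; [have := Th1; lra|have := Lc6; lra].
move/(@sum_pos_ex (fun x => w x * fsc w y j x)) => [x hx hf].
have /andP[wx _] := hw x hx; apply: lt_le_trans (hmax x hx).
by rewrite ltNge; apply/negP => h'; move: hf; rewrite ltNge mulr_ge0_le0.
Qed.

Lemma fsc_ge0 w y j x : (x < N)%N -> (y < N)%N -> 0 <= fsc w y j x.
Proof. by move=> hx hy; rewrite /fsc; case: ifP => // _; exact: Q0. Qed.

Lemma chF_le w y j i : isw w -> (y < N)%N -> argmax (fsc w y j) i -> 0 < fsc w y j i ->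
  forall x, (x < N)%N -> 0 <= chF w y j i x <= w x.
Proof.
move=> hw hy [hi hmax] g0 x hx; have /andP[wx _] := hw x hx; rewrite /chF.
have r0 : 0 <= fsc w y j x / fsc w y j i by rewrite divr_ge0 // ?fsc_ge0 // ltW.
have r1 : fsc w y j x / fsc w y j i <= 1 by rewrite ler_pdivrMr // mul1r hmax.
by apply/andP; split; nra.
Qed.

Lemma isw_F w y j i : isw w -> (y < N)%N -> argmax (fsc w y j) i -> 0 < fsc w y j i -> isw (chF w y j i).
Proof.
move=> hw hy hi g0 x hx; have /andP[h1 h2] := chF_le hw hy hi g0 hx.
by have /andP[h3 h4] := hw x hx; rewrite h1 (le_trans h2).
Qed.

Lemma mass_F w y j i : mass (chF w y j i) = mass w - (\sum_(x < N) w x * fsc w y j x) / fsc w y j i.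
Proof. by rewrite /mass mulr_suml -sumrB; apply: eq_bigr => x _; rewrite /chF mulrBr mulr1 mulrA. Qed.

Lemma pot_filter w y j i : isw w -> thr <= mass w -> (y < N)%N -> (j < K)%N ->
  Bd * mass w ^+ 2 <= \sum_(x < N) \sum_(z < N) w x * w z * Q x z ->
  argmax (fsc w y j) i -> pot (chF w y j i) <= pot w - 1.
Proof.
move=> hw hm hy hj hB hi; have t0 := thr0; have m0 := lt_le_trans t0 hm.
have g0 := fsc_max_gt0 hw hy hj hB m0 hi.
have hF := isw_F hw hy hi g0.
have sF : (supp (chF w y j i) < supp w)%N.
  apply: (@supp_lt _ _ i); first by case: hi.
  - by move=> x _ h; rewrite /chF h mul0r.
  - by move: g0; rewrite {1}/fsc; case: (ltP 0 (w i)) => //= [/gt_eqF -> //|_]; rewrite ltxx.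
  - by rewrite /chF divff ?gt_eqF // subrr mulr0.
have mF : mass (chF w y j i) <= mass w.
  by apply: ler_sum => x _; have /andP[] := chF_le hw hy hi g0 (ltn_ord x).
have hp : (mass (chF w y j i) / thr) ^+ p <= (mass w / thr) ^+ p.
  have ge w' : isw w' -> 0 <= mass w' / thr by move=> hw'; rewrite divr_ge0 ?mass_ge0 ?(ltW t0).
  by apply: lerXn2r; rewrite ?nnegrE ?ge // ler_pM2r // invr_gt0.
have p1 : 1 <= (mass w / thr) ^+ p by rewrite exprn_ege1 // ler_pdivlMr // mul1r.
have p2 : 0 <= (mass (chF w y j i) / thr) ^+ p by rewrite exprn_ge0 // divr_ge0 ?mass_ge0 // ltW.
have {}sF : (supp (chF w y j i))%:R + 1 <= (supp w)%:R :> R by rewrite natr1 ler_nat.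
have s0 : 0 <= (supp (chF w y j i))%:R :> R by [].
rewrite /pot; move: hp p1 p2 sF s0.
set a := (mass (chF w y j i) / thr) ^+ p; set c := (mass w / thr) ^+ p.
set u := (supp (chF w y j i))%:R; set s := (supp w)%:R => hp p1 p2 sF s0.
have : a * u <= c * (s - 1) by apply: ler_pM => //; lra.
nra.
Qed.

Section good.
Variables (S0 : pred nat) (qm : nat -> R).
Definition s0 : R := \sum_(x < N | S0 x) 1.
Hypothesis s0_ge : al * N%:R / 2 <= s0.
Hypothesis qm0 : forall x, (x < N)%N -> 0 <= qm x.
Hypothesis qm_tri : forall x y t, (x < N)%N -> (y < N)%N -> qm x <= t -> qm y <= t -> Q x y <= Th * t.
Hypothesis qm_tri2 : forall x y t, (x < N)%N -> (y < N)%N -> Q y x <= t -> qm x <= t -> qm y <= Th * t.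
Hypothesis qm_sum : \sum_(x < N | S0 x) qm x <= s0.

Definition u w : R := \sum_(x < N | S0 x) w x.
(** Good weight may be lost at [1 / Lc] times the relative rate of the total mass; integrated along
    a branch, this gives the logarithm. As the mass stays above [al * N / 8] and
    [Lc >= 2 ln (8 / al)], at least half of the good points remain. *)
Definition good w := s0 * (1 - Lc^-1 * ln (N%:R / mass w)) <= u w /\ s0 / 2 <= u w.

Lemma s0_gt0 : 0 < s0.
Proof. by apply: lt_le_trans s0_ge; rewrite divr_gt0 // mulr_gt0 // N0R. Qed.

Lemma u_le_mass w : isw w -> u w <= mass w.
Proof.
move=> hw; rewrite /mass (bigID (fun x : 'I_N => S0 x)) /= lerDl sumr_ge0 // => x _.
by case/andP: (hw x (ltn_ord x)).
Qed.

Lemma good_mass w : isw w -> good w -> thr <= mass w.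
Proof.
move=> hw [_ h]; apply: le_trans (u_le_mass hw); apply: le_trans h.
by have := s0_ge; rewrite /thr; have := al0; have := N0R; nra.
Qed.

Lemma ln_8al : ln (8 / al) <= Lc / 2.
Proof.
have q0 : (0 : R) < 2 ^+ lam by rewrite exprn_gt0.
apply: (@le_trans _ _ (ln (2 ^+ (lam + 3)))).
  rewrite ler_ln ?posrE ?divr_gt0 ?exprn_gt0 // ler_pdivrMr // exprD.
  rewrite (_ : 2 ^+ 3 = 8 :> R); last by ring.
  by move: lam_al; set q := 2 ^+ lam; lra.
have l2 : ln (2 : R) <= 1.
  by have := @le_ln1Dx R 1; rewrite -[1 + 1]/(2 : R); apply; lra.
have LcE : Lc = 2 * lam%:R + 6 by rewrite Lc_def natrD natrM.
rewrite lnXn // LcE -[ln 2 *+ _]mulr_natr natrD.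
have : 0 <= lam%:R + 3 :> R by rewrite addr_ge0.
nra.
Qed.

(** The relative loss [r] of mass satisfies [r <= - ln (1 - r)], so the loss of good weight is
    charged to the logarithm. To control that logarithm the mass must first be known to exceed
    [thr]; this comes from the crude bound [s0 / 4] on the remaining good weight, one step losing at
    most [s0 / 6]. *)
Lemma good_step w w' : isw w -> isw w' -> good w -> mass w' <= mass w ->
  u w - s0 * (Lc^-1 * ((mass w - mass w') / mass w)) <= u w' -> good w'.
Proof.
move=> hw hw' hg hm hu; have m0 : 0 < mass w := lt_le_trans thr0 (good_mass hw hg).
have [g1 g2] := hg; have L6 := Lc6; have sp := s0_gt0.
have L0 : 0 < Lc^-1 by rewrite invr_gt0; lra.
have L1 : Lc^-1 <= 6^-1 by rewrite lef_pV2 ?posrE //; lra.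
have LL : Lc^-1 * Lc = 1 by rewrite mulVf // gt_eqF //; lra.
have r0 : 0 <= (mass w - mass w') / mass w by rewrite divr_ge0 // ?subr_ge0 // ltW.
have r1 : (mass w - mass w') / mass w <= 1.
  by rewrite ler_pdivrMr // mul1r lerBlDr lerDl mass_ge0.
have u4 : s0 / 4 <= u w'.
  have : Lc^-1 * ((mass w - mass w') / mass w) <= 6^-1 by nra.
  nra.
have m4 : thr <= mass w'.
  apply: le_trans (u_le_mass hw'); apply: le_trans u4.
  by have := s0_ge; rewrite /thr; lra.
have m0' : 0 < mass w' := lt_le_trans thr0 m4.
have n0 := N0R.
have lnE : ln (N%:R / mass w') = ln (N%:R / mass w) + ln (mass w / mass w').
  rewrite -lnM ?posrE ?divr_gt0 //; congr ln; field; by rewrite !gt_eqF.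
have ln1 : (mass w - mass w') / mass w <= ln (mass w / mass w').
  have h : mass w' / mass w > 0 by rewrite divr_gt0.
  have := @le_ln1Dx R (mass w' / mass w - 1).
  rewrite (addrC 1) subrK => /(_ ltac:(lra)) h2.
  rewrite (_ : mass w / mass w' = (mass w' / mass w)^-1); last by rewrite invf_div.
  rewrite lnV ?posrE // mulrBl divff ?gt_eqF //; lra.
have G1 : s0 * (1 - Lc^-1 * ln (N%:R / mass w')) <= u w'.
  apply: le_trans hu; rewrite lnE; have : s0 * (Lc^-1 * ((mass w - mass w') / mass w)) <= s0 * (Lc^-1 * ln (mass w / mass w')).
    by rewrite ler_pM2l // ler_pM2l.
  nra.
split=> //; apply: le_trans G1; rewrite ler_pM2l //.
have l8 : ln (N%:R / mass w') <= Lc / 2.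
  apply: le_trans ln_8al; rewrite ler_ln ?posrE ?divr_gt0 // ler_pdivrMr // mulrAC ler_pdivlMr //.
  by move: m4; rewrite /thr; lra.
have : Lc^-1 * ln (N%:R / mass w') <= Lc^-1 * (Lc / 2) by rewrite ler_pM2l.
rewrite mulrA LL; lra.
Qed.

Definition core x : bool := S0 x && (qm x <= H).

(** Markov inequality: [qm] has mean at most 1 over the good points, so at most [s0 / H] of them are
    outside the core, and [H] is chosen to make this [s0 / Lc] times [al / 16]. *)
Lemma core_loss w (P : pred nat) : isw w -> (forall x, (x < N)%N -> core x -> P x) ->
  u w - s0 * (Lc^-1 * (al / 16)) <= \sum_(x < N | S0 x) if P x then w x else 0.
Proof.
move=> hw hP; rewrite lerBlDr.
have hH : s0 * (Lc^-1 * (al / 16)) = s0 / H.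
  by rewrite H_def; field; rewrite !gt_eqF //; have := Lc6; lra.
rewrite hH; apply: (@le_trans _ _ (\sum_(x < N | S0 x) ((if P x then w x else 0) + qm x / H))).
  apply: ler_sum => x hx; have /andP[w0 w1] := hw x (ltn_ord x).
  have q0 := qm0 (ltn_ord x); have h0 := H0.
  have r0 : 0 <= qm x / H by rewrite divr_ge0 // ltW.
  case: ifP => hp; first by rewrite lerDl.
  rewrite add0r (le_trans w1) // ler_pdivlMr // mul1r leNgt; apply/negP => h.
  by move: hp; rewrite hP // /core hx ltW.
by rewrite big_split /= -mulr_suml lerD2l ler_pM2r ?invr_gt0 ?H0.
Qed.

Lemma core_mass w : isw w -> good w ->
  thr <= \sum_(x < N | S0 x) if core x then w x else 0.
Proof.
move=> hw [_ hg]; apply: le_trans (core_loss hw (fun x _ h => h)).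
have L6 := Lc6; have sp := s0_gt0; have := s0_ge; rewrite /thr.
have L0 : 0 < Lc^-1 by rewrite invr_gt0; lra.
have L1 : Lc^-1 <= 6^-1 by rewrite lef_pV2 ?posrE //; lra.
have : Lc^-1 * (al / 16) <= 1 / 4 by have := al0; have := al1; nra.
nra.
Qed.

Lemma sum_core_le w (P : pred nat) : isw w -> (forall x, (x < N)%N -> core x -> P x) ->
  \sum_(x < N | S0 x) (if core x then w x else 0) <= \sum_(x < N) if P x then w x else 0.
Proof.
move=> hw hP; rewrite [X in _ <= X](bigID (fun x : 'I_N => S0 x)) /= -[X in X <= _]addr0.
apply: lerD.
  apply: ler_sum => x _; have /andP[w0 w1] := hw x (ltn_ord x).
  case: ifP => hc; last by case: ifP.
  by rewrite hP.
by apply: sumr_ge0 => x _; have /andP[w0 w1] := hw x (ltn_ord x); case: ifP.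
Qed.

Lemma good_dense w : isw w -> good w -> exists2 y, (y < N)%N & thr <= ball w y (tau 0).
Proof.
move=> hw hg; have h := core_mass hw hg.
have [y hy hc] : exists2 y, (y < N)%N & core y.
  apply: contrapT => hn; move: h; rewrite big1 => [|x hx]; first by have := thr0; lra.
  by case: ifP => // hc; case: hn; exists x.
exists y => //; apply: le_trans h _; apply: (sum_core_le (P := fun x => Q x y <= tau 0)) => //.
move=> x hx /andP[_ hqx]; rewrite /tau expr0 mul1r.
by apply: qm_tri => //; case/andP: hc.
Qed.

(** The core is entirely inside radius [tau j.+1] or entirely outside radius [tau j], according to
    the position of the centre. The child containing it loses at most the non-core good points,
    while its mass drops by at least a fraction [al / 16]: by the failure of [stopA] for [chA], and
    because the initial ball is heavy for [chB]. *)
Lemma good_split w y j : isw w -> good w -> (y < N)%N -> thr <= ball w y (tau 0) ->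
  ~~ stopA w y j -> good (chA w y j) \/ good (chB w y j).
Proof.
move=> hw hg hy hb hA; have m0 := lt_le_trans thr0 (good_mass hw hg).
have L0 : 0 < Lc^-1 by rewrite invr_gt0; have := Lc6; lra.
have sp := s0_gt0.
have key a : al / 16 <= a -> s0 * (Lc^-1 * (al / 16)) <= s0 * (Lc^-1 * a).
  by move=> ha; rewrite ler_pM2l // ler_pM2l.
case: (leP (qm y) (Th * tau j)) => hq.
  left; apply: (good_step hw (isw_A y j hw) hg); first exact: ball_mass.
  apply: le_trans (core_loss (P := fun x => Q x y <= tau j.+1) hw _).
    rewrite lerD2l lerN2; apply: key; rewrite ler_pdivlMr //.
    by move: hA; rewrite /stopA -leNgt mass_A; lra.
  move=> x hx /andP[_ hqx]; rewrite tauS -mulrA; apply: qm_tri => //.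
  apply: (le_trans hqx); rewrite /tau; have := @exprn_ege1 R j _ TT1; have := Th1; have := H0.
  set P := (_ ^+ _) => h0 t1 P1.
  have : 1 <= Th * (P * Th) by nra.
  nra.
right; apply: (good_step hw (isw_B y j hw) hg).
  by rewrite mass_B lerBlDr lerDl ball_ge0.
apply: le_trans (core_loss (P := fun x => tau j < Q x y) hw _).
  rewrite lerD2l lerN2; apply: key; rewrite ler_pdivlMr // mass_B.
  have := ball_le y hw (tau_le (leq0n j)); have := mass_le hw.
  by move: hb; rewrite /thr; have := al0; nra.
move=> x hx /andP[_ hqx]; rewrite ltNge; apply/negP => h.
move: hq; rewrite ltNge => /negP; apply; apply: qm_tri2 (hx) _ _ _ => //; first by rewrite Qsym.
apply: (le_trans hqx); rewrite /tau; have := @exprn_ege1 R j _ TT1; have := Th1; have := H0.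
set P := (_ ^+ _) => h0 t1 P1.
have : 1 <= P * Th by nra.
nra.
Qed.

(** [stopA] leaves too little mass outside for the whole core, so some core point is in the ball and
    the centre is near the true mean. A point with positive score is therefore far from the mean and
    its score is at most [Th * qm]. Scores total at most [Th * s0] on the good points but at least
    [Th * Lc * mass w] overall, so good weight leaves [Lc] times more slowly. *)
Lemma good_filter w y j i : isw w -> good w -> (y < N)%N -> (j < K)%N -> stopA w y j ->
  Bd * mass w ^+ 2 <= \sum_(x < N) \sum_(z < N) w x * w z * Q x z ->
  argmax (fsc w y j) i -> good (chF w y j i).
Proof.
move=> hw hg hy hj hA hB hi; have m0 := lt_le_trans thr0 (good_mass hw hg).
have g0 := fsc_max_gt0 hw hy hj hB m0 hi.
have hF := isw_F hw hy hi g0; have sp := s0_gt0; have T1 := Th1.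
have [x0 [hx0 hc hq0]] : exists x, [/\ (x < N)%N, core x & Q x y <= tau j.+1].
  apply: contrapT => hn; have := core_mass hw hg; rewrite leNgt => /negP; apply.
  apply: (@le_lt_trans _ _ (\sum_(x < N) if ~~ (Q x y <= tau j.+1) then w x else 0)).
    apply: (sum_core_le (P := fun x => ~~ (Q x y <= tau j.+1))) => // x hx hcx.
    by apply/negP => h; apply: hn; exists x.
  have -> : \sum_(x < N) (if ~~ (Q x y <= tau j.+1) then w x else 0) = mass w - ball w y (tau j.+1).
    by rewrite /mass /ball -sumrB; apply: eq_bigr => x _; case: (_ <= _) => /=; rewrite ?subr0 ?subrr.
  move: hA; rewrite /stopA /thr; have := mass_le hw; have := al0; have := N0R; nra.
have qy : qm y <= Th * tau j.+1.
  apply: qm_tri2 (hx0) _ _ _ => //; first by rewrite Qsym.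
  have /andP[_ h] := hc; apply: (le_trans h).
  rewrite /tau; have := @exprn_ege1 R j.+1 _ TT1; have := H0.
  set P := (_ ^+ _) => h0 P1.
  have : 1 <= P * Th by nra.
  nra.
have mF : mass (chF w y j i) <= mass w.
  by apply: ler_sum => x _; have /andP[] := chF_le hw hy hi g0 (ltn_ord x).
apply: (good_step hw hF hg mF).
have hS := fsc_sum hw hy hj hB m0.
have sc x : (x < N)%N -> fsc w y j x <= Th * qm x.
  move=> hx; rewrite /fsc; case: ifP => [/andP[_ h]|_]; last by rewrite mulr_ge0 ?qm0 //; lra.
  case: (leP (Th * tau j.+1) (qm x)) => h2; first by apply: qm_tri => //; apply: le_trans qy _.
  have : Q x y <= Th * (Th * tau j.+1) by apply: qm_tri => //; exact: ltW.
  by rewrite mulrA leNgt h.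
have uF : u (chF w y j i) = u w - (\sum_(x < N | S0 x) w x * fsc w y j x) / fsc w y j i.
  by rewrite /u mulr_suml -sumrB; apply: eq_bigr => x _; rewrite /chF mulrBr mulr1 mulrA.
rewrite uF mass_F lerD2l lerN2.
set gi := fsc w y j i in g0 *; set S := \sum_(x < N) _ in hS *.
have -> : mass w - (mass w - S / gi) = S / gi by ring.
have -> : s0 * (Lc^-1 * (S / gi / mass w)) = (s0 * (Lc^-1 * (S / mass w))) / gi by ring.
rewrite ler_pM2r ?invr_gt0 //.
apply: (@le_trans _ _ (s0 * Th)).
  apply: (@le_trans _ _ (\sum_(x < N | S0 x) Th * qm x)).
    apply: ler_sum => x _; have /andP[w0 w1] := hw x (ltn_ord x).
    apply: le_trans (sc x (ltn_ord x)); rewrite ler_piMl // fsc_ge0 //.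
  by rewrite -mulr_sumr mulrC ler_pM2r //; lra.
have L6 := Lc6; rewrite ler_pM2l // ler_pdivlMl; last lra.
by rewrite ler_pdivlMr // [Lc * Th]mulrC.
Qed.

End good.

End node.

(** * Certified clusters: accuracy and number of their means *)

Section leaves.
Variables (R : realType) (n D N : nat) (X : nat -> nat -> R) (al T : R).
Hypothesis N0 : (0 < N)%N.
Hypothesis al0 : 0 < al.
Hypothesis T0 : 0 < T.
Notation K2 := (D + D)%N.
Notation mass := (@mass R N).
Notation isw := (@isw R N).
Notation dot := (@dot R n).
Notation sq := (@sq R n).
Notation thr := (@thr R N al).
Implicit Types (w : nat -> R) (v : nat -> R).

Definition mean w (c : nat) : R := (\sum_(x < N) w x * X x c) / mass w.

Definition certified w := forall v, sq v = 1 ->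
  \sum_(x < N) \sum_(z < N) w x * w z * dot v (fun c => X x c - X z c) ^+ K2 <= T * mass w ^+ 2.

Lemma dotBr v x y : dot v (fun c => x c - y c) = dot v x - dot v y.
Proof. by rewrite /Submission.dot -sumrB; apply: eq_bigr => c _; rewrite mulrBr. Qed.

Lemma dot_mean v w : 0 < mass w -> dot v (mean w) = (\sum_(x < N) w x * dot v (X x)) / mass w.
Proof.
move=> m0; rewrite /Submission.dot mulr_suml.
under [RHS]eq_bigr do rewrite mulr_sumr mulr_suml.
rewrite exchange_big; apply: eq_bigr => c _ /=; rewrite /mean mulrA mulr_sumr mulr_suml.
by apply: eq_bigr => x _; rewrite mulrCA !mulrA.
Qed.

Lemma even_pow_ge0 (t : R) k : 0 <= t ^+ (k + k).
Proof. by rewrite exprD -expr2 sqr_ge0. Qed.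

(** Two uses of Jensen. The first passes from the mean of the sub-weight to its points, whose
    contribution is at most that of the whole cluster; the second passes from the mean of the
    cluster to its points, which leaves the certified double sum. *)
Lemma sub_mean (P : pred 'I_N) (ov : 'I_N -> R) w v : isw w -> certified w -> sq v = 1 -> 0 < mass w ->
  (forall x, P x -> 0 <= ov x <= w x) -> 0 < \sum_(x | P x) ov x ->
  ((\sum_(x | P x) ov x * dot v (X x)) / \sum_(x | P x) ov x - dot v (mean w)) ^+ K2
    <= T * mass w / \sum_(x | P x) ov x.
Proof.
move=> hw hc hv m0 ho; set o := \sum_(x | P x) ov x => o0.
have w0 (x : 'I_N) : 0 <= w x by case/andP: (hw x (ltn_ord x)).
set f := fun x : 'I_N => dot v (X x) - dot v (mean w).
have -> : (\sum_(x | P x) ov x * dot v (X x)) / o - dot v (mean w) = (\sum_(x | P x) ov x * f x) / o.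
  rewrite /f; under [in RHS]eq_bigr do rewrite mulrBr.
  by rewrite sumrB -mulr_suml mulrBl -/o mulrAC divff ?mul1r // gt_eqF.
have ov0 x : P x -> 0 <= ov x by case/ho/andP.
apply: (le_trans (@jensen R _ P ov f D ov0 o0)).
rewrite ler_pdivlMr // divfK ?gt_eqF //.
have hf (x : 'I_N) : f x ^+ K2 <= (\sum_(z < N) w z * dot v (fun c => X x c - X z c) ^+ K2) / mass w.
  have := @jensen R _ predT (fun z : 'I_N => w z) (fun z => dot v (fun c => X x c - X z c)) D.
  move=> /(_ (fun z _ => w0 z) m0); rewrite -/(mass w).
  suff -> : (\sum_(z < N) w z * dot v (fun c => X x c - X z c)) / mass w = f x by [].
  under eq_bigr do rewrite dotBr mulrBr.
  by rewrite sumrB -mulr_suml mulrBl -/(mass w) mulrAC divff ?gt_eqF // mul1r /f dot_mean.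
apply: (@le_trans _ _ (\sum_(x < N) w x * ((\sum_(z < N) w z * dot v (fun c => X x c - X z c) ^+ K2) / mass w))).
  rewrite [X in _ <= X](bigID P) /= -[X in X <= _]addr0; apply: lerD.
    apply: ler_sum => x hx; have /andP[h1 h2] := ho x hx.
    apply: ler_pM => //; exact: even_pow_ge0.
  apply: sumr_ge0 => x _; apply: mulr_ge0 => //; apply: divr_ge0; last exact: ltW.
  by apply: sumr_ge0 => z _; apply: mulr_ge0 => //; exact: even_pow_ge0.
have -> : \sum_(x < N) w x * ((\sum_(z < N) w z * dot v (fun c => X x c - X z c) ^+ K2) / mass w)
   = (\sum_(x < N) \sum_(z < N) w x * w z * dot v (fun c => X x c - X z c) ^+ K2) / mass w.
  rewrite mulr_suml; apply: eq_bigr => x _; rewrite mulrA mulr_sumr; congr (_ / _).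
  by apply: eq_bigr => z _; rewrite mulrA.
by rewrite ler_pdivrMr // -mulrA -expr2; exact: hc.
Qed.

(** Test the direction of [x] itself. *)
Lemma dir_bound (x : nat -> R) (b : R) : 0 <= b ->
  (forall v, sq v = 1 -> dot v x ^+ K2 <= b) -> (0 < D)%N -> sq x ^+ D <= b.
Proof.
move=> b0 h hD; have s0 : 0 <= sq x by exact: sq_ge0.
case: (eqVneq (sq x) 0) => [->|sn]; first by rewrite expr0n gtn_eqF.
have sp : 0 < sq x by rewrite lt_def sn.
set r := Num.sqrt (sq x); have rp : 0 < r by rewrite sqrtr_gt0.
have rr : r * r = sq x by rewrite -expr2 sqr_sqrtr.
have hd : dot (fun c => x c / r) x = r.
  rewrite /Submission.dot; transitivity (sq x / r).
    by rewrite /Submission.sq mulr_suml; apply: eq_bigr => c _; rewrite mulrAC.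
  by rewrite -rr mulfK // gt_eqF.
have hs : sq (fun c => x c / r) = 1.
  transitivity (sq x / (r * r)); last by rewrite rr divff.
  by rewrite /Submission.sq mulr_suml; apply: eq_bigr => c _; rewrite invfM mulrACA.
by have := h _ hs; rewrite hd exprD -exprMn rr.
Qed.

Section accuracy.
Variables (S0 : pred nat) (mu : nat -> R) (sg : R).
Notation s0 := (@s0 R N S0).
Hypothesis s0_ge : al * N%:R / 2 <= s0.
Hypothesis sg0 : 0 < sg.
Hypothesis S0_moment : forall v, sq v = 1 ->
  \sum_(x < N | S0 x) dot v (fun c => X x c - mu c) ^+ K2 <= s0 * sg.

Lemma good_mean w : isw w -> certified w -> s0 / 2 <= @u R N S0 w -> (0 < D)%N ->
  sq (fun c => mean w c - mu c) ^+ D <= 4 ^+ D * (4 * T / al + 2 * sg).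
Proof.
move=> hw hc hu hD.
have w0 (x : 'I_N) : 0 <= w x by case/andP: (hw x (ltn_ord x)).
have w1 (x : 'I_N) : w x <= 1 by case/andP: (hw x (ltn_ord x)).
have n0 : 0 < N%:R :> R by rewrite ltr0n.
have sp : 0 < s0 by apply: lt_le_trans s0_ge; rewrite divr_gt0 // mulr_gt0.
have up : 0 < @u R N S0 w by apply: lt_le_trans hu; rewrite divr_gt0.
have um : @u R N S0 w <= mass w by exact: u_le_mass.
have m0 : 0 < mass w := lt_le_trans up um.
have mN : mass w <= N%:R by exact: mass_le.
apply: dir_bound => // [|v hv].
  by rewrite mulr_ge0 ?exprn_ge0 // addr_ge0 ?divr_ge0 ?mulr_ge0 // ltW.
set o := @u R N S0 w in up um hu *.
set a := (\sum_(x < N | S0 x) w x * dot v (X x)) / o.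
have h1 : (a - dot v (mean w)) ^+ K2 <= T * mass w / o.
  by apply: sub_mean => // x _; rewrite w0 lexx.
have h2 : (a - dot v mu) ^+ K2 <= 2 * sg.
  have -> : a - dot v mu = (\sum_(x < N | S0 x) w x * dot v (fun c => X x c - mu c)) / o.
    under eq_bigr do rewrite dotBr mulrBr.
    by rewrite sumrB -mulr_suml mulrBl -/o mulrAC divff ?gt_eqF // mul1r.
  apply: (le_trans (@jensen R _ (fun x : 'I_N => S0 x) (fun x : 'I_N => w x) (fun x => dot v (fun c => X x c - mu c)) D (fun x _ => w0 x) up)).
  rewrite ler_pdivrMr //; apply: (@le_trans _ _ (s0 * sg)).
    apply: le_trans (S0_moment hv); apply: ler_sum => x _.
    by rewrite ler_piMl // even_pow_ge0.
  have h : s0 <= 2 * o by lra.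
  by rewrite (_ : 2 * sg * _ = 2 * o * sg); [rewrite ler_pM2r|rewrite /o /u; ring].
have -> : dot v (fun c => mean w c - mu c) = (dot v (mean w) - a) + (a - dot v mu).
  by rewrite dotBr; ring.
apply: (le_trans (pow_add_le _ _ _)); rewrite ler_pM2l ?exprn_gt0 //.
apply: lerD => //; have -> : (dot v (mean w) - a) ^+ K2 = (a - dot v (mean w)) ^+ K2.
  by rewrite -opprB !exprD -!exprMn mulrNN.
apply: (le_trans h1); rewrite ler_pdivrMr // mulrAC ler_pdivlMr //.
have h' : al * mass w <= al * N%:R by rewrite ler_pM2l.
have h : mass w * al <= 4 * o by rewrite mulrC; move: s0_ge; lra.
rewrite (_ : T * mass w * al = T * (mass w * al)); last by rewrite mulrA.
by rewrite (_ : 4 * T * o = T * (4 * o)); [rewrite ler_pM2l|ring].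
Qed.

End accuracy.

Definition overlap w w' : R := \sum_(x < N) Num.min (w x) (w' x).

(** Contrapositive: the pointwise minimum is a sub-weight of both clusters. If it is heavy, its mean
    is close to both means by [sub_mean], so these are close to each other. *)
Lemma far_overlap w w' : isw w -> isw w' -> certified w -> certified w' -> (0 < D)%N ->
  0 < mass w -> 0 < mass w' ->
  4 ^+ D * T * (32 / al) < sq (fun c => mean w c - mean w' c) ^+ D ->
  overlap w w' <= al / 16 * Num.max (mass w) (mass w').
Proof.
move=> hw hw' hc hc' hD m0 m0'; apply: contraTT; rewrite -ltNge -leNgt => ho.
have w0 (x : 'I_N) : 0 <= w x by case/andP: (hw x (ltn_ord x)).
have w0' (x : 'I_N) : 0 <= w' x by case/andP: (hw' x (ltn_ord x)).
have M0 : 0 < Num.max (mass w) (mass w') by rewrite lt_max m0.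
have op : 0 < overlap w w' by apply: lt_trans ho; rewrite mulr_gt0 // divr_gt0.
apply: dir_bound => // [|v hv].
  apply: mulr_ge0; last by rewrite divr_ge0 // ltW.
  by apply: mulr_ge0; [rewrite exprn_ge0|exact: ltW].
set o := overlap w w' in op ho *.
set a := (\sum_(x < N) Num.min (w x) (w' x) * dot v (X x)) / o.
have h1 : (a - dot v (mean w)) ^+ K2 <= T * mass w / o.
  by apply: (@sub_mean predT (fun x => Num.min (w x) (w' x))) => // x _; rewrite le_min w0 w0' ge_min lexx.
have h2 : (a - dot v (mean w')) ^+ K2 <= T * mass w' / o.
  by apply: (@sub_mean predT (fun x => Num.min (w x) (w' x))) => // x _; rewrite le_min w0 w0' ge_min lexx orbT.
have -> : dot v (fun c => mean w c - mean w' c) = (dot v (mean w) - a) + (a - dot v (mean w')).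
  by rewrite dotBr; ring.
apply: (le_trans (pow_add_le _ _ _)); rewrite -mulrA ler_pM2l ?exprn_gt0 //.
have -> : (dot v (mean w) - a) ^+ K2 = (a - dot v (mean w)) ^+ K2.
  by rewrite -opprB !exprD -!exprMn mulrNN.
have M1 : mass w <= Num.max (mass w) (mass w') by rewrite le_max lexx.
have M2 : mass w' <= Num.max (mass w) (mass w') by rewrite le_max lexx orbT.
set M := Num.max _ _ in ho M0 M1 M2.
apply: (le_trans (lerD h1 h2)); rewrite -mulrDl -mulrDr ler_pdivrMr // -mulrA ler_pM2l //.
rewrite mulrAC ler_pdivlMr //; nra.
Qed.

(** Let [F] be the sum of the [k] weights, each normalized to mass 1. Then [k ^ 2 <= N * sum F ^ 2].
    A diagonal term of the expanded square is at most [8 / (al N)] and, overlaps being small, an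
    off-diagonal one at most [1 / (2 N)]; thus [k ^ 2 <= 8 k / al + k ^ 2 / 2]. *)
Lemma leaf_count (k : nat) (W : nat -> nat -> R) :
  (forall i, (i < k)%N -> isw (W i) /\ thr <= mass (W i)) ->
  (forall i j, (i < j)%N -> (j < k)%N -> overlap (W i) (W j) <= al / 16 * Num.max (mass (W i)) (mass (W j))) ->
  k%:R <= 16 / al.
Proof.
move=> h1 h2; have n0 : 0 < N%:R :> R by rewrite ltr0n.
have tp : 0 < thr by exact: thr0.
pose F x := \sum_(i < k) W i x / mass (W i).
have mp (i : 'I_k) : 0 < mass (W i) by apply: lt_le_trans tp _; case: (h1 i (ltn_ord i)).
have m1 (i : 'I_k) : (mass (W i))^-1 <= 8 / (al * N%:R).
  rewrite -[8 / _]invrK invf_div lef_pV2 ?posrE ?divr_gt0 ?mulr_gt0 //.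
  by case: (h1 i (ltn_ord i)).
have sF : \sum_(x < N) F x = k%:R.
  rewrite exchange_big /=; transitivity (\sum_(i < k) (1 : R)); last by rewrite sumr_const card_ord.
  by apply: eq_bigr => i _; rewrite -mulr_suml -/(mass (W i)) divff // gt_eqF.
have cs : k%:R ^+ 2 <= N%:R * \sum_(x < N) F x ^+ 2.
  have := @jensen R _ predT (fun _ : 'I_N => 1) (fun x : 'I_N => F x) 1 (fun _ _ => ler01).
  rewrite sumr_const card_ord => /(_ n0).
  rewrite (eq_bigr (fun x : 'I_N => F x)) ?sF => [|x _]; last by rewrite mul1r.
  rewrite [X in _ <= X / _](eq_bigr (fun x : 'I_N => F x ^+ 2)) => [|x _]; last by rewrite mul1r.
  rewrite -[(1 + 1)%N]/2%N; set S := \sum_(x < N | predT x) _ => h.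
  have E1 : k%:R ^+ 2 = (k%:R / N%:R) ^+ 2 * (N%:R * N%:R) :> R by field; rewrite gt_eqF.
  have E2 : N%:R * S = S / N%:R * (N%:R * N%:R) by field; rewrite gt_eqF.
  by rewrite E1 -[X in _ <= X]/(N%:R * S) E2 ler_pM2r // mulr_gt0.
have ww (i j : 'I_k) : i != j -> \sum_(x < N) W i x * W j x <= al / 16 * Num.max (mass (W i)) (mass (W j)).
  have key (a b : 'I_k) : (a < b)%N -> \sum_(x < N) W a x * W b x <= al / 16 * Num.max (mass (W a)) (mass (W b)).
    move=> ab; apply: le_trans (h2 a b ab (ltn_ord b)); apply: ler_sum => x _.
    have [+ _] := h1 a (ltn_ord a); have [+ _] := h1 b (ltn_ord b).
    move=> /(_ x (ltn_ord x)) /andP[b0 b1] /(_ x (ltn_ord x)) /andP[a0 a1].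
    by rewrite le_min; apply/andP; split; nra.
  move=> ij; have [lt|gt|eq] := ltngtP i j; first exact: key.
    rewrite maxC; under eq_bigr do rewrite mulrC.
    exact: key.
  by move: ij; rewrite (val_inj eq) eqxx.
have big : \sum_(x < N) F x ^+ 2 <= k%:R * (8 / (al * N%:R)) + k%:R ^+ 2 / (2 * N%:R).
  have -> : \sum_(x < N) F x ^+ 2 = \sum_(i < k) \sum_(j < k) (\sum_(x < N) W i x * W j x) / (mass (W i) * mass (W j)).
    transitivity (\sum_(x < N) \sum_(i < k) \sum_(j < k) W i x * W j x / (mass (W i) * mass (W j))).
      apply: eq_bigr => x _; rewrite expr2 mulr_suml; apply: eq_bigr => i _.
      by rewrite mulr_sumr; apply: eq_bigr => j _; rewrite invfM mulrACA.
    rewrite exchange_big; apply: eq_bigr => i _; rewrite exchange_big; apply: eq_bigr => j _.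
    by rewrite [RHS]mulr_suml.
  have t (i : 'I_k) : \sum_(j < k) (\sum_(x < N) W i x * W j x) / (mass (W i) * mass (W j)) <=
      8 / (al * N%:R) + \sum_(j < k) (2 * N%:R)^-1.
    rewrite (bigD1 i) //= [X in _ <= _ + X](bigD1 i) //=; apply: lerD.
      apply: (le_trans _ (m1 i)); rewrite ler_pdivrMr ?mulr_gt0 // mulrA mulVf ?gt_eqF // mul1r.
      apply: ler_sum => x _; have [+ _] := h1 i (ltn_ord i) => /(_ x (ltn_ord x)) /andP[a0 a1]; nra.
    rewrite -[X in X <= _]add0r; apply: lerD; first by rewrite invr_ge0 mulr_ge0 // ltW.
    apply: ler_sum => j ji; have ij : i != j by rewrite eq_sym.
    have mij : 0 < mass (W i) * mass (W j) by rewrite mulr_gt0.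
    rewrite ler_pdivrMr //; apply: (le_trans (ww i j ij)).
    have thl (l : 'I_k) : al * N%:R <= 8 * mass (W l).
      by case: (h1 l (ltn_ord l)) => _; rewrite /Submission.thr; lra.
    have mx : al * N%:R * Num.max (mass (W i)) (mass (W j)) <= 8 * (mass (W i) * mass (W j)).
      have := thl i; have := thl j; have := mp i; have := mp j.
      by case: (leP (mass (W i)) (mass (W j))) => *; nra.
    rewrite -ler_pdivrMl ?invr_gt0 ?mulr_gt0 // invrK.
    by move: mx; set mm := Num.max _ _; lra.
  apply: (@le_trans _ _ (\sum_(i < k) (8 / (al * N%:R) + \sum_(j < k) (2 * N%:R)^-1))).
    by apply: ler_sum => i _; exact: t.
  rewrite le_eqVlt; apply/orP; left; apply/eqP.
  rewrite !sumr_const card_ord -[_ *+ k]mulr_natl -[(2 * N%:R)^-1 *+ k]mulr_natl; ring.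
have h3 : k%:R ^+ 2 <= 8 * k%:R / al + k%:R ^+ 2 / 2.
  apply: (le_trans cs); apply: (@le_trans _ _ (N%:R * (k%:R * (8 / (al * N%:R)) + k%:R ^+ 2 / (2 * N%:R)))).
    by rewrite ler_pM2l.
  rewrite le_eqVlt; apply/orP; left; apply/eqP; field; by rewrite !gt_eqF.
case: (posnP k) => [->|kp]; first by rewrite divr_ge0 // ltW.
have k0 : 0 < k%:R :> R by rewrite ltr0n.
rewrite -(ler_pM2l k0) -expr2.
have -> : k%:R * (16 / al) = 2 * (8 * k%:R / al) by ring.
lra.
Qed.

End leaves.

(** * The program *)

Definition aINP : 'I_15 := @Ordinal 15 0 isT.
Definition aOUT : 'I_15 := @Ordinal 15 1 isT.
Definition aSTK : 'I_15 := @Ordinal 15 2 isT.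
Definition aW : 'I_15 := @Ordinal 15 3 isT.
Definition aDIG : 'I_15 := @Ordinal 15 4 isT.
Definition aMT : 'I_15 := @Ordinal 15 5 isT.
Definition aLT : 'I_15 := @Ordinal 15 6 isT.
Definition aGT : 'I_15 := @Ordinal 15 7 isT.
Definition aUU : 'I_15 := @Ordinal 15 8 isT.
Definition aGV : 'I_15 := @Ordinal 15 9 isT.
Definition aMEAN : 'I_15 := @Ordinal 15 10 isT.

Declare Scope ex_scope.
Delimit Scope ex_scope with ex.
Bind Scope ex_scope with ex.
Notation "a +n b" := (NO true a b) (at level 50, left associativity).
Notation "a -n b" := (NO false a b) (at level 50, left associativity).
Notation "a *n b" := (NM a b) (at level 40, left associativity).
Notation "a +r b" := (RO ROadd a b) (at level 50, left associativity).
Notation "a -r b" := (RO ROsub a b) (at level 50, left associativity).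
Notation "a *r b" := (RO ROmul a b) (at level 40, left associativity).
Notation "a /r b" := (RO ROdiv a b) (at level 40, left associativity).
Definition RC k := RN (NC k).
Definition notN a := NC 1 -n a.
Definition andN a b := Ite a b (NC 0).
Definition orN a b := Ite a (NC 1) b.
Definition leR a b := notN (LtR b a).
Definition eqR a b := andN (leR a b) (leR b a).
Definition eqN a b := andN (notN (LtN a b)) (notN (LtN b a)).
Definition SumR v b e := RBig false v b e.
Definition ProdR v b e := RBig true v b e.

(* variables: 0 n, 1 d, 2 N, 3 D = 2d, 4 2D, 5 n^D, 6 n^(2D), 7 n^(2D)+1,
   8 the exponent p, 9 K, 10 number of rounds, 11 ceil(1/alpha), 12 lambda,
   13 kappa, 20 stack height, 21 number of outputs, 22 flag of the oracle. *)
Definition eAl := RG aINP (NC 0).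
Definition eSig := ProdR 30 (NV 3) (RN (NC 68 *n NV 3)).
Definition eTh := ProdR 30 (NV 3) (RC 16).
Definition eH := RC 16 *r RN (NV 12 +n NV 12 +n NC 6) /r eAl.
Definition ePow b j := ProdR 31 (NV 9) (Ite (LtN (NV 31) j) b (RC 1)).
Definition eTau j := ePow (eTh *r eTh) j *r eTh *r eH.
Definition eB := RC 4 *r ProdR 31 (NV 9) (eTh *r eTh) *r (eTh *r eTh *r (eTh *r eTh)) *r eH.
Definition eEps := RC 1 /r RN (NV 5).
Definition eThr := eAl *r RN (NV 2) /r RC 8.
Definition ePt i c := RG aINP (NC 2 +n (i *n NV 0 +n c)).
(** Arrays contain only reals, so the table of digits stores them as reals and they are used through
    equality tests with naturals. *)
Definition eDig k I := RG aDIG (k *n NV 6 +n I).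
Definition ePW I (f : ex false -> ex true) := ProdR 32 (NV 4)
  (SumR 33 (NV 0) (Ite (eqR (eDig (NV 32) I) (RN (NV 33))) (f (NV 33)) (RC 0))).
Definition eSq (f : ex false -> ex true) := SumR 33 (NV 0) (f (NV 33) *r f (NV 33)).
Definition eSqD f := ProdR 34 (NV 3) (eSq f).
Definition eQF f := (SumR 35 (NV 6) (RG aLT (NV 35) *r ePW (NV 35) f) +r RC 2 *r eEps *r eSqD f) /r eSig.
Definition eDif x y c := ePt x c -r ePt y c.
Definition eQ x y := eQF (eDif x y).
Definition eMass := SumR 36 (NV 2) (RG aW (NV 36)).
Definition eBall y t := SumR 37 (NV 2) (Ite (leR (eQ (NV 37) y) t) (RG aW (NV 37)) (RC 0)).
Definition eCnt c I := SumR 32 (NV 4) (Ite (eqR (eDig (NV 32) I) (RN c)) (RC 1) (RC 0)).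
Definition eSim I J := eqN (NFind 38 (NV 0) (notN (eqR (eCnt (NV 38) I) (eCnt (NV 38) J)))) (NV 0).
Definition eSym I := SumR 39 (NV 6) (Ite (eSim I (NV 39)) (RG aGT (NV 39)) (RC 0))
  /r SumR 39 (NV 6) (Ite (eSim I (NV 39)) (RC 1) (RC 0)).
Definition eBSm2 := eB *r eSig *r (eMass *r eMass).
Definition eTr := SumR 30 (NV 5) (RG aLT (NV 30 *n NV 5 +n NV 30)).
Definition eIp a b := SumR 30 (NV 6) (RG a (NV 30) *r RG b (NV 30)).
(** The machine has no division of naturals; the quotient is the least [q] with
    [I < (q + 1) n ^ D]. *)
Definition eDiv I := NFind 30 (NV 5) (LtN I (NV 30 *n NV 5 +n NV 5)).
Definition eMod I := I -n eDiv I *n NV 5.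
Definition eU j b := RG aUU (j *n NV 5 +n b).
Definition eA a b := RG aLT (a *n NV 5 +n b) +r Ite (eqN a b) eEps (RC 0).
Definition eAU a j := SumR 31 (NV 5) (eA a (NV 31) *r eU j (NV 31)).
Definition eUU j := SumR 30 (NV 5) (SumR 31 (NV 5) (eU j (NV 30) *r eU j (NV 31) *r eA (NV 30) (NV 31))).
Definition eUn j := SumR 30 (NV 5) (eU j (NV 30) *r eU j (NV 30)).
Definition cSkip := HN 29 (NC 0).

Definition cLoad := HFor 40 (NV 2) (HR aW (NV 40) (RG aSTK (NV 20 *n NV 2 +n NV 40))).
Definition cL0 := HFor 40 (NV 6) (HR aLT (NV 40) (RC 0)).
Definition cMT := HFor 40 (NV 6) (HR aMT (NV 40)
  (SumR 41 (NV 2) (SumR 42 (NV 2) (RG aW (NV 41) *r RG aW (NV 42) *r ePW (NV 40) (eDif (NV 41) (NV 42)))))).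
(** If the Euclidean part of the quasi-metric is already large, [L = 0] is a suitable valid tensor
    and no relaxation is run. Otherwise the same quantity bounds the norm of the moment tensor,
    which the step length of the moment correction requires. *)
Definition cEuclid := HN 22 (LtR eBSm2
  (SumR 41 (NV 2) (SumR 42 (NV 2) (RG aW (NV 41) *r RG aW (NV 42) *r (RC 2 *r eEps *r eSqD (eDif (NV 41) (NV 42))))))).
Definition cGtr := HFor 40 (NV 6) (HR aGT (NV 40)
  (Ite (eqN (eDiv (NV 40)) (eMod (NV 40))) (RC 0 -r eEps) (RC 0))).
Definition cGmt := HFor 40 (NV 6) (HR aGT (NV 40) (eBSm2 /r eIp aMT aMT *r RG aMT (NV 40))).
Definition cGS := HFor 43 (NV 5) (HFor 44 (NV 5) (HR aUU (NV 43 *n NV 5 +n NV 44)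
  (Ite (eqN (NV 43) (NV 44)) (RC 1) (RC 0) -r
   SumR 45 (NV 5) (Ite (LtN (NV 45) (NV 43)) (eAU (NV 43) (NV 45) /r eUU (NV 45) *r eU (NV 45) (NV 44)) (RC 0))))).
(** The first row with a nonpositive value provides the correction. If there is none, all
    constraints hold: the flag is raised, and the zero correction makes the update that ends the
    round leave [L] unchanged. *)
Definition cGpsd := HSeq (HN 26 (NFind 46 (NV 5) (leR (eUU (NV 46)) (RC 0))))
  (HIf (LtN (NV 26) (NV 5))
    (HFor 40 (NV 6) (HR aGT (NV 40)
      (eEps /r eUn (NV 26) *r (eU (NV 26) (eDiv (NV 40)) *r eU (NV 26) (eMod (NV 40))))))
    (HSeq (HN 22 (NC 1)) (HFor 40 (NV 6) (HR aGT (NV 40) (RC 0))))).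
Definition cG := HIf (LtR (RC 2) eTr) cGtr (HIf (LtR (eIp aLT aMT) eBSm2) cGmt (HSeq cGS cGpsd)).
Definition cUpd := HFor 40 (NV 6) (HR aLT (NV 40) (RG aLT (NV 40) +r eSym (NV 40))).
Definition cRelax := HFor 23 (NV 7) (HIf (NV 22) cSkip (HSeq cG cUpd)).

Definition cPush (e : ex true) :=
  HSeq (HFor 40 (NV 2) (HR aSTK (NV 20 *n NV 2 +n NV 40) e)) (HN 20 (NV 20 +n NC 1)).
Definition eStopA j := LtR ((RC 1 -r eAl /r RC 16) *r eMass) (eBall (NV 50) (eTau (j +n NC 1))).
Definition ePp b := ProdR 30 (NV 8) b.
Definition eStopB j := leR (ePp (eBall (NV 50) (eTau (j +n NC 1))) +r ePp (eMass -r eBall (NV 50) (eTau j))) (ePp eMass).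
Definition cSplit := HSeq
  (cPush (Ite (leR (eQ (NV 40) (NV 50)) (eTau (NV 51 +n NC 1))) (RG aW (NV 40)) (RC 0)))
  (cPush (Ite (LtR (eTau (NV 51)) (eQ (NV 40) (NV 50))) (RG aW (NV 40)) (RC 0))).
Definition cFilter := HSeq (HFor 40 (NV 2) (HR aGV (NV 40)
    (Ite (andN (LtR (RC 0) (RG aW (NV 40))) (LtR (eTh *r eTh *r eTau (NV 51 +n NC 1)) (eQ (NV 40) (NV 50))))
      (eQ (NV 40) (NV 50)) (RC 0))))
  (HSeq (HN 52 (NFind 41 (NV 2) (eqN (NFind 42 (NV 2) (LtR (RG aGV (NV 41)) (RG aGV (NV 42)))) (NV 2))))
  (cPush (RG aW (NV 40) *r (RC 1 -r RG aGV (NV 40) /r RG aGV (NV 52))))).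
Definition cNode := HSeq (HN 50 (NFind 49 (NV 2) (leR eThr (eBall (NV 49) (eTau (NC 0))))))
  (HIf (LtN (NV 50) (NV 2))
    (HSeq (HN 51 (NFind 48 (NV 9) (orN (eStopA (NV 48)) (eStopB (NV 48)))))
      (HIf (eStopA (NV 51)) cFilter cSplit))
    cSkip).
Definition eRho := ProdR 30 (NV 3) (RC 4) *r (RC 2 *r eB *r eSig) *r (RC 32 /r eAl).
Definition cLeaf := HSeq (HFor 40 (NV 0) (HR aMEAN (NV 40)
    (SumR 41 (NV 2) (RG aW (NV 41) *r ePt (NV 41) (NV 40)) /r eMass)))
  (HIf (eqN (NFind 47 (NV 2) (andN (LtN (NV 47) (NV 21))
      (leR (eSqD (fun c => RG aMEAN c -r RG aOUT (NV 47 *n NV 0 +n c))) eRho))) (NV 2))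
    (HSeq (HFor 40 (NV 0) (HR aOUT (NV 21 *n NV 0 +n NV 40) (RG aMEAN (NV 40))))
      (HN 21 (NV 21 +n NC 1)))
    cSkip).
(** One round pops one cluster. The number of rounds is fixed in advance, so rounds with an empty
    stack do nothing. A cluster lighter than [eThr] cannot contain half of the good points and is
    dropped. *)
Definition cBody := HIf (NV 20)
  (HSeq (HN 20 (NV 20 -n NC 1)) (HSeq cLoad
  (HIf (leR eThr eMass)
    (HSeq cL0 (HSeq cMT (HSeq cEuclid (HSeq cRelax (HIf (NV 22) cNode cLeaf)))))
    cSkip)))
  cSkip.
Definition cInit := HSeq (HN 20 (NC 1)) (HSeq (HN 21 (NC 0)) (HSeq
  (HFor 40 (NV 2) (HR aSTK (NV 40) (RC 1)))
  (HFor 40 (NV 6) (HSeq (HN 41 (NV 40)) (HFor 42 (NV 4) (HSeq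
    (HN 43 (NFind 44 (NV 6) (LtN (NV 41) (NV 44 *n NV 0 +n NV 0))))
    (HSeq (HR aDIG (NV 42 *n NV 6 +n NV 40) (RN (NV 41 -n NV 43 *n NV 0)))
      (HN 41 (NV 43))))))))).
Definition cMain := HSeq cInit (HFor 28 (NV 10) cBody).
Definition Pm : pred nat := fun v => (v < 14)%N.

Lemma ok_main : okhc Pm cMain. Proof. by vm_compute. Qed.

(** The parameters are computed in stages: a stage may use as loop bounds only variables that it
    does not assign, so each bound has to be completed by an earlier stage. *)
Definition cP1 := HN 3 (NV 1 +n NV 1).
Definition cP2 := HSeq (HN 4 (NV 3 +n NV 3)) (HSeq (HN 5 (NC 1)) (HSeq (HFor 30 (NV 3) (HN 5 (NV 5 *n NV 0)))
  (HSeq (HN 12 (NFind 31 (NV 2) (leR (RC 1) (ProdR 32 (NV 2) (Ite (LtN (NV 32) (NV 31)) (RC 2) (RC 1)) *r eAl))))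
  (HN 11 (NFind 31 (NV 2) (leR (RC 1) (RN (NV 31) *r eAl))))))).
Definition cP3 := HSeq (HN 6 (NV 5 *n NV 5)) (HSeq (HN 7 (NV 6 +n NC 1))
  (HSeq (HN 33 (NC 16)) (HSeq (HN 14 (NC 16)) (HSeq
  (HN 13 (NFind 31 (NV 2) (leR (RN (NV 12 +n NC 5)) (ProdR 32 (NV 2) (Ite (LtN (NV 32) (NV 31)) (RC 16 *r RC 16 *r RC 16) (RC 1))))))
  (HN 9 (NV 13 +n NV 13 +n NC 1)))))).
Definition cP4 := HN 8 (NC 16 *n NV 14 *n NV 14).
Definition dblc := HN 10 (NV 10 +n NV 10).
(** The number of rounds is built by repeated multiplication by [8 * An]: the factor [An] is a
    protected variable, as [NM] requires, and the factor 8 is three doublings. *)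
Definition cP5 := HSeq (HN 10 (NV 2)) (HSeq
  (HFor 30 (NV 8) (HSeq (HN 10 (NV 10 *n NV 11)) (HSeq dblc (HSeq dblc dblc))))
  (HN 10 (NV 10 +n NV 10 +n NV 10 +n NC 1))).
Lemma ok_P1 : okhc (fun v => v < 3)%N cP1. Proof. by vm_compute. Qed.
Lemma ok_P2 : okhc (fun v => v < 4)%N cP2. Proof. by vm_compute. Qed.
Lemma ok_P3 : okhc (fun v => v < 6)%N cP3. Proof. by vm_compute. Qed.
Lemma ok_P4 : okhc (fun v => (v == 14)%N) cP4. Proof. by vm_compute. Qed.
Lemma ok_P5 : okhc (fun v => (v == 8) || (v == 11))%N cP5. Proof. by vm_compute. Qed.
Definition cAll := HSeq cP1 (HSeq cP2 (HSeq cP3 (HSeq cP4 (HSeq cP5 cMain)))).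

(** * Frame conditions and rules for loops *)

Section frames.
Variable R : realType.
Notation hst := (hst R).

Definition frame (vs : seq nat) (As : seq 'I_15) (s s' : hst) :=
  (forall w, w \notin vs -> nv s' w = nv s w) /\ (forall a, a \notin As -> ra s' a =1 ra s a).

Fixpoint wv c := match c with HN v _ => [:: v] | HR _ _ _ => [::] | HSeq a b => wv a ++ wv b
  | HIf _ a b => wv a ++ wv b | HFor v _ a => v :: wv a end.
Fixpoint wa c := match c with HN v _ => [::] | HR a _ _ => [:: a] | HSeq a b => wa a ++ wa b
  | HIf _ a b => wa a ++ wa b | HFor v _ a => wa a end.

Lemma frame_refl vs As s : frame vs As s s. Proof. by []. Qed.
Lemma frame_trans vs As s1 s2 s3 : frame vs As s1 s2 -> frame vs As s2 s3 -> frame vs As s1 s3.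
Proof.
move=> [h1 h2] [h3 h4]; split=> [w hw|a ha x]; first by rewrite h3 ?h1.
by rewrite h4 ?h2.
Qed.
Lemma frame_sub vs vs' As As' s1 s2 : {subset vs <= vs'} -> {subset As <= As'} ->
  frame vs As s1 s2 -> frame vs' As' s1 s2.
Proof.
move=> hv ha [h1 h2]; split=> [w hw|a hA]; [apply: h1|apply: h2].
  by apply: contra hw; exact: hv.
by apply: contra hA; exact: ha.
Qed.

Lemma run_frame c (s : hst) : frame (wv c) (wa c) s (run c s).
Proof.
elim: c s => [v e|a i e|c1 IH1 c2 IH2|e c1 IH1 c2 IH2|v b c IH] s /=.
- by split=> [w|//] /=; rewrite inE => hw; rewrite upd_neq.
- by split=> [//|a'] /=; rewrite inE => /negbTE ha x /=; rewrite ha.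
- apply: frame_trans; [apply: frame_sub (IH1 s)|apply: frame_sub (IH2 _)];
    by move=> x hx; rewrite mem_cat hx ?orbT.
- by case: ifP => _; [apply: frame_sub (IH1 s)|apply: frame_sub (IH2 s)];
    by move=> x hx; rewrite mem_cat hx ?orbT.
- move: (iota _ _) => l; elim: l s => [|i l IHl] s /=; first exact: frame_refl.
  apply: frame_trans (IHl _); apply: (@frame_trans _ _ _ (updv s v i)).
    by split=> [w|//] /=; rewrite inE negb_or => /andP[hw _]; rewrite upd_neq.
  by apply: frame_sub (IH _) => x hx //; rewrite inE hx orbT.
Qed.

Lemma for_rule v (b : ex false) c (I : nat -> hst -> Prop) s : I 0%N s ->
  (forall i s', (i < ev b s)%N -> I i s' -> I i.+1 (run c (updv s' v i))) ->
  I (ev b s) (run (HFor v b c) s).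
Proof.
move=> h0 hS /=; suff H m : (m <= ev b s)%N -> I m (foldl (fun st i => run c (updv st v i)) s (iota 0 m)).
  exact: H.
elim: m => // m IH hm; rewrite -addn1 iotaD foldl_cat /= addn1; apply: hS => //; exact: IH (ltnW hm).
Qed.

(** The body may use both the entries already written and the untouched old ones; an in-place update
    such as [cUpd] needs the latter, as do the earlier rows in the Gram-Schmidt loop. *)
Lemma for_arr v (b idx : ex false) a (e : ex true) (s : hst) (f : nat -> nat) (g : nat -> R) :
  (forall i s', (i < ev b s)%N -> frame [:: v] [:: a] s s' -> nv s' v = i ->
     (forall j, (j < i)%N -> ra s' a (f j) = g j) ->
     (forall x, (forall j, (j < i)%N -> x <> f j) -> ra s' a x = ra s a x) ->
     ev idx s' = f i /\ (ev e s' : R) = g i) ->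
  (forall i j, (i < j)%N -> (j < ev b s)%N -> f i <> f j) ->
  let s2 := run (HFor v b (HR a idx e)) s in
  [/\ frame [:: v] [:: a] s s2, forall j, (j < ev b s)%N -> ra s2 a (f j) = g j &
      forall x, (forall j, (j < ev b s)%N -> x <> f j) -> ra s2 a x = ra s a x].
Proof.
move=> h hinj; pose I i (s' : hst) := [/\ frame [:: v] [:: a] s s',
  forall j, (j < i)%N -> ra s' a (f j) = g j &
  forall x, (forall j, (j < i)%N -> x <> f j) -> ra s' a x = ra s a x].
apply: (@for_rule v b (HR a idx e) I) => [|i s' hi [h1 h2 h3]]; first by split.
have fr : frame [:: v] [:: a] s (updv s' v i).
  apply: (frame_trans h1); split=> // w; rewrite inE /= => hw; by rewrite upd_neq.
have [e1 e2] := h i (updv s' v i) hi fr (upd_eq _ _ _) h2 h3.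
split.
- apply: (frame_trans fr); split=> //= a'; rewrite inE => /negbTE ha x /=; by rewrite ha.
- move=> j hj /=; rewrite eqxx /= e1 e2; case: eqP => [E|ne].
    have [lt|gt|-> //] := ltngtP j i; first by case: (hinj j i lt hi).
    by move: gt; rewrite ltnNge -ltnS hj.
  by apply: h2; rewrite ltn_neqAle -ltnS hj andbT; apply/eqP => E; apply: ne; rewrite E.
- move=> x hx /=; rewrite eqxx /= e1; case: eqP => [E|_]; first by case: (hx i).
  by apply: h3 => j hj; apply: hx; exact: ltnW.
Qed.

End frames.

Arguments ev : simpl never.
Arguments run : simpl never.

Section rules.
Variable R : realType.
Notation hst := (hst R).
Implicit Types (s : hst).

Lemma nvU s v x w : nv (updv s v x) w = if w == v then x else nv s w. Proof. by []. Qed.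
Lemma raU s v x : ra (updv s v x) = ra s. Proof. by []. Qed.
Lemma ev_NC k s : ev (NC k) s = k. Proof. by []. Qed.
Lemma ev_NV v s : ev (NV v) s = nv s v. Proof. by []. Qed.
Lemma ev_NA a b s : ev (a +n b) s = (ev a s + ev b s)%N. Proof. by []. Qed.
Lemma ev_NS a b s : ev (a -n b) s = (ev a s - ev b s)%N. Proof. by []. Qed.
Lemma ev_NM a b s : ev (a *n b) s = (ev a s * ev b s)%N. Proof. by []. Qed.
Lemma ev_RA a b s : ev (a +r b) s = (ev a s : R) + ev b s. Proof. by []. Qed.
Lemma ev_RS a b s : ev (a -r b) s = (ev a s : R) - ev b s. Proof. by []. Qed.
Lemma ev_RM a b s : ev (a *r b) s = (ev a s : R) * ev b s. Proof. by []. Qed.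
Lemma ev_RD a b s : ev (a /r b) s = (ev a s : R) / ev b s. Proof. by []. Qed.
Lemma ev_RN a s : (ev (RN a) s : R) = (ev a s)%:R. Proof. by []. Qed.
Lemma ev_RC a s : (ev (RC a) s : R) = a%:R. Proof. by []. Qed.
Lemma ev_RG a i s : (ev (RG a i) s : R) = ra s a (ev i s). Proof. by []. Qed.
Lemma ev_Sum v b e s : (ev (SumR v b e) s : R) = \sum_(i < ev b s) (ev e (updv s v i) : R).
Proof. by []. Qed.
Lemma ev_Prod v b e s : (ev (ProdR v b e) s : R) = \prod_(i < ev b s) (ev e (updv s v i) : R).
Proof. by []. Qed.
Lemma ev_Ite t c (a b : ex t) s : ev (Ite c a b) s = if ev c s != 0%N then ev a s else ev b s.
Proof. by []. Qed.
Lemma ev_LtN a b s : (ev (LtN a b) s != 0%N) = (ev a s < ev b s)%N.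
Proof. by rewrite /ev -/(ev a s) -/(ev b s); case: (_ < _)%N. Qed.
Lemma ev_LtR a b s : (ev (LtR a b) s != 0%N) = ((ev a s : R) < ev b s).
Proof. by rewrite /ev -/(ev a s) -/(ev b s); case: (_ < _). Qed.
Lemma ev_notN a s : (ev (notN a) s != 0%N) = ~~ (ev a s != 0%N).
Proof. by rewrite /notN ev_NS ev_NC; case: (ev a s). Qed.
Lemma ev_andN a b s : (ev (andN a b) s != 0%N) = (ev a s != 0%N) && (ev b s != 0%N).
Proof. by rewrite /andN ev_Ite; case: ifP. Qed.
Lemma ev_orN a b s : (ev (orN a b) s != 0%N) = (ev a s != 0%N) || (ev b s != 0%N).
Proof. by rewrite /orN ev_Ite; case: ifP. Qed.
Lemma ev_leR a b s : (ev (leR a b) s != 0%N) = ((ev a s : R) <= ev b s).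
Proof. by rewrite /leR ev_notN ev_LtR -leNgt. Qed.
Lemma ev_eqR a b s : (ev (eqR a b) s != 0%N) = ((ev a s : R) == ev b s).
Proof. by rewrite /eqR ev_andN !ev_leR -eq_le. Qed.
Lemma ev_eqN a b s : (ev (eqN a b) s != 0%N) = (ev a s == ev b s).
Proof. by rewrite /eqN ev_andN !ev_notN !ev_LtN -!leqNgt eqn_leq andbC. Qed.
Lemma ev_Find v b e s : ev (NFind v b e) s = find (fun i => ev e (updv s v i) != 0%N) (iota 0 (ev b s)).
Proof. by []. Qed.

End rules.

(* [rewrite] would match these rules modulo unfolding of the macros. *)
Ltac evs := repeat first [
  match goal with |- context [ev (NC ?k) ?s] => rewrite (ev_NC k s) end |
  match goal with |- context [ev (NV ?k) ?s] => rewrite (ev_NV k s) end |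
  match goal with |- context [ev (?a +n ?b) ?s] => rewrite (ev_NA a b s) end |
  match goal with |- context [ev (?a -n ?b) ?s] => rewrite (ev_NS a b s) end |
  match goal with |- context [ev (?a *n ?b) ?s] => rewrite (ev_NM a b s) end |
  match goal with |- context [ev (?a +r ?b) ?s] => rewrite (ev_RA a b s) end |
  match goal with |- context [ev (?a -r ?b) ?s] => rewrite (ev_RS a b s) end |
  match goal with |- context [ev (?a *r ?b) ?s] => rewrite (ev_RM a b s) end |
  match goal with |- context [ev (?a /r ?b) ?s] => rewrite (ev_RD a b s) end |
  match goal with |- context [ev (RN ?a) ?s] => rewrite (ev_RN a s) end |
  match goal with |- context [ev (RC ?a) ?s] => rewrite (ev_RC a s) end |
  match goal with |- context [ev (RG ?a ?i) ?s] => rewrite (ev_RG a i s) end |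
  match goal with |- context [ev (SumR ?v ?b ?e) ?s] => rewrite (ev_Sum v b e s) end |
  match goal with |- context [ev (ProdR ?v ?b ?e) ?s] => rewrite (ev_Prod v b e s) end |
  match goal with |- context [ev (Ite ?c ?a ?b) ?s] => rewrite (ev_Ite c a b s) end |
  match goal with |- context [ev (LtN ?a ?b) ?s != 0%N] => rewrite (ev_LtN a b s) end |
  match goal with |- context [ev (LtR ?a ?b) ?s != 0%N] => rewrite (ev_LtR a b s) end |
  match goal with |- context [ev (notN ?a) ?s != 0%N] => rewrite (ev_notN a s) end |
  match goal with |- context [ev (andN ?a ?b) ?s != 0%N] => rewrite (ev_andN a b s) end |
  match goal with |- context [ev (orN ?a ?b) ?s != 0%N] => rewrite (ev_orN a b s) end |
  match goal with |- context [ev (leR ?a ?b) ?s != 0%N] => rewrite (ev_leR a b s) end |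
  match goal with |- context [ev (eqR ?a ?b) ?s != 0%N] => rewrite (ev_eqR a b s) end |
  match goal with |- context [ev (eqN ?a ?b) ?s != 0%N] => rewrite (ev_eqN a b s) end |
  match goal with |- context [ev (NFind ?v ?b ?e) ?s] => rewrite (ev_Find v b e s) end ].

(** * Values of the expressions of the program *)

Section evaluation.
Variable R : realType.
Notation hst := (hst R).
Implicit Types (s : hst).

Lemma findP (a : pred nat) m :
  let k := find a (iota 0 m) in
  [/\ (k <= m)%N, (k < m)%N -> a k & forall j, (j < k)%N -> a j = false].
Proof.
have hs := find_size a (iota 0 m); rewrite size_iota in hs.
split=> // [h|j hj].
  have hh : has a (iota 0 m) by rewrite has_find size_iota.
  by have := nth_find 0%N hh; rewrite nth_iota // add0n.
by have := before_find 0%N hj; rewrite nth_iota ?add0n // (leq_trans hj).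
Qed.

Variables (n D N lam K p : nat) (al : R) (X : nat -> nat -> R).
Hypothesis n0 : (0 < n)%N.
Notation K2 := (D + D)%N.
Notation ND := (n ^ D)%N.
Notation M := (n ^ (D + D))%N.
Notation sg := (@sigma R D).
Notation Th := (16 ^+ D : R).

Record Cst s : Prop := {
  c_n : nv s 0 = n; c_N : nv s 2 = N; c_D : nv s 3 = D; c_K2 : nv s 4 = K2;
  c_ND : nv s 5 = ND; c_M : nv s 6 = M; c_it : nv s 7 = M.+1; c_p : nv s 8 = p;
  c_K : nv s 9 = K; c_lam : nv s 12 = lam;
  c_al : ra s aINP 0 = al;
  c_X : forall i c, (i < N)%N -> (c < n)%N -> ra s aINP (2 + (i * n + c)) = X i c;
  c_dig : forall k I, (k < K2)%N -> (I < M)%N -> ra s aDIG (k * M + I) = (I %/ n ^ k %% n)%N%:R }.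

Lemma Cst_frame vs As s s' : all (fun v => 14 <= v)%N vs -> aINP \notin As -> aDIG \notin As ->
  frame vs As s s' -> Cst s -> Cst s'.
Proof.
move=> hv h1 h2 [f1 f2] [*]; have hn w : (w < 14)%N -> nv s' w = nv s w.
  by move=> hw; apply: f1; apply/negP => /(allP hv); rewrite leqNgt hw.
by split; rewrite ?hn ?f2 // => *; rewrite f2 //; auto.
Qed.

Lemma Cst_updv s v x : (14 <= v)%N -> Cst s -> Cst (updv s v x).
Proof.
move=> hv; apply: (@Cst_frame [:: v] [::]) => //=; first by rewrite hv.
by split=> // w; rewrite inE => hw /=; rewrite upd_neq.
Qed.

Lemma pw_ext (f g : nat -> R) k I : (forall c, (c < n)%N -> f c = g c) -> pw n k f I = pw n k g I.
Proof. by move=> h; apply: eq_bigr => j _; rewrite h // ltn_pmod. Qed.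

Lemma prod_const m (x : R) : \prod_(i < m) x = x ^+ m.
Proof. by rewrite prodr_const card_ord. Qed.

Lemma ev_Al s : Cst s -> (ev eAl s : R) = al.
Proof. by move=> h; rewrite /eAl; evs; rewrite (c_al h). Qed.

Lemma ev_Sig s : Cst s -> (ev eSig s : R) = sg.
Proof.
move=> h; rewrite /eSig; evs; rewrite (c_D h) /sigma -prod_const; apply: eq_bigr => i _.
by evs; rewrite nvU /= (c_D h).
Qed.

Lemma ev_Th s : Cst s -> (ev eTh s : R) = Th.
Proof. by move=> h; rewrite /eTh; evs; rewrite (c_D h) -prod_const; apply: eq_bigr. Qed.

Lemma prod_if m j (b : R) : (j <= m)%N ->
  \prod_(i < m) (if (i < j)%N then b else 1) = b ^+ j.
Proof.
move=> hj; rewrite -(subnKC hj) big_split_ord /= -[RHS]mulr1; congr (_ * _).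
  by rewrite -prod_const; apply: eq_bigr => i _; rewrite ltn_ord.
by rewrite big1 // => i _; rewrite ltnNge leq_addr.
Qed.

Definition Lc : R := (2 * lam + 6)%:R.
Definition Hc : R := 16 * Lc / al.
Definition Bc : R := 4 * (Th * Th) ^+ K * Th ^+ 4 * Hc.

Lemma ev_H s : Cst s -> (ev eH s : R) = Hc.
Proof.
by move=> h; rewrite /eH; evs; rewrite (ev_Al h) (c_lam h) /Hc /Lc addnn mul2n.
Qed.

Lemma ev_Pow (b : ex true) (j : ex false) s (bv : R) jv : Cst s -> (jv <= K)%N ->
  (forall i, (ev b (updv s 31 i) : R) = bv) -> (forall i, ev j (updv s 31 i) = jv) ->
  (ev (ePow b j) s : R) = bv ^+ jv.
Proof.
move=> h hj hb hjv; rewrite /ePow; evs; rewrite (c_K h) -(@prod_if K) //.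
by apply: eq_bigr => i _; evs; rewrite nvU eqxx hb hjv.
Qed.

Lemma ev_Tau (j : ex false) s jv : Cst s -> (jv <= K)%N -> (forall i, ev j (updv s 31 i) = jv) ->
  (ev (eTau j) s : R) = tau Th Hc jv.
Proof.
move=> h hj hjv; rewrite /eTau 2!ev_RM (ev_Th h) (ev_H h) (@ev_Pow _ _ _ (Th * Th) jv) // => i.
by rewrite ev_RM ev_Th //; exact: Cst_updv.
Qed.

Lemma ev_B s : Cst s -> (ev eB s : R) = Bc.
Proof.
move=> h; rewrite /eB; evs; rewrite (ev_Th h) (ev_H h) (c_K h) /Bc -[(_ * _) ^+ K]prod_const.
congr (_ * _ * _ * _); last by ring.
by apply: eq_bigr => i _; rewrite ev_RM ev_Th //; exact: Cst_updv.
Qed.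

Lemma ev_Eps s : Cst s -> (ev eEps s : R) = eps R n D.
Proof. by move=> h; rewrite /eEps; evs; rewrite (c_ND h) mul1r. Qed.

Lemma ev_Thr s : Cst s -> (ev eThr s : R) = thr N al.
Proof. by move=> h; rewrite /eThr; evs; rewrite (ev_Al h) (c_N h). Qed.

Lemma ev_PW (I : ex false) (f : ex false -> ex true) s i (g : nat -> R) : Cst s -> (i < M)%N ->
  (forall k c, ev I (updv (updv s 32 k) 33 c) = i) ->
  (forall k c, (c < n)%N -> (ev (f (NV 33)) (updv (updv s 32 k) 33 c) : R) = g c) ->
  (ev (ePW I f) s : R) = pw n K2 g i.
Proof.
move=> h hi hI hf; rewrite /ePW; evs; rewrite (c_K2 h); apply: eq_bigr => k _.
evs; rewrite nvU /= (c_n h); set dg := (i %/ n ^ k %% n)%N.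
have hd : (dg < n)%N by rewrite ltn_pmod.
have E (c : 'I_n) : (ev (Ite (eqR (eDig (NV 32) I) (RN (NV 33))) (f (NV 33)) (RC 0)) (updv (updv s 32 k) 33 c) : R) =
    if dg == c then g c else 0.
  evs; rewrite (hf _ _ (ltn_ord c)) /eDig; evs; rewrite !nvU /= hI (c_M h) /= (c_dig h) // eqr_nat.
  by case: ifP.
rewrite (eq_bigr _ (fun c _ => E c)) (bigD1 (Ordinal hd)) //= eqxx big1 ?addr0 // => c hc.
by have -> : (dg == c) = false by apply: contraNF hc => /eqP e; apply/eqP/val_inj.
Qed.

Lemma ev_Sq (f : ex false -> ex true) s (g : nat -> R) : Cst s -> (forall c, (c < n)%N -> (ev (f (NV 33)) (updv s 33 c) : R) = g c) ->
  (ev (eSq f) s : R) = sq n g.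
Proof. by move=> h hf; rewrite /eSq; evs; rewrite (c_n h); apply: eq_bigr => c _; evs; rewrite hf. Qed.

Lemma ev_SqD (f : ex false -> ex true) s (g : nat -> R) : Cst s -> (forall k c, (c < n)%N -> (ev (f (NV 33)) (updv (updv s 34 k) 33 c) : R) = g c) ->
  (ev (eSqD f) s : R) = sq n g ^+ D.
Proof.
move=> h hf; rewrite /eSqD; evs; rewrite (c_D h) -prod_const; apply: eq_bigr => k _.
by apply: ev_Sq => [|c hc]; [exact: Cst_updv|exact: hf].
Qed.

Definition dif (a b : nat) (c : nat) : R := X a c - X b c.
Definition QL (L : nat -> R) (a b : nat) : R := qf n D L (dif a b) / sg.

Lemma ev_Dif (x y : ex false) s a b c : Cst s -> ev x s = a -> ev y s = b -> nv s 33 = c ->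
  (a < N)%N -> (b < N)%N -> (c < n)%N -> (ev (eDif x y (NV 33)) s : R) = dif a b c.
Proof.
move=> h ha hb hc la lb lc; rewrite /eDif /ePt; evs; rewrite ha hb hc (c_n h) !(c_X h) //.
Qed.

Definition fv (v : nat) := (v \notin [:: 32; 33; 34; 35])%N.

Lemma ev_Q x y s : Cst s -> fv x -> fv y -> (nv s x < N)%N -> (nv s y < N)%N ->
  (ev (eQ (NV x) (NV y)) s : R) = QL (ra s aLT) (nv s x) (nv s y).
Proof.
move=> h; rewrite /fv !inE !negb_or => /and4P[/negbTE x1 /negbTE x2 /negbTE x3 /negbTE x4].
move=> /and4P[/negbTE y1 /negbTE y2 /negbTE y3 /negbTE y4] lx ly.
rewrite /eQ /eQF ev_RD (ev_Sig h) ev_RA !ev_RM ev_RC (ev_Eps h) ev_Sum ev_NV (c_M h) /QL /qf; congr ((_ + _ * _) / _).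
  apply: eq_bigr => I _; evs; rewrite nvU eqxx raU; congr (_ * _).
  apply: ev_PW => [|//|k c|k c hc]; first exact: Cst_updv.
    by evs; rewrite !nvU.
  apply: ev_Dif => //; first by do ! apply: Cst_updv.
    by evs; rewrite !nvU x1 x2 x4.
  by evs; rewrite !nvU y1 y2 y4.
apply: ev_SqD => // k c hc; apply: ev_Dif => //; first by do ! apply: Cst_updv.
  by evs; rewrite !nvU x2 x3.
by evs; rewrite !nvU y2 y3.
Qed.

Lemma ev_Mass s : Cst s -> (ev eMass s : R) = mass N (ra s aW).
Proof. by move=> h; rewrite /eMass; evs; rewrite (c_N h). Qed.

Lemma ev_Ball y (t : ex true) s tv : Cst s -> fv y -> (y != 37)%N -> (nv s y < N)%N ->
  (forall i, (ev t (updv s 37 i) : R) = tv) ->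
  (ev (eBall (NV y) t) s : R) = ball N (QL (ra s aLT)) (ra s aW) (nv s y) tv.
Proof.
move=> h fy /negbTE y7 ly ht; rewrite /eBall; evs; rewrite (c_N h); apply: eq_bigr => x _.
have hU : Cst (updv s 37 x) by exact: Cst_updv.
by rewrite ev_Ite ev_leR ev_RG ev_NV ev_RC ht ev_Q // !nvU ?eqxx ?y7.
Qed.

Lemma count_ds_lt k I c : (n <= c)%N -> count_mem c (ds n k I) = 0%N.
Proof.
move=> hc; apply/count_memPn/negP => /(allP (all_ds n0 k I)); by rewrite ltnNge hc.
Qed.

Lemma simP I J : sim n D I J = [forall c : 'I_n, count_mem (c : nat) (ds n K2 I) == count_mem (c : nat) (ds n K2 J)].
Proof.
apply/idP/forallP => [/permP h c|h]; first by rewrite h.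
apply/allP => c _ /=; case: (ltnP c n) => hc; last by rewrite !count_ds_lt.
exact: (h (Ordinal hc)).
Qed.

Lemma count_ds_sum c I : (\sum_(k < K2) if ((I %/ n ^ k %% n)%N == c)%N then 1 else 0 : R) =
  (count_mem c (ds n K2 I))%:R.
Proof.
rewrite -[X in count_mem c X](mkseq_nth 0%N) /mkseq size_ds count_map.
rewrite -sum1_count big_mkcond natr_sum -(big_mkord predT (fun k => if (I %/ n ^ k %% n == c)%N then 1 else 0 : R)).
rewrite /index_iota subn0 [RHS]big_mkcond big_seq [RHS]big_seq; apply: eq_bigr => k.
rewrite mem_iota add0n /= => hk; by rewrite nth_ds.
Qed.

Lemma ev_Cnt (c I : ex false) s cv Iv : Cst s -> (Iv < M)%N -> (forall k, ev c (updv s 32 k) = cv) ->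
  (forall k, ev I (updv s 32 k) = Iv) ->
  (ev (eCnt c I) s : R) = (count_mem cv (ds n K2 Iv))%:R.
Proof.
move=> h hI hc hIv; rewrite /eCnt; evs; rewrite (c_K2 h) -count_ds_sum; apply: eq_bigr => k _.
by evs; rewrite /eDig; evs; rewrite !nvU eqxx hc hIv /= (c_M h) (c_dig h) // eqr_nat.
Qed.

Lemma ev_Sim (I J : ex false) s Iv Jv : Cst s -> (Iv < M)%N -> (Jv < M)%N ->
  (forall k c, ev I (updv (updv s 38 c) 32 k) = Iv) -> (forall k c, ev J (updv (updv s 38 c) 32 k) = Jv) ->
  (ev (eSim I J) s != 0%N) = sim n D Iv Jv.
Proof.
move=> h hI hJ hIv hJv; rewrite /eSim; evs; rewrite (c_n h) simP.
set a := (fun i : nat => _).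
have aE i : a i = (count_mem i (ds n K2 Iv) != count_mem i (ds n K2 Jv)).
  have hU : Cst (updv s 38 i) by exact: Cst_updv.
  rewrite /a; evs; rewrite (@ev_Cnt _ _ _ i Iv) // ?(@ev_Cnt _ _ _ i Jv) ?eqr_nat // => k; by evs; rewrite !nvU.
have [k1 k2 k3] := findP a n; apply/eqP/forallP => [E c|H].
  by have := k3 c; rewrite E ltn_ord aE => /(_ isT) /negbFE.
apply/eqP; rewrite eqn_leq k1 leqNgt; apply/negP => hk; have := k2 hk; rewrite aE.
by have /eqP -> := H (Ordinal hk); rewrite eqxx.
Qed.

Lemma ev_Sym (I : ex false) s Iv : Cst s -> (Iv < M)%N -> (forall j k c, ev I (updv (updv (updv s 39 j) 38 c) 32 k) = Iv) ->
  (ev (eSym I) s : R) = Sym n D (ra s aGT) Iv.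
Proof.
move=> h hI hIv; rewrite /eSym; evs; rewrite (c_M h) /Sym; congr (_ / _); apply: eq_bigr => J _.
all: have hU : Cst (updv s 39 J) by [exact: Cst_updv].
all: have hS : (ev (eSim I (NV 39)) (updv s 39 J) != 0%N) = sim n D Iv J by apply: ev_Sim => // k c; evs; rewrite !nvU.
all: by evs; rewrite hS.
Qed.

Lemma ev_BSm2 s : Cst s -> (ev eBSm2 s : R) = Bc * sg * mass N (ra s aW) ^+ 2.
Proof. by move=> h; rewrite /eBSm2; evs; rewrite (ev_B h) (ev_Sig h) (ev_Mass h) expr2. Qed.

Lemma ev_Tr s : Cst s -> (ev eTr s : R) = tr n D (ra s aLT).
Proof.
move=> h; rewrite /eTr; evs; rewrite (c_ND h); apply: eq_bigr => a _.
by evs; rewrite !nvU /= (c_ND h).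
Qed.

Lemma ev_Ip a b s : Cst s -> (ev (eIp a b) s : R) = ip n D (ra s a) (ra s b).
Proof. by move=> h; rewrite /eIp; evs; rewrite (c_M h); apply: eq_bigr => I _; evs; rewrite !nvU. Qed.

Lemma ev_Div (I : ex false) s Iv : Cst s -> (Iv < M)%N -> (forall q, ev I (updv s 30 q) = Iv) ->
  ev (eDiv I) s = (Iv %/ ND)%N.
Proof.
move=> h hI hIv; rewrite /eDiv; evs; rewrite (c_ND h); set a := (fun i : nat => _).
have nd : (0 < ND)%N by rewrite expn_gt0 n0.
have aE q : a q = (Iv %/ ND <= q)%N.
  by rewrite /a; evs; rewrite hIv !nvU /= (c_ND h) -mulSnr -ltn_divLR // ltnS.
have [k1 k2 k3] := findP a ND.
have hd : (Iv %/ ND < ND)%N by rewrite ltn_divLR // -expnD.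
have kl : (find a (iota 0 ND) < ND)%N.
  rewrite ltn_neqAle k1 andbT; apply/eqP => E; have := k3 (Iv %/ ND)%N; rewrite E hd aE leqnn.
  by move=> /(_ isT).
apply/eqP; rewrite eqn_leq; apply/andP; split; last by have := k2 kl; rewrite aE.
rewrite leqNgt; apply/negP => hlt; have := k3 _ hlt; by rewrite aE leqnn.
Qed.

Lemma ev_Mod (I : ex false) s Iv : Cst s -> (Iv < M)%N -> ev I s = Iv -> (forall q, ev I (updv s 30 q) = Iv) ->
  ev (eMod I) s = (Iv %% ND)%N.
Proof.
move=> h hI hs hIv; rewrite /eMod; evs; rewrite hs (@ev_Div _ _ Iv) // (c_ND h).
by rewrite {1}(divn_eq Iv ND) addKn.
Qed.

End evaluation.

(** * One round of the relaxation method *)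

Section oracle.
Variable R : realType.
Notation hst := (hst R).
Implicit Types (s : hst).

Lemma run_HN v e s : run (HN v e) s = updv s v (ev e s). Proof. by []. Qed.
Lemma run_HSeq c1 c2 s : run (HSeq c1 c2) s = run c2 (run c1 s). Proof. by []. Qed.
Lemma run_HIf e c1 c2 s : run (HIf e c1 c2) s = if ev e s != 0%N then run c1 s else run c2 s.
Proof. by []. Qed.

Lemma for_id v (b : ex false) a (e : ex true) s (g : nat -> R) :
  (forall i s', (i < ev b s)%N -> frame [:: v] [:: a] s s' -> nv s' v = i -> (ev e s' : R) = g i) ->
  let s2 := run (HFor v b (HR a (NV v) e)) s in
  frame [:: v] [:: a] s s2 /\ forall j, (j < ev b s)%N -> ra s2 a j = g j.
Proof.
move=> h; have [] := @for_arr R v b (NV v) a e s id g.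
- by move=> i s' hi fr hv _ _; split; [rewrite ev_NV|exact: h].
- by move=> i j ij _ E; rewrite E ltnn in ij.
- by move=> h1 h2 _; split.
Qed.

Variables (n D N lam K p : nat) (al : R) (X : nat -> nat -> R).
Hypothesis n0 : (0 < n)%N.
Notation K2 := (D + D)%N.
Notation ND := (n ^ D)%N.
Notation M := (n ^ (D + D))%N.
Notation sg := (@sigma R D).
Notation Cst := (@Cst R n D N lam K p al X).
Notation dif := (dif X).
Notation Bc := (@Bc R D lam K al).
Notation eps := (@eps R n D).

Lemma pair_lt a b : (a < ND)%N -> (b < ND)%N -> (a * ND + b < M)%N.
Proof.
move=> ha hb; apply: (@leq_trans (a.+1 * ND)); first by rewrite mulSn addnC ltn_add2r.
by rewrite expnD leq_mul2r ha orbT.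
Qed.

Definition MT (w : nat -> R) I : R := \sum_(x < N) \sum_(z < N) w x * w z * pw n K2 (dif x z) I.

Lemma run_cL0 s : Cst s -> let s' := run cL0 s in
  frame [:: 40] [:: aLT] s s' /\ forall I, (I < M)%N -> ra s' aLT I = 0.
Proof.
move=> h s'; have [] := @for_id 40 (NV 6) aLT (RC 0) s (fun _ => 0); first by move=> *; rewrite ev_RC.
by rewrite ev_NV (c_M h).
Qed.

Ltac csf h := apply: (Cst_frame _ _ _ _ h); [..|eassumption].

Lemma run_cMT s : Cst s -> let s' := run cMT s in
  frame [:: 40] [:: aMT] s s' /\ forall I, (I < M)%N -> ra s' aMT I = MT (ra s aW) I.
Proof.
move=> h; set e := SumR 41 (NV 2) (SumR 42 (NV 2) (RG aW (NV 41) *r RG aW (NV 42) *r ePW (NV 40) (eDif (NV 41) (NV 42)))).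
have [] := @for_id 40 (NV 6) aMT e s (MT (ra s aW)); last by rewrite ev_NV (c_M h).
move=> i s' hi fr hv; rewrite ev_NV (c_M h) in hi.
have h' : Cst s' by exact: (Cst_frame _ _ _ fr h).
have [_ fra] := fr; rewrite /e; evs; rewrite (c_N h'); apply: eq_bigr => x _.
evs; rewrite nvU /= (c_N h'); apply: eq_bigr => z _; evs; rewrite !nvU /= !fra //.
congr (_ * _); have h2 : Cst (updv (updv s' 41 x) 42 z) by do 2 apply: Cst_updv => //.
apply: (ev_PW n0 h2) => // k c hc.
by apply: (@ev_Dif R n D N lam K p al X) => //; do ! apply: Cst_updv => //.
Qed.

Lemma run_cEuclid s : Cst s -> exists2 b : nat, run cEuclid s = updv s 22 b &
  (b != 0%N) = (Bc * sg * mass N (ra s aW) ^+ 2 <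
    \sum_(x < N) \sum_(z < N) ra s aW x * ra s aW z * (2 * eps * sq n (dif x z) ^+ D)).
Proof.
move=> h; rewrite /cEuclid run_HN; eexists; first by [].
rewrite ev_LtR (ev_BSm2 h); congr (_ < _).
evs; rewrite (c_N h); apply: eq_bigr => x _.
evs; rewrite nvU /= (c_N h); apply: eq_bigr => z _; evs; rewrite !nvU /=.
have h2 : Cst (updv (updv s 41 x) 42 z) by do 2 apply: Cst_updv => //.
rewrite (ev_Eps h2); congr (_ * (_ * _)); apply: (ev_SqD h2) => k c hc.
by apply: (@ev_Dif R n D N lam K p al X) => //; do ! apply: Cst_updv => //.
Qed.

Definition Aen (L : nat -> R) a b : R := L (a * ND + b)%N + (if a == b then eps else 0).
Definition Urow (u : nat -> R) k b : R := u (k * ND + b)%N.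
Definition gsrec (L u : nat -> R) k b : R := (if k == b then 1 else 0) -
  \sum_(j < ND) if (j < k)%N then (\sum_(c < ND) Aen L k c * Urow u j c) / qA ND (Aen L) (Urow u j) (Urow u j) * Urow u j b else 0.

Lemma qA_eq (A : nat -> nat -> R) f f' g g' : (forall a, (a < ND)%N -> f a = f' a) -> (forall a, (a < ND)%N -> g a = g' a) ->
  qA ND A f g = qA ND A f' g'.
Proof. by move=> h1 h2; apply: eq_bigr => a _; apply: eq_bigr => b _; rewrite h1 // h2. Qed.

(** Row [k] depends only on earlier rows, so the recurrence proved for it remains true while later
    rows are written. *)
Lemma gsrec_ext L u u' k b : (b < ND)%N -> (forall j c, (j < k)%N -> (c < ND)%N -> Urow u j c = Urow u' j c) ->
  gsrec L u k b = gsrec L u' k b.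
Proof.
move=> hb h; rewrite /gsrec; congr (_ - _); apply: eq_bigr => j _; case: ifP => // jk.
rewrite !h // (@qA_eq _ _ (Urow u' j) _ (Urow u' j)) => [|a ha|a ha]; rewrite ?h //.
by congr (_ / _ * _); apply: eq_bigr => c _; rewrite h.
Qed.

Lemma ev_A (a b : ex false) s av bv : Cst s -> ev a s = av -> ev b s = bv ->
  (ev (eA a b) s : R) = Aen (ra s aLT) av bv.
Proof. by move=> h ha hb; rewrite /eA; evs; rewrite ha hb (ev_Eps h) (c_ND h). Qed.

Lemma ev_U (j b : ex false) s jv bv : Cst s -> ev j s = jv -> ev b s = bv ->
  (ev (eU j b) s : R) = Urow (ra s aUU) jv bv.
Proof. by move=> h ha hb; rewrite /eU; evs; rewrite ha hb (c_ND h). Qed.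

Lemma ev_UU j s : Cst s -> (40 <= j)%N ->
  (ev (eUU (NV j)) s : R) = qA ND (Aen (ra s aLT)) (Urow (ra s aUU) (nv s j)) (Urow (ra s aUU) (nv s j)).
Proof.
move=> h hj; rewrite /eUU; evs; rewrite (c_ND h); apply: eq_bigr => a _; evs; rewrite nvU /= (c_ND h).
apply: eq_bigr => b _; have hc : Cst (updv (updv s 30 a) 31 b) by do 2 apply: Cst_updv => //.
have j0 : (j == 30)%N = false by lia.
have j1 : (j == 31)%N = false by lia.
evs; rewrite (@ev_U _ _ _ (nv s j) a hc) ?(@ev_U _ _ _ (nv s j) b hc) ?(@ev_A _ _ _ a b hc) //.
all: by evs; rewrite !nvU ?j0 ?j1.
Qed.

Lemma ev_Un j s : Cst s -> (40 <= j)%N || (j == 26)%N ->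
  (ev (eUn (NV j)) s : R) = \sum_(a < ND) Urow (ra s aUU) (nv s j) a * Urow (ra s aUU) (nv s j) a.
Proof.
move=> h hj; rewrite /eUn; evs; rewrite (c_ND h); apply: eq_bigr => a _.
have hc : Cst (updv s 30 a) by apply: Cst_updv.
have j0 : (j == 30)%N = false by lia.
by evs; rewrite (@ev_U _ _ _ (nv s j) a hc) //; evs; rewrite !nvU ?j0.
Qed.

Lemma run_cGS s : Cst s -> let s' := run cGS s in
  frame [:: 43; 44] [:: aUU] s s' /\
  forall k b, (k < ND)%N -> (b < ND)%N -> Urow (ra s' aUU) k b = gsrec (ra s aLT) (ra s' aUU) k b.
Proof.
move=> h s'; pose I i (t : hst) := frame [:: 43; 44] [:: aUU] s t /\
  forall k b, (k < i)%N -> (b < ND)%N -> Urow (ra t aUU) k b = gsrec (ra s aLT) (ra t aUU) k b.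
suff : I (ev (NV 5) s) s' by rewrite /I ev_NV (c_ND h).
apply: for_rule => [|i t hi [fr ht]]; first by split.
rewrite ev_NV (c_ND h) in hi.
set t1 := updv t 43 i.
have fr1 : frame [:: 43; 44] [:: aUU] s t1.
  apply: (frame_trans fr); split=> // w; rewrite !inE negb_or => /andP[hw _]; by rewrite nvU (negbTE hw).
have h1 : Cst t1 by exact: (Cst_frame _ _ _ fr1 h).
set e := _ -r _.
have := @for_arr R 44 (NV 5) (NV 43 *n NV 5 +n NV 44) aUU e t1
  (fun b => i * ND + b)%N (fun b => gsrec (ra s aLT) (ra t aUU) i b).
rewrite ev_NV (c_ND h1).
case=> [b t2 hb fr2 hv o1 o2|b c bc hc E|fr3 g1 g2].
- have h2 : Cst t2 by exact: (Cst_frame _ _ _ fr2 h1).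
  have v43 : nv t2 43 = i by case: fr2 => -> //; rewrite nvU.
  have rLT : ra t2 aLT =1 ra s aLT.
    by move=> x; case: fr2 => _ ->//; case: fr1 => _ ->.
  have rU j c : (j < i)%N -> (c < ND)%N -> Urow (ra t2 aUU) j c = Urow (ra t aUU) j c.
    move=> ji hc; rewrite /Urow o2 // => b' _ E; have : (j.+1 * ND <= i * ND)%N by rewrite leq_mul2r ji orbT.
    by rewrite mulSn; lia.
  split; first by evs; rewrite v43 hv (c_ND h2).
  rewrite -(gsrec_ext _ hb rU) /e; evs; rewrite v43 hv (c_ND h2) /gsrec; congr (_ - _).
  apply: eq_bigr => j _; have h3 : Cst (updv t2 45 j) by apply: Cst_updv.
  evs; rewrite !nvU /= v43; case: ifP => // ji.
  rewrite (@ev_UU 45 _ h3) // (@ev_U _ _ _ j b h3) ?ev_NV ?nvU //= ?nvU /=.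
  congr (_ / _ * _); last by apply: eq_bigr => a _; apply: eq_bigr => a' _; rewrite /Aen rLT.
  rewrite /eAU; evs; rewrite (c_ND h3); apply: eq_bigr => c _.
  have h4 : Cst (updv (updv t2 45 j) 31 c) by apply: Cst_updv.
  evs; rewrite (@ev_A _ _ _ i c h4) ?(@ev_U _ _ _ j c h4) //.
  by rewrite /Aen /= rLT.
- lia.
- have fr4 : frame [:: 43; 44] [:: aUU] t1 (run (HFor 44 (NV 5) (HR aUU (NV 43 *n NV 5 +n NV 44) e)) t1).
    by apply: frame_sub fr3 => // x; rewrite !inE => ->; rewrite orbT.
  split; first exact: frame_trans fr4.
  set t3 := run _ t1 in fr3 g1 g2 fr4 *.
  have same j c : (j < i)%N -> (c < ND)%N -> Urow (ra t3 aUU) j c = Urow (ra t aUU) j c.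
    move=> ji hc; rewrite /Urow g2 // => b' _ E; have : (j.+1 * ND <= i * ND)%N by rewrite leq_mul2r ji orbT.
    by rewrite mulSn; lia.
  move=> k b; rewrite ltnS leq_eqVlt => /orP[/eqP ->|ki] hb.
    rewrite {1}/Urow g1 //; apply: gsrec_ext => // j c ji hc; by rewrite same.
  rewrite same // ht //; apply: gsrec_ext => // j c jk hc; rewrite same //; exact: ltn_trans ki.
Qed.

Lemma qA_Aen L c : qA ND (Aen L) c c =
  \sum_(a < ND) \sum_(b < ND) c a * c b * L (a * ND + b)%N + eps * \sum_(a < ND) c a * c a.
Proof.
rewrite /qA mulr_sumr -big_split; apply: eq_bigr => a _ /=.
transitivity (\sum_(b < ND) (c a * c b * L (a * ND + b)%N + c a * c b * (if a == b then eps else 0))).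
  by apply: eq_bigr => b _; rewrite /Aen mulrDr.
rewrite big_split /=; congr (_ + _); rewrite (bigD1 a) //= eqxx big1 ?addr0 1?mulrC // => b ba.
by case: eqP => [E|]; [case/eqP: ba; by apply/val_inj; rewrite /= E|rewrite mulr0].
Qed.

Lemma sim_swap a b : (a < ND)%N -> (b < ND)%N -> sim n D (a * ND + b) (b * ND + a).
Proof. by move=> ha hb; rewrite /sim !ds_cat //; rewrite perm_catC. Qed.

Lemma symm_Aen L : symm n D L -> forall a b, (a < ND)%N -> (b < ND)%N -> Aen L a b = Aen L b a.
Proof.
move=> hL a b ha hb; rewrite /Aen [b == a]eq_sym; congr (_ + _).
by apply: hL; [exact: pair_lt|exact: pair_lt|exact: sim_swap].
Qed.

(** Each of the first three cases carries the violated constraint and the correction of one progress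
    lemma; the last one, flagged [true], carries everything needed for [L] to be valid and
    useful. *)
Variant update (L Mt G : nat -> R) (B : R) : bool -> Prop :=
| UpTrace of 2 < tr n D L & (forall I, (I < M)%N -> G I = - eps * diagT R n D I) : update L Mt G B false
| UpMoment of ip n D L Mt < B & (forall I, (I < M)%N -> G I = B / ip n D Mt Mt * Mt I) : update L Mt G B false
| UpPsd (u : nat -> R) of 0 < \sum_(a < ND) u a * u a &
    \sum_(a < ND) \sum_(b < ND) u a * u b * L (a * ND + b)%N + eps * \sum_(a < ND) u a * u a <= 0 &
    (forall I, (I < M)%N -> G I = eps / (\sum_(a < ND) u a * u a) * outer n D u I) : update L Mt G B false
| UpDone of tr n D L <= 2 & psd n D L & B <= ip n D L Mt & (forall I, (I < M)%N -> G I = 0) : update L Mt G B true.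

Lemma ev_DivMod j s : Cst s -> (40 <= j)%N -> (nv s j < M)%N ->
  ev (eDiv (NV j)) s = (nv s j %/ ND)%N /\ ev (eMod (NV j)) s = (nv s j %% ND)%N.
Proof.
move=> h hj hlt; have j0 : (j == 30)%N = false by lia.
by split; [apply: (ev_Div n0 h)|apply: (ev_Mod n0 h)] => // q; evs; rewrite nvU j0.
Qed.

Lemma run_cG s : Cst s -> nv s 22 = 0%N -> symm n D (ra s aLT) -> let s' := run cG s in
  frame [:: 40; 43; 44; 26; 22] [:: aGT; aUU] s s' /\
  update (ra s aLT) (ra s aMT) (ra s' aGT) (Bc * sg * mass N (ra s aW) ^+ 2) (nv s' 22 != 0%N).
Proof.
move=> h v22 hs s'.
have fr : frame [:: 40; 43; 44; 26; 22] [:: aGT; aUU] s s'.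
  by apply: frame_sub (run_frame cG s) => x; rewrite /= !inE => *; lia.
split=> //; move: fr; rewrite {}/s' /cG run_HIf.
evs; rewrite (ev_Tr h); case: ltP => [ht|ht] /=.
  move=> [_ _].
  have [] := @for_id 40 (NV 6) aGT (Ite (eqN (eDiv (NV 40)) (eMod (NV 40))) (RC 0 -r eEps) (RC 0)) s
    (fun I => - eps * diagT R n D I); last first.
    rewrite ev_NV (c_M h) => f1 f2; have -> : nv (run cGtr s) 22 = 0%N by case: f1 => -> //.
    exact: UpTrace.
  move=> i s' hi f hv; rewrite ev_NV (c_M h) in hi; have h' : Cst s' by exact: (Cst_frame _ _ _ f h).
  evs; rewrite -[40%N]/40%N; have [|-> ->] := ev_DivMod (j := 40) h' isT; first by rewrite hv.
  by rewrite hv (ev_Eps h') /diagT; case: ifP => _; rewrite ?mulr0 ?mulr1 // sub0r.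
rewrite run_HIf; evs; rewrite (ev_Ip _ _ h) (ev_BSm2 h).
set B := Bc * sg * _ ^+ 2; case: ltP => [hm|hm] /=.
  move=> [_ _].
  have [] := @for_id 40 (NV 6) aGT (eBSm2 /r eIp aMT aMT *r RG aMT (NV 40)) s
    (fun I => B / ip n D (ra s aMT) (ra s aMT) * ra s aMT I); last first.
    rewrite ev_NV (c_M h) => f1 f2; have -> : nv (run cGmt s) 22 = 0%N by case: f1 => -> //.
    exact: UpMoment.
  move=> i s' hi f hv; have h' : Cst s' by exact: (Cst_frame _ _ _ f h).
  evs; rewrite (ev_Ip _ _ h') (ev_BSm2 h') hv.
  have e1 : ra s' aMT =1 ra s aMT by case: f => _; apply.
  have e2 : ra s' aW =1 ra s aW by case: f => _; apply.
  rewrite e1 /B; congr (_ * _ ^+ 2 / _ * _); first by apply: eq_bigr => x _.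
  by apply: eq_bigr => x _; rewrite !e1.
move=> _; rewrite run_HSeq; have [f1 gs] := run_cGS h; set s1 := run cGS s in f1 gs *.
have h1 : Cst s1 by exact: (Cst_frame _ _ _ f1 h).
have eL : ra s1 aLT =1 ra s aLT by case: f1 => _; apply.
have eN : ND = nv s1 5 by rewrite (c_ND h1).
rewrite /cGpsd run_HSeq run_HN; set k := ev _ s1; set s2 := updv s1 26 k.
have [k1 k2 k3] : [/\ (k <= ND)%N,
   (k < ND)%N -> qA ND (Aen (ra s aLT)) (Urow (ra s1 aUU) k) (Urow (ra s1 aUU) k) <= 0 &
   forall j, (j < k)%N -> 0 < qA ND (Aen (ra s aLT)) (Urow (ra s1 aUU) j) (Urow (ra s1 aUU) j)].
  have E i : (ev (leR (eUU (NV 46)) (RC 0)) (updv s1 46 i) != 0%N) =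
      (qA ND (Aen (ra s aLT)) (Urow (ra s1 aUU) i) (Urow (ra s1 aUU) i) <= 0).
    have hi : Cst (updv s1 46 i) by apply: Cst_updv.
    evs; rewrite (@ev_UU 46 _ hi) // nvU /=; congr (_ <= _).
    by apply: eq_bigr => a _; apply: eq_bigr => b _; rewrite /Aen eL.
  move: (findP (fun i => ev (leR (eUU (NV 46)) (RC 0)) (updv s1 46 i) != 0%N) ND).
  rewrite -[find _ _]/(ev (NFind 46 (NC ND) (leR (eUU (NV 46)) (RC 0))) s1).
  have -> : ev (NFind 46 (NC ND) (leR (eUU (NV 46)) (RC 0))) s1 = k by rewrite /k; evs; rewrite (c_ND h1).
  move=> [k1 k2 k3]; split=> // [/k2|j /k3]; rewrite E // => /negbT; by rewrite -ltNge.
have h2 : Cst s2 by apply: Cst_updv.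
have Unorm j : (j < ND)%N -> 0 < \sum_(a < ND) Urow (ra s1 aUU) j a * Urow (ra s1 aUU) j a.
  move=> hj; apply: (@U_norm R ND (Aen (ra s aLT)) (Urow (ra s1 aUU))) => // a b; exact: gs.
rewrite run_HIf; evs; rewrite nvU eqxx (c_ND h2); case: ltnP => hk /=.
  have [] := @for_id 40 (NV 6) aGT (eEps /r eUn (NV 26) *r (eU (NV 26) (eDiv (NV 40)) *r eU (NV 26) (eMod (NV 40)))) s2
    (fun I => eps / (\sum_(a < ND) Urow (ra s1 aUU) k a * Urow (ra s1 aUU) k a) * outer n D (Urow (ra s1 aUU) k) I).
    move=> i s3 hi f hv; rewrite ev_NV (c_M h2) in hi; have h3 : Cst s3 by exact: (Cst_frame _ _ _ f h2).
    have v26 : nv s3 26 = k by case: f => ->.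
    have e1 : ra s3 aUU =1 ra s1 aUU by case: f => _; apply.
    have [|d1 d2] := ev_DivMod (j := 40) h3 isT; first by rewrite hv.
    evs; rewrite (ev_Eps h3) (@ev_Un 26 _ h3) // v26.
    rewrite (@ev_U _ _ _ k (i %/ ND)%N h3) ?(@ev_U _ _ _ k (i %% ND)%N h3) ?d1 ?d2 ?hv //.
    rewrite /outer /Urow !e1; congr (_ / _ * _); apply: eq_bigr => a _; by rewrite !e1.
  rewrite ev_NV (c_M h2) => f2 f3; set s3 := run _ s2 in f2 f3 *.
  have -> : nv s3 22 = 0%N by case: f2 => -> // _; rewrite /s2 nvU /=; case: f1 => ->.
  apply: (@UpPsd _ _ _ _ (Urow (ra s1 aUU) k)) => //; first exact: Unorm.
  by rewrite -qA_Aen; exact: k2.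
rewrite run_HSeq run_HN ev_NC; set s3 := updv s2 22 1.
have h3 : Cst s3 by apply: Cst_updv.
have [] := @for_id 40 (NV 6) aGT (RC 0) s3 (fun I => 0); first by move=> *; rewrite ev_RC.
rewrite ev_NV (c_M h3) => f2 f3; set s4 := run _ s3 in f2 f3 *.
have -> : nv s4 22 = 1%N by case: f2 => -> //=.
apply: UpDone => // c; rewrite -qA_Aen; apply: (@gs_psd R ND (Aen (ra s aLT)) (Urow (ra s1 aUU))).
- exact: symm_Aen.
- by move=> a b; exact: gs.
- by move=> j hj; apply: k3; apply: leq_trans hk.
Qed.

Lemma run_cUpd s : Cst s -> let s' := run cUpd s in frame [:: 40] [:: aLT] s s' /\
  forall I, (I < M)%N -> ra s' aLT I = ra s aLT I + Sym n D (ra s aGT) I.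
Proof.
move=> h; have [] := @for_arr R 40 (NV 6) (NV 40) aLT (RG aLT (NV 40) +r eSym (NV 40)) s id
  (fun I => ra s aLT I + Sym n D (ra s aGT) I).
- move=> i s' hi fr hv _ hx; rewrite ev_NV (c_M h) in hi; have h' : Cst s' by exact: (Cst_frame _ _ _ fr h).
  split; first by rewrite ev_NV.
  evs; rewrite hv hx => [|j ji E]; last by rewrite E ltnn in ji.
  rewrite (@ev_Sym _ _ _ _ _ _ _ _ _ n0 (NV 40) s' i h') //.
  congr (_ + _); rewrite /Sym; congr (_ / _); by apply: eq_bigr => J _; case: fr => _ ->.
- by move=> i j ij _ E; rewrite E ltnn in ij.
- by rewrite ev_NV (c_M h).
Qed.

End oracle.

Lemma frame_subb (R : realType) vs vs' As As' (s1 s2 : hst R) :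
  all (fun v => v \in vs') vs -> all (fun a => a \in As') As -> frame vs As s1 s2 -> frame vs' As' s1 s2.
Proof. by move=> h1 h2; apply: frame_sub; exact/allP. Qed.

(** * Outcome of the relaxation method *)

Section relaxation_loop.
Variable R : realType.
Notation hst := (hst R).
Implicit Types (s : hst) (L G w v : nat -> R).
Variables (n D N lam K p : nat) (al : R) (X : nat -> nat -> R).
Hypothesis n0 : (0 < n)%N.
Hypothesis al0 : 0 < al.
Hypothesis D0 : (0 < D)%N.
Notation K2 := (D + D)%N.
Notation ND := (n ^ D)%N.
Notation M := (n ^ (D + D))%N.
Notation sg := (@sigma R D).
Notation Cst := (@Cst R n D N lam K p al X).
Notation dif := (dif X).
Notation Bc := (@Bc R D lam K al).
Notation eps := (@eps R n D).
Notation ip := (@ip R n D).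
Notation MT := (@MT R n D N X).
Notation mass := (@mass R N).

Lemma sg_gt0 : 0 < sg. Proof using D0. by rewrite exprn_gt0 // ltr0n muln_gt0 D0. Qed.
Lemma Lc_gt0 : 0 < Lc R lam. Proof using. by rewrite ltr0n addn_gt0 orbT. Qed.
Lemma Hc_gt0 : 0 < Hc lam al. Proof using al0. by rewrite divr_gt0 // mulr_gt0 // Lc_gt0. Qed.
Lemma Bc_gt0 : 0 < Bc.
Proof using al0.
have T0 : 0 < 16 ^+ D :> R by rewrite exprn_gt0.
apply: mulr_gt0 Hc_gt0; apply: mulr_gt0; last by rewrite exprn_gt0.
by apply: mulr_gt0 => //; rewrite exprn_gt0 // mulr_gt0.
Qed.

Lemma ip_ext L L' A A' : (forall I, (I < M)%N -> L I = L' I) -> (forall I, (I < M)%N -> A I = A' I) ->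
  ip L A = ip L' A'.
Proof. by move=> h h'; apply: eq_bigr => I _; rewrite h // h'. Qed.

Lemma symm_ext L L' : (forall I, (I < M)%N -> L I = L' I) -> symm n D L -> symm n D L'.
Proof. by move=> h hs I J hI hJ hIJ; rewrite -!h //; exact: hs. Qed.

Lemma tr_ext L L' : (forall I, (I < M)%N -> L I = L' I) -> tr n D L = tr n D L'.
Proof. by move=> h; apply: eq_bigr => a _; rewrite h // pair_lt. Qed.

Lemma psd_ext L L' : (forall I, (I < M)%N -> L I = L' I) -> psd n D L -> psd n D L'.
Proof.
move=> h hp c; apply: le_trans (hp c) _; rewrite le_eqVlt; apply/orP; left; apply/eqP; congr (_ + _).
by apply: eq_bigr => a _; apply: eq_bigr => b _; rewrite h // pair_lt.
Qed.

Lemma Sym_ext G G' I : (forall J, (J < M)%N -> G J = G' J) -> Sym n D G I = Sym n D G' I.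
Proof. by move=> h; rewrite /Sym; congr (_ / _); apply: eq_bigr => J _; rewrite h. Qed.

Lemma dot_sq v w : dot n v w ^+ 2 <= sq n v * sq n w.
Proof.
apply: discriminant => t; have := sq_ge0 n (fun c => v c + t * w c).
rewrite (_ : sq n _ = sq n v + 2 * t * dot n v w + t * t * sq n w) // /sq /dot !mulr_sumr -!big_split.
by apply: eq_bigr => c _ /=; ring.
Qed.

Lemma ip_MT L w : ip L (MT w) = \sum_(x < N) \sum_(z < N) w x * w z * ip L (pw n K2 (dif x z)).
Proof.
rewrite /Submission.ip /Submission.MT; under eq_bigr do rewrite mulr_sumr.
rewrite exchange_big; apply: eq_bigr => x _ /=; under eq_bigr do rewrite mulr_sumr.
rewrite exchange_big; apply: eq_bigr => z _ /=; rewrite mulr_sumr; apply: eq_bigr => I _; ring.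
Qed.

(** The squared norm is a fourfold sum of powers of scalar products. By Cauchy-Schwarz it is at most
    the square of the sum of the terms [w x * w z * |x - z|^(2 D)], which the hypothesis bounds by
    [B * n ^ D / 2]. *)
Lemma MT_norm w B : isw N w ->
  \sum_(x < N) \sum_(z < N) w x * w z * (2 * eps * sq n (dif x z) ^+ D) <= B ->
  ip (MT w) (MT w) <= (B * ND%:R / 2) ^+ 2.
Proof.
move=> hw; have w0 (x : 'I_N) : 0 <= w x by case/andP: (hw x (ltn_ord x)).
have np : 0 < ND%:R :> R by rewrite ltr0n expn_gt0 n0.
set S := \sum_(x < N) \sum_(z < N) w x * w z * sq n (dif x z) ^+ D.
have S0 : 0 <= S by apply: sumr_ge0 => x _; apply: sumr_ge0 => z _; rewrite !mulr_ge0 ?exprn_ge0 ?sq_ge0.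
have -> : \sum_(x < N) \sum_(z < N) w x * w z * (2 * eps * sq n (dif x z) ^+ D) = 2 * eps * S.
  rewrite /S mulr_sumr; apply: eq_bigr => x _; rewrite mulr_sumr; apply: eq_bigr => z _; ring.
move=> hB; apply: (@le_trans _ _ (S ^+ 2)); last first.
  apply: lerXn2r; rewrite ?nnegrE //.
    apply: mulr_ge0; last by rewrite invr_ge0.
    apply: mulr_ge0; last exact: ltW.
    by apply: le_trans hB; rewrite !mulr_ge0 // invr_ge0 ltW.
  have : 2 * eps * S * ND%:R <= B * ND%:R by rewrite ler_pM2r.
  have -> : 2 * eps * S * ND%:R = 2 * S * (eps * ND%:R) by ring.
  by rewrite /Submission.eps mulVf ?gt_eqF // mulr1; lra.
have hd v v' : dot n v v' ^+ K2 <= sq n v ^+ D * sq n v' ^+ D.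
  rewrite exprD -!exprMn -expr2; apply: lerXn2r; rewrite ?nnegrE ?sqr_ge0 ?mulr_ge0 ?sq_ge0 //.
  exact: dot_sq.
rewrite ip_MT expr2 {1}/S mulr_suml; apply: ler_sum => x _; rewrite mulr_suml; apply: ler_sum => z _.
rewrite -[X in _ <= X]mulrA ler_wpM2l ?mulr_ge0 // ipC ip_MT mulr_sumr; apply: ler_sum => x' _.
rewrite mulr_sumr; apply: ler_sum => z' _; rewrite mulrCA ler_wpM2l ?mulr_ge0 //.
by rewrite (ip_pw_pw _ n0).
Qed.

Definition oracle_spec w (L : nat -> R) (found : bool) :=
  if found then valid n D L /\ Bc * mass w ^+ 2 <= \sum_(x < N) \sum_(z < N) w x * w z * QL n D X L x z
  else certified n D N X (2 * Bc * sg) w.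

(** As long as the flag is down, round [i] has reduced the squared distance to [pw v] to
    [1 - i * eps ^ 2] for each unit [v] of moment at least [2 B]. The loop runs once more than
    [1 / eps ^ 2], which rules out such [v]. The factor 2 between the certified moment and the
    threshold [B] tested on [L] is the margin used by [progress_moment]. *)
Lemma run_oracle s : Cst s -> isw N (ra s aW) -> 0 < mass (ra s aW) ->
  let s' := run cRelax (run cEuclid (run cMT (run cL0 s))) in
  frame [:: 22; 23; 26; 29; 40; 43; 44] [:: aLT; aMT; aGT; aUU] s s' /\
  oracle_spec (ra s aW) (ra s' aLT) (nv s' 22 != 0%N).
Proof.
move=> h hw m0; set w := ra s aW; set B := Bc * sg * mass w ^+ 2.
have B0 : 0 < B by apply: mulr_gt0; [apply: mulr_gt0 Bc_gt0 sg_gt0|rewrite exprn_gt0].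
have e0 : 0 < eps by rewrite invr_gt0 ltr0n expn_gt0 n0.
have w0 (x : 'I_N) : 0 <= w x by case/andP: (hw x (ltn_ord x)).
have [f1 L0] := run_cL0 h; set s1 := run cL0 s in f1 L0 *.
have h1 : Cst s1 by exact: (Cst_frame _ _ _ f1 h).
have [f2 Mt] := run_cMT n0 h1; set s2 := run cMT s1 in f2 Mt *.
have h2 : Cst s2 by exact: (Cst_frame _ _ _ f2 h1).
have [b e3 hb] := run_cEuclid h2; rewrite e3; set s3 := updv s2 22 b.
have h3 : Cst s3 by apply: Cst_updv.
have fr3 : frame [:: 22; 23; 26; 29; 40; 43; 44] [:: aLT; aMT; aGT; aUU] s s3.
  apply: (@frame_trans _ _ _ _ s1); first exact: frame_subb f1.
  apply: (@frame_trans _ _ _ _ s2); first exact: frame_subb f2.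
  by split=> // v; rewrite !inE nvU; case: eqP.
have W2 : ra s2 aW =1 w by move=> x; case: f2 => _ ->//; case: f1 => _ ->.
have mE : mass (ra s2 aW) = mass w by apply: eq_bigr => x _; rewrite W2.
set EU := \sum_(x < N) \sum_(z < N) w x * w z * (2 * eps * sq n (dif x z) ^+ D).
have {}hb : (b != 0%N) = (B < EU).
  rewrite hb mE; congr (_ < _); apply: eq_bigr => x _; apply: eq_bigr => z _; by rewrite !W2.
have L3 I : (I < M)%N -> ra s3 aLT I = 0.
  by move=> hI; rewrite /s3 /=; case: f2 => _ -> //; exact: L0.
have M3 I : (I < M)%N -> ra s3 aMT I = MT w I.
  move=> hI; rewrite /s3 /= Mt //; apply: eq_bigr => x _; apply: eq_bigr => z _.
  by case: f1 => _ f1; rewrite !f1.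
pose Inv i t := [/\ frame [:: 22; 23; 26; 29; 40; 43; 44] [:: aLT; aMT; aGT; aUU] s t,
  symm n D (ra t aLT), (forall I, (I < M)%N -> ra t aMT I = MT w I) &
  if nv t 22 != 0%N then valid n D (ra t aLT) /\ Bc * mass w ^+ 2 <= \sum_(x < N) \sum_(z < N) w x * w z * QL n D X (ra t aLT) x z
  else EU <= B /\ forall v, sq n v = 1 -> 2 * B <= ip (pw n K2 v) (MT w) ->
   ip (fun I => ra t aLT I - pw n K2 v I) (fun I => ra t aLT I - pw n K2 v I) <= 1 - i%:R * eps ^+ 2].
have QLE L x z : QL n D X L x z * sg = ip L (pw n K2 (dif x z)) + 2 * eps * sq n (dif x z) ^+ D.
  by rewrite /QL /qf divfK // gt_eqF // sg_gt0.
have sumQ L : (\sum_(x < N) \sum_(z < N) w x * w z * QL n D X L x z) * sg = ip L (MT w) + EU.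
  rewrite ip_MT -big_split mulr_suml; apply: eq_bigr => x _ /=; rewrite mulr_suml -big_split.
  by apply: eq_bigr => z _ /=; rewrite -mulrA QLE mulrDr.
have EU0 : 0 <= EU.
  by apply: sumr_ge0 => x _; apply: sumr_ge0 => z _; rewrite !mulr_ge0 ?exprn_ge0 ?sq_ge0 // ltW.
have BQ L : B <= ip L (MT w) + EU -> Bc * mass w ^+ 2 <= \sum_(x < N) \sum_(z < N) w x * w z * QL n D X L x z.
  by move=> hB; rewrite -(ler_pM2r sg_gt0) sumQ; apply: le_trans hB; rewrite /B mulrAC.
suff : Inv M.+1 (run cRelax s3).
  case=> fr _ _ hI; split=> //; rewrite /oracle_spec; case: ifP hI => // _ [_ hI] v hv.
  rewrite leNgt; apply/negP => hlt; have := hI v hv.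
  have -> : ip (pw n K2 v) (MT w) = \sum_(x < N) \sum_(z < N) w x * w z * dot n v (fun c => X x c - X z c) ^+ K2.
    rewrite ip_MT; apply: eq_bigr => x _; apply: eq_bigr => z _; by rewrite (ip_pw_pw _ n0).
  have -> : 2 * B = 2 * Bc * sg * mass w ^+ 2 by rewrite /B; ring.
  move=> /(_ (ltW hlt)); apply/negP; rewrite -ltNge.
  apply: lt_le_trans (ip_ge0 _ _ _); rewrite subr_lt0 -natr1 mulrDl mul1r.
  have -> : M%:R * eps ^+ 2 = 1.
    rewrite /Submission.eps expnD natrM expr2 mulrACA divff ?mulr1 ?divff // pnatr_eq0 -lt0n expn_gt0 n0 //.
  by rewrite ltrDl exprn_gt0.
have -> : M.+1 = ev (NV 7) s3 by rewrite ev_NV (c_it h3).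
rewrite /cRelax; apply: for_rule => [|i t hi [ft hs hM hI]].
  split=> //.
  - by move=> I J hI hJ _; rewrite !L3.
  - rewrite nvU /= hb; case: ifP => hBE.
    split; last first.
      by apply: BQ; rewrite /Submission.ip big1 ?add0r ?ltW // => I _; rewrite L3 // mul0r.
    split; first by move=> I J hI hJ _; rewrite !L3.
      by rewrite /tr big1 // => a _; rewrite L3 // pair_lt.
    move=> c; rewrite big1 ?add0r => [|a _]; last by rewrite big1 // => a' _; rewrite L3 ?mulr0 // pair_lt.
    by apply: mulr_ge0; [exact: ltW|apply: sumr_ge0 => a _; rewrite -expr2 sqr_ge0].
  split; first by rewrite leNgt hBE.
  move=> v hv _; rewrite mul0r subr0 (@ip_ext _ (fun I => - pw n K2 v I) _ (fun I => - pw n K2 v I)) => [|I hI|I hI].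
  + have -> : ip (fun I => - pw n K2 v I) (fun I => - pw n K2 v I) = ip (pw n K2 v) (pw n K2 v).
      by apply: eq_bigr => I _; rewrite mulrNN.
    by rewrite (ip_pw_pw _ n0) -[dot n v v]/(sq n v) hv expr1n.
  + by rewrite L3 // sub0r.
  + by rewrite L3 // sub0r.
set t1 := updv t 23 i.
have ft1 : frame [:: 22; 23; 26; 29; 40; 43; 44] [:: aLT; aMT; aGT; aUU] s t1.
  by apply: (frame_trans ft); split=> // u hu; rewrite nvU; case: eqP hu => // ->.
have ht1 : Cst t1 by exact: (Cst_frame _ _ _ ft1 h).
rewrite run_HIf ev_NV nvU /=; case: ifP hI => hdn hI.
  split=> //.
  - by apply: (frame_trans ft1); split=> // u hu; rewrite /= /upd; case: eqP hu => // ->.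
  - by rewrite /= /upd /= hdn.
rewrite run_HSeq.
have v22 : nv t1 22 = 0%N by apply/eqP/negbFE.
have [f4 up] := run_cG n0 ht1 v22 hs; set t2 := run cG t1 in f4 up *.
have ht2 : Cst t2 by exact: (Cst_frame _ _ _ f4 ht1).
have [f5 LE] := run_cUpd n0 ht2; set t3 := run cUpd t2 in f5 LE *.
have ft3 : frame [:: 22; 23; 26; 29; 40; 43; 44] [:: aLT; aMT; aGT; aUU] s t3.
  apply: (frame_trans ft1); apply: (@frame_trans _ _ _ _ t2).
    exact: frame_subb f4.
  exact: frame_subb f5.
have LE' I : (I < M)%N -> ra t3 aLT I = ra t aLT I + Sym n D (ra t2 aGT) I.
  by move=> hI'; rewrite LE //; case: f4 => _ ->.
have n22 : nv t3 22 = nv t2 22 by case: f5 => ->.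
have WE : ra t1 aW =1 w by case: ft1 => _; apply.
have mE' : mass (ra t1 aW) = mass w by apply: eq_bigr => x _; rewrite WE.
have [hEU hD] := hI.
split=> //.
- by apply: symm_ext (symmD hs (@symm_Sym R n D (ra t2 aGT))) => I hI'; rewrite LE'.
- by move=> I hI'; case: f5 => _ -> //; case: f4 => _ -> //; exact: hM.
have prog G v : (forall I, (I < M)%N -> ra t2 aGT I = G I) ->
   ip (fun I => ra t aLT I + Sym n D G I - pw n K2 v I) (fun I => ra t aLT I + Sym n D G I - pw n K2 v I) <=
   ip (fun I => ra t aLT I - pw n K2 v I) (fun I => ra t aLT I - pw n K2 v I) - eps ^+ 2 ->
   ip (fun I => ra t aLT I - pw n K2 v I) (fun I => ra t aLT I - pw n K2 v I) <= 1 - i%:R * eps ^+ 2 ->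
   ip (fun I => ra t3 aLT I - pw n K2 v I) (fun I => ra t3 aLT I - pw n K2 v I) <= 1 - i.+1%:R * eps ^+ 2.
  move=> hG p1 p2.
  rewrite (@ip_ext _ (fun I => ra t aLT I + Sym n D G I - pw n K2 v I) _ (fun I => ra t aLT I + Sym n D G I - pw n K2 v I)) => [|I hI'|I hI'].
  - by apply: (le_trans p1); rewrite -natr1; lra.
  - by rewrite LE' // (Sym_ext _ hG).
  - by rewrite LE' // (Sym_ext _ hG).
have MtE A : ip A (ra t1 aMT) = ip A (MT w) by apply: ip_ext => // I hI'; rewrite hM.
have MtE2 : ip (ra t1 aMT) (ra t1 aMT) = ip (MT w) (MT w) by apply: ip_ext => // I hI'; rewrite hM.
rewrite n22; move: up; rewrite mE' -/B.
case=> [ht hG|hm hG|u hu hn hG|ht hp hm hG] /=.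
- split=> // v hv hv2; apply: (prog _ v hG) => //; last exact: hD.
  exact: progress_trace.
- rewrite MtE in hm.
  split=> // v hv hv2; apply: (prog (fun I => B / ip (MT w) (MT w) * MT w I) v) => //; last exact: hD.
    by move=> I hI'; rewrite hG // MtE2 hM.
  apply: progress_moment => //; exact: MT_norm.
- split=> // v hv hv2; apply: (prog _ v hG) => //; last exact: hD.
  exact: progress_psd.
have LL I : (I < M)%N -> ra t aLT I = ra t3 aLT I.
  move=> hI'; rewrite LE' // (Sym_ext (G' := fun=> 0)) // /Sym [X in X / _]big1 ?mul0r ?addr0 // => J _.
  by case: ifP.
split.
  split; first exact: symm_ext hs.
  - by rewrite -(tr_ext LL).
  - exact: psd_ext LL _.
apply: BQ; rewrite -(ip_ext LL (fun I _ => erefl (MT w I))).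
by rewrite MtE in hm; rewrite (le_trans hm) // lerDl.
Qed.

End relaxation_loop.

(** * Execution of a node and of a leaf *)

Section nodes_leaves.
Variable R : realType.
Notation hst := (hst R).
Implicit Types (s : hst) (L w g : nat -> R).
Variables (n D N lam K p : nat) (al : R) (X : nat -> nat -> R).
Hypothesis n0 : (0 < n)%N.
Notation Cst := (@Cst R n D N lam K p al X).
Notation Th := (16 ^+ D : R).
Notation H := (Hc lam al).
Notation Bc := (@Bc R D lam K al).
Notation sg := (@sigma R D).
Notation mass := (@mass R N).
Notation mean := (@mean R N X).
Notation sq := (@sq R n).
Notation thr := (@thr R N al).
Notation tau := (@tau R Th H).

Lemma frame_ra vs As s s' a : frame vs As s s' -> a \notin As -> ra s' a = ra s a.
Proof. by move=> [_ h] ha; apply/funext => x; exact: h. Qed.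

Lemma frame_updv vs As s v x : v \in vs -> frame vs As s (updv s v x).
Proof. by move=> hv; split=> // u hu; rewrite nvU; case: eqP hu => // ->; rewrite hv. Qed.

Definition Stk s (l : seq (nat -> R)) := nv s 20 = size l /\
  forall i x, (i < size l)%N -> (x < N)%N -> ra s aSTK (i * N + x)%N = nth (fun=> 0) l i x.
Definition Outs s (ws : seq (nat -> R)) := nv s 21 = size ws /\
  forall i c, (i < size ws)%N -> (c < n)%N -> ra s aOUT (i * n + c)%N = mean (nth (fun=> 0) ws i) c.

Lemma Stk_frame vs As s s' l : 20%N \notin vs -> aSTK \notin As -> frame vs As s s' -> Stk s l -> Stk s' l.
Proof. by move=> h1 h2 [f1 f2] [e1 e2]; split=> [|i x hi hx]; rewrite ?f1 ?f2 // e2. Qed.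

Lemma Outs_frame vs As s s' l : 21%N \notin vs -> aOUT \notin As -> frame vs As s s' -> Outs s l -> Outs s' l.
Proof. by move=> h1 h2 [f1 f2] [e1 e2]; split=> [|i x hi hx]; rewrite ?f1 ?f2 // e2. Qed.

Lemma Cst_mod vs As s s' : frame vs As s s' -> all (leq 14) vs -> aINP \notin As -> aDIG \notin As -> Cst s -> Cst s'.
Proof. by move=> f h1 h2 h3 h; exact: (Cst_frame h1 h2 h3 f h). Qed.

Lemma run_cPush (e : ex true) s g l : Stk s l -> Cst s ->
  (forall i s', (i < N)%N -> frame [:: 40] [:: aSTK] s s' -> nv s' 40 = i -> (ev e s' : R) = g i) ->
  let s' := run (cPush e) s in frame [:: 20; 40] [:: aSTK] s s' /\ Stk s' (rcons l g).
Proof.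
move=> [e1 e2] h he.
have [] := @for_arr R 40 (NV 2) (NV 20 *n NV 2 +n NV 40) aSTK e s (fun x => size l * N + x)%N g.
- move=> i s' hi fr hv _ _; rewrite ev_NV (c_N h) in hi; split; last exact: he.
  by have h' := Cst_mod fr isT isT isT h; evs; rewrite hv (c_N h'); case: fr => ->//; rewrite e1.
- by move=> i j; lia.
rewrite ev_NV (c_N h) => f1 g1 g2; rewrite /cPush run_HSeq run_HN; set s1 := run _ s in f1 g1 g2 *.
split.
  apply: (@frame_trans _ _ _ _ s1); first exact: frame_subb f1.
  exact: frame_updv.
split; first by evs; rewrite nvU /= size_rcons; case: f1 => -> //; rewrite e1 addn1.
move=> i x; rewrite size_rcons ltnS nth_rcons leq_eqVlt => /orP[/eqP ->|hi] hx /=.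
  by rewrite ltnn eqxx g1.
rewrite hi g2 ?e2 // => j hj E.
have : (i.+1 * N <= size l * N)%N by rewrite leq_mul2r hi orbT.
by rewrite mulSn; lia.
Qed.

Lemma ev_TauP v s : Cst s -> (40 <= v)%N -> (nv s v < K)%N ->
  (ev (eTau (NV v +n NC 1)) s : R) = tau (nv s v).+1 /\ (ev (eTau (NV v)) s : R) = tau (nv s v).
Proof.
move=> h hv hj; have v1 : (v == 31)%N = false by lia.
split; apply: (ev_Tau h); rewrite ?(ltnW hj) // => i.
  by evs; rewrite nvU v1 addn1.
by evs; rewrite nvU v1.
Qed.

Lemma ev_ballP y v s : Cst s -> (40 <= v)%N -> (40 <= y)%N -> (nv s v < K)%N -> (nv s y < N)%N ->
  (ev (eBall (NV y) (eTau (NV v +n NC 1))) s : R) = ball N (QL n D X (ra s aLT)) (ra s aW) (nv s y) (tau (nv s v).+1) /\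
  (ev (eBall (NV y) (eTau (NV v))) s : R) = ball N (QL n D X (ra s aLT)) (ra s aW) (nv s y) (tau (nv s v)).
Proof.
move=> h hv hy hj hlt; have fy : fv y by rewrite /fv !inE; lia.
have v1 : (v == 37)%N = false by lia.
have y1 : y != 37%N by lia.
split; apply: (ev_Ball n0 h) => // i; have hi : Cst (updv s 37 i) by apply: Cst_updv.
  by have [|-> _] := ev_TauP hi hv; rewrite nvU v1.
by have [|_ ->] := ev_TauP hi hv; rewrite nvU v1.
Qed.

Lemma ev_stopA v s : Cst s -> (40 <= v)%N -> (nv s v < K)%N -> (nv s 50 < N)%N ->
  (ev (eStopA (NV v)) s != 0%N) = stopA N (QL n D X (ra s aLT)) al Th H (ra s aW) (nv s 50) (nv s v).
Proof.
move=> h hv hj hy; rewrite /eStopA; evs; have [-> _] := ev_ballP h hv (y := 50) isT hj hy.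
by rewrite (ev_Al h) (ev_Mass h).
Qed.

Lemma ev_pp (b : ex true) s (x : R) : Cst s -> (forall i, (ev b (updv s 30 i) : R) = x) -> (ev (ePp b) s : R) = x ^+ p.
Proof. by move=> h hb; rewrite /ePp; evs; rewrite (c_p h) -prod_const; apply: eq_bigr => i _. Qed.

Lemma ev_stopB v s : Cst s -> (40 <= v)%N -> (nv s v < K)%N -> (nv s 50 < N)%N ->
  (ev (eStopB (NV v)) s != 0%N) = stopB N (QL n D X (ra s aLT)) Th H p (ra s aW) (nv s 50) (nv s v).
Proof.
move=> h hv hj hy; rewrite /eStopB; evs; have v1 : (v == 30)%N = false by lia.
have hU i : Cst (updv s 30 i) by apply: Cst_updv.
have B i : (ev (eBall (NV 50) (eTau (NV v +n NC 1))) (updv s 30 i) : R) = ball N (QL n D X (ra s aLT)) (ra s aW) (nv s 50) (tau (nv s v).+1) /\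
  (ev (eBall (NV 50) (eTau (NV v))) (updv s 30 i) : R) = ball N (QL n D X (ra s aLT)) (ra s aW) (nv s 50) (tau (nv s v)).
  by have := @ev_ballP 50 v _ (hU i) hv isT; rewrite !nvU v1 /=; apply.
rewrite (ev_pp h (fun i => (B i).1)) (@ev_pp eMass _ (mass (ra s aW)) h) => [|i]; last by rewrite (ev_Mass (hU i)).
rewrite (ev_pp (x := mass (ra s aW) - ball N (QL n D X (ra s aLT)) (ra s aW) (nv s 50) (tau (nv s v))) h) // => i.
by evs; rewrite (ev_Mass (hU i)) (B i).2.
Qed.

Variant node_out (L w : nat -> R) : seq (nat -> R) -> Prop :=
| NoCentre of (forall y, (y < N)%N -> ball N (QL n D X L) w y (tau 0) < thr) : node_out L w [::]
| Filter y j i of (y < N)%N & (j < K)%N & stopA N (QL n D X L) al Th H w y j &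
   argmax N (fsc (QL n D X L) Th H w y j) i : node_out L w [:: chF (QL n D X L) Th H w y j i]
| Split y j of (y < N)%N & (j < K)%N & thr <= ball N (QL n D X L) w y (tau 0) &
   ~~ stopA N (QL n D X L) al Th H w y j & stopB N (QL n D X L) Th H p w y j :
   node_out L w [:: chA (QL n D X L) Th H w y j; chB (QL n D X L) Th H w y j].

Lemma argmax_ex (f : nat -> R) m : (0 < m)%N -> exists2 i, (i < m)%N & forall z, (z < m)%N -> f z <= f i.
Proof.
case: m => // m _; elim: m => [|m [i hi IH]].
  by exists 0%N => // z; rewrite ltnS leqn0 => /eqP ->.
case: (leP (f m.+1) (f i)) => h.
  exists i; first exact: ltnW.
  by move=> z; rewrite ltnS leq_eqVlt => /orP[/eqP ->|/IH].
exists m.+1 => // z; rewrite ltnS leq_eqVlt => /orP[/eqP -> //|/IH hz].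
by apply: le_trans (ltW h).
Qed.

Lemma run_cNode s l : Cst s -> Stk s l -> (0 < N)%N ->
  (forall y, thr <= ball N (QL n D X (ra s aLT)) (ra s aW) y (tau 0) ->
    exists2 j, (j < K)%N & stopA N (QL n D X (ra s aLT)) al Th H (ra s aW) y j ||
      stopB N (QL n D X (ra s aLT)) Th H p (ra s aW) y j) ->
  let s' := run cNode s in frame [:: 20; 29; 40; 50; 51; 52] [:: aSTK; aGV] s s' /\
  exists2 ch, node_out (ra s aLT) (ra s aW) ch & Stk s' (l ++ ch).
Proof.
move=> h hl N0 hgrow s'.
set L := ra s aLT; set w := ra s aW; set Q := QL n D X L.
have fr : frame [:: 20; 29; 40; 50; 51; 52] [:: aSTK; aGV] s s'.
  exact: frame_subb (run_frame cNode s).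
split=> //; rewrite {fr}/s' /cNode run_HSeq run_HN; set y := ev _ s; set s1 := updv s 50 y.
have E49 i : (i < N)%N -> (ev (leR eThr (eBall (NV 49) (eTau (NC 0)))) (updv s 49 i) != 0%N) = (thr <= ball N Q w i (tau 0)).
  move=> hi; have hU : Cst (updv s 49 i) by apply: Cst_updv.
  evs; rewrite (ev_Thr hU) (@ev_Ball _ _ _ _ _ _ _ _ _ n0 49 (eTau (NC 0)) _ (tau 0) hU) ?nvU //.
  by move=> k; apply: (ev_Tau (Cst_updv _ _ hU)) => // q; evs.
have [y1 y2 y3] : [/\ (y <= N)%N, (y < N)%N -> thr <= ball N Q w y (tau 0) &
   forall i, (i < y)%N -> ball N Q w i (tau 0) < thr].
  have := findP (fun i => ev (leR eThr (eBall (NV 49) (eTau (NC 0)))) (updv s 49 i) != 0%N) N.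
  have -> : find (fun i => ev (leR eThr (eBall (NV 49) (eTau (NC 0)))) (updv s 49 i) != 0%N) (iota 0 N) = y.
    by rewrite /y ev_Find ev_NV (c_N h).
  case=> a1 a2 a3; split=> // [hy|i hi]; first by rewrite -E49 ?a2.
  by have := a3 i hi; rewrite E49 ?(leq_trans hi) // => /negbT; rewrite -ltNge.
have h1 : Cst s1 by apply: Cst_updv.
rewrite run_HIf; evs; rewrite nvU eqxx (c_N h1); case: ltnP => hy; last first.
  exists [::]; first by apply: NoCentre => i hi; apply: y3; exact: leq_trans hy.
  rewrite cats0 run_HN; apply: (@Stk_frame [:: 29; 50] [::] s) => //.
  by apply: (@frame_trans _ _ _ _ s1); exact: frame_updv.
rewrite run_HSeq run_HN; set j := ev _ s1; set s2 := updv s1 51 j.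
have E48 i : (i < K)%N -> (ev (orN (eStopA (NV 48)) (eStopB (NV 48))) (updv s1 48 i) != 0%N) =
    stopA N Q al Th H w y i || stopB N Q Th H p w y i.
  move=> hi; have hU : Cst (updv s1 48 i) by apply: Cst_updv.
  by evs; rewrite ev_stopA ?ev_stopB // ?nvU.
have [j0 jab] : (j < K)%N /\ (stopA N Q al Th H w y j || stopB N Q Th H p w y j).
  have := findP (fun i => ev (orN (eStopA (NV 48)) (eStopB (NV 48))) (updv s1 48 i) != 0%N) K.
  have -> : find (fun i => ev (orN (eStopA (NV 48)) (eStopB (NV 48))) (updv s1 48 i) != 0%N) (iota 0 K) = j.
    by rewrite /j ev_Find ev_NV (c_K h1).
  case=> a1 a2 a3; have jK : (j < K)%N.
    rewrite ltn_neqAle a1 andbT; apply/eqP => E; have [i hi hab] := hgrow y (y2 hy).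
    by have := a3 i; rewrite E hi E48 // hab => /(_ isT).
  by split=> //; rewrite -E48 // a2.
have h2 : Cst s2 by apply: Cst_updv.
have hl2 : Stk s2 l by [].
rewrite run_HIf ev_stopA ?nvU //=; case: ifP => hA.
  rewrite /cFilter 2!run_HSeq run_HN.
  have [] := @for_id R 40 (NV 2) aGV (Ite (andN (LtR (RC 0) (RG aW (NV 40))) (LtR (eTh *r eTh *r eTau (NV 51 +n NC 1)) (eQ (NV 40) (NV 50))))
      (eQ (NV 40) (NV 50)) (RC 0)) s2 (fsc Q Th H w y j).
    move=> i s3 hi f3 hv; rewrite ev_NV (c_N h2) in hi; have h3 := Cst_mod f3 isT isT isT h2.
    have v50 : nv s3 50 = y by case: f3 => -> //.
    have v51 : nv s3 51 = j by case: f3 => -> //.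
    evs; rewrite (ev_Th h3) (@ev_Q _ _ _ _ _ _ _ _ _ n0 40 50 _ h3) ?hv ?v50 //.
    have [|-> _] := @ev_TauP 51 _ h3 isT; first by rewrite v51.
    by rewrite v51 /fsc (frame_ra f3) // (frame_ra f3).
  rewrite ev_NV (c_N h2) => f3 g3; set s3 := run _ s2 in f3 g3 *.
  have h3 := Cst_mod f3 isT isT isT h2.
  set i := ev _ s3; set s4 := updv s3 52 i; have h4 : Cst s4 by apply: Cst_updv.
  have hi : argmax N (fsc Q Th H w y j) i.
    have [m hm hmax] := argmax_ex (fsc Q Th H w y j) N0.
    have E a : (a < N)%N -> (ev (eqN (NFind 42 (NV 2) (LtR (RG aGV (NV 41)) (RG aGV (NV 42)))) (NV 2)) (updv s3 41 a) != 0%N) =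
      [forall z : 'I_N, fsc Q Th H w y j z <= fsc Q Th H w y j a].
      move=> ha; rewrite ev_eqN ev_Find ev_NV nvU /= (c_N h3).
      set P := (fun _ => _ : bool); have PE z : (z < N)%N -> P z = (fsc Q Th H w y j a < fsc Q Th H w y j z).
        by move=> hz; rewrite /P; evs; rewrite !nvU /= !g3.
      have [b1 b2 b3] := findP P N; apply/eqP/forallP => [e z|hz].
        by have := b3 z; rewrite e ltn_ord PE // => /(_ isT) /negbT; rewrite -leNgt.
      apply/eqP; rewrite eqn_leq b1 leqNgt; apply/negP => hlt; have := b2 hlt; rewrite PE //.
      by rewrite ltNge (hz (Ordinal hlt)).
    have := findP (fun a => ev (eqN (NFind 42 (NV 2) (LtR (RG aGV (NV 41)) (RG aGV (NV 42)))) (NV 2)) (updv s3 41 a) != 0%N) N.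
    have -> : find (fun a => ev (eqN (NFind 42 (NV 2) (LtR (RG aGV (NV 41)) (RG aGV (NV 42)))) (NV 2)) (updv s3 41 a) != 0%N) (iota 0 N) = i.
      by rewrite /i ev_Find ev_NV (c_N h3).
    case=> b1 b2 b3; have iN : (i < N)%N.
      rewrite ltn_neqAle b1 andbT; apply/eqP => e; have := b3 m; rewrite e hm E // => /(_ isT) /negbT /negP; apply.
      by apply/forallP => z; exact: hmax.
    split=> // z hz; have := b2 iN; rewrite E // => /forallP /(_ (Ordinal hz)) //.
  have hl3 : Stk s3 l by exact: Stk_frame f3 hl2.
  have hl4 : Stk s4 l by apply: (@Stk_frame [:: 52] [::] s3) hl3 => //; exact: frame_updv.
  have eG : ra s4 aGV = ra s3 aGV by [].
  have P1 x t : (x < N)%N -> frame [:: 40] [:: aSTK] s4 t -> nv t 40 = x ->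
    (ev (RG aW (NV 40) *r (RC 1 -r RG aGV (NV 40) /r RG aGV (NV 52))) t : R) = chF Q Th H w y j i x.
    move=> hx f5 hv; have v52 : nv t 52 = i by case: f5 => -> //.
    have [iN _] := hi; have eW : ra s4 aW = w by exact: (frame_ra (s' := s3) f3).
    by evs; rewrite hv v52 !(frame_ra f5) // eG eW !g3.
  have [_ hs] := run_cPush hl4 h4 P1.
  exists [:: chF Q Th H w y j i]; first exact: (Filter hy j0 hA hi).
  by rewrite cats1.
have jB : stopB N Q Th H p w y j by move: jab; rewrite hA.
rewrite /cSplit run_HSeq.
have EV (t : hst) x : Cst t -> (x < N)%N -> ra t aLT = L -> ra t aW = w -> nv t 50 = y -> nv t 51 = j -> nv t 40 = x ->
  (ev (Ite (leR (eQ (NV 40) (NV 50)) (eTau (NV 51 +n NC 1))) (RG aW (NV 40)) (RC 0)) t : R) = chA Q Th H w y j x /\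
  (ev (Ite (LtR (eTau (NV 51)) (eQ (NV 40) (NV 50))) (RG aW (NV 40)) (RC 0)) t : R) = chB Q Th H w y j x.
  move=> ht hx eL eW v50 v51 v40; evs; rewrite (@ev_Q _ _ _ _ _ _ _ _ _ n0 40 50 _ ht) ?v40 ?v50 //.
  by have [|-> ->] := @ev_TauP 51 _ ht isT; rewrite v51 // eL eW.
have P1 x t : (x < N)%N -> frame [:: 40] [:: aSTK] s2 t -> nv t 40 = x ->
  (ev (Ite (leR (eQ (NV 40) (NV 50)) (eTau (NV 51 +n NC 1))) (RG aW (NV 40)) (RC 0)) t : R) = chA Q Th H w y j x.
  move=> hx ft hv; have ht := Cst_mod ft isT isT isT h2.
  apply: (EV t x ht hx _ _ _ _ hv).1; rewrite ?(frame_ra ft) //; by case: ft => ->.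
have [f3 l3] := run_cPush hl2 h2 P1; set s3 := run _ s2 in f3 l3 *.
have h3 := Cst_mod f3 isT isT isT h2.
have P2 x t : (x < N)%N -> frame [:: 40] [:: aSTK] s3 t -> nv t 40 = x ->
  (ev (Ite (LtR (eTau (NV 51)) (eQ (NV 40) (NV 50))) (RG aW (NV 40)) (RC 0)) t : R) = chB Q Th H w y j x.
  move=> hx ft hv; have ht := Cst_mod ft isT isT isT h3.
  apply: (EV t x ht hx _ _ _ _ hv).2; rewrite ?(frame_ra ft) ?(frame_ra f3) //; by case: ft => -> //; case: f3 => ->.
have [f4 l4] := run_cPush l3 h3 P2.
exists [:: chA Q Th H w y j; chB Q Th H w y j]; first by apply: Split; rewrite ?hA ?y2.
by rewrite -cat_rcons cats1.
Qed.

(** The separation required by [far_overlap] with the certified bound [2 * Bc * sg]: means that are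
    farther apart belong to clusters of small overlap, whose number [leaf_count] bounds. *)
Definition rho : R := 4 ^+ D * (2 * Bc * sg) * (32 / al).

Lemma ev_Rho s : Cst s -> (ev eRho s : R) = rho.
Proof.
move=> h; rewrite /eRho; evs; rewrite (ev_B h) (ev_Sig h) (ev_Al h) (c_D h) /rho -[4 ^+ D]prod_const.
by congr (_ * _ * _).
Qed.

Definition near (w w' : nat -> R) := sq (fun c => mean w c - mean w' c) ^+ D <= rho.

Lemma run_cLeaf s ws : Cst s -> Outs s ws -> (size ws <= N)%N ->
  let s' := run cLeaf s in frame [:: 21; 29; 40] [:: aOUT; aMEAN] s s' /\
  ((exists2 i, (i < size ws)%N & near (ra s aW) (nth (fun=> 0) ws i)) /\ Outs s' ws \/
   (forall i, (i < size ws)%N -> ~~ near (ra s aW) (nth (fun=> 0) ws i)) /\ Outs s' (rcons ws (ra s aW))).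
Proof.
move=> h ho hsz s'.
have fr : frame [:: 21; 29; 40] [:: aOUT; aMEAN] s s' by exact: frame_subb (run_frame cLeaf s).
split=> //; rewrite {fr}/s' /cLeaf run_HSeq; set w := ra s aW.
have [] := @for_id R 40 (NV 0) aMEAN (SumR 41 (NV 2) (RG aW (NV 41) *r ePt (NV 41) (NV 40)) /r eMass) s (mean w).
  move=> c t hc ft hv; have ht := Cst_mod ft isT isT isT h; rewrite ev_NV (c_n h) in hc.
  evs; rewrite (ev_Mass ht) (c_N ht) (frame_ra ft) //; congr (_ / _); apply: eq_bigr => x _.
  by rewrite /ePt; evs; rewrite !nvU /= hv (c_n ht) (c_X ht) // (frame_ra ft).
rewrite ev_NV (c_n h) => f1 g1; set s1 := run _ s in f1 g1 *.
have h1 := Cst_mod f1 isT isT isT h.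
have ho1 : Outs s1 ws by apply: Outs_frame f1 ho.
have [q1 q2] := ho1.
set P := (fun i => (i < size ws)%N && (sq (fun c => mean w c - mean (nth (fun=> 0) ws i) c) ^+ D <= rho)).
have E : (ev (eqN (NFind 47 (NV 2) (andN (LtN (NV 47) (NV 21))
      (leR (eSqD (fun c => RG aMEAN c -r RG aOUT (NV 47 *n NV 0 +n c))) eRho))) (NV 2)) s1 != 0%N) =
   (find P (iota 0 N) == N).
  rewrite ev_eqN ev_Find ev_NV (c_N h1); congr (_ == _); apply: eq_find => i.
  have hi : Cst (updv s1 47 i) by apply: Cst_updv.
  evs; rewrite !nvU /= q1 (ev_Rho hi) /P; case: ltnP => //= hlt; congr (_ <= _).
  apply: (ev_SqD hi) => k c hc; evs; rewrite !nvU /= (c_n h1) g1 // -q2 //.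
rewrite run_HIf E; have [b1 b2 b3] := findP P N; case: eqP => e.
  right; split.
    move=> i hi; have := b3 i; rewrite e (leq_trans hi hsz) /P hi /= => /(_ isT) /negbT //.
  rewrite run_HSeq run_HN.
  have [] := @for_arr R 40 (NV 0) (NV 21 *n NV 0 +n NV 40) aOUT (RG aMEAN (NV 40)) s1 (fun c => size ws * n + c)%N (mean w).
  - move=> c t hc ft hv _ _; rewrite ev_NV (c_n h1) in hc; have ht := Cst_mod ft isT isT isT h1.
    evs; rewrite hv (c_n ht) (frame_ra ft) // g1 //; split=> //; by case: ft => -> //; rewrite q1.
  - by move=> i j; lia.
  rewrite ev_NV (c_n h1) => f2 g2 g3; set s2 := run _ s1 in f2 g2 g3 *.
  split; first by evs; rewrite nvU /= size_rcons; case: f2 => -> //; rewrite q1 addn1.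
  move=> i c; rewrite size_rcons ltnS nth_rcons leq_eqVlt => /orP[/eqP ->|hi] hc.
    by rewrite ltnn eqxx /= g2.
  rewrite hi /= g3 ?q2 // => j hj Ej.
  have : (i.+1 * n <= size ws * n)%N by rewrite leq_mul2r hi orbT.
  by rewrite mulSn; lia.
left; split; last first.
  by apply: (@Outs_frame [:: 29] [::] s1) => //; exact: (run_frame cSkip s1).
have hlt : (find P (iota 0 N) < N)%N by rewrite ltn_neqAle b1 andbT; apply/eqP.
by have /andP[a1 a2] := b2 hlt; exists (find P (iota 0 N)).
Qed.

End nodes_leaves.

Section seq_predicates.
Variable T : Type.
Implicit Types (P : T -> Prop) (l : seq T).
Fixpoint allp P l := if l is a :: l' then P a /\ allp P l' else True.
Fixpoint exp P l := if l is a :: l' then P a \/ exp P l' else False.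
Lemma allp_cat P l1 l2 : allp P (l1 ++ l2) <-> allp P l1 /\ allp P l2.
Proof. by elim: l1 => [|a l IH] /=; tauto. Qed.
Lemma exp_cat P l1 l2 : exp P (l1 ++ l2) <-> exp P l1 \/ exp P l2.
Proof. by elim: l1 => [|a l IH] /=; tauto. Qed.
End seq_predicates.

(** * Invariant of the main loop *)

Section main_loop.
Variable R : realType.
Notation hst := (hst R).
Implicit Types (s : hst) (L w g : nat -> R).
Variables (n D N lam K p kap ST : nat) (al : R) (X : nat -> nat -> R).
Hypothesis n0 : (0 < n)%N.
Hypothesis D2 : (2 <= D)%N.
Hypothesis N0 : (0 < N)%N.
Hypothesis al0 : 0 < al.
Hypothesis al1 : al < 1.
Hypothesis p0 : (0 < p)%N.
Hypothesis lam_al : 1 <= 2 ^+ lam * al.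
Hypothesis kap_p : (lam + 5 <= p ^ kap)%N.
Hypothesis K_def : K = (2 * kap + 1)%N.
Hypothesis N_al : 16 / al <= N%:R.
Notation Cst := (@Cst R n D N lam K p al X).
Notation Th := (16 ^+ D : R).
Notation H := (Hc lam al).
Notation Lc := (Lc R lam).
Notation Bc := (@Bc R D lam K al).
Notation sg := (@sigma R D).
Notation mass := (@mass R N).
Notation mean := (@mean R N X).
Notation sq := (@sq R n).
Notation thr := (@thr R N al).
Notation isw := (@isw R N).
Notation pot := (@pot R N al p).
Notation T := (2 * Bc * sg).
Notation certified := (@certified R n D N X T).
Notation Stk := (@Stk R N).
Notation Outs := (@Outs R n N X).
Notation near := (@near R n D N lam K al X).
Notation rho := (@rho R D lam K al).

Variables (S0 : pred nat) (mu : nat -> R).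
Notation s0 := (@s0 R N S0).
Notation good := (@good R N Lc S0).

(* The property of the input, with good points [S0], under which the deterministic
   algorithm is correct. *)
Definition good_data := [/\ al * N%:R / 2 <= s0,
  forall L, valid n D L -> \sum_(x < N | S0 x) qf n D L (fun c => X x c - mu c) <= s0 * sg &
  forall v, sq v = 1 -> \sum_(x < N | S0 x) dot n v (fun c => X x c - mu c) ^+ (D + D) <= s0 * sg].

(** The mean of the good leaf may be discarded because a previously returned mean is within [rho];
    the error of the latter combines [rho] with the accuracy of the good leaf. *)
Definition err : R := 4 ^+ D * (rho + 4 ^+ D * (4 * T / al + 2 * sg)).
Definition ok_mean w := sq (fun c => mean w c - mu c) ^+ D <= err.

Lemma D0 : (0 < D)%N. Proof. exact: ltnW. Qed.
Lemma T_gt0 : 0 < T.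
Proof. by apply: mulr_gt0; [apply: mulr_gt0 => //; exact: Bc_gt0|exact: sg_gt0 D0]. Qed.

Lemma sg0 : 0 < sg. Proof. exact: sg_gt0 D0. Qed.

Lemma Th1 : 1 <= Th. Proof. by rewrite exprn_ege1 // ler1n. Qed.

Lemma pw_opp (v : nat -> R) I : pw n (D + D) (fun c => - v c) I = pw n (D + D) v I.
Proof.
rewrite /pw; under eq_bigr do rewrite -mulN1r.
by rewrite big_split /= prodr_const card_ord addnn -mul2n exprM sqrrN expr1n expr1n mul1r.
Qed.

Lemma qf_opp L (v : nat -> R) : qf n D L (fun c => - v c) = qf n D L v.
Proof.
rewrite /qf; congr (_ + _ * _ ^+ _); first by apply: eq_bigr => I _; rewrite pw_opp.
by apply: eq_bigr => c _; rewrite mulrNN.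
Qed.

Lemma qf_fun_ext L (v v' : nat -> R) : v =1 v' -> qf n D L v = qf n D L v'.
Proof. by move=> h; congr qf; exact/funext. Qed.

Section quasi_metric.
Variable L : nat -> R.
Hypothesis hL : valid n D L.
Notation Q := (QL n D X L).
Notation qm := (fun x => qf n D L (fun c => X x c - mu c) / sg).

Lemma QsymL x y : (x < N)%N -> (y < N)%N -> Q x y = Q y x.
Proof.
move=> _ _; rewrite /QL -qf_opp; congr (_ / _); apply: qf_fun_ext => c; by rewrite /dif opprB.
Qed.

Lemma Q0L x y : (x < N)%N -> (y < N)%N -> 0 <= Q x y.
Proof. by case: hL => h1 _ h3 _ _; rewrite divr_ge0 ?qf_ge0 // ltW // sg0. Qed.

Lemma qf_tri v v' v'' (t : R) : (forall c, v'' c = v c + v' c) -> qf n D L v / sg <= t -> qf n D L v' / sg <= t ->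
  qf n D L v'' / sg <= Th * t.
Proof.
case: hL => h1 _ h3 hv; rewrite !ler_pdivrMr ?sg0 // => a b; rewrite (qf_fun_ext _ hv) -mulrA.
exact: qf_triangle.
Qed.

Lemma QtriL x y z t : (x < N)%N -> (y < N)%N -> (z < N)%N -> Q x y <= t -> Q y z <= t -> Q x z <= Th * t.
Proof. by move=> _ _ _; apply: qf_tri => c; rewrite /dif; ring. Qed.

Lemma qm0L x : (x < N)%N -> 0 <= qm x.
Proof. by case: hL => h1 _ h3 _; rewrite divr_ge0 ?qf_ge0 // ltW // sg0. Qed.

Lemma qm_triL x y t : (x < N)%N -> (y < N)%N -> qm x <= t -> qm y <= t -> Q x y <= Th * t.
Proof.
move=> _ _ h1 h2; apply: (@qf_tri (fun c => X x c - mu c) (fun c => - (X y c - mu c))) => //.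
  by move=> c; rewrite /dif; ring.
by rewrite qf_opp.
Qed.

Lemma qm_tri2L x y t : (x < N)%N -> (y < N)%N -> Q y x <= t -> qm x <= t -> qm y <= Th * t.
Proof. by move=> _ _; apply: qf_tri => c; rewrite /dif; ring. Qed.

Lemma qm_sumL : good_data -> \sum_(x < N | S0 x) qm x <= s0.
Proof. by case=> _ h _; rewrite -mulr_suml ler_pdivrMr ?sg0 // h. Qed.

End quasi_metric.

Lemma weq_mass g w : (forall x, (x < N)%N -> w x = g x) -> mass w = mass g.
Proof. by move=> h; apply: eq_bigr => x _; rewrite h. Qed.
Lemma weq_pot g w : (forall x, (x < N)%N -> w x = g x) -> pot w = pot g.
Proof.
move=> h; rewrite /Submission.pot (weq_mass h); congr (_ + _ * _%:R); apply: eq_bigr => x _; by rewrite h.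
Qed.
Lemma weq_isw g w : (forall x, (x < N)%N -> w x = g x) -> isw g -> isw w.
Proof. by move=> h hg x hx; rewrite h // hg. Qed.
Lemma weq_good g w : (forall x, (x < N)%N -> w x = g x) -> good g -> good w.
Proof.
move=> h; rewrite /Submission.good (weq_mass h).
by have -> : u N S0 w = u N S0 g by apply: eq_bigr => x _; rewrite h.
Qed.

Lemma Stk_mod vs As s s' l : frame vs As s s' -> 20%N \notin vs -> aSTK \notin As -> Stk s l -> Stk s' l.
Proof. by move=> f h1 h2; exact: (Stk_frame h1 h2 f). Qed.
Lemma Outs_mod vs As s s' l : frame vs As s s' -> 21%N \notin vs -> aOUT \notin As -> Outs s l -> Outs s' l.
Proof. by move=> f h1 h2; exact: (Outs_frame h1 h2 f). Qed.

(** Elapsed rounds plus the potential of the stack never exceed [ST] while the stack is nonempty.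
    Accuracy is carried by [i_good]: either some waiting cluster is still good, or an accurate mean
    has already been returned. *)
Record Inv (t : nat) s (l ws : seq (nat -> R)) : Prop := {
  i_cst : Cst s;
  i_stk : Stk s l;
  i_out : Outs s ws;
  i_isw : allp isw l;
  i_time : l = [::] \/ \sum_(g <- l) pot g + t%:R <= ST%:R;
  i_ws : forall i, (i < size ws)%N -> let w := nth (fun=> 0) ws i in [/\ isw w, thr <= mass w & certified w];
  i_far : forall i j, (i < j)%N -> (j < size ws)%N -> ~~ near (nth (fun=> 0) ws j) (nth (fun=> 0) ws i);
  i_good : good_data -> exp good l \/ exists2 i, (i < size ws)%N & ok_mean (nth (fun=> 0) ws i) }.

Lemma thr_gt0 : 0 < thr. Proof. exact: thr0. Qed.

Lemma near_sym w w' : near w w' = near w' w.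
Proof.
rewrite /Submission.near; congr (_ ^+ _ <= _); apply: eq_bigr => c _; by rewrite -[LHS]mulrNN !opprB.
Qed.

Lemma ws_count t s l ws : Inv t s l ws -> (size ws)%:R <= 16 / al.
Proof.
move=> h; apply: (@leaf_count R N al N0 al0 _ (fun i => nth (fun=> 0) ws i)).
  by move=> i hi; have [] := i_ws h hi.
move=> i j ij hj; have [a1 a2 a3] := i_ws h hj; have [b1 b2 b3] := i_ws h (ltn_trans ij hj).
have t0 := thr_gt0.
apply: (far_overlap (T := T) al0 T_gt0 b1 a1 b3 a3 D0); rewrite ?(lt_le_trans t0) //.
by have := i_far h ij hj; rewrite near_sym /Submission.near -ltNge.
Qed.

Lemma sq_add_pow (a b : nat -> R) (U V : R) : 0 <= U -> 0 <= V -> sq a ^+ D <= U -> sq b ^+ D <= V ->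
  sq (fun c => a c + b c) ^+ D <= 4 ^+ D * (U + V).
Proof.
move=> U0 V0 hU hV; have a0 := sq_ge0 n a; have b0 := sq_ge0 n b.
set m := Num.max (sq a) (sq b).
have m0 : 0 <= m by rewrite le_max a0.
apply: (@le_trans _ _ ((4 * m) ^+ D)).
  apply: lerXn2r; rewrite ?nnegrE ?sq_ge0 ?mulr_ge0 //.
  have := sq_add n a b; have : sq a <= m by rewrite le_max lexx.
  have : sq b <= m by rewrite le_max lexx orbT.
  lra.
rewrite exprMn ler_pM2l ?exprn_gt0 // /m; case: (leP (sq a) (sq b)) => _; lra.
Qed.

Lemma rho_ge0 : 0 <= rho.
Proof. by rewrite mulr_ge0 ?divr_ge0 ?(ltW al0) // mulr_ge0 ?exprn_ge0 // ltW // T_gt0. Qed.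

Lemma certified_ok w : good_data -> isw w -> certified w -> good w ->
  sq (fun c => mean w c - mu c) ^+ D <= 4 ^+ D * (4 * T / al + 2 * sg).
Proof.
move=> [h1 h2 h3] hw hc [_ hg].
exact: (good_mean N0 al0 T_gt0 h1 sg0 h3 hw hc hg D0).
Qed.

Lemma e1_ge0 : 0 <= 4 ^+ D * (4 * T / al + 2 * sg).
Proof.
have t0 := T_gt0; have s0' := sg0; apply: mulr_ge0; first by rewrite exprn_ge0.
apply: addr_ge0; last by rewrite mulr_ge0 // ltW.
by rewrite divr_ge0 ?(ltW al0) // mulr_ge0 // ltW.
Qed.

Lemma run_cBody t i s l ws : Inv t s l ws ->
  exists l' ws', Inv t.+1 (run cBody (updv s 28 i)) l' ws'.
Proof.
case: (lastP l) => {l} [|l g] h.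
  have e20 : nv s 20 = 0%N by case: (i_stk h) => ->.
  have fr : frame [:: 28; 29] [::] s (run cBody (updv s 28 i)).
    rewrite /cBody run_HIf ev_NV nvU /= e20 /= run_HN.
    by apply: (@frame_trans _ _ _ _ (updv s 28 i)); exact: frame_updv.
  exists [::], ws; split.
  - exact: (Cst_mod fr isT isT isT (i_cst h)).
  - exact: (Stk_mod fr isT isT (i_stk h)).
  - exact: (Outs_mod fr isT isT (i_out h)).
  - by [].
  - by left.
  - exact: i_ws h.
  - exact: i_far h.
  - exact: i_good h.
have h0 := i_cst h; have [st1 st2] := i_stk h; rewrite size_rcons in st1.
have [hil hig] : allp isw l /\ isw g by have := i_isw h; rewrite -cats1 allp_cat /= => -[? []].
have ht : \sum_(g <- l) pot g + pot g + t%:R <= ST%:R.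
  case: (i_time h) => [/(f_equal size)|]; first by rewrite size_rcons.
  by rewrite -cats1 big_cat big_seq1 /=.
rewrite /cBody run_HIf ev_NV nvU /= st1 /= run_HSeq run_HN.
set s1 := updv (updv s 28 i) 20 _.
have fr1 : frame [:: 20; 28] [::] s s1 by apply: (@frame_trans _ _ _ _ (updv s 28 i)); exact: frame_updv.
have h1 : Cst s1 := Cst_mod fr1 isT isT isT h0.
have hl1 : Stk s1 l.
  split; first by rewrite /s1; evs; rewrite !nvU /= st1 subn1.
  by move=> k x hk hx; rewrite /= st2 ?size_rcons ?leqW // nth_rcons hk.
rewrite run_HSeq.
have [] := @for_id R 40 (NV 2) aW (RG aSTK (NV 20 *n NV 2 +n NV 40)) s1 g.
  move=> x s' hx fr hv; rewrite ev_NV (c_N h1) in hx; have h' := Cst_mod fr isT isT isT h1.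
  evs; rewrite hv (c_N h') (frame_ra fr) //; case: fr => -> // _; rewrite hl1.1.
  by rewrite [LHS]st2 ?size_rcons // nth_rcons ltnn eqxx.
rewrite ev_NV (c_N h1); set s2 := run _ s1 => fr2 hw.
have h2 := Cst_mod fr2 isT isT isT h1; have hl2 : Stk s2 l by exact: (Stk_mod fr2 isT isT hl1).
have ho1 : Outs s1 ws by exact: (Outs_mod fr1 isT isT (i_out h)).
have ho2 : Outs s2 ws by exact: (Outs_mod fr2 isT isT ho1).
set w := ra s2 aW; have hwi : isw w := weq_isw hw hig.
have pw1 : 1 <= pot w by apply: pot_ge1.
have hgood : good_data -> good w \/ exp good l \/ exists2 i, (i < size ws)%N & ok_mean (nth (fun=> 0) ws i).
  move=> hd; case: (i_good h hd) => [|hr]; last by right; right.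
  rewrite -cats1 exp_cat => -[hr|/= [hr|//]]; first by right; left.
  by left; exact: weq_good hr.
rewrite -(weq_pot hw) -/w in ht.
(* Common end of the branches that return no new mean: the popped cluster is replaced by children
   [ch] of potential smaller by 1. *)
have finish s' ch : Cst s' -> Stk s' (l ++ ch) -> Outs s' ws -> allp isw ch -> \sum_(g <- ch) pot g <= pot w - 1 ->
  (good_data -> good w -> exp good ch \/ exists2 i, (i < size ws)%N & ok_mean (nth (fun=> 0) ws i)) -> exists l' ws', Inv t.+1 s' l' ws'.
  move=> a1 a2 a3 a4 a5 a6; exists (l ++ ch), ws; split=> //.
  - by rewrite allp_cat.
  - by right; rewrite big_cat /= -natr1; lra.
  - exact: i_ws h.
  - exact: i_far h.
  - move=> hd; rewrite exp_cat; case: (hgood hd) => [/(a6 hd)|]; tauto.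
rewrite run_HIf; evs; rewrite (ev_Thr h2) (ev_Mass h2) -/w; case: leP => hm; last first.
  have fr3 : frame [:: 29] [::] s2 (run cSkip s2) by exact: run_frame cSkip s2.
  apply: (finish _ [::]) => //.
  - exact: Cst_mod fr3 isT isT isT h2.
  - by rewrite cats0; exact: (Stk_mod fr3 isT isT hl2).
  - by rewrite big_nil subr_ge0.
  - by move=> [hd _ _] /(good_mass N0 al0 hd hwi); rewrite leNgt hm.
have m0 : 0 < mass w := lt_le_trans thr_gt0 hm.
rewrite 4!run_HSeq; have [fr3 ho] := run_oracle n0 al0 D0 h2 hwi m0.
set s3 := run cRelax _ in fr3 ho *.
have h3 := Cst_mod fr3 isT isT isT h2; have hl3 : Stk s3 l by exact: (Stk_mod fr3 isT isT hl2).
have ho3 : Outs s3 ws by exact: (Outs_mod fr3 isT isT ho2).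
have e3 : ra s3 aW = w by exact: frame_ra fr3 _.
rewrite run_HIf ev_NV; move: ho; rewrite /oracle_spec; case: ifP => hf.
  move=> [hL hB].
  have HLc : Lc = (2 * lam + 6)%:R by [].
  have HHc : H = 16 * Lc / al by [].
  have HBc : Bc = 4 * (Th * Th) ^+ K * Th ^+ 4 * H by [].
  have gr y : thr <= ball N (QL n D X (ra s3 aLT)) w y (tau Th H 0) -> _ :=
    fun hy => @growth R N (QL n D X (ra s3 aLT)) al Th H K p lam kap N0 al0 al1 Th1 p0 lam_al kap_p K_def w y hwi hm hy.
  have [|fr4 [ch hch hs]] := run_cNode n0 h3 hl3 N0; first by rewrite e3; exact: gr.
  set s4 := run cNode s3 in fr4 hs *; rewrite e3 in hch.
  have h4 := Cst_mod fr4 isT isT isT h3.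
  have ho4 : Outs s4 ws by exact: (Outs_mod fr4 isT isT ho3).
  apply: (finish _ ch) => //.
  - case: hch => [//|y j k hy hj hA hk|y j hy hj hb hA hB'] /=.
    + split=> //; apply: (isw_F (Q0L hL) hwi hy hk).
      exact: (fsc_max_gt0 N0 al0 al1 Th1 p0 lam_al kap_p K_def HLc HHc HBc (QsymL (ra s3 aLT)) (Q0L hL) (QtriL hL) hwi hy hj hB m0 hk).
    + by split; [exact: isw_A|split=> //; exact: isw_B].
  - case: hch => [//|y j k hy hj hA hk|y j hy hj hb hA hB'].
    + by rewrite big_nil subr_ge0.
    + rewrite big_seq1.
      exact: (pot_filter N0 al0 al1 Th1 p0 lam_al kap_p K_def HLc HHc HBc (QsymL (ra s3 aLT)) (Q0L hL) (QtriL hL) hwi hm hy hj hB hk).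
    + rewrite big_cons big_seq1.
      exact: (pot_split N0 al0 al1 Th1 p0 lam_al kap_p K_def HLc HHc hwi hm hb hA hB').
  - move=> hd hg; left; have [hd1 _ _] := hd; have hqs := qm_sumL hL hd.
    case: hch => [hno|y j k hy hj hA hk|y j hy hj hb hA hB'] /=.
    + have [y hy] := good_dense N0 al0 al1 Th1 p0 lam_al kap_p K_def HLc HHc hd1 (qm0L hL) (qm_triL hL) hqs hwi hg.
      by rewrite leNgt hno.
    + left; exact: (good_filter N0 al0 al1 Th1 p0 lam_al kap_p K_def HLc HHc HBc (QsymL (ra s3 aLT)) (Q0L hL) (QtriL hL) hd1 (qm0L hL) (qm_triL hL) (qm_tri2L hL) hqs hwi hg hy hj hA hB hk).
    + have [] := good_split N0 al0 al1 Th1 p0 lam_al kap_p K_def HLc HHc (QsymL (ra s3 aLT)) hd1 (qm0L hL) (qm_triL hL) (qm_tri2L hL) hqs hwi hg hy hb hA; tauto.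
move=> hc.
have wsN : (size ws <= N)%N.
  by rewrite -(ler_nat R); apply: le_trans N_al; exact: ws_count h.
have [fr4 hleaf] := run_cLeaf n0 h3 ho3 wsN; set s4 := run cLeaf s3 in fr4 hleaf *; rewrite e3 in hleaf.
have h4 := Cst_mod fr4 isT isT isT h3; have hl4 : Stk s4 l by exact: (Stk_mod fr4 isT isT hl3).
case: hleaf => [[[k hk hnear] ho4]|[hfar ho4]].
  apply: (finish _ [::]) => //; rewrite ?cats0 // ?big_nil ?subr_ge0 //.
  move=> hd hg; right; exists k => //; rewrite /ok_mean /err.
  have hnear' := hnear; rewrite near_sym /Submission.near in hnear'.
  have := sq_add_pow rho_ge0 e1_ge0 hnear' (certified_ok hd hwi hc hg).
  by congr (_ ^+ _ <= _); apply: eq_bigr => c _; congr (_ * _); ring.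
exists l, (rcons ws w); split=> //.
- by right; move: ht pw1; rewrite -natr1; lra.
- move=> k; cbv zeta; rewrite size_rcons ltnS nth_rcons leq_eqVlt => /orP[/eqP ->|hk].
    by rewrite ltnn eqxx.
  by rewrite hk; exact: (i_ws h hk).
- move=> a b ab; rewrite size_rcons ltnS !nth_rcons leq_eqVlt => /orP[/eqP E|hb].
    by rewrite E in ab *; rewrite ltnn eqxx ab; exact: hfar.
  by rewrite hb (ltn_trans ab hb); exact: (i_far h ab hb).
move=> hd; case: (hgood hd) => [hg|[|[k hk hok]]]; [right|by left|right].
  exists (size ws); first by rewrite size_rcons.
  rewrite nth_rcons ltnn eqxx /ok_mean /err; apply: le_trans (certified_ok hd hwi hc hg) _.
  have e1 := e1_ge0; have r0 := rho_ge0; have f4 : 1 <= 4 ^+ D :> R by rewrite exprn_ege1 // ler1n.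
  by move: (4 ^+ D * (_ + _)) e1 => E1 e1; nra.
by exists k; [rewrite size_rcons leqW|rewrite nth_rcons hk].
Qed.

Record Cst0 s : Prop := {
  c0_n : nv s 0 = n; c0_N : nv s 2 = N; c0_D : nv s 3 = D; c0_K2 : nv s 4 = (D + D)%N;
  c0_ND : nv s 5 = (n ^ D)%N; c0_M : nv s 6 = (n ^ (D + D))%N; c0_it : nv s 7 = (n ^ (D + D)).+1; c0_p : nv s 8 = p;
  c0_K : nv s 9 = K; c0_ST : nv s 10 = ST; c0_lam : nv s 12 = lam;
  c0_al : ra s aINP 0 = al;
  c0_X : forall i c, (i < N)%N -> (c < n)%N -> ra s aINP (2 + (i * n + c)) = X i c }.

Definition cDig := HFor 40 (NV 6) (HSeq (HN 41 (NV 40)) (HFor 42 (NV 4) (HSeq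
    (HN 43 (NFind 44 (NV 6) (LtN (NV 41) (NV 44 *n NV 0 +n NV 0))))
    (HSeq (HR aDIG (NV 42 *n NV 6 +n NV 40) (RN (NV 41 -n NV 43 *n NV 0)))
      (HN 41 (NV 43)))))).

Lemma run_cDig s : Cst0 s -> let s' := run cDig s in
  frame [:: 40; 41; 42; 43] [:: aDIG] s s' /\
  forall k I, (k < D + D)%N -> (I < n ^ (D + D))%N -> ra s' aDIG (k * n ^ (D + D) + I)%N = (I %/ n ^ k %% n)%N%:R.
Proof.
move=> h s'; set M := (n ^ (D + D))%N.
have fr : frame [:: 40; 41; 42; 43] [:: aDIG] s s' by exact: frame_subb (run_frame cDig s).
split=> //; rewrite {fr}/s'.
pose P i t := frame [:: 40; 41; 42; 43] [:: aDIG] s t /\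
  forall k I, (k < D + D)%N -> (I < i)%N -> ra t aDIG (k * M + I)%N = (I %/ n ^ k %% n)%N%:R :> R.
suff : P M (run cDig s) by case.
have -> : M = ev (NV 6) s by rewrite ev_NV (c0_M h).
apply: for_rule => [|i t hi [ft ht]]; first by split.
rewrite ev_NV (c0_M h) -/M in hi.
rewrite run_HSeq run_HN ev_NV nvU /=; set t1 := updv (updv t 40 i) 41 i.
have ft1 : frame [:: 40; 41; 42; 43] [:: aDIG] s t1.
  by apply: (frame_trans ft); apply: (@frame_trans _ _ _ _ (updv t 40 i)); exact: frame_updv.
pose P2 k t := [/\ frame [:: 40; 41; 42; 43] [:: aDIG] s t, nv t 40 = i, nv t 41 = (i %/ n ^ k)%N &
  forall k' I, (k' < D + D)%N -> (I < i)%N || (I == i) && (k' < k)%N -> ra t aDIG (k' * M + I)%N = (I %/ n ^ k' %% n)%N%:R :> R].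
have : P2 (D + D)%N (run (HFor 42 (NV 4) (HSeq
    (HN 43 (NFind 44 (NV 6) (LtN (NV 41) (NV 44 *n NV 0 +n NV 0))))
    (HSeq (HR aDIG (NV 42 *n NV 6 +n NV 40) (RN (NV 41 -n NV 43 *n NV 0)))
      (HN 41 (NV 43))))) t1).
  have -> : (D + D)%N = ev (NV 4) t1 by rewrite ev_NV; case: ft1 => -> // _; rewrite (c0_K2 h).
  apply: for_rule => [|k t2 hk [f2 v40 v41 hd]].
    split=> //; first by rewrite expn0 divn1.
    move=> k I hk; rewrite ltn0 andbF orbF => hI; exact: ht.
  rewrite !run_HSeq (run_HN 43); set q := ev _ _.
  have v0 : nv t2 0 = n by case: f2 => -> // _; rewrite (c0_n h).
  have v6 : nv t2 6 = M by case: f2 => -> // _; rewrite (c0_M h).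
  have qE : q = (i %/ n ^ k.+1)%N.
    rewrite /q ev_Find ev_NV nvU /= v6; set x := (i %/ n ^ k)%N in v41.
    have -> : (i %/ n ^ k.+1 = x %/ n)%N by rewrite /x expnSr divnMA.
    set a := (fun _ => _ : bool); have aE z : a z = (x %/ n <= z)%N.
      by rewrite /a; evs; rewrite !nvU /= v0 v41 -mulSnr -ltn_divLR // ltnS.
    have [b1 b2 b3] := findP a M.
    have xM : (x %/ n < M)%N by apply: leq_ltn_trans hi; apply: leq_trans (leq_div _ _) (leq_div _ _).
    have kl : (find a (iota 0 M) < M)%N.
      rewrite ltn_neqAle b1 andbT; apply/eqP => E; have := b3 (x %/ n)%N; rewrite E xM aE leqnn.
      by move=> /(_ isT).
    apply/eqP; rewrite eqn_leq; apply/andP; split; last by have := b2 kl; rewrite aE.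
    by rewrite leqNgt; apply/negP => hlt; have := b3 _ hlt; rewrite aE leqnn.
  set t3 := updv (updv t2 42 k) 43 q.
  have ft3 : frame [:: 40; 41; 42; 43] [:: aDIG] s t3.
    by apply: (frame_trans f2); apply: (@frame_trans _ _ _ _ (updv t2 42 k)); exact: frame_updv.
  have -> : run (HR aDIG (NV 42 *n NV 6 +n NV 40) (RN (NV 41 -n NV 43 *n NV 0))) t3 =
     upda t3 aDIG (k * M + i)%N (i %/ n ^ k %% n)%N%:R.
    rewrite -[LHS]/(upda t3 aDIG (ev (NV 42 *n NV 6 +n NV 40) t3) (ev (RN (NV 41 -n NV 43 *n NV 0)) t3)).
    congr upda; evs; rewrite !nvU /= ?v6 ?v40 // v41 v0 qE expnSr divnMA.
    by congr _%:R; rewrite {1}(divn_eq (i %/ n ^ k) n) addKn.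
  set t4 := upda _ _ _ _.
  have f4 : frame [:: 40; 41; 42; 43] [:: aDIG] s t4.
    apply: (frame_trans ft3); split=> // a; rewrite inE => /negbTE ha x; by rewrite /= ha.
  rewrite run_HN; split.
  - by apply: (frame_trans f4); exact: frame_updv.
  - by [].
  - by rewrite nvU /= -qE.
  - move=> k' I hk' hI; rewrite /=; case: eqP => [E|ne].
      have MI : (I < M)%N by case/orP: hI => [/ltn_trans -> //|/andP[/eqP -> _]].
      have kk : k' = k by have := f_equal (divn^~ M) E; rewrite !divnMDl ?(leq_ltn_trans (leq0n i) hi) // !divn_small // !addn0.
      by move: E; rewrite kk => /addnI ->.
    apply: hd => //; case/orP: hI => [->//|/andP[/eqP eI]]; rewrite ltnS leq_eqVlt => /orP[/eqP ek|hlt].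
      by case: ne; rewrite eI ek.
    by rewrite eI eqxx hlt orbT.
move=> [f5 _ _ hd]; split=> // k I hk; rewrite ltnS leq_eqVlt => hI; apply: hd => //.
by case/orP: hI => ->; rewrite ?hk ?orbT.
Qed.

Hypothesis ST_ge : 3 * (8 / al) ^+ p * N%:R + 1 <= ST%:R.

Lemma run_cInit s : Cst0 s -> Inv 0 (run cInit s) [:: fun=> 1] [::] /\ nv (run cInit s) 10 = ST.
Proof.
move=> h; rewrite /cInit 3!run_HSeq -/cDig run_HN run_HN !ev_NC.
set s1 := updv (updv s 20 1) 21 0.
have fr1 : frame [:: 20; 21] [::] s s1 by apply: (@frame_trans _ _ _ _ (updv s 20 1)); exact: frame_updv.
have [] := @for_id R 40 (NV 2) aSTK (RC 1) s1 (fun=> 1); first by move=> *; rewrite ev_RC.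
set s2 := run _ s1 => f2 g2; rewrite ev_NV in g2.
have fr2 : frame [:: 20; 21; 40] [:: aSTK] s s2.
  by apply: (@frame_trans _ _ _ _ s1); [exact: frame_subb fr1|exact: frame_subb f2].
have h2 : Cst0 s2.
  by case: h => *; case: fr2 => fa fb; split; rewrite ?fa ?fb // => *; rewrite fb //; auto.
have [f3 g3] := run_cDig h2; set s3 := run cDig s2 in f3 g3 *.
have fr3 : frame [:: 20; 21; 40; 41; 42; 43] [:: aSTK; aDIG] s s3.
  by apply: (@frame_trans _ _ _ _ s2); [exact: frame_subb fr2|exact: frame_subb f3].
split; last by case: fr3 => -> // _; rewrite (c0_ST h).
have h1w : isw (fun=> 1) by move=> x _; rewrite ler01 lexx.
split=> //.
- by case: h => *; case: fr3 => fa fb; split; rewrite ?fa ?fb // => *; rewrite ?fb //; auto.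
- split; first by case: f3 => -> //; case: f2 => ->.
  move=> i x; rewrite ltnS leqn0 => /eqP -> hx; rewrite mul0n add0n /= (frame_ra f3) // g2 //.
  by rewrite /s1 /= !/upd /= (c0_N h).
- by split=> //; case: f3 => -> //; case: f2 => ->.
- right; rewrite big_seq1 addr0; apply: le_trans ST_ge; rewrite /Submission.pot addrC lerD2r.
  have sN : (supp N (fun=> 1 : R))%:R <= N%:R :> R.
    rewrite ler_nat -[X in (_ <= X)%N](card_ord N) -sum1_card; apply: leq_sum => x _; exact: leq_b1.
  have -> : mass (fun=> 1) / thr = 8 / al.
    rewrite /Submission.mass sumr_const card_ord /Submission.thr; field; rewrite gt_eqF //= pnatr_eq0 -lt0n N0 //.
  by rewrite ler_wpM2l // mulr_ge0 // exprn_ge0 // divr_ge0 // ltW.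
move=> [hd _ _]; left; left.
have sp : 0 < s0 by apply: lt_le_trans hd; rewrite divr_gt0 // mulr_gt0 // ltr0n.
have uE : u N S0 (fun=> 1 : R) = s0 by [].
rewrite /Submission.good uE /Submission.mass sumr_const card_ord divff ?ln1 ?mulr0 ?subr0 ?mulr1; last by rewrite pnatr_eq0 -lt0n.
by split=> //; rewrite ler_pdivrMr // ler_peMr // ?ler1n // ltW.
Qed.

Theorem run_cMain s : Cst0 s -> exists ws, let s' := run cMain s in
  [/\ nv s' 0 = n, Outs s' ws, (size ws)%:R <= 16 / al &
   good_data -> exists2 i, (i < size ws)%N & ok_mean (nth (fun=> 0) ws i)].
Proof.
move=> h; have [h0 e10] := run_cInit h; rewrite /cMain run_HSeq; set s1 := run cInit s in h0 e10 *.
pose P i t := exists l ws, Inv i t l ws.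
have : P ST (run (HFor 28 (NV 10) cBody) s1).
  have -> : ST = ev (NV 10) s1 by rewrite ev_NV e10.
  apply: for_rule => [|i t _ [l [ws ht]]]; first by exists [:: fun=> 1], [::].
  exact: run_cBody ht.
move=> [l [ws hi]]; exists ws; split.
- exact: c_n (i_cst hi).
- exact: i_out hi.
- exact: ws_count hi.
(* Every potential is at least 1, so after [ST] rounds the time bound leaves no room for a cluster
   on the stack. *)
move=> hd; have l0 : l = [::].
  case: (i_time hi) => // hs; case: l hi hs => // g l hi; rewrite big_cons; have [hg hl] := i_isw hi.
  have p1 : 1 <= pot g by exact: pot_ge1.
  have : 0 <= \sum_(g <- l) pot g.
    elim: l {hi} hl => [|g' l IH] /=; first by rewrite big_nil.
    move=> [a b]; rewrite big_cons; apply: addr_ge0; last exact: IH.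
    by apply: le_trans (pot_ge1 _ _ _ a) => //.
  move=> q1; rewrite -[X in _ <= X]add0r lerD2r => q2; exfalso; move: q2; apply/negP; rewrite -ltNge.
  by apply: lt_le_trans ltr01 _; apply: (le_trans p1); rewrite lerDl.
by have := i_good hi hd; rewrite l0 /= => -[].
Qed.

End main_loop.

(** This is [16 ^ 3]. Minimality of [kap] then gives [16 ^ (3 (kap - 1)) < lam + 5], so the growth
    [16 ^ (4 D kap)] of the radii is, up to [C ^ D], at most the power [4 D / 3] of [lam + 5]; this
    leaves room for a further factor [lam] below the power [2 D]. *)
Definition pexp : nat := (16 * 16 * 16)%N.

(** * Computation of the parameters *)

Section parameters.
Variable R : realType.
Notation hst := (hst R).
Implicit Types (s : hst).
Variables (n d N : nat) (inp : nat -> R).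
Notation al := (inp 0).
Hypothesis n0 : (0 < n)%N.
Hypothesis al0 : 0 < al.
Hypothesis al1 : al < 2^-1.
Hypothesis N_al : 16 / al <= N%:R.
Notation D := (d + d)%N.

Definition least (f : nat -> bool) k := f k /\ forall j, (j < k)%N -> f j = false.

Lemma find_least (f : nat -> bool) m : (exists2 k, (k < m)%N & f k) ->
  least f (find f (iota 0 m)) /\ (find f (iota 0 m) < m)%N.
Proof.
move=> [k km hk]; have [b1 b2 b3] := findP f m.
have hlt : (find f (iota 0 m) < m)%N.
  rewrite ltn_neqAle b1 andbT; apply/eqP => E; have := b3 k; rewrite E km hk => /(_ isT) //.
by split=> //; split; [exact: b2|exact: b3].
Qed.

(** The searches for [An] and [lam] stop at [N]; this guarantees that they succeed. *)
Lemma N_gt : exists2 k, (k < N)%N & 1 <= k%:R * al.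
Proof.
have hN : 16 <= N%:R * al by rewrite -ler_pdivrMr.
have N0 : (0 < N)%N by case: (N) hN => //; rewrite mul0r; lra.
exists N.-1; first by rewrite prednK.
have : N%:R = N.-1%:R + 1 :> R by rewrite natr1 prednK.
by move=> E; rewrite E in hN; have := al1; lra.
Qed.

Lemma run_cP1 s : run cP1 s = updv s 3 (nv s 1 + nv s 1)%N. Proof. by []. Qed.

Definition fAn k : bool := 1 <= k%:R * al.
Definition flam k : bool := 1 <= 2 ^+ k * al.
Definition fkap lam k : bool := (lam + 5 <= pexp ^ k)%N.

Lemma run_pow b m x s : (b < 30)%N -> (x < 30)%N -> (m < 30)%N -> b != x -> b != m -> nv s b = 1%N ->
  let s' := run (HFor 30 (NV m) (HN b (NV b *n NV x))) s in frame [:: 30; b] [::] s s' /\ nv s' b = (nv s x ^ nv s m)%N.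
Proof.
move=> hb hx hm bx bm h1 s'; pose I i t := frame [:: 30; b] [::] s t /\ nv t b = (nv s x ^ i)%N.
suff : I (ev (NV m) s) s' by rewrite ev_NV.
apply: for_rule => [|i t hi [f1 f2]]; first by split.
rewrite run_HN; split.
  apply: (frame_trans f1); apply: (@frame_trans _ _ _ _ (updv t 30 i)); apply: frame_updv; rewrite !inE ?eqxx ?orbT //.
have x30 : x != 30%N by lia.
evs; rewrite nvU eqxx !nvU f2; have -> : (b == 30)%N = false by lia.
rewrite (negbTE x30); case: f1 => -> //; last by rewrite !inE negb_or x30 eq_sym.
by rewrite expnSr.
Qed.

Lemma run_cP2 s : nv s 2 = N -> ra s aINP =1 inp -> let s' := run cP2 s in
  frame [:: 4; 5; 11; 12; 30] [::] s s' /\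
  [/\ nv s' 4 = (nv s 3 + nv s 3)%N, nv s' 5 = (nv s 0 ^ nv s 3)%N,
     least flam (nv s' 12) /\ (nv s' 12 < N)%N & least fAn (nv s' 11) /\ (nv s' 11 < N)%N].
Proof.
move=> hN hi; rewrite /cP2 4!run_HSeq.
set s1 := run (HN 4 _) s; set s2 := run (HN 5 _) s1.
have f2 : frame [:: 4; 5; 11; 12; 30] [::] s s2.
  apply: (@frame_trans _ _ _ _ s1); exact: frame_updv.
have [] := @run_pow 5 3 0 s2 isT isT isT isT isT erefl; set s3 := run _ s2 => f3 e3.
have e4 : nv s3 4 = (nv s 3 + nv s 3)%N by case: f3 => -> //.
have {f2}f3 : frame [:: 4; 5; 11; 12; 30] [::] s s3 by apply: (frame_trans f2); exact: frame_subb f3.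
have {}e3 : nv s3 5 = (nv s 0 ^ nv s 3)%N by rewrite e3.
have N3 : nv s3 2 = N by case: f3 => -> //.
have I3 x : ra s3 aINP x = inp x by case: f3 => _ ->.
rewrite (run_HN 12); set lam := ev _ s3; set s4 := updv s3 12 lam.
have hlam : least flam lam /\ (lam < N)%N.
  have -> : lam = find flam (iota 0 N).
    rewrite /lam ev_Find ev_NV N3; apply: eq_in_find => k; rewrite mem_iota add0n => /= hk.
    evs; rewrite nvU /= N3 /flam -(@prod_if R N) ?(ltnW hk) // /eAl; evs; rewrite /= I3; congr (_ <= _ * _).
    by apply: eq_bigr => i _; evs; rewrite !nvU.
  apply: find_least; have [k hk h] := N_gt; exists k => //; apply: (le_trans h).
  by rewrite ler_pM2r // -natrX ler_nat ltnW // ltn_expl.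
rewrite run_HN; set An := ev _ s4.
have hAn : least fAn An /\ (An < N)%N.
  have -> : An = find fAn (iota 0 N).
    rewrite /An ev_Find ev_NV nvU /= N3; apply: eq_find => k.
    by evs; rewrite nvU /= /fAn /eAl; evs; rewrite /= I3.
  by apply: find_least; exact: N_gt.
split; first by apply: (frame_trans f3); apply: (@frame_trans _ _ _ _ s4); exact: frame_updv.
by [].
Qed.

Lemma run_cP3 s lam : nv s 2 = N -> nv s 12 = lam -> least flam lam /\ (lam < N)%N -> let s' := run cP3 s in
  frame [:: 6; 7; 9; 13; 14; 33] [::] s s' /\
  [/\ nv s' 6 = (nv s 5 * nv s 5)%N, nv s' 7 = (nv s 5 * nv s 5).+1, nv s' 14 = 16%N,
     least (fkap lam) (nv s' 13) /\ (nv s' 13 < N)%N & nv s' 9 = (2 * nv s' 13 + 1)%N].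
Proof.
move=> hN hl [hlam lamN]; rewrite /cP3 5!run_HSeq.
set s1 := run (HN 6 _) s; set s2 := run (HN 7 _) s1; set s3 := run (HN 33 _) s2; set s4 := run (HN 14 _) s3.
have f4 : frame [:: 6; 7; 9; 13; 14; 33] [::] s s4.
  apply: (@frame_trans _ _ _ _ s1); first exact: frame_updv.
  apply: (@frame_trans _ _ _ _ s2); first exact: frame_updv.
  apply: (@frame_trans _ _ _ _ s3); exact: frame_updv.
have N4 : nv s4 2 = N by case: f4 => -> //.
have l4 : nv s4 12 = lam by case: f4 => -> //.
rewrite (run_HN 13); set kap := ev _ s4; set s5 := updv s4 13 kap.
have hk : least (fkap lam) kap /\ (kap < N)%N.
  have -> : kap = find (fkap lam) (iota 0 N).
    rewrite /kap ev_Find ev_NV N4; apply: eq_in_find => k; rewrite mem_iota add0n => /= hk.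
    evs; rewrite !nvU /= hN hl /fkap -(ler_nat R) natrX /pexp !natrM -(@prod_if R N) ?(ltnW hk) //; congr (_ <= _).
    by apply: eq_bigr => i _; evs; rewrite !nvU.
  apply: find_least; exists lam => //; rewrite /fkap.
  have l1 : (0 < lam)%N.
    by case: (posnP lam) hlam => // -> [+ _]; rewrite /flam expr0 mul1r; have := al1; lra.
  apply: (@leq_trans (16 ^ lam)); last by rewrite leq_exp2r // /pexp -mulnA leq_pmulr.
  case: (lam) l1 => // m _; elim: m => // m IH; rewrite expnS.
  by have : (m.+1 + 5 <= 16 ^ m.+1)%N by []; lia.
split.
  by apply: (frame_trans f4); apply: (@frame_trans _ _ _ _ s5); exact: frame_updv.
rewrite run_HN; split=> //; first exact: addn1.
by rewrite nvU eqxx; evs; rewrite !nvU /= mul2n -addnn.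
Qed.

Lemma run_cP4 s : nv s 14 = 16%N -> let s' := run cP4 s in frame [:: 8] [::] s s' /\ nv s' 8 = pexp.
Proof.
move=> h; rewrite /cP4 run_HN; split; first exact: frame_updv.
by rewrite nvU eqxx; evs; rewrite h.
Qed.

(** Reals cannot be rounded by the machine, so [1 / al] is replaced by the least integer [An] with
    [An * al >= 1]. The value dominates the potential [3 (8 / al) ^ p N + 1] of the initial
    cluster. *)
Definition STv (An : nat) : nat := (3 * ((8 * An) ^ pexp * N) + 1)%N.

Lemma run_cP5 s : nv s 8 = pexp -> nv s 2 = N -> let s' := run cP5 s in
  frame [:: 10; 30] [::] s s' /\ nv s' 10 = STv (nv s 11).
Proof.
move=> h8 h2; rewrite /cP5 2!run_HSeq; set s1 := run (HN 10 (NV 2)) s.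
have f1 : frame [:: 10; 30] [::] s s1 by exact: frame_updv.
set c := HSeq _ _; pose P i t := frame [:: 10; 30] [::] s t /\ nv t 10 = ((8 * nv s 11) ^ i * N)%N.
have : P (nv s 8) (run (HFor 30 (NV 8) c) s1).
  have -> : nv s 8 = ev (NV 8) s1 by [].
  apply: for_rule => [|i t hi [f2 e2]]; first by split=> //; rewrite expn0 mul1n.
  rewrite /c /dblc 3!run_HSeq !run_HN; split.
    apply: (frame_trans f2); do 4 (apply: frame_trans; last exact: frame_updv); exact: frame_updv.
  do 6 (evs; rewrite ?nvU /=); rewrite e2; case: f2 => -> // _.
  by rewrite expnS; lia.
rewrite h8; set s2 := run _ s1 => -[f2 e2]; rewrite run_HN; split.
  by apply: (frame_trans f2); exact: frame_updv.
by evs; rewrite nvU eqxx e2 /STv; lia.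
Qed.

Definition Xbound (An : nat) : nat := (STv An + n ^ (D + D) + D + D + n + pexp + 16)%N.

Lemma pexp_gt0 : (0 < pexp)%N. Proof. by rewrite /pexp !muln_gt0. Qed.

Opaque pexp.

Lemma run_params (X := fun i c => inp (2 + (i * n + c))%N) :
  let s0 := input_hst n d N inp in
  let s5 := run cP5 (run cP4 (run cP3 (run cP2 (run cP1 s0)))) in
  exists lam An kap,
  [/\ least flam lam, least fAn An & least (fkap lam) kap] /\
  Cst0 n D N lam (2 * kap + 1) pexp (STv An) (inp 0) X s5 /\
  (forall B, (Xbound An <= B)%N ->
   [/\ safe B cP1 s0, safe B cP2 (run cP1 s0), safe B cP3 (run cP2 (run cP1 s0)),
      safe B cP4 (run cP3 (run cP2 (run cP1 s0))) & safe B cP5 (run cP4 (run cP3 (run cP2 (run cP1 s0))))] /\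
   safe B cMain s5).
Proof.
cbv zeta; set s0 := input_hst n d N inp; rewrite run_cP1; set s1 := updv s0 3 D.
have I1 : ra s1 aINP =1 inp by [].
have [f2 [e4 e5 [hl lN] [hA AN]]] := run_cP2 (s := s1) erefl I1; set s2 := run cP2 s1 in f2 e4 e5 hl lN hA AN *.
have N2 : nv s2 2 = N by case: f2 => ->.
have [f3 [e6 e7 e14 [hk kN] e9]] := @run_cP3 s2 (nv s2 12) N2 erefl (conj hl lN).
set s3 := run cP3 s2 in f3 e6 e7 e14 hk kN e9 *.
have [f4 e8] := run_cP4 e14; set s4 := run cP4 s3 in f4 e8 *.
have N4 : nv s4 2 = N by case: f4 => ->// _; case: f3 => -> //.
have [f5 e10] := run_cP5 e8 N4; set s5 := run cP5 s4 in f5 e10 *.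
clearbody s5; clearbody s4; clearbody s3; clearbody s2.
have A4 : nv s4 11 = nv s2 11 by case: f4 => -> // _; case: f3 => -> //.
rewrite A4 in e10.
set lam := nv s2 12 in hl lN hk *; set An := nv s2 11 in hA AN e10 A4 *; set kap := nv s3 13 in hk kN e9 *.
exists lam, An, kap; split; first by split; [exact: hl|exact: hA|exact: hk].
have fr : frame [:: 3; 4; 5; 6; 7; 8; 9; 10; 11; 12; 13; 14; 30; 33] [::] s0 s5.
  apply: (@frame_trans _ _ _ _ s1); first exact: frame_updv.
  apply: (@frame_trans _ _ _ _ s2); first exact: frame_subb f2.
  apply: (@frame_trans _ _ _ _ s3); first exact: frame_subb f3.
  by apply: (@frame_trans _ _ _ _ s4); [exact: frame_subb f4|exact: frame_subb f5].
have E34 v : v \notin [:: 8; 10; 30] -> nv s5 v = nv s3 v.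
  rewrite !inE !negb_or => /and3P[a b c]; case: f5 => ->; last by rewrite !inE negb_or b.
  by case: f4 => ->//; rewrite inE.
have E23 v : v \notin [:: 6; 7; 8; 9; 10; 13; 14; 30; 33] -> nv s5 v = nv s2 v.
  rewrite !inE !negb_or => /and5P[a b c d' /and5P[e f g h i]].
  rewrite E34 ?inE ?negb_or ?c ?e ?h //; case: f3 => -> //.
  by rewrite !inE !negb_or a b d' f g i.
have v0 : nv s5 0 = n by case: fr => ->.
have v1 : nv s5 1 = d by case: fr => ->.
have v2 : nv s5 2 = N by case: fr => ->.
have v3 : nv s5 3 = D by rewrite E23 //; case: f2 => ->.
have v4 : nv s5 4 = (D + D)%N by rewrite E23.
have v5 : nv s5 5 = (n ^ D)%N by rewrite E23.
have e5' : nv s2 5 = (n ^ D)%N by [].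
have v6 : nv s5 6 = (n ^ (D + D))%N by rewrite E34 // e6 e5' -(expnD n D D).
have v7 : nv s5 7 = (n ^ (D + D)).+1 by rewrite E34 // e7 e5' -(expnD n D D).
have v8 : nv s5 8 = pexp by case: f5 => -> //.
have v9 : nv s5 9 = (2 * kap + 1)%N by rewrite E34.
have v11 : nv s5 11 = An by rewrite E23.
have v12 : nv s5 12 = lam by rewrite E23.
have v13 : nv s5 13 = kap by rewrite E34.
split.
  split=> //; first by rewrite (frame_ra fr).
  by move=> i c _ _; rewrite (frame_ra fr).
have An0 : (0 < An)%N by case: hA; rewrite /fAn; case: (posnP An) => // ->; rewrite mul0r; lra.
have NST : (2 * N + 1 <= STv An)%N.
  rewrite /STv leq_add2r; apply: (@leq_trans (3 * N)); first by rewrite leq_mul2r orbT.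
  by rewrite leq_mul2l /= leq_pmull // expn_gt0 muln_gt0 An0.
have dN : (d + 0 <= D)%N by rewrite leq_add2l.
have nD : (n ^ D <= n ^ (D + D))%N by rewrite leq_pexp2l // leq_addr.
move=> B hB; have XB := hB; rewrite /Xbound in XB.
have b0 : (n <= B)%N by apply: leq_trans XB; lia.
have c1 : (STv An <= B)%N by apply: leq_trans XB; lia.
have c2 : (n ^ (D + D) + 16 <= B)%N by apply: leq_trans XB; lia.
have c3 : (D + D <= B)%N by apply: leq_trans XB; lia.
have c4 : (pexp <= B)%N by apply: leq_trans XB; lia.
have c16 : (16 <= B)%N by apply: leq_trans XB; lia.
split; last first.
  apply: safe_static ok_main _ => v; rewrite /Pm.
  do 14 (case: v => [_|v]; first by rewrite ?v0 ?v1 ?v2 ?v3 ?v4 ?v5 ?v6 ?v7 ?v8 ?v9 ?e10 ?v11 ?v12 ?v13; lia).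
  by [].
split.
- apply: safe_static ok_P1 _ => v.
  do 3 (case: v => [_|v] /=; first by lia). by [].
- apply: safe_static ok_P2 _ => v.
  do 4 (case: v => [_|v]; first by rewrite /s1 /s0 /updv /upd /=; lia). by [].
- apply: safe_static ok_P3 _ => v.
  have h6 w : (w < 6)%N -> nv s2 w = nv s5 w by move=> hw; rewrite E23 // !inE; lia.
  move=> hv; rewrite h6 //; move: hv.
  do 6 (case: v => [_|v] /=; first by rewrite ?v0 ?v1 ?v2 ?v3 ?v4 ?v5; lia). by [].
- apply: safe_static ok_P4 _ => v /eqP ->; by rewrite e14.
- apply: safe_static ok_P5 _ => v /orP[] /eqP ->; first by rewrite e8.
  by rewrite A4 -/An; lia.
Qed.

End parameters.

(** Coefficient and degree depend on the program alone, so its running time is polynomial in the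
    largest loop bound. *)
Definition polyb (f : nat -> nat) := exists A B, forall X, (f X <= A * X.+1 ^ B)%N.

Lemma polyb_c k : polyb (fun=> k).
Proof. by exists k, 0%N => X; rewrite expn0 muln1. Qed.
Lemma polyb_add f g : polyb f -> polyb g -> polyb (fun X => f X + g X)%N.
Proof.
move=> [A [B h]] [A' [B' h']]; exists (A + A')%N, (B + B')%N => X; rewrite mulnDl; apply: leq_add.
  by apply: leq_trans (h X) _; rewrite leq_mul2l leq_pexp2l ?leq_addr ?orbT.
by apply: leq_trans (h' X) _; rewrite leq_mul2l leq_pexp2l ?leq_addl ?orbT.
Qed.
Lemma polyb_X f : polyb f -> polyb (fun X => X * f X)%N.
Proof.
move=> [A [B h]]; exists A, B.+1 => X; rewrite expnS mulnCA; exact: leq_mul.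
Qed.

Lemma tex_poly t (e : ex t) : polyb (fun X => tex X e).
Proof.
elim: e => /= *; repeat first [exact: polyb_c | assumption | apply: polyb_add | apply: polyb_X].
Qed.

Lemma thc_poly c : polyb (fun X => thc X c).
Proof.
by elim: c => /= *; repeat first [exact: polyb_c | exact: tex_poly | assumption | apply: polyb_add | apply: polyb_X].
Qed.

(** * Guarantee of the program on a fixed input *)

Section algorithm.
Variable R : realType.

Definition coord n (x : 'rV[R]_n) (c : nat) : R := oapp (fun j => x ord0 j) 0 (insub c).
Lemma coordE n (x : 'rV[R]_n) (j : 'I_n) : coord x j = x ord0 j.
Proof. by rewrite /coord valK. Qed.

Lemma input_coord n d (alpha tau : R) (T : seq 'rV[R]_n) w i (c : 'I_n) : (i < size T)%N ->
  reals (input d alpha tau T w) (2 + (i * n + c))%N = nth 0 T i ord0 c.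
Proof.
move=> hi /=; elim: T i hi => [|x T IH] [|i] //= hi; rewrite nth_cat size_map size_enum_ord.
  by rewrite mul0n !add0n ltn_ord (nth_map c) ?size_enum_ord // nth_ord_enum.
by rewrite add0n mulSn -addnA ltnNge leq_addr /= addKn; move: (IH i hi); rewrite ?add0n.
Qed.

(** The time and the list are produced before [S0] and [mu] are quantified: the output does not
    depend on which points are good, and the same list serves every admissible choice. *)
Theorem algorithm_ok (n d : nat) (alpha tau : R) (T : seq 'rV[R]_n) w :
  (0 < n)%N -> (0 < d)%N -> 0 < alpha -> alpha < 2^-1 -> 16 / alpha <= (size T)%:R ->
  exists lam An kap t L, let N := size T in let D := (d + d)%N in
  [/\ least (fun k => 1 <= 2 ^+ k * alpha) lam, least (fun k => 1 <= k%:R * alpha) An &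
      least (fun k => lam + 5 <= pexp ^ k)%N kap] /\
  [/\ returns (program 21 cAll) d alpha tau T w t L,
      (t <= thc (Xbound n d N An) cAll + 40 * (N * n + N + N + 3))%N,
      (size L)%:R <= 16 / alpha &
      forall S0 (mu : 'rV[R]_n),
        good_data n D N alpha (fun i => coord (nth 0 T i)) S0 (coord mu) ->
        exists2 x, x \in L & sq n (fun c => coord x c - coord mu c) ^+ D <= err D lam (2 * kap + 1) alpha].
Proof.
move=> n0 d0 a0 a1 hN; set N := size T in hN *; set D := (d + d)%N.
set inp := reals (input d alpha tau T w).
have i0 : inp 0%N = alpha by [].
have := @run_params R n d N inp n0 a0 a1 hN; set s0 := input_hst n d N inp; cbv zeta.
set s5 := run cP5 _ => -[lam [An [kap [[hl hA hk] [h5 hsafe]]]]].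
have N0 : (0 < N)%N by rewrite -(ltr_nat R); apply: lt_le_trans hN; rewrite divr_gt0.
have D2 : (2 <= D)%N by rewrite /D; lia.
have al1 : alpha < 1 by lra.
have p0 := pexp_gt0.
have Kd : (2 * kap + 1 = 2 * kap + 1)%N by [].
have An1 : 1 <= An%:R * alpha by case: hA.
have hST : 3 * (8 / alpha) ^+ pexp * N%:R + 1 <= (STv N An)%:R.
  rewrite /STv natrD lerD2r natrM -mulrA ler_pM2l // natrM ler_pM2r ?ltr0n // natrX natrM.
  apply: lerXn2r; rewrite ?nnegrE ?divr_ge0 ?mulr_ge0 ?(ltW a0) //.
  by rewrite ler_pdivrMr // -mulrA ler_peMr.
pose X := fun i c => inp (2 + (i * n + c))%N.
have main S0 mu := @run_cMain R n D N lam (2 * kap + 1)%N pexp kap (STv N An) alpha X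
  n0 D2 N0 a0 al1 p0 hl.1 hk.1 Kd hN S0 mu hST s5 h5.
have frag : run cAll s0 = run cMain s5 by rewrite /cAll 5!run_HSeq.
have [[q1 q2 q3 q4 q5] q6] := hsafe _ (leqnn _).
have hs : safe (Xbound n d N An) cAll s0.
  exact: (safe_seq q1 (safe_seq q2 (safe_seq q3 (safe_seq q4 (safe_seq q5 q6))))).
have out S0 mu : exists ws, [/\ nv (run cAll s0) 21 = size ws, (size ws)%:R <= 16 / alpha, nv (run cAll s0) 0 = n,
   (forall i c, (i < size ws)%N -> (c < n)%N -> ra (run cAll s0) aOUT (i * n + c)%N = mean N X (nth (fun=> 0) ws i) c) &
   good_data n D N alpha X S0 mu -> exists2 i, (i < size ws)%N & ok_mean n D N lam (2 * kap + 1) alpha X mu (nth (fun=> 0) ws i)].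
  rewrite frag; have [ws [b1 [b2 b3] b4 b5]] := main S0 mu; exists ws.
  by split; [exact: b2|exact: b4|exact: b1|exact: b3|exact: b5].
have aE : inord 1 = aOUT by apply: val_inj; rewrite /= inordK.
(* The size of the output is needed before any good set is given; it holds for every input, so a
   dummy good set and mean are supplied. *)
have [ws0 [c1 c2 c3 _ _]] := out pred0 (fun=> 0).
have szN : (size ws0 <= N)%N by rewrite -(ler_nat R); exact: le_trans c2 hN.
have [|t [L [hr ht hL]]] := @program_ok R 21 cAll n d alpha tau T w (Xbound n d N An) hs c3.
  rewrite -/N -/inp -/s0 c1; apply: (leq_trans _ (leq_addl _ _)); by rewrite leq_mul2r szN orbT.
rewrite -/N -/inp -/s0 c1 in ht hL.
exists lam, An, kap, t, L; cbv zeta; split; first by split; [exact: hl|exact: hA|exact: hk].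
split; [exact: hr| | |].
- apply: (leq_trans ht); apply: leq_add (leqnn _) _; apply: leq_mul (leqnn _) _.
  apply: leq_add _ (leqnn _); apply: leq_add (leqnn _) _; exact: szN.
- rewrite hL size_map size_iota; exact: c2.
move=> S0 mu hd; have [ws [b1 b2 b3 b4 b5]] := out S0 (coord mu).
have XE (i : 'I_N) (c : 'I_n) : X i c = coord (nth 0 T i) c by rewrite coordE /X /inp input_coord.
have [|i hi hok] := b5.
  case: hd => g1 g2 g3; split; [exact: g1|move=> L' hL'|move=> v hv].
    apply: le_trans (g2 L' hL'); rewrite le_eqVlt; apply/orP; left; apply/eqP.
    apply: eq_bigr => x _; rewrite /qf; congr (_ + _ * _ ^+ _).
      by apply: eq_bigr => I _; congr (_ * _); apply: (pw_ext n0) => c hc; rewrite (XE x (Ordinal hc)).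
    by apply: eq_bigr => c _; rewrite XE.
  apply: le_trans (g3 v hv); rewrite le_eqVlt; apply/orP; left; apply/eqP.
  apply: eq_bigr => x _; congr (_ ^+ _); apply: eq_bigr => c _; by rewrite XE.
set x := \row_(j < n) ra (run cAll s0) (inord 1) (i * n + j)%N.
exists x.
  rewrite hL; apply/mapP; exists i; last reflexivity.
  by rewrite mem_iota add0n -c1 b1 hi.
apply: le_trans hok; rewrite le_eqVlt; apply/orP; left; apply/eqP; congr (_ ^+ _).
apply: eq_bigr => c _; have -> : coord x c = mean N X (nth (fun=> 0) ws i) c.
  rewrite coordE mxE aE; exact: (b4 i c hi (ltn_ord c)).
reflexivity.
Qed.

End algorithm.

(** * Expectation and independence *)

Section density.
Local Open Scope ereal_scope.
Import HBNNSimple.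
Context d d' (U : measurableType d) (E : measurableType d') (R : realType).
Variables (P : {measure set U -> \bar R}) (nu : {measure set E -> \bar R}).
Variables (Y : U -> E) (W : U -> R).
Hypothesis mY : measurable_fun setT Y.
Hypothesis mW : measurable_fun setT W.
Hypothesis W0 : forall x, (0 <= W x)%R.
Hypothesis hnu : forall B, measurable B -> \int[P]_x (\1_B (Y x) * W x)%:E = nu B.

(** Approximation from below by simple functions. With [W = 1] this is the change of variables to
    the law of [Y], with [Y = id] the integration against a density, and with [W] a product of other
    factors the induction step for independence. *)
Lemma ge0_integral_density (f : E -> R) : measurable_fun setT f -> (forall y, (0 <= f y)%R) ->
  \int[P]_x (f (Y x) * W x)%:E = \int[nu]_y (f y)%:E.
Proof.
move=> mf f0; have mef : measurable_fun setT (fun y => (f y)%:E : \bar R) by exact/measurable_EFinP.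
pose g := nnsfun_approx measurableT mef.
have g0 n y : (0 <= g n y)%R by exact: fun_ge0.
have gnd y m n : (m <= n)%N -> (g m y <= g n y)%R.
  by move=> mn; have /lefP := nd_nnsfun_approx measurableT mef mn; apply.
have gc y : EFin (g n y) @[n --> \oo] --> (f y)%:E.
  by apply: (cvg_nnsfun_approx measurableT mef) => // z _; rewrite /= lee_fin.
have mg n : measurable_fun setT (g n) by exact: measurable_funP.
have mgY n : measurable_fun setT (fun x => g n (Y x)).
  by apply: (@measurableT_comp _ _ _ _ _ _ (g n : E -> R)) => //.
have A n : \int[P]_x (g n (Y x) * W x)%:E = \int[nu]_y (g n y)%:E.
  under eq_integral do rewrite fimfunEord mulr_suml -sumEFin.
  under [RHS]eq_integral do rewrite fimfunEord -sumEFin.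
  set s := fset_set _.
  have s0 (i : 'I_(size (finmap.enum_fset s))) : (0 <= (finmap.enum_fset s)`_i)%R.
    have : (finmap.enum_fset s)`_i \in finmap.enum_fset s by exact: mem_nth.
    by rewrite -[_ \in _]/(_ \in s) in_fset_set // => /set_mem [y _ <-].
  have mi (r : R) : measurable (g n @^-1` [set r]) by rewrite -[X in measurable X]setTI; exact: mg.
  have m1 (r : R) : measurable_fun setT (fun y : E => \1_(g n @^-1` [set r]) y : R).
    exact: measurable_indic.
  have m1Y (r : R) : measurable_fun setT (fun x => \1_(g n @^-1` [set r]) (Y x) : R).
    exact: (measurableT_comp (m1 r) mY).
  rewrite ge0_integral_sum //; last 2 first.
  - move=> i; apply/measurable_EFinP; apply: measurable_funM => //; exact: measurable_funM.
  - by move=> i x _; rewrite lee_fin !mulr_ge0 // s0.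
  rewrite ge0_integral_sum //; last 2 first.
  - by move=> i; apply/measurable_EFinP; exact: measurable_funM.
  - by move=> i x _; rewrite lee_fin mulr_ge0 // s0.
  apply: eq_bigr => i _.
  under eq_integral do rewrite -mulrA EFinM.
  rewrite ge0_integralZl_EFin //; last 2 first.
  - by move=> x _; rewrite lee_fin mulr_ge0.
  - by apply/measurable_EFinP; exact: measurable_funM.
  under [RHS]eq_integral do rewrite EFinM.
  rewrite ge0_integralZl_EFin //; last exact/measurable_EFinP.
  by rewrite (hnu (mi _)) (integral_indic _ measurableT (mi _)) setIT.
have L : \int[P]_x (g n (Y x) * W x)%:E @[n --> \oo] --> \int[P]_x (f (Y x) * W x)%:E.
  have -> : \int[P]_x (f (Y x) * W x)%:E = \int[P]_x limn (fun n => (g n (Y x) * W x)%:E).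
    apply: eq_integral => x _; apply/esym/cvg_lim => //.
    rewrite EFinM; under eq_fun do rewrite EFinM.
    by apply: cvgeM => //; exact: cvg_cst.
  apply: cvg_monotone_convergence => //.
  - by move=> n; apply/measurable_EFinP; exact: measurable_funM.
  - by move=> n x _; rewrite lee_fin mulr_ge0.
  - by move=> x _ m n mn; rewrite lee_fin ler_wpM2r // gnd.
have Rr : \int[nu]_y (g n y)%:E @[n --> \oo] --> \int[nu]_y (f y)%:E.
  have -> : \int[nu]_y (f y)%:E = \int[nu]_y limn (fun n => (g n y)%:E).
    by apply: eq_integral => x _; apply/esym/cvg_lim.
  apply: cvg_monotone_convergence => //.
  - by move=> n; exact/measurable_EFinP.
  - by move=> n x _; rewrite lee_fin.
  - by move=> x _ m n mn; rewrite lee_fin gnd.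
have E' : (fun n => \int[P]_x (g n (Y x) * W x)%:E) = (fun n => \int[nu]_y (g n y)%:E) by apply/funext => n.
by rewrite E' in L; exact: (cvg_unique _ L Rr).
Qed.
End density.

Section expectation.
Local Open Scope ereal_scope.
Context d (U : measurableType d) (R : realType) (P : probability U R).
Implicit Types (Z : U -> R).

Definition EX Z : R := (\int[P]_w Z w)%R.
Definition itg Z := P.-integrable setT (EFin \o Z).

Lemma itgE Z : itg Z -> \int[P]_w (Z w)%:E = (EX Z)%:E.
Proof. by move=> h; rewrite /EX /Rintegral fineK //; exact: integrable_fin_num. Qed.

Lemma itgD Z Z' : itg Z -> itg Z' -> itg (fun w => Z w + Z' w)%R.
Proof. by move=> h h'; apply: eq_integrable (integrableD measurableT h h') => // w _; rewrite /= EFinD. Qed.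
Lemma itgB Z Z' : itg Z -> itg Z' -> itg (fun w => Z w - Z' w)%R.
Proof. by move=> h h'; apply: eq_integrable (integrableB measurableT h h') => // w _; rewrite /= EFinB. Qed.
Lemma itgZ c Z : itg Z -> itg (fun w => c * Z w)%R.
Proof. by move=> h; apply: eq_integrable (integrableZl measurableT c h) => // w _; rewrite /= EFinM. Qed.
Lemma itg_cst (c : R) : itg (fun=> c).
Proof. exact: finite_measure_integrable_cst. Qed.
Lemma itg_sum (I : Type) (s : seq I) (Q : pred I) (F : I -> U -> R) : (forall i, Q i -> itg (F i)) ->
  itg (fun w => \sum_(i <- s | Q i) F i w)%R.
Proof.
move=> h; elim: s => [|i s IH].
  by under [X in itg X]eq_fun do rewrite big_nil; exact: itg_cst.
rewrite (_ : (fun w => _) = (fun w => if Q i then F i w + \sum_(i <- s | Q i) F i w else \sum_(i <- s | Q i) F i w)%R).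
  by case hi : (Q i) => //; exact: (itgD (h i hi) IH).
by apply/funext => w; rewrite big_cons.
Qed.

Lemma EXD Z Z' : itg Z -> itg Z' -> EX (fun w => Z w + Z' w)%R = (EX Z + EX Z')%R.
Proof. by move=> h h'; rewrite /EX RintegralD. Qed.
Lemma EXB Z Z' : itg Z -> itg Z' -> EX (fun w => Z w - Z' w)%R = (EX Z - EX Z')%R.
Proof. by move=> h h'; rewrite /EX RintegralB. Qed.
Lemma EXZ c Z : itg Z -> EX (fun w => c * Z w)%R = (c * EX Z)%R.
Proof. by move=> h; rewrite /EX RintegralZl. Qed.
Lemma EX_cst (c : R) : EX (fun=> c) = c.
Proof. 
have h : P setT = 1 by exact: probability_setT.
by rewrite /EX Rintegral_cst //= h mulr1.
 Qed.
Lemma EX_sum (I : Type) (s : seq I) (Q : pred I) (F : I -> U -> R) : (forall i, Q i -> itg (F i)) ->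
  EX (fun w => \sum_(i <- s | Q i) F i w)%R = (\sum_(i <- s | Q i) EX (F i))%R.
Proof.
move=> h; elim: s => [|i s IH].
  by under [X in EX X]eq_fun do rewrite big_nil; rewrite big_nil EX_cst.
under [X in EX X]eq_fun do rewrite big_cons; rewrite big_cons; case: ifP => hi //.
by rewrite (EXD (h i hi) (itg_sum s h)) IH.
Qed.
Lemma EX_ge0 Z : (forall w, 0 <= Z w)%R -> (0 <= EX Z)%R.
Proof. by move=> h; apply: Rintegral_ge0. Qed.
Lemma itg_dom Z Z' : measurable_fun setT Z' -> (forall w, `|Z' w| <= `|Z w|)%R -> itg Z -> itg Z'.
Proof.
move=> m h i; apply: (le_integrable measurableT _ _ i); first exact/measurable_EFinP.
by move=> w _; rewrite /= lee_fin.
Qed.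

Lemma markov_EX Z (t : R) : itg Z -> (forall w, 0 <= Z w)%R -> (0 < t)%R -> P [set w | (t <= Z w)%R] <= (EX Z / t)%:E.
Proof.
move=> i h t0; have mZ : measurable_fun setT Z by case/integrableP: i => /measurable_EFinP.
have mS : measurable [set w | (t <= Z w)%R].
  by rewrite -[X in measurable X]setTI; exact: (measurable_fun_le (f := fun=> t)).
have : \int[P]_w (t * \1_[set w | (t <= Z w)%R] w)%:E <= \int[P]_w (Z w)%:E.
  apply: ge0_le_integral => //.
  - by move=> w _; rewrite lee_fin mulr_ge0 // ltW.
  - apply/measurable_EFinP; apply: measurable_funM => //; exact: measurable_indic.
  - exact/measurable_EFinP.
  move=> w _; rewrite lee_fin indicE; have [hw|hw] := boolP (w \in _); last by rewrite mulr0.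
  by rewrite mulr1; move/set_mem: hw.
rewrite itgE //; under eq_integral do rewrite EFinM.
rewrite ge0_integralZl_EFin ?(ltW t0) //; last by apply/measurable_EFinP; exact: measurable_indic.
rewrite integral_indic // setIT muleC => H.
by rewrite EFinM lee_pdivlMr.
Qed.

End expectation.

Section independence.
Local Open Scope ereal_scope.
Context d d' (U : measurableType d) (E : measurableType d') (R : realType) (K : finType).
Variables (P : probability U R) (X : K -> U -> E).
Hypothesis mX : forall k, measurable_fun setT (X k).
Hypothesis indep : forall B : K -> set E, (forall k, measurable (B k)) ->
  P [set w | forall k, B k (X k w)] = \prod_k P (X k @^-1` B k).
Implicit Types (f : K -> E -> R).

Lemma mprod f : (forall k, measurable_fun setT (f k)) -> forall Q : pred K,
  measurable_fun setT (fun w => (\prod_(k | Q k) f k (X k w))%R).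
Proof.
move=> mf Q; under eq_fun do rewrite -big_filter.
by apply: measurable_prod => k _; exact: (measurableT_comp (mf k) (mX k)).
Qed.

(** For indicators this is the hypothesis of independence. Indicators are then replaced by general
    functions one coordinate at a time; [s] lists the coordinates whose function need not be an
    indicator. *)
Lemma ge0_indep_prod f (e : K -> R) : (forall k, measurable_fun setT (f k)) -> (forall k y, (0 <= f k y)%R) ->
  (forall k, \int[P]_w (f k (X k w))%:E = (e k)%:E) ->
  \int[P]_w (\prod_k f k (X k w))%:E = (\prod_k e k)%:E.
Proof.
suff H (s : seq K) : forall f e, (forall k, measurable_fun setT (f k)) -> (forall k y, (0 <= f k y)%R) ->
  (forall k, \int[P]_w (f k (X k w))%:E = (e k)%:E) ->
  (forall k, k \notin s -> exists2 B, measurable B & f k = \1_B) ->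
  \int[P]_w (\prod_k f k (X k w))%:E = (\prod_k e k)%:E.
  by move=> mf f0 he; apply: (H (enum K)) => // k; rewrite mem_enum.
have m1 k B : measurable B -> measurable (X k @^-1` B) by move=> mB; rewrite -[X in measurable X]setTI; exact: mX.
elim: s => [|k0 s IH] {}f {}e mf f0 he hs.
  have /choice[B hB] : forall k, exists B, measurable B /\ f k = \1_B.
    by move=> k; have [//|B mB eB] := hs k; exists B.
  have -> : \int[P]_w (\prod_k f k (X k w))%:E = \int[P]_w (\1_[set w | forall k, B k (X k w)] w)%:E.
    apply: eq_integral => w _; congr (_%:E); rewrite indicE.
    have [hw|hw] := boolP (w \in _).
      by rewrite big1 // => k _; rewrite (hB k).2 indicE mem_set //; move/set_mem: hw; apply.
    have [k hk] : exists k, ~ B k (X k w) by apply/not_existsP => h; case/negP: hw; apply/mem_set => k; have := h k; apply: contrapT.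
    by rewrite (bigD1 k) //= (hB k).2 indicE memNset // mul0r.
  rewrite integral_indic //; last first.
    rewrite (_ : [set w | _] = \bigcap_(k in setT) (X k @^-1` B k)); last first.
      by apply/seteqP; split=> w /= h k; [move=> _; exact: h|exact: (h k I)].
    by apply: fin_bigcap_measurable => // k _; apply: m1; case: (hB k).
  transitivity (P [set w | forall k, B k (X k w)]); first by rewrite setIT.
  rewrite (@indep B); last by move=> k; case: (hB k).
  rewrite -prodEFin; apply: eq_bigr => k _.
  by rewrite -he (hB k).2 (integral_indic _ measurableT (m1 k _ (hB k).1)) setIT.
pose W w := (\prod_(k | k != k0) f k (X k w))%R.
pose c := (\prod_(k | k != k0) e k)%R.
have e0 k : (0 <= e k)%R by rewrite -lee_fin -he; apply: integral_ge0 => w _; rewrite lee_fin.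
have c0 : (0 <= c)%R by apply: prodr_ge0.
have W0 w : (0 <= W w)%R by apply: prodr_ge0.
have mW : measurable_fun setT W by exact: mprod.
(* Weighted by the product of the other factors, the law of [X k0] is just multiplied by the
   constant [c]: this is the induction hypothesis with the factor at [k0] replaced by an
   indicator. *)
have hnu B : measurable B -> \int[P]_w (\1_B (X k0 w) * W w)%:E = mscale (NngNum c0) (pushforward P (X k0)) B.
  move=> mB.
  pose f' k := if k == k0 then \1_B else f k.
  pose e' k := if k == k0 then fine (P (X k0 @^-1` B)) else e k.
  have h : \int[P]_w (\prod_k f' k (X k w))%:E = (\prod_k e' k)%:E.
    apply: IH => [k|k y|k|k hk]; rewrite /f' /e'; case: eqVneq => [E1|ne] //.
    - by rewrite E1 (integral_indic _ measurableT (m1 k0 _ mB)) setIT fineK // fin_num_measure //; exact: m1.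
    - by exists B.
    - by apply: hs; rewrite inE negb_or ne.
  transitivity (c * fine (P (X k0 @^-1` B)))%:E; last first.
    by rewrite EFinM fineK // fin_num_measure //; exact: m1.
  transitivity (\int[P]_w (\prod_k f' k (X k w))%:E).
    apply: eq_integral => w _; rewrite (bigD1 k0) //= /f' eqxx; congr (_ * _)%:E.
    by apply: eq_bigr => k /negbTE ->.
  rewrite h (bigD1 k0) //= /e' eqxx mulrC; congr (_ * _)%:E.
  by apply: eq_bigr => k /negbTE ->.
have := @ge0_integral_density _ _ _ _ _ P _ (X k0) W (mX k0) mW W0 (hnu (mX k0)) (f k0) (mf k0) (f0 k0).
have mef : measurable_fun setT (EFin \o f k0) by exact/measurable_EFinP.
rewrite ge0_integral_mscale //; last by move=> y _; rewrite lee_fin.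
rewrite ge0_integral_pushforward //; last by move=> y _; rewrite lee_fin.
rewrite preimage_setT [X in _ * X]he -EFinM => h.
rewrite [in RHS](bigD1 k0) //= mulrC -h; apply: eq_integral => w _.
by rewrite (bigD1 k0).
Qed.

Notation itg := (itg P).
Notation EX := (EX P).

(** The factors are split into positive and negative parts one coordinate at a time; [s] lists the
    coordinates whose factor may still change sign. *)
Lemma indep_prod f : (forall k, measurable_fun setT (f k)) -> (forall k, itg (fun w => f k (X k w))) ->
  itg (fun w => \prod_k f k (X k w))%R /\ EX (fun w => \prod_k f k (X k w))%R = (\prod_k EX (fun w => f k (X k w)))%R.
Proof.
suff H (s : seq K) : forall f, (forall k, measurable_fun setT (f k)) -> (forall k, itg (fun w => f k (X k w))) ->
  (forall k, k \notin s -> forall y, (0 <= f k y)%R) ->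
  itg (fun w => \prod_k f k (X k w))%R /\ EX (fun w => \prod_k f k (X k w))%R = (\prod_k EX (fun w => f k (X k w)))%R.
  by move=> mf hf; apply: (H (enum K)) => // k; rewrite mem_enum.
elim: s => [|k0 s IH] {}f mf hf hs.
  have f0 k y : (0 <= f k y)%R by exact: hs.
  have h := ge0_indep_prod mf f0 (fun k => itgE (hf k)).
  have hi : itg (fun w => \prod_k f k (X k w))%R.
    apply/integrableP; split; first by apply/measurable_EFinP; exact: mprod.
    under eq_integral do rewrite /= ger0_norm ?prodr_ge0 //.
    by rewrite h ltry.
  by split=> //; apply/EFin_inj; rewrite -itgE.
pose fp y : R := Num.max (f k0 y) 0%R; pose fm y : R := Num.max (- f k0 y)%R 0%R.
have fpm y : (f k0 y = fp y - fm y)%R by rewrite /fp /fm; case: (lerP (f k0 y) 0%R) => h; case: (lerP (- f k0 y)%R 0%R) => h'; lra.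
have mfp : measurable_fun setT fp by apply: measurable_maxr => //.
have mfm : measurable_fun setT fm by apply: measurable_maxr => //; exact: measurableT_comp.
have dom (h : E -> R) : measurable_fun setT h -> (forall y, `|h y| <= `|f k0 y|)%R -> itg (fun w => h (X k0 w)).
  move=> mh hh; apply: (le_integrable measurableT _ _ (hf k0)).
    by apply/measurable_EFinP; exact: (measurableT_comp mh (mX k0)).
  by move=> w _; rewrite /= lee_fin.
have ip : itg (fun w => fp (X k0 w)).
  apply: dom => // y; rewrite /fp; case: (lerP (f k0 y) 0%R) => h; rewrite ?normr0 //.
have im : itg (fun w => fm (X k0 w)).
  apply: dom => // y; rewrite /fm; case: (lerP (- f k0 y)%R 0%R) => h; rewrite ?normr0 ?normrN //.
pose g (h : E -> R) k := if k == k0 then h else f k.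
have gh (h : E -> R) : measurable_fun setT h -> (forall y, 0 <= h y)%R -> itg (fun w => h (X k0 w)) ->
  itg (fun w => h (X k0 w) * \prod_(k | k != k0) f k (X k w))%R /\
  EX (fun w => h (X k0 w) * \prod_(k | k != k0) f k (X k w))%R = (EX (fun w => h (X k0 w)) * \prod_(k | k != k0) EX (fun w => f k (X k w)))%R.
  move=> mh h0 ih; have := IH (g h).
  have -> : (fun w => \prod_k g h k (X k w))%R = (fun w => h (X k0 w) * \prod_(k | k != k0) f k (X k w))%R.
    apply/funext => w; rewrite (bigD1 k0) //= /g eqxx; congr (_ * _)%R; by apply: eq_bigr => k /negbTE ->.
  have -> : (\prod_k EX (fun w => g h k (X k w)))%R = (EX (fun w => h (X k0 w)) * \prod_(k | k != k0) EX (fun w => f k (X k w)))%R.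
    rewrite (bigD1 k0) //= /g eqxx; congr (_ * _)%R; by apply: eq_bigr => k /negbTE ->.
  apply => k.
  - by rewrite /g; case: eqVneq.
  - by rewrite /g; case: eqVneq => [->|].
  - by move=> hk y; rewrite /g; case: eqVneq => // ne; apply: hs; rewrite inE negb_or ne.
have [p1 p2] := gh fp mfp (fun y => ltac:(by rewrite /fp le_max lexx orbT)) ip.
have [q1 q2] := gh fm mfm (fun y => ltac:(by rewrite /fm le_max lexx orbT)) im.
have fE : (fun w => \prod_k f k (X k w))%R = (fun w => fp (X k0 w) * \prod_(k | k != k0) f k (X k w) - fm (X k0 w) * \prod_(k | k != k0) f k (X k w))%R.
  by apply/funext => w; rewrite (bigD1 k0) //= fpm mulrBl.
rewrite fE; split; first exact: itgB.
rewrite EXB // p2 q2 -mulrBl [RHS](bigD1 k0) //=; congr (_ * _)%R.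
rewrite (_ : (fun w => f k0 (X k0 w)) = (fun w => fp (X k0 w) - fm (X k0 w))%R); last by apply/funext.
by rewrite EXB.
Qed.

End independence.

(** * Gaussian moments *)

Section gaussian_moments.
Variables (R : realType) (m : R).
Notation leb := (@lebesgue_measure R).

Definition gk k (x : R) : R := (x - m) ^+ k * normal_pdf m 1 x.

Lemma pdfE x : normal_pdf m 1 x = normal_peak 1 * expR (- (x - m) ^+ 2 / 2).
Proof. by rewrite normal_pdfE ?oner_eq0 // /normal_fun expr1n. Qed.

Lemma pow_exp k (z : R) : 0 <= z -> z ^+ k <= k`!%:R * expR z.
Proof.
case: k => [|k] z0; first by rewrite expr0 fact0 mul1r (le_trans _ (expR_ge1Dx z)) // lerDl.
have := expR_ge1Dxn k z0; have f0 : 0 < (k.+1)`!%:R :> R by rewrite ltr0n fact_gt0.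
rewrite mulrC => h; rewrite mulrC -ler_pdivrMr //; move: h; rewrite mulrC; lra.
Qed.

Definition Ck k : R := 1 + 3 ^+ k * k`!%:R.
Lemma Ck_ge1 k : 1 <= Ck k. Proof. by rewrite /Ck lerDl mulr_ge0 // exprn_ge0. Qed.

(** Part of the exponent, [3 y^2 / 8], absorbs the power of [y]. What remains is, up to a constant,
    the density of standard deviation 2, whose integrability is known. *)
Lemma gauss_dom k (y : R) : `|y| ^+ k * expR (- y ^+ 2 / 2) <= Ck k * expR (- y ^+ 2 / 8).
Proof.
set z := 3 / 8 * y ^+ 2; have y2 : 0 <= y ^+ 2 by exact: sqr_ge0.
have z0 : 0 <= z by rewrite /z; lra.
have e : expR (- y ^+ 2 / 8) = expR z * expR (- y ^+ 2 / 2).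
  by rewrite -expRD; congr expR; rewrite /z; field.
rewrite e mulrA; apply: ler_wpM2r; first exact: expR_ge0.
apply: (@le_trans _ _ (1 + (y ^+ 2) ^+ k)).
  case: (lerP `|y| 1) => h.
    by apply: (@le_trans _ _ 1); [rewrite exprn_ile1|rewrite lerDl exprn_ge0].
  apply: (@le_trans _ _ ((y ^+ 2) ^+ k)); last by rewrite lerDr.
  rewrite -real_normK ?num_real // -exprM mul2n; apply: ler_weXn2l; [exact: ltW|by rewrite -addnn leq_addr].
rewrite /Ck mulrDl mul1r; apply: lerD; first by rewrite (le_trans _ (expR_ge1Dx z)) // lerDl.
apply: (@le_trans _ _ ((3 * z) ^+ k)).
  by apply: lerXn2r; rewrite ?nnegrE //; rewrite /z; lra.
by rewrite exprMn -mulrA ler_pM2l ?exprn_gt0 // pow_exp.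
Qed.

Lemma measurable_gk k : measurable_fun setT (gk k).
Proof.
by apply: measurable_funM; [apply: measurable_funX; exact: measurable_funB|exact: measurable_normal_pdf].
Qed.

Lemma gk_dom k x : `|gk k x| <= Ck k * (normal_peak 1 / normal_peak 2) * normal_pdf m 2 x.
Proof.
have p1 : 0 < normal_peak (1 : R) by rewrite normal_peak_gt0 ?oner_eq0.
have p2 : 0 < normal_peak (2 : R) by rewrite normal_peak_gt0.
rewrite /gk normrM pdfE normal_pdfE // /normal_fun (ger0_norm (x := _ * expR _)); last first.
  by rewrite mulr_ge0 ?expR_ge0 // ltW.
have -> : (2 : R) ^+ 2 *+ 2 = 8 by rewrite -mulr_natr; ring.
rewrite normrX (_ : Ck k * (normal_peak 1 / normal_peak 2) * (normal_peak 2 * expR (- (x - m) ^+ 2 / 8)) =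
   normal_peak 1 * (Ck k * expR (- (x - m) ^+ 2 / 8))); last by field; rewrite gt_eqF.
rewrite mulrCA ler_pM2l //; exact: gauss_dom.
Qed.

Lemma itg_gk k : leb.-integrable setT (EFin \o gk k).
Proof.
have h := integrableZl measurableT (Ck k * (normal_peak 1 / normal_peak 2)) (integrable_normal_pdf m (2 : R)).
apply: (le_integrable measurableT _ _ h).
  by apply/measurable_EFinP; exact: measurable_gk.
move=> x _; rewrite /= lee_fin; apply: (le_trans (gk_dom k x)); exact: ler_norm.
Qed.

(* The derivative of [- gk k]; that its integral vanishes is the recurrence
   satisfied by the moments. *)
Definition hk k x : R := gk k.+1 x - k%:R * gk k.-1 x.

Lemma hk_derive k (x : R) : is_derive x (1 : R) (fun y : R => - gk k y) (hk k x).
Proof.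
pose s : R -> R := id - cst m.
have d1 : is_derive x (1 : R) s 1.
  by have := is_deriveB (is_derive_id x (1:R)) (is_derive_cst m x (1:R)); rewrite subr0.
pose q : R -> R := (- 2^-1) \*: (s ^+ 2).
have d2 : is_derive x (1 : R) q (- (x - m)).
  apply: (is_derive_eq (is_deriveZ (- 2^-1) (is_deriveX 2 d1))).
  have -> : s x = x - m by [].
  by rewrite /GRing.scale /= /GRing.scale /= expr1 mulr1; field.
have d3 := is_derive1_comp (is_derive_expR (q x)) d2.
have d4 := is_deriveN (is_deriveZ (normal_peak 1) (is_deriveM (is_deriveX k d1) d3)).
have E : (fun y : R => - gk k y) = - (normal_peak 1 \*: (s ^+ k * (expR \o q))).
  apply/funext => y; rewrite /gk pdfE /= !fctE /= /q /s /GRing.scale /=; congr (- _).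
  have -> : - 2^-1 *: ((id - cst m) ^+ 2) y = - (y - m) ^+ 2 / 2.
    by rewrite /GRing.scale /= (_ : ((id - cst m) ^+ 2) y = (y - m) ^+ 2) //; field.
  by rewrite mulrCA.
rewrite E; apply: (is_derive_eq d4).
rewrite /hk /gk pdfE /q /s /= !fctE /GRing.scale /= /GRing.scale /=.
have -> : - 2^-1 * (x - m) ^+ 2 = - (x - m) ^+ 2 / 2 by field.
by rewrite mulr1 (exprS (x - m) k); ring.
Qed.

Lemma gk_cont k : continuous (gk k).
Proof.
move=> x; have [h _] := hk_derive k x.
have : {for x, continuous (fun y : R => - gk k y)} by apply: differentiable_continuous; apply/derivable1_diffP.
move=> c; have := @continuousN _ _ _ _ _ c.
have -> : (fun y => - - gk k y) = gk k by apply/funext => y; rewrite opprK.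
exact.
Qed.

Lemma gk_decay k (y : R) : `|y| * `|gk k (m + y)| <= Ck k.+1 * normal_peak 1.
Proof.
have p1 : 0 < normal_peak (1 : R) by rewrite normal_peak_gt0 ?oner_eq0.
rewrite /gk pdfE (_ : m + y - m = y); last by ring.
rewrite normrM (ger0_norm (x := _ * expR _)); last by rewrite mulr_ge0 ?expR_ge0 // ltW.
rewrite normrX mulrA -exprS mulrCA mulrC ler_pM2r //.
apply: (le_trans (gauss_dom k.+1 y)); rewrite ler_piMr ?(le_trans _ (Ck_ge1 _)) //.
by rewrite -[X in _ <= X](@expR0 R) ler_expR; have := sqr_ge0 y; lra.
Qed.

Definition Jk k : R := fine (\int[leb]_x (gk k x)%:E)%E.

Lemma Jk_E k : (\int[leb]_x (gk k x)%:E)%E = (Jk k)%:E.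
Proof. by rewrite /Jk fineK //; exact: (integrable_fin_num measurableT (itg_gk k)). Qed.

Lemma itg_hk k : leb.-integrable setT (EFin \o hk k).
Proof.
apply: (eq_integrable measurableT _ _ _ (integrableB measurableT (itg_gk k.+1) (integrableZl measurableT k%:R (itg_gk k.-1)))).
by move=> x _; rewrite /= /hk EFinB EFinM.
Qed.

Lemma int_hk k : (\int[leb]_x (hk k x)%:E)%E = (Jk k.+1 - k%:R * Jk k.-1)%:E.
Proof.
rewrite EFinB EFinM -!Jk_E -integralZl //; last exact: itg_gk.
rewrite -integralB //; [exact: itg_gk|apply: integrableZl => //; exact: itg_gk].
Qed.

Lemma int_hk_cc k (N : nat) : (\int[leb]_(x in `[(m - N.+1%:R)%R, (m + N.+1%:R)%R]) (hk k x)%:E)%E =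
  (gk k (m - N.+1%:R) - gk k (m + N.+1%:R))%:E.
Proof.
have cF : continuous (fun y : R => - gk k y).
  by move=> x; apply: differentiable_continuous; apply/derivable1_diffP; have [] := hk_derive k x.
rewrite (@continuous_FTC2 R (hk k) (fun y : R => - gk k y)).
- by rewrite -EFinB; congr (_%:E); ring.
- by rewrite ltrD2l; have : 0 < N.+1%:R :> R by []; lra.
- apply: continuous_subspaceT => x; rewrite /hk.
  apply: (@continuousB _ _ _ (gk k.+1) (fun x => k%:R * gk k.-1 x)); first exact: gk_cont.
  by apply: (@continuousM _ _ (fun=> k%:R)); [exact: cvg_cst|exact: gk_cont].
- split=> [x _||]; first by have [] := hk_derive k x.
  + by apply: cvg_at_right_filter; exact: cF.
  + by apply: cvg_at_left_filter; exact: cF.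
- by move=> x _; have [_ e] := hk_derive k x; rewrite derive1E.
Qed.

(** The integral of [hk] over [[m - N - 1, m + N + 1]] is a difference of boundary values, of size
    [O(1 / N)] by [gk_decay]; by dominated convergence the integral over the line vanishes. *)
Lemma Jk_rec k : Jk k.+1 = k%:R * Jk k.-1.
Proof.
pose f N (x : R) := ((hk k x)%:E * (\1_`[(m - N.+1%:R)%R, (m + N.+1%:R)%R] x)%:E)%E.
have L1 : (\int[leb]_x f N x)%E @[N --> \oo] --> (\int[leb]_x (hk k x)%:E)%E.
  apply: (@dominated_cvg _ _ _ leb setT measurableT f (EFin \o hk k) (fun x => `|(hk k x)%:E|%E)).
  - move=> N; apply: emeasurable_funM; first by apply: (measurable_int leb); exact: itg_hk.
    by apply/measurable_EFinP; exact: measurable_indic.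
  - move=> x _; apply: cvg_near_cst; near=> N.
    rewrite /f indicE mem_set ?mule1 //= in_itv /=.
    have : `|x - m| <= N%:R by near: N; exact: nbhs_infty_ger.
    by rewrite ler_norml -[N.+1%:R]natr1; lra.
  - by [].
  - exact: integrable_norm (itg_hk k).
  move=> N x _; rewrite /f abseM -[X in (_ <= X)%E]mule1 lee_wpmul2l //= lee_fin indicE.
  by case: (_ \in _); rewrite ?normr1 ?normr0.
have L2 : (\int[leb]_x f N x)%E @[N --> \oo] --> (0%R)%:E.
  have -> : (fun N => \int[leb]_x f N x)%E = EFin \o (fun N => gk k (m - N.+1%:R) - gk k (m + N.+1%:R)).
    apply/funext => N /=; rewrite -int_hk_cc [RHS]integral_mkcond.
    by apply: eq_integral => x _; rewrite /f patchE indicE; case: (_ \in _); rewrite ?mule1 ?mule0.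
  apply: cvg_EFin; first by near=> N.
  pose C := 2 * (Ck k.+1 * normal_peak 1).
  have C0 : 0 <= C by have := gk_decay k 0; rewrite normr0 mul0r /C; lra.
  apply: (squeeze_cvgr (f := fun N => - (C * harmonic N)) (h := fun N => C * harmonic N)).
  - near=> N; rewrite /= -ler_norml.
    apply: (le_trans (ler_normB _ _)); rewrite /harmonic ler_pdivlMr // mulrC mulrDr /C.
    have := gk_decay k (- N.+1%:R); have := gk_decay k (N.+1%:R); rewrite normrN !(ger0_norm (x := N.+1%:R)) //; lra.
  - rewrite -oppr0; apply: cvgN; rewrite -(mulr0 C); apply: cvgM; [exact: cvg_cst|exact: cvg_harmonic].
  - rewrite -(mulr0 C); apply: cvgM; [exact: cvg_cst|exact: cvg_harmonic].
have e : (Jk k.+1 - k%:R * Jk k.-1)%:E = 0%:E :> \bar R.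
  by rewrite -int_hk; exact: (cvg_unique (@ereal_hausdorff R) L1 L2).
by have /eqP := EFin_inj e; rewrite subr_eq0 => /eqP.
Unshelve. all: by end_near.
Qed.

Lemma Jk_mu1 k : Jk k = mu1 R k.
Proof.
have J0 : Jk 0 = 1.
  rewrite /Jk (_ : (fun x => (gk 0 x)%:E) = (fun x => (normal_pdf m 1 x)%:E)) ?integral_normal_pdf //.
  by apply/funext => x; rewrite /gk expr0 mul1r.
elim/ltn_ind: k => -[|[|k]] IH //; first by rewrite Jk_rec mul0r.
by rewrite Jk_rec /= IH.
Qed.

Context d (U : measurableType d) (P : probability U R) (Y : U -> R).
Hypothesis mY : measurable_fun setT Y.
Hypothesis law : forall B, measurable B -> P (Y @^-1` B) = normal_prob m 1 B.

Lemma int_law (f : R -> R) : measurable_fun setT f -> (forall y, 0 <= f y) ->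
  (\int[P]_w (f (Y w))%:E = \int[leb]_y (f y * normal_pdf m 1 y)%:E)%E.
Proof.
move=> mf f0.
have h1 := @ge0_integral_density _ _ _ _ R P (pushforward P Y) Y (fun=> 1) mY (@measurable_cst _ _ _ _ _ _) (fun=> ler01).
have nuE B : measurable B -> (\int[leb]_x (\1_B (id x) * normal_pdf m 1 x)%:E)%E = normal_prob m 1 B.
  move=> mB; rewrite /normal_prob [RHS]integral_mkcond; apply: eq_integral => x _.
  by rewrite patchE indicE; case: (_ \in _); rewrite ?mul1r ?mul0r.
have h2 := @ge0_integral_density _ _ _ _ R leb (normal_prob m 1) id (normal_pdf m 1) (@measurable_id _ _ _) (@measurable_normal_pdf _ _ _) (@normal_pdf_ge0 _ _ _) nuE f mf f0.
rewrite [RHS]h2.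
have h3 B : measurable B -> (\int[P]_x (\1_B (Y x) * 1)%:E)%E = normal_prob m 1 B.
  move=> mB; rewrite -law //; have mYB : measurable (Y @^-1` B) by rewrite -[X in measurable X]setTI; exact: mY.
  by under eq_integral do rewrite mulr1; rewrite (integral_indic _ measurableT mYB) setIT.
have := @ge0_integral_density _ _ _ _ R P (normal_prob m 1) Y (fun=> 1) mY (measurable_cst _) (fun=> ler01) h3 f mf f0.
by move=> <-; apply: eq_integral => w _; rewrite mulr1.
Qed.

Lemma itg_law k : itg P (fun w => (Y w - m) ^+ k).
Proof.
have mf : measurable_fun setT (fun y : R => `|(y - m) ^+ k|).
  by apply: measurableT_comp => //; apply: measurable_funX; exact: measurable_funB.
apply/integrableP; split.
  by apply/measurable_EFinP; apply: measurable_funX; exact: measurable_funB.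
have := int_law mf (fun y => normr_ge0 _); rewrite /= => ->.
have /integrableP[_] := itg_gk k; apply: le_lt_trans; apply: ge0_le_integral => //=.
- by move=> x _; rewrite lee_fin mulr_ge0 // normal_pdf_ge0.
- by apply/measurable_EFinP; apply: measurable_funM => //; exact: measurable_normal_pdf.
- by apply/measurable_EFinP; apply: measurableT_comp => //; exact: measurable_gk.
by move=> x _; rewrite lee_fin /gk normrM (ger0_norm (normal_pdf_ge0 _ _ _)).
Qed.

Lemma EX_law k : EX P (fun w => (Y w - m) ^+ k) = mu1 R k.
Proof.
have mx : measurable_fun setT (fun y : R => (y - m) ^+ k) by apply: measurable_funX; exact: measurable_funB.
pose fp (y : R) := (`|(y - m) ^+ k| + (y - m) ^+ k) / 2; pose fm (y : R) := (`|(y - m) ^+ k| - (y - m) ^+ k) / 2.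
have mn : measurable_fun setT (fun y : R => `|(y - m) ^+ k|) by exact: measurableT_comp.
have mfp : measurable_fun setT fp by apply: measurable_funM => //; exact: measurable_funD.
have mfm : measurable_fun setT fm by apply: measurable_funM => //; exact: measurable_funB.
have fp0 y : 0 <= fp y by rewrite /fp; have := lerNnormlW (lexx `|(y - m) ^+ k|); lra.
have fm0 y : 0 <= fm y by rewrite /fm; have := ler_norm ((y - m) ^+ k); lra.
have E y : (y - m) ^+ k = fp y - fm y by rewrite /fp /fm; field.
have b (f : R -> R) : measurable_fun setT f -> (forall y, `|f y| <= `|(y - m) ^+ k|) -> itg P (fun w => f (Y w)).
  move=> mf hf; apply: (itg_dom _ _ (itg_law k)) => [|w]; last exact: hf.
  exact: (measurableT_comp mf mY).
have ip : itg P (fun w => fp (Y w)).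
  apply: b => // y; rewrite ger0_norm // /fp; have := ler_norm ((y - m) ^+ k); lra.
have im : itg P (fun w => fm (Y w)).
  apply: b => // y; rewrite ger0_norm // /fm; have := lerNnormlW (lexx `|(y - m) ^+ k|); lra.
have bl (f : R -> R) : measurable_fun setT f -> (forall y, 0 <= f y <= `|(y - m) ^+ k|) ->
    leb.-integrable setT (fun y => (f y * normal_pdf m 1 y)%:E).
  move=> mf hf; apply: (le_integrable measurableT _ _ (itg_gk k)).
    by apply/measurable_EFinP; apply: measurable_funM => //; exact: measurable_normal_pdf.
  move=> x _; rewrite /= lee_fin /gk !normrM; apply: ler_wpM2r => //.
  by have /andP[h0 h1] := hf x; rewrite (ger0_norm h0).
apply: EFin_inj; rewrite -itgE; last exact: itg_law.
rewrite -Jk_mu1 -Jk_E.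
under eq_integral do rewrite E EFinB.
rewrite integralB // int_law // int_law // -integralB //.
- by apply: eq_integral => y _; rewrite -EFinB -mulrBl -E.
- by apply: bl => // y; rewrite fp0 /= /fp; have := ler_norm ((y - m) ^+ k); lra.
- by apply: bl => // y; rewrite fm0 /= /fm; have := lerNnormlW (lexx `|(y - m) ^+ k|); lra.
Qed.

End gaussian_moments.

(** * Moments of a Gaussian vector *)

Section multi.
Variables (R : realType) (n : nat).
Hypothesis n0 : (0 < n)%N.

Lemma prod_count (v : nat -> R) (s : seq nat) : all (fun c => c < n)%N s ->
  \prod_(c <- s) v c = \prod_(c < n) v c ^+ count_mem (c : nat) s.
Proof.
elim: s => [|a s IH] /=; first by rewrite big_nil big1.
move=> /andP[ha hs]; rewrite big_cons IH //.
under [RHS]eq_bigr do rewrite exprD.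
rewrite big_split /=; congr (_ * _); rewrite (bigD1 (Ordinal ha)) //= eqxx expr1 big1 ?mulr1 // => c hc.
suff -> : (a == c) = false by [].
by apply/negbTE; apply: contra hc => /eqP e; apply/eqP/val_inj.
Qed.

Lemma pw_prod K (v : nat -> R) I : pw n K v I = \prod_(c <- ds n K I) v c.
Proof.
rewrite pw_tz; elim: K I => [|k IH] I /=; first by rewrite big_nil.
by rewrite big_cons IH.
Qed.

Notation brl := (g_sigma_algebraType [set A : set 'rV[R]_n | open A]).

Lemma measurable_coord (j : 'I_n) : measurable_fun setT (fun x : brl => (x : 'rV[R]_n) ord0 j).
Proof.
apply: (measurability _ (RGenOInfty.measurableE R)) => //= _ [_ [r ->] <-].
rewrite setTI; apply: sub_sigma_algebra => /=.
apply: open_comp; last exact: rray_open.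
by move=> x _; exact: coord_continuous.
Qed.

Context d (U : measurableType d) (P : probability U R) (mu : 'rV[R]_n) (Y : U -> 'rV[R]_n).
Hypothesis hY : gaussian_id P mu Y.

Lemma measurable_sample : measurable_fun setT (Y : U -> brl).
Proof. by move=> _ B mB; rewrite setTI; apply: hY.1. Qed.

Lemma measurable_sample_coord (j : 'I_n) : measurable_fun setT (fun w => Y w ord0 j).
Proof. exact: (measurableT_comp (measurable_coord j) measurable_sample). Qed.

Lemma coord_law (j : 'I_n) B : measurable B -> P ((fun w => Y w ord0 j) @^-1` B) = normal_prob (mu ord0 j) 1 B.
Proof.
move=> mB; have := hY.2 (fun k => if k == j then B else setT).
rewrite (bigD1 j) //= eqxx big1 ?mule1; last first.
  by move=> k /negbTE ->; exact: probability_setT.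
move=> <-; last by move=> k; case: ifP.
congr (P _); apply/seteqP; split=> w /=; last by move=> /(_ j); rewrite eqxx.
by move=> h k; case: eqP => // ->.
Qed.

Lemma coord_indep (B : 'I_n -> set R) : (forall k, measurable (B k)) ->
  P [set w | forall k, B k (Y w ord0 k)] = (\prod_k P ((fun w => Y w ord0 k) @^-1` B k))%E.
Proof. by move=> mB; rewrite hY.2 //; apply: eq_bigr => k _; rewrite coord_law. Qed.

Definition cen w (c : nat) : R := coord (Y w) c - coord mu c.

Lemma sample_moment s : all (fun c => c < n)%N s ->
  itg P (fun w => \prod_(c <- s) cen w c) /\ EX P (fun w => \prod_(c <- s) cen w c) = mom R n s.
Proof.
move=> hs; pose f (k : 'I_n) (y : R) := (y - mu ord0 k) ^+ count_mem (k : nat) s.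
have mf k : measurable_fun setT (f k) by apply: measurable_funX; exact: measurable_funB.
have := indep_prod measurable_sample_coord coord_indep mf
  (fun k => itg_law (measurable_sample_coord k) (@coord_law k) _).
have -> : (fun w => \prod_(c <- s) cen w c) = (fun w => \prod_(k < n) f k (Y w ord0 k)).
  by apply/funext => w; rewrite prod_count //; apply: eq_bigr => k _; rewrite /f /cen !coordE.
move=> [h1 ->]; split=> //; apply: eq_bigr => k _.
exact: (EX_law (measurable_sample_coord k) (@coord_law k)).
Qed.

Variable D : nat.
Hypothesis D0 : (0 < D)%N.
Notation K2 := (D + D)%N.
Definition dvn (I : nat) (x : 'rV[R]_n) : R := pw n K2 (fun c => coord x c - coord mu c) I - momT R n D I.

Lemma measurable_dvn I : measurable_fun setT (dvn I : brl -> R).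
Proof.
apply: measurable_funB => //.
rewrite (_ : (fun x : brl => _) = (fun x : brl => \prod_(k < K2) (fun x : brl => coord x (I %/ n ^ k %% n)%N - coord mu (I %/ n ^ k %% n)%N) x)) //.
apply: measurable_prod => k _; apply: measurable_funB => //.
have hc : (I %/ n ^ k %% n < n)%N by rewrite ltn_mod.
rewrite (_ : (fun x : brl => _) = (fun x : brl => (x : 'rV[R]_n) ord0 (Ordinal hc))); first exact: measurable_coord.
by apply/funext => x; rewrite -(coordE x (Ordinal hc)).
Qed.

(** The second moment of the deviation is a variance, hence at most the moment of the doubled word
    [s ++ s], of order [4 D]. *)
Lemma dvn_moments I : [/\ itg P (fun w => dvn I (Y w)), itg P (fun w => dvn I (Y w) ^+ 2),
  EX P (fun w => dvn I (Y w)) = 0 & EX P (fun w => dvn I (Y w) ^+ 2) <= dev R D ^+ 2].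
Proof.
pose s := ds n K2 I; have hs : all (fun c => c < n)%N s by exact: all_ds.
pose p w := \prod_(c <- s) cen w c.
have hss : all (fun c => c < n)%N (s ++ s) by rewrite all_cat hs.
have [i1 e1] := sample_moment hs; have [i2 e2] := sample_moment hss.
have E w : dvn I (Y w) = p w - momT R n D I by rewrite /dvn pw_prod.
have E2 w : dvn I (Y w) ^+ 2 = \prod_(c <- s ++ s) cen w c - 2 * momT R n D I * p w + momT R n D I ^+ 2.
  by rewrite E big_cat /= -/(p w); ring.
have ip2 : itg P (fun w => 2 * momT R n D I * p w) by exact: itgZ.
have j1 : itg P (fun w => dvn I (Y w)).
  by under eq_fun do rewrite E; apply: itgB => //; exact: itg_cst.
have j2 : itg P (fun w => dvn I (Y w) ^+ 2).
  by under eq_fun do rewrite E2; apply: itgD; [exact: itgB|exact: itg_cst].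
split=> //.
  under [X in EX P X]eq_fun do rewrite E; rewrite EXB //; last exact: itg_cst.
  by rewrite EX_cst e1 subrr.
under [X in EX P X]eq_fun do rewrite E2.
have i3 : itg P (fun w => \prod_(c <- s ++ s) cen w c - 2 * momT R n D I * p w) by exact: itgB.
rewrite (EXD i3 (itg_cst P _)) (EXB i2 ip2) (EXZ _ i1) EX_cst e1 e2.
rewrite -/(momT R n D I); apply: (@le_trans _ _ (mom R n (s ++ s))).
  by have := sqr_ge0 (momT R n D I); lra.
have := mom_le R n0 hss; rewrite size_cat size_ds => h.
have d0 : 0 <= dev R D by rewrite /dev exprn_ge0.
rewrite -(@ler_pXn2r _ 2) ?nnegrE ?mom_ge0 ?exprn_ge0 //.
apply: (le_trans h); rewrite /dev -!exprM.
have -> : (K2 + K2 = 4 * D)%N by lia.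
by rewrite (_ : D * 2 * 2 = 4 * D)%N //; lia.
Qed.

End multi.

(** * Concentration by blocks *)

Section blocks.
Context d d' (U : measurableType d) (E : measurableType d') (R : realType) (G s M : nat).
Variables (P : probability U R) (X : 'I_G * 'I_s -> U -> E) (u : 'I_M -> E -> R) (V : R).
Hypothesis mX : forall k, measurable_fun setT (X k).
Hypothesis indep : forall B : 'I_G * 'I_s -> set E, (forall k, measurable (B k)) ->
  P [set w | forall k, B k (X k w)] = (\prod_k P (X k @^-1` B k))%E.
Hypothesis mu_ : forall I, measurable_fun setT (u I).
Hypothesis itg1 : forall I k, itg P (fun w => u I (X k w)).
Hypothesis itg2 : forall I k, itg P (fun w => u I (X k w) ^+ 2).
Hypothesis EX1 : forall I k, EX P (fun w => u I (X k w)) = 0.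
Hypothesis EX2 : forall I k, EX P (fun w => u I (X k w) ^+ 2) <= V.
Hypothesis V0 : 0 < V.
Hypothesis s0 : (0 < s)%N.
Hypothesis sM : (64 * M <= s)%N.

Definition bavg (b : 'I_G) (I : 'I_M) w : R := (\sum_(r < s) u I (X (b, r) w)) / s%:R.
Definition Zb b w : R := \sum_(I < M) bavg b I w ^+ 2.
Definition cV : R := 63 / V.
(* Independence bounds the expectation of [Qb] by [2 ^+ G], while each block with
   [V < Zb b w] contributes a factor 64. *)
Definition Qb w : R := \prod_(b < G) (1 + cV * Zb b w).

Notation opt := (option ('I_M * 'I_s * 'I_s)).
(** Encodes a summand of the factor of a block in [Qb]: [None] selects 1, and [Some (J, r1, r2)] the
    product of the values of [u J] at the samples [r1] and [r2]. Written as a product over all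
    samples of the block, each summand falls under [indep_prod]. *)
Definition coef (o : opt) : R := if o is Some _ then cV / s%:R ^+ 2 else 1.
Definition gfac (o : opt) (r : 'I_s) (x : E) : R :=
  if o is Some (J, r1, r2) then u J x ^+ ((r == r1) + (r == r2)) else 1.

Lemma sum_option (T : finType) (F : option T -> R) : \sum_o F o = F None + \sum_t F (Some t).
Proof.
rewrite (bigD1 None) //=; congr (_ + _).
rewrite (reindex_omap Some id) /=; first by apply: eq_bigl => t; rewrite eqxx.
by case.
Qed.

Lemma sum_triple (F : 'I_M -> 'I_s -> 'I_s -> R) :
  \sum_(t : 'I_M * 'I_s * 'I_s) F t.1.1 t.1.2 t.2 = \sum_I \sum_r1 \sum_r2 F I r1 r2.
Proof. by rewrite pair_big /= pair_big. Qed.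

Lemma prod_ind (r1 : 'I_s) (a : 'I_s -> R) : \prod_r a r ^+ (r == r1) = a r1.
Proof. by rewrite (bigD1 r1) //= eqxx expr1 big1 ?mulr1 // => r /negbTE ->. Qed.

Lemma factor_Zb b w : 1 + cV * Zb b w = \sum_o coef o * \prod_r gfac o r (X (b, r) w).
Proof.
rewrite sum_option /= big1 // mul1r; congr (_ + _).
pose F I r1 r2 : R := cV / s%:R ^+ 2 * \prod_r u I (X (b, r) w) ^+ ((r == r1) + (r == r2)).
rewrite (_ : \sum_t _ = \sum_(t : 'I_M * 'I_s * 'I_s) F t.1.1 t.1.2 t.2); last by apply: eq_bigr => -[[I r1] r2].
rewrite sum_triple.
rewrite /Zb mulr_sumr; apply: eq_bigr => I _.
rewrite /bavg.
transitivity (cV / s%:R ^+ 2 * ((\sum_(r < s) u I (X (b, r) w)) * (\sum_(r < s) u I (X (b, r) w)))).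
  by rewrite exprMn exprVn; ring.
rewrite mulr_suml mulr_sumr; apply: eq_bigr => r1 _.
rewrite mulr_sumr mulr_sumr; apply: eq_bigr => r2 _; congr (_ * _).
under eq_bigr do rewrite exprD.
by rewrite big_split /= !prod_ind.
Qed.

Lemma gfac_itg o k : itg P (fun w => gfac o k.2 (X k w)).
Proof.
case: o => [[[I r1] r2]|] /=; last exact: itg_cst.
case: (k.2 == r1); case: (k.2 == r2) => /=.
- exact: itg2.
- by under eq_fun do rewrite expr1; exact: itg1.
- by under eq_fun do rewrite expr1; exact: itg1.
- by under eq_fun do rewrite expr0; exact: itg_cst.
Qed.

Lemma measurable_gfac o r : measurable_fun setT (gfac o r).
Proof. by case: o => [[[I r1] r2]|] ; rewrite /gfac //; apply: measurable_funX; exact: mu_. Qed.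

Lemma Qb_expand w : Qb w = \sum_(f : {ffun 'I_G -> opt}) (\prod_b coef (f b)) * \prod_k gfac (f k.1) k.2 (X k w).
Proof.
rewrite /Qb; under eq_bigr do rewrite factor_Zb.
rewrite bigA_distr_bigA /=; apply: eq_bigr => f _; rewrite big_split /=; congr (_ * _).
by rewrite pair_big /=; apply: eq_bigr => -[b r].
Qed.

Lemma term_itg (f : {ffun 'I_G -> opt}) : itg P (fun w => \prod_k gfac (f k.1) k.2 (X k w)) /\
  EX P (fun w => \prod_k gfac (f k.1) k.2 (X k w)) = \prod_b \prod_r EX P (fun w => gfac (f b) r (X (b, r) w)).
Proof.
have [h1 h2] := indep_prod mX indep (fun k => measurable_gfac (f k.1) k.2) (fun k => gfac_itg (f k.1) k).
by split=> //; rewrite h2 pair_big /=; apply: eq_bigr => -[b r].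
Qed.

Lemma itg_Qb : itg P Qb.
Proof.
rewrite (_ : Qb = fun w => \sum_(f : {ffun 'I_G -> opt}) (\prod_b coef (f b)) * \prod_k gfac (f k.1) k.2 (X k w)); last by apply/funext => w; exact: Qb_expand.
by apply: itg_sum => f _; apply: itgZ; case: (term_itg f).
Qed.

(** Terms with [r1 != r2] vanish since the entries are centred, and the [M * s] diagonal ones are at
    most [63 / s ^ 2] each. The total is at most [1 + 63 M / s], and [64 M <= s]. *)
Lemma EX_block b : \sum_o coef o * \prod_r EX P (fun w => gfac o r (X (b, r) w)) <= 2.
Proof.
have c0 : 0 <= cV / s%:R ^+ 2 by rewrite /cV !divr_ge0 ?exprn_ge0 // ltW.
have s1 : 0 < s%:R :> R by rewrite ltr0n.
rewrite sum_option /= big1; last by move=> r _; rewrite EX_cst.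
rewrite mul1r -[X in _ <= X]/(1 + 1) lerD2l.
pose F I r1 r2 : R := cV / s%:R ^+ 2 * \prod_r EX P (fun w => u I (X (b, r) w) ^+ ((r == r1) + (r == r2))).
rewrite (_ : \sum_t _ = \sum_(t : 'I_M * 'I_s * 'I_s) F t.1.1 t.1.2 t.2); last by apply: eq_bigr => -[[I r1] r2].
rewrite sum_triple.
apply: (@le_trans _ _ (\sum_(I < M) \sum_(r1 < s) cV / s%:R ^+ 2 * V)).
  apply: ler_sum => I _; apply: ler_sum => r1 _; rewrite (bigD1 r1) //= [X in _ + X]big1 ?addr0.
    rewrite /F; apply: ler_wpM2l => //; rewrite (bigD1 r1) //= eqxx big1 ?mulr1; first exact: EX2.
    by move=> r /negbTE ->; under [X in EX P X]eq_fun do rewrite expr0; rewrite EX_cst.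
  move=> r2 ne; rewrite /F (bigD1 r1) //= eqxx eq_sym (negbTE ne) /= addn0.
  by under [X in EX P X]eq_fun do rewrite expr1; rewrite EX1 mul0r mulr0.
rewrite !sumr_const !card_ord -[_ *+ s]mulr_natr -[_ *+ M]mulr_natr /cV.
have -> : 63 / V / s%:R ^+ 2 * V * s%:R * M%:R = 63 * M%:R / s%:R.
  by field; rewrite !gt_eqF.
rewrite ler_pdivrMr // mul1r -natrM ler_nat; apply: leq_trans sM; exact: leq_mul.
Qed.

Lemma EX_Qb : EX P Qb <= 2 ^+ G.
Proof.
rewrite (_ : Qb = fun w => \sum_(f : {ffun 'I_G -> opt}) (\prod_b coef (f b)) * \prod_k gfac (f k.1) k.2 (X k w)); last by apply/funext => w; exact: Qb_expand.
rewrite EX_sum; last by move=> f _; apply: itgZ; case: (term_itg f).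
have -> : \sum_(f : {ffun 'I_G -> opt}) EX P (fun w => (\prod_b coef (f b)) * \prod_k gfac (f k.1) k.2 (X k w)) =
  \sum_(f : {ffun 'I_G -> opt}) \prod_b (coef (f b) * \prod_r EX P (fun w => gfac (f b) r (X (b, r) w))).
  by apply: eq_bigr => f _; have [h1 h2] := term_itg f; rewrite EXZ // h2 big_split.
rewrite -(bigA_distr_bigA (fun b o => coef o * \prod_r EX P (fun w => gfac o r (X (b, r) w)))) /=.
have -> : 2 ^+ G = \prod_(b < G) (2 : R) by rewrite prodr_const card_ord.
apply: ler_prod => b _; rewrite EX_block andbT.
have c0 : 0 <= cV / s%:R ^+ 2 by rewrite /cV !divr_ge0 ?exprn_ge0 // ltW.
apply: sumr_ge0 => o _; case: o => [[[I r1] r2]|] /=; last first.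
  by rewrite mul1r big1 // => r _; rewrite EX_cst.
apply: mulr_ge0 => //; have [e|ne] := eqVneq r1 r2.
  apply: prodr_ge0 => r _; apply: EX_ge0 => w; rewrite -e; case: (r == r1); last by rewrite expr0.
  exact: sqr_ge0.
rewrite (bigD1 r1) //= eqxx (negbTE ne) /= addn0.
by under [X in EX P X]eq_fun do rewrite expr1; rewrite EX1 mul0r.
Qed.

Lemma Zb_ge0 b w : 0 <= Zb b w. Proof. by apply: sumr_ge0 => I _; exact: sqr_ge0. Qed.

Lemma fac_ge1 b w : 1 <= 1 + cV * Zb b w.
Proof. by rewrite lerDl mulr_ge0 ?Zb_ge0 // /cV divr_ge0 // ltW. Qed.

Lemma Qb_ge0 w : 0 <= Qb w.
Proof. by apply: prodr_ge0 => b _; apply: le_trans (fac_ge1 b w). Qed.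

Definition goodb w : {set 'I_G} := [set b | Zb b w <= V].

(** If at least half of the blocks were bad, their factors, each at least [1 + 63 = 8 ^ 2], would
    give [8 ^ G]; the other factors are at least 1. *)
Lemma goodb_large w : Qb w < 8 ^+ G -> (G < 2 * #|goodb w|)%N.
Proof.
move=> h; rewrite ltnNge; apply/negP => hc.
have cb : (#|~: goodb w| + #|goodb w| = G)%N by rewrite addnC cardsC card_ord.
suff : 8 ^+ G <= Qb w by rewrite leNgt h.
apply: (@le_trans _ _ (64 ^+ #|~: goodb w|)).
  have -> : (64 : R) = 8 ^+ 2 by ring.
  rewrite -exprM; apply: ler_weXn2l; first by rewrite ler1n.
  lia.
rewrite /Qb (bigID (mem (~: goodb w))) /= -[X in X <= _]mulr1; apply: ler_pM => //.
- rewrite -prodr_const; apply: ler_prod => b; rewrite inE inE -ltNge => hb; rewrite ler0n /=.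
  have : 63 <= cV * Zb b w by rewrite /cV mulrAC ler_pdivlMr // ler_pM2l // ltW.
  lra.
- by elim/big_rec: _ => // b x _ hx; have := fac_ge1 b w; nra.
Qed.

(** Markov inequality for [Qb]: mean at most [2 ^ G] against the level [8 ^ G]. *)
Lemma goodb_event : exists2 Ev, measurable Ev & ((1 - (4^-1) ^+ G)%:E <= P Ev)%E /\ forall w, Ev w -> (G < 2 * #|goodb w|)%N.
Proof.
have mQ : measurable_fun setT Qb by have /integrableP[/measurable_EFinP] := itg_Qb.
have g8 : 0 < (8 : R) ^+ G by rewrite exprn_gt0.
have mS : measurable [set w | 8 ^+ G <= Qb w].
  by rewrite -[X in measurable X]setTI; exact: (measurable_fun_le (f := fun=> 8 ^+ G)).
exists (~` [set w | 8 ^+ G <= Qb w]); first exact: measurableC.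
split; last by move=> w /= /negP; rewrite -ltNge => /goodb_large.
rewrite probability_setC // EFinB; apply: leeB => //.
apply: (le_trans (markov_EX itg_Qb Qb_ge0 g8)); rewrite lee_fin ler_pdivrMr //.
rewrite -exprMn; have -> : 4^-1 * 8 = 2 :> R by field.
exact: EX_Qb.
Qed.

Lemma sqr_mean (T : finType) (A : {set T}) (a : T -> R) : (0 < #|A|)%N ->
  ((\sum_(t in A) a t) / #|A|%:R) ^+ 2 <= (\sum_(t in A) a t ^+ 2) / #|A|%:R.
Proof.
move=> A0; have c0 : 0 < #|A|%:R :> R by rewrite ltr0n.
set c := #|A|%:R in c0 *; set m := (\sum_(t in A) a t) / c.
have : 0 <= \sum_(t in A) (a t - m) ^+ 2 by apply: sumr_ge0 => t _; exact: sqr_ge0.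
have -> : \sum_(t in A) (a t - m) ^+ 2 = \sum_(t in A) a t ^+ 2 - 2 * m * \sum_(t in A) a t + c * m ^+ 2.
  have -> : c * m ^+ 2 = \sum_(t in A) m ^+ 2 by rewrite sumr_const /c mulr_natl.
  rewrite mulr_sumr -sumrB -big_split /=; apply: eq_bigr => t _; ring.
have -> : \sum_(t in A) a t = m * c by rewrite /m divfK // gt_eqF.
move=> h; rewrite ler_pdivlMr //; nra.
Qed.

(** The blocks have equal size, so the mean over their union is the mean of their means, and a mean
    of vectors of squared norm at most [V] has squared norm at most [V]. *)
Lemma goodb_avg w : (G < 2 * #|goodb w|)%N ->
  \sum_(I < M) ((\sum_(b in goodb w) \sum_(r < s) u I (X (b, r) w)) / (#|goodb w| * s)%:R) ^+ 2 <= V.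
Proof.
move=> hG; have c0 : (0 < #|goodb w|)%N by lia.
have c1 : 0 < #|goodb w|%:R :> R by rewrite ltr0n.
apply: (@le_trans _ _ (\sum_(I < M) (\sum_(b in goodb w) bavg b I w ^+ 2) / #|goodb w|%:R)).
  apply: ler_sum => I _; apply: le_trans (sqr_mean _ c0).
  rewrite le_eqVlt; apply/orP; left; apply/eqP; congr (_ ^+ 2).
  by rewrite /bavg -mulr_suml natrM invfM mulrA mulrAC.
rewrite -mulr_suml ler_pdivrMr // exchange_big /=.
apply: (@le_trans _ _ (\sum_(b in goodb w) V)); last by rewrite sumr_const mulr_natr.
by apply: ler_sum => b; rewrite inE.
Qed.

End blocks.

(** * From the random samples to the input list *)

Section transfer.
Variables (R : realType) (n m : nat).
Implicit Types (T : seq 'rV[R]_n).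

(** The permutation is tracked on positions rather than on values, since an adversarial point may
    coincide with a sample; [S0] marks the positions in [T] of the samples selected by [A]. *)
Lemma samples_in_list T (x : 'I_m -> 'rV[R]_n) bad (A : {set 'I_m}) :
  perm_eq T ([seq x i | i : 'I_m] ++ bad) ->
  exists S0 : pred nat, forall F : 'rV[R]_n -> R,
    \sum_(i < size T | S0 i) F (nth 0 T i) = \sum_(j in A) F (x j).
Proof.
set L := _ ++ bad => /(perm_iotaP 0)[Is hIs eT].
pose Q p := if (insub p : option 'I_m) is Some j then j \in A else false.
have sT : size T = size Is by rewrite eT size_map.
have sL : size L = (m + size bad)%N by rewrite size_cat size_map size_enum_ord.
exists (fun i => Q (nth 0%N Is i)) => F.
have -> : \sum_(i < size T | Q (nth 0%N Is i)) F (nth 0 T i) = \sum_(p <- Is | Q p) F (nth 0 L p).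
  rewrite (big_nth 0%N) big_mkord sT; apply: eq_bigr => i _.
  by rewrite eT (nth_map 0%N).
rewrite (perm_big _ hIs) /= sL iotaD big_cat /= add0n [X in _ + X]big1_seq ?addr0; last first.
  move=> p /andP[]; rewrite mem_iota /Q; case: insubP => // j hj _ _ /andP[h _].
  by move: hj; rewrite ltnNge h.
have -> : iota 0 m = index_iota 0 m by rewrite /index_iota subn0.
rewrite big_mkord; apply: eq_big => [j|j _]; first by rewrite /Q valK.
rewrite /L nth_cat size_map size_enum_ord ltn_ord; congr F.
by rewrite (nth_map j) ?size_enum_ord // nth_ord_enum.
Qed.

End transfer.

Section from_average.
Variables (R : realType) (n D : nat) (K : finType) (A : {set K}) (v : K -> nat -> R).
Hypothesis n0 : (0 < n)%N.
Hypothesis D0 : (0 < D)%N.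
Hypothesis A0 : (0 < #|A|)%N.
Notation K2 := (D + D)%N.
Hypothesis havg : \sum_(I < n ^ K2) ((\sum_(k in A) (pw n K2 (v k) I - momT R n D I)) / #|A|%:R) ^+ 2 <= dev R D ^+ 2.

Let avg (I : nat) : R := (\sum_(k in A) pw n K2 (v k) I) / #|A|%:R.

Let c0 : 0 < #|A|%:R :> R. Proof. by rewrite ltr0n. Qed.

Let havg' : \sum_(I < n ^ K2) (avg I - momT R n D I) ^+ 2 <= dev R D ^+ 2.
Proof.
apply: le_trans havg; rewrite le_eqVlt; apply/orP; left; apply/eqP; apply: eq_bigr => I _; congr (_ ^+ 2).
have e : \sum_(k in A) momT R n D I = momT R n D I * #|A|%:R by rewrite sumr_const mulr_natr.
by rewrite sumrB e [RHS]mulrBl (mulfK (lt0r_neq0 c0)).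
Qed.

Let ip_avg L : ip n D L avg = (\sum_(k in A) ip n D L (pw n K2 (v k))) / #|A|%:R.
Proof.
rewrite /ip exchange_big /= mulr_suml; apply: eq_bigr => I _.
by rewrite /avg -mulr_sumr mulrA.
Qed.

Let tr_avg : tr n D avg = (\sum_(k in A) sq n (v k) ^+ D) / #|A|%:R.
Proof.
under eq_bigr do rewrite -tr_pw //.
by rewrite /tr exchange_big /= mulr_suml; apply: eq_bigr.
Qed.

Lemma qf_from_average L : valid n D L -> \sum_(k in A) qf n D L (v k) <= #|A|%:R * sigma R D.
Proof.
move=> hL; have := valid_moment n0 D0 hL havg'; rewrite ip_avg tr_avg.
rewrite mulrA -mulrDl ler_pdivrMr // [sigma R D * _]mulrC; apply: le_trans.
by rewrite mulr_sumr -big_split.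
Qed.

Lemma valid_pw (u : nat -> R) : sq n u = 1 -> valid n D (pw n K2 u).
Proof.
move=> hu; split; first exact: symm_pw.
  by rewrite tr_pw // hu expr1n ler1n.
move=> c; apply: addr_ge0.
  rewrite (_ : \sum_(a < n ^ D) _ = (\sum_(a < n ^ D) c a * pw n D u a) ^+ 2) ?sqr_ge0 //.
  rewrite expr2 mulr_suml; apply: eq_bigr => a _; rewrite mulr_sumr.
  by apply: eq_bigr => b _; rewrite pw_split //; ring.
apply: mulr_ge0; first exact: ltW (eps_gt0 R n0 D).
by apply: sumr_ge0 => a _; rewrite -expr2 sqr_ge0.
Qed.

(** The rank one tensor of a unit vector is valid, and its quasi-metric dominates the directional
    moment. *)
Lemma dot_from_average u : sq n u = 1 -> \sum_(k in A) dot n u (v k) ^+ K2 <= #|A|%:R * sigma R D.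
Proof.
move=> hu; apply: le_trans (qf_from_average (valid_pw hu)); apply: ler_sum => k _.
rewrite /qf ip_pw_pw // lerDl; apply: mulr_ge0; first by apply: mulr_ge0 => //; exact: ltW (eps_gt0 R n0 D).
by rewrite exprn_ge0 // sq_ge0.
Qed.

End from_average.

Section samples.
Context d (U : measurableType d) (R : realType) (P : probability U R).
Variables (n m : nat) (mu : 'rV[R]_n) (X : 'I_m -> U -> 'rV[R]_n).
Notation brl := (g_sigma_algebraType [set A : set 'rV[R]_n | open A]).

Lemma indep_embed (K : finType) (f : K -> 'I_m) (B : K -> set brl) : mutually_independent P X -> injective f ->
  (forall k, measurable (B k)) ->
  P [set w | forall k, B k (X (f k) w)] = (\prod_k P ((X (f k) : U -> brl) @^-1` B k))%E.
Proof.
move=> hX fi mB.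
pose B' i : set 'rV[R]_n := if [pick k | f k == i] is Some k then B k else setT.
have E k : B' (f k) = B k.
  by rewrite /B'; case: pickP => [k' /eqP /fi -> //|/(_ k)]; rewrite eqxx.
have := hX (f @: [set: K])%SET B'; rewrite big_imset /=; last by move=> ? ? _ _; exact: fi.
have -> : [set w | forall i, i \in (f @: [set: K])%SET -> B' i (X i w)] = [set w | forall k, B k (X (f k) w)].
  apply/seteqP; split=> w /= h.
    by move=> k; rewrite -E; apply: h; apply: imset_f; rewrite inE.
  by move=> i /imsetP[k _ ->]; rewrite E.
move=> -> => [|i /imsetP[k _ ->]]; last by rewrite E; exact: mB.
by apply: eq_big => [k|k _]; rewrite ?inE // E.
Qed.

Theorem good_samples D N (al : R) G (T : U -> seq 'rV[R]_n) : (0 < n)%N -> (0 < D)%N -> (0 < G)%N -> 0 < al ->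
  gaussian_samples P mu X -> 2 * al * N%:R <= m%:R -> (G * (64 * n ^ (D + D)) <= m)%N ->
  (forall o, size (T o) = N /\ exists bad, perm_eq (T o) ([seq X i o | i : 'I_m] ++ bad)) ->
  exists2 Ev, measurable Ev & ((1 - (4^-1) ^+ G)%:E <= P Ev)%E /\
    forall o, Ev o -> exists S0, good_data n D N al (fun i => coord (nth 0 (T o) i)) S0 (coord mu).
Proof.
move=> n0 D0 G0 al0 [hg hi] hm hGm hT.
(* Rounding discards fewer than [G] samples; as [s] is positive, the blocks still contain at least
   half of the [m] samples. *)
pose s := (m %/ G)%N.
have sM : (64 * n ^ (D + D) <= s)%N by rewrite /s leq_divRL // mulnC.
have M0 : (0 < n ^ (D + D))%N by rewrite expn_gt0 n0.
have s0 : (0 < s)%N by lia.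
have Gs : (G * s <= m)%N by rewrite mulnC leq_trunc_div.
have Gs2 : (m <= 2 * (G * s))%N.
  have := divn_eq m G; have := ltn_pmod m G0; rewrite -/s; nia.
have hf (k : 'I_G * 'I_s) : (k.1 * s + k.2 < m)%N.
  have := ltn_ord k.1; have := ltn_ord k.2; nia.
pose f k := Ordinal (hf k).
have fi : injective f.
  move=> [b r] [b' r'] /(congr1 val) /= e; have rl := ltn_ord r; have rl' := ltn_ord r'.
  have e1 : (b : nat) = b'.
    have := congr1 (divn^~ s) e; by rewrite !divnMDl // !divn_small // !addn0.
  have e2 : (r : nat) = r' by move: e; rewrite e1 => /addnI.
  by congr (_, _); apply: val_inj.
pose u (I : 'I_(n ^ (D + D))) : brl -> R := dvn mu D I.
have dv I k := @dvn_moments _ n n0 _ _ P mu (X (f k)) (hg (f k)) D D0 I.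
have d0 : 0 < dev R D ^+ 2.
  by rewrite /dev -exprM; apply: exprn_gt0; rewrite ltr0n; lia.
have [Ev mEv [hEv hgood]] := @goodb_event _ _ U brl R G s (n ^ (D + D))%N P (fun k => X (f k)) u (dev R D ^+ 2)
  (fun k => measurable_sample (hg (f k))) (fun B mB => indep_embed hi fi mB) (fun I => measurable_dvn n0 mu D I)
  (fun I k => let: And4 h _ _ _ := dv I k in h) (fun I k => let: And4 _ h _ _ := dv I k in h)
  (fun I k => let: And4 _ _ h _ := dv I k in h) (fun I k => let: And4 _ _ _ h := dv I k in h) d0 s0 sM.
exists Ev => //; split=> // o ho; have {}hgood := hgood _ ho.
have [sT [bad hbad]] := hT o.
set g := goodb _ _ _ o in hgood.
have hav := goodb_avg d0 s0 sM hgood.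
pose A : {set 'I_G * 'I_s} := finset.setX g [set: 'I_s]%SET.
have cA : #|A| = (#|g| * s)%N by rewrite cardsX cardsT card_ord.
have A0 : (0 < #|A|)%N by rewrite cA muln_gt0 s0 andbT; lia.
have sumA (F : 'I_G * 'I_s -> R) : \sum_(k in A) F k = \sum_(b in g) \sum_(r < s) F (b, r).
  rewrite pair_big /=; apply: eq_big => [[b r]|[b r] _] //; by rewrite !inE /= andbT.
have [S0 hS] := samples_in_list (f @: A) hbad.
have hSA (F : 'rV[R]_n -> R) : \sum_(i < N | S0 i) F (nth 0 (T o) i) = \sum_(k in A) F (X (f k) o).
  by rewrite -sT hS big_imset //= => ? ? _ _; exact: fi.
have hs0 : Submission.s0 R N S0 = #|A|%:R by rewrite /Submission.s0 (hSA (fun=> 1)) sumr_const.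
pose v k (c : nat) : R := coord (X (f k) o) c - coord mu c.
have havg : \sum_(I < n ^ (D + D)) ((\sum_(k in A) (pw n (D + D) (v k) I - momT R n D I)) / #|A|%:R) ^+ 2 <= dev R D ^+ 2.
  by apply: le_trans hav; apply: ler_sum => I _; rewrite sumA cA.
exists S0; split.
(* More than half of the blocks are good and the blocks cover half of the samples, so a quarter of
   [m >= 2 al N] remains: this is the [al N / 2] of [good_data]. *)
- rewrite hs0 cA; have h1 : (m <= 4 * (#|g| * s))%N by nia.
  have : m%:R <= 4 * (#|g| * s)%:R :> R by rewrite -natrM ler_nat.
  lra.
- move=> L hL; rewrite hs0 (hSA (fun x => qf n D L (fun c => coord x c - coord mu c))).
  exact: (qf_from_average n0 D0 A0 havg hL).
- move=> z hz; rewrite hs0 (hSA (fun x => dot n z (fun c => coord x c - coord mu c) ^+ (D + D))).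
  exact: (dot_from_average n0 D0 A0 havg hz).
Qed.

End samples.

(** * The quantitative bounds *)

Section bounds.
Variable R : realType.

(** From [(7 / 5) ^ 2 <= 2] and [ln (5 / 7) <= - 2 / 7]. *)
Lemma ln2_ge : 4 / 7 <= ln (2 : R).
Proof.
have h : ln (5 / 7 : R) <= - (2 / 7).
  have := @le_ln1Dx R (- (2 / 7)); rewrite (_ : 1 + - (2 / 7) = 5 / 7 :> R); last by field.
  by apply; lra.
have e : ln (7 / 5 : R) = - ln (5 / 7) by rewrite -lnV ?posrE ?invf_div //; lra.
have : ln ((7 / 5 : R) ^+ 2) <= ln 2 by rewrite ler_ln ?posrE ?exprn_gt0 //; lra.
by rewrite lnXn; [rewrite e mulr2n; lra|lra].
Qed.

Lemma log_inv_ge (tau : R) : 4 / 7 <= log_inv tau.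
Proof.
apply: (le_trans ln2_ge); rewrite /log_inv ler_ln ?posrE //; last by rewrite lt_max ltr0Sn.
by rewrite le_max lexx.
Qed.

Section poly.
Variable c1 : R.
Definition adm (n d : nat) (al tau : R) (N An : nat) := [/\ (0 < n)%N, (0 < d)%N, 0 < al < 2^-1,
  N%:R <= c1 * sample_scale n d al tau & An%:R <= 2 / al].
(** The functions bounded by [time_base ^ O(d)]. This class is closed under sums, products and fixed
    powers, which reduces the time bound to its ingredients. *)
Definition pb (f : nat -> nat -> R -> R -> nat -> nat -> R) :=
  (forall n d al tau N An, adm n d al tau N An -> 0 <= f n d al tau N An) /\
  exists k : nat, forall n d al tau N An, adm n d al tau N An -> f n d al tau N An <= time_base n d al tau ^+ (k * d).

(** The base is at least [2 * 4 / 7 > 1] because [al < 1 / 2] and [log_inv >= 4 / 7]. This lets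
    constants be absorbed by powers, through [(8 / 7) ^ 6 >= 2]. *)
Lemma base_parts n d al tau N An : adm n d al tau N An -> let b := time_base n d al tau in
  [/\ 8 / 7 <= b, n%:R <= b, d%:R <= b, log_inv tau <= b & 1 / al <= 2 * b].
Proof.
move=> [n0 d0 /andP[a0 a1] _ _] b; have l := log_inv_ge tau; rewrite {}/b /time_base.
have n1 : 1 <= n%:R :> R by rewrite ler1n.
have d1 : 1 <= d%:R :> R by rewrite ler1n.
have i2 : 2 <= al^-1 by rewrite -[2]invrK lef_pV2 ?posrE // ltW.
rewrite div1r; set i := al^-1 in i2 *; set u := n%:R in n1 *; set v := d%:R in d1 *; set w := log_inv tau in l *.
have nd : 1 <= u * v by nra.
have li : 8 / 7 <= w * i by nra.
have uv0 : 0 <= u * v by lra.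
have wi0 : 0 <= w * i by lra.
rewrite -mulrA; split.
- nra.
- have : 1 <= v * (w * i) by nra.
  rewrite -mulrA => h; nra.
- have : 1 <= u * (w * i) by nra.
  rewrite [u * v]mulrC -mulrA => h; nra.
- have : w <= w * i by nra.
  move=> h; apply: (le_trans h); nra.
- have : 4 / 7 * i <= w * i by rewrite ler_pM2r //; lra.
  have : w * i <= u * v * (w * i) by nra.
  nra.
Qed.

Lemma pb_of (f : nat -> nat -> R -> R -> nat -> nat -> R) k :
  (forall n d al tau N An, adm n d al tau N An -> 0 <= f n d al tau N An <= time_base n d al tau ^+ k) -> pb f.
Proof.
move=> h; split=> [n d al tau N An a|]; first by case/andP: (h _ _ _ _ _ _ a).
exists k => n d al tau N An a; have /andP[_ h2] := h _ _ _ _ _ _ a; apply: (le_trans h2).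
have [b1 _ _ _ _] := base_parts a; case: a => _ d0 _ _ _.
by apply: ler_weXn2l; [lra|rewrite leq_pmulr].
Qed.

Lemma pbM f g : pb f -> pb g -> pb (fun n d al tau N An => f n d al tau N An * g n d al tau N An).
Proof.
move=> [f0 [k hf]] [g0 [l hg]]; split=> [n d al tau N An a|]; first by rewrite mulr_ge0 ?f0 ?g0.
by exists (k + l)%N => n d al tau N An a; rewrite mulnDl exprD; apply: ler_pM; rewrite ?f0 ?g0 ?hf ?hg.
Qed.

Lemma pb_cst (c : R) : 0 <= c -> pb (fun _ _ _ _ _ _ => c).
Proof.
move=> c0; apply: (@pb_of _ (6 * (Num.truncn c).+1)) => n d al tau N An a; rewrite c0 /=.
have [b1 _ _ _ _] := base_parts a; rewrite exprM.
have h2 : 2 <= time_base n d al tau ^+ 6.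
  apply: (@le_trans _ _ ((8 / 7) ^+ 6)); first by rewrite -[X in X <= _]divr1 ; lra.
  by apply: lerXn2r; rewrite ?nnegrE //; lra.
apply: (@le_trans _ _ (2 ^+ (Num.truncn c).+1)); last by apply: lerXn2r; rewrite ?nnegrE ?exprn_ge0 //; lra.
apply: ltW; apply: (lt_le_trans (truncnS_gt c)); rewrite -natrX ler_nat ltnW // ltn_expl //.
Qed.

Lemma pbD f g : pb f -> pb g -> pb (fun n d al tau N An => f n d al tau N An + g n d al tau N An).
Proof.
move=> hf hg; have [f0 [k h1]] := hf; have [g0 [l h2]] := hg; have [_ [j hj]] := pb_cst (ler0n R 2).
split=> [n d al tau N An a|]; first by rewrite addr_ge0 ?f0 ?g0.
exists (j + (k + l))%N => n d al tau N An a; rewrite !mulnDl !exprD.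
have [b1 _ _ _ _] := base_parts a; set b := time_base n d al tau in b1.
have p t : 1 <= b ^+ t by rewrite exprn_ege1 //; lra.
have := hj _ _ _ _ _ _ a; have := h1 _ _ _ _ _ _ a; have := h2 _ _ _ _ _ _ a; rewrite -/b.
have := p (k * d)%N; have := p (l * d)%N; set x := b ^+ (k * d); set y := b ^+ (l * d); set z := b ^+ (j * d).
move=> y1 x1 gy fx z2.
have : x + y <= 2 * (x * y) by nra.
have : 2 * (x * y) <= z * (x * y) by rewrite ler_wpM2r // mulr_ge0; lra.
lra.
Qed.

Lemma pbX f e : pb f -> pb (fun n d al tau N An => f n d al tau N An ^+ e).
Proof.
move=> [f0 [k h]]; split=> [n d al tau N An a|]; first by rewrite exprn_ge0 // f0.
exists (k * e)%N => n d al tau N An a; rewrite mulnAC exprM; apply: lerXn2r; rewrite ?nnegrE ?f0 ?h //.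
by apply: le_trans (f0 _ _ _ _ _ _ a) (h _ _ _ _ _ _ a).
Qed.

Lemma pb_le f g : pb g -> (forall n d al tau N An, adm n d al tau N An -> 0 <= f n d al tau N An <= g n d al tau N An) -> pb f.
Proof.
move=> [g0 [k h]] hf; split=> [n d al tau N An a|]; first by case/andP: (hf _ _ _ _ _ _ a).
by exists k => n d al tau N An a; have /andP[_ h2] := hf _ _ _ _ _ _ a; apply: (le_trans h2); exact: h.
Qed.

Lemma pb_n : pb (fun n _ _ _ _ _ => n%:R).
Proof. by apply: (@pb_of _ 1) => n d al tau N An /base_parts[_ h _ _ _]; rewrite ler0n expr1. Qed.
Lemma pb_d : pb (fun _ d _ _ _ _ => d%:R).
Proof. by apply: (@pb_of _ 1) => n d al tau N An /base_parts[_ _ h _ _]; rewrite ler0n expr1. Qed.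
Lemma pb_l : pb (fun _ _ _ tau _ _ => log_inv tau).
Proof.
by apply: (@pb_of _ 1) => n d al tau N An /base_parts[_ _ _ h _]; rewrite expr1 h andbT; have := log_inv_ge tau; lra.
Qed.
Lemma pb_a : pb (fun _ _ al _ _ _ => 1 / al).
Proof.
apply: (@pb_le _ (fun n d al tau _ _ => 2 * time_base n d al tau)).
  apply: pbM; first exact: pb_cst.
  by apply: (@pb_of _ 1) => n d al tau N An /base_parts[h _ _ _ _]; rewrite expr1 lexx andbT; lra.
move=> n d al tau N An a; have [_ _ _ _ h] := base_parts a; case: a => _ _ /andP[a0 _] _ _.
by rewrite h andbT divr_ge0 // ltW.
Qed.

Lemma pbXd f e : (forall n d al tau N An, adm n d al tau N An -> 0 <= f n d al tau N An <= time_base n d al tau) ->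
  pb (fun n d al tau N An => f n d al tau N An ^+ (e * d)).
Proof.
move=> h; split=> [n d al tau N An a|]; first by have /andP[h1 _] := h _ _ _ _ _ _ a; rewrite exprn_ge0.
exists e => n d al tau N An a; have /andP[h1 h2] := h _ _ _ _ _ _ a.
by apply: lerXn2r; rewrite ?nnegrE // (le_trans h1 h2).
Qed.

Lemma pb_nd e : pb (fun n d _ _ _ _ => n%:R ^+ (e * d)).
Proof. by apply: (@pbXd (fun n _ _ _ _ _ => n%:R)) => n d al tau N An /base_parts[_ h _ _ _]; rewrite ler0n. Qed.
Lemma pb_dd e : pb (fun _ d _ _ _ _ => d%:R ^+ (e * d)).
Proof. by apply: (@pbXd (fun _ d _ _ _ _ => d%:R)) => n d al tau N An /base_parts[_ _ h _ _]; rewrite ler0n. Qed.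

Lemma fact_le_pow d : (d`! <= d ^ d)%N.
Proof.
have h e : (e <= d)%N -> (e`! <= d ^ e)%N.
  by elim: e => // e IH he; rewrite factS expnS; apply: leq_mul => //; exact: IH (ltnW he).
exact: h.
Qed.

Lemma pb_N : pb (fun _ _ _ _ N _ => N%:R).
Proof.
apply: (@pb_le _ (fun n d al tau _ _ => `|c1| * (d%:R ^+ (2 * d) * n%:R ^+ (4 * d) * log_inv tau * (1 / al) ^+ 7))).
  apply: pbM; first exact: pb_cst.
  by apply: pbM; [apply: pbM; [apply: pbM; [exact: pb_dd|exact: pb_nd]|exact: pb_l]|apply: pbX; exact: pb_a].
move=> n d al tau N An a; rewrite ler0n /=; have [n0 d0 /andP[a0 _] hN _] := a; apply: (le_trans hN).
have l0 : 0 <= log_inv tau by have := log_inv_ge tau; lra.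
have s0 : 0 <= sample_scale n d al tau.
  by rewrite /sample_scale divr_ge0 ?exprn_ge0 ?(ltW a0) // mulr_ge0 // mulr_ge0 ?exprn_ge0.
apply: (@le_trans _ _ (`|c1| * sample_scale n d al tau)); first by rewrite ler_wpM2r // ler_norm.
rewrite ler_wpM2l // /sample_scale div1r exprVn; apply: ler_wpM2r; first by rewrite invr_ge0 exprn_ge0 // ltW.
apply: ler_wpM2r => //; apply: ler_wpM2r; first by rewrite exprn_ge0.
by rewrite mulnC exprM; apply: lerXn2r; rewrite ?nnegrE // -?natrX ler_nat fact_le_pow.
Qed.

Lemma pb_An : pb (fun _ _ _ _ _ An => An%:R).
Proof.
apply: (@pb_le _ (fun _ _ al _ _ _ => 2 * (1 / al))); first by apply: pbM; [exact: pb_cst|exact: pb_a].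
by move=> n d al tau N An [_ _ _ _ h]; rewrite ler0n mulrA mulr1.
Qed.

Theorem time_bound : exists k : nat, forall n d al tau N An, adm n d al tau N An ->
  (thc (Xbound n d N An) cAll + 40 * (N * n + N + N + 3))%:R <= time_base n d al tau ^+ (k * d).
Proof.
have pX : pb (fun n d _ _ N An => (Xbound n d N An)%:R).
  apply: (@pb_le _ (fun n d al tau N An => 3 * ((8 * An%:R) ^+ pexp * N%:R) + 1 + n%:R ^+ (4 * d) + 4 * d%:R + n%:R + (pexp + 16)%:R)).
    apply: pbD; last exact: pb_cst.
    apply: pbD; last exact: pb_n.
    apply: pbD; last by apply: pbM; [exact: pb_cst|exact: pb_d].
    apply: pbD; last exact: pb_nd.
    apply: pbD; last exact: pb_cst.
    apply: pbM; first exact: pb_cst.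
    apply: pbM; last exact: pb_N.
    by apply: pbX; apply: pbM; [exact: pb_cst|exact: pb_An].
  move=> n d al tau N An _; rewrite ler0n /= /Xbound /STv.
  have -> : (d + d + (d + d) = 4 * d)%N by lia.
  move: pexp => q; rewrite !natrD !natrM !natrX !natrM.
  have : 0 <= d%:R :> R by [].
  move: ((8%:R * An%:R) ^+ q) (n%:R ^+ (4 * d)) => x y; lra.
have [A [B hAB]] := thc_poly cAll.
have [_ [k hk]] : pb (fun n d al tau N An => (thc (Xbound n d N An) cAll + 40 * (N * n + N + N + 3))%:R).
  apply: (@pb_le _ (fun n d al tau N An => A%:R * ((Xbound n d N An)%:R + 1) ^+ B + 40 * (N%:R * n%:R + N%:R + N%:R + 3))).
    apply: pbD.
      apply: pbM; first exact: pb_cst.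
      by apply: pbX; apply: pbD => //; exact: pb_cst.
    apply: pbM; first exact: pb_cst.
    apply: pbD; last exact: pb_cst.
    apply: pbD; last exact: pb_N.
    by apply: pbD; [apply: pbM; [exact: pb_N|exact: pb_n]|exact: pb_N].
  move=> n d al tau N An _; rewrite ler0n /= natrD; apply: lerD.
    by rewrite natr1 -natrX -natrM ler_nat; exact: hAB.
  by rewrite natrM !natrD natrM.
by exists k.
Qed.

End poly.

Lemma least_pred (f : nat -> bool) k : least f k -> (0 < k)%N -> f k.-1 = false.
Proof. by move=> [_ h] k0; apply: h; rewrite ltn_predL. Qed.

Lemma An_le (al : R) An : 0 < al -> al < 2^-1 -> least (fun k => 1 <= k%:R * al) An -> An%:R <= 2 / al.
Proof.
move=> a0 a1 h; case: (posnP An) => [->|An0]; first by rewrite divr_ge0 // ltW.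
have := least_pred h An0; rewrite leNgt => /negbFE => lt; rewrite ler_pdivlMr //.
have : An%:R = An.-1%:R + 1 :> R by rewrite natr1 prednK.
by move=> ->; lra.
Qed.

Lemma lam_le (al : R) lam : 0 < al -> al < 2^-1 -> least (fun k => 1 <= 2 ^+ k * al) lam -> lam%:R <= 1 + 7 / 4 * ln al^-1.
Proof.
move=> a0 a1 h; have i1 : 1 <= al^-1 by rewrite invf_ge1 //; lra.
have l0 := ln_ge0 i1.
case: (posnP lam) => [->|l1]; first by rewrite addr_ge0 ?mulr_ge0.
have := least_pred h l1; rewrite leNgt => /negbFE => lt.
have : ln (2 ^+ lam.-1 : R) <= ln al^-1.
  by rewrite ler_ln ?posrE ?exprn_gt0 ?invr_gt0 // -[al^-1]mul1r ler_pdivlMr // ltW.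
rewrite lnXn // -[_ *+ lam.-1]mulr_natr; have := ln2_ge.
have : lam%:R = lam.-1%:R + 1 :> R by rewrite natr1 prednK.
have : 0 <= lam.-1%:R :> R by [].
move: (lam.-1%:R : R) (lam%:R : R) (ln (2 : R)) (ln al^-1) l0 => x y z w; nra.
Qed.

End bounds.

(** * Size of the error *)

Section error.
Variable R : realType.

Lemma pexpE : pexp = (16 ^ 3)%N.
Proof. by rewrite /pexp. Qed.

(** The dominant term of [err] is a multiple of [Bc * sigma / al], and [Bc] has itself a factor
    [Lc / al]: hence [al ^ 2]. The powers of [16 ^ D] split into [16 ^ (10 D)] and the fourth power
    of [16 ^ (D (kap - 1))]. *)
Lemma err_bound lam kap (al : R) D : 0 < al -> al < 2^-1 -> (1 < D)%N -> least (fun k => lam + 5 <= pexp ^ k)%N kap ->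
  err D lam (2 * kap + 1) al <= 10240 * (16 ^+ 11) ^+ D * sigma R D * ((lam + 5)%:R ^+ 2) ^+ D / al ^+ 2.
Proof.
move=> a0 a1 D1 [hk1 hk2].
case: kap hk1 hk2 => [|kap] hk1 hk2; first by move: hk1; rewrite expn0; lia.
have : (lam + 5 <= pexp ^ kap)%N = false by exact: hk2.
move/negbT; rewrite -ltnNge pexpE -expnM mulnC expnM => hlt.
set x : R := 16 ^+ kap; set l : R := (lam + 5)%:R; set s := sigma R D.
have l1 : 1 <= l by rewrite ler1n addnS.
have x1 : 1 <= x by rewrite exprn_ege1 // ler1n.
have hx : x ^+ 3 <= l by rewrite /x -!natrX ler_nat ltnW.
(* Both sides are cubed to use [x ^ 3 <= l]; it remains to compare the exponents [4 D + 3] and [6 D]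
   of [l]. *)
have hxl : (x ^+ 4) ^+ D * l <= (l ^+ 2) ^+ D.
  rewrite -(@ler_pXn2r _ 3) ?nnegrE ?mulr_ge0 ?exprn_ge0 //; try lra.
  apply: (@le_trans _ _ ((l ^+ 4) ^+ D * l ^+ 3)).
    rewrite exprMn; apply: ler_wpM2r; first by rewrite exprn_ge0 //; lra.
    rewrite -[_ ^+ D ^+ 3]exprM -[_ ^+ _ ^+ (D * 3)]exprM -[l ^+ 4 ^+ D]exprM (_ : 4 * (D * 3) = 3 * (4 * D))%N; last by lia.
    rewrite exprM; apply: lerXn2r; rewrite ?nnegrE ?exprn_ge0 //; lra.
  by rewrite -!exprM -exprD; apply: ler_weXn2l => //; lia.
have s0 : 0 <= s by rewrite /s /sigma exprn_ge0.
have al2 : 1 <= al^-1 by rewrite invf_ge1 //; lra.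
pose y := (x ^+ 4) ^+ D; have y1 : 1 <= y by rewrite /y exprn_ege1 // exprn_ege1.
pose z : R := (16 ^+ 10) ^+ D; have z1 : 1 <= z by rewrite /z exprn_ege1 // exprn_ege1 // ler1n.
have eB : Bc D lam (2 * kap.+1 + 1) al = 64 * (z * y) * Lc R lam * al^-1.
  rewrite /Bc /Hc /z /y /x.
  rewrite -[4 * _ * _]mulrA.
  have -> : (16 ^+ D * 16 ^+ D : R) ^+ (2 * kap.+1 + 1) * (16 ^+ D) ^+ 4 = (16 ^+ 10) ^+ D * ((16 ^+ kap) ^+ 4) ^+ D.
    rewrite -exprD -!exprM -!exprD; congr (_ ^+ _); lia.
  by ring.
have hL : Lc R lam <= 2 * l.
  by rewrite /Lc /l -natrM ler_nat; lia.
have L1 : 1 <= Lc R lam by rewrite /Lc ler1n; lia.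
have hp : (16 ^+ 11 : R) ^+ D = 4 ^+ D * 4 ^+ D * z by rewrite /z -!exprMn; congr (_ ^+ _); ring.
rewrite /err /rho eB -/s hp.
set f : R := 4 ^+ D; have f1 : 1 <= f by rewrite exprn_ege1 // ler1n.
rewrite -exprVn; move: (Lc R lam) al^-1 hL L1 al2 => L i hL L1 i1.
set t := 2 * (64 * (z * y) * L * i) * s.
have zy : 1 <= z * y by nra.
have zyl : 1 <= z * y * L by nra.
have zyi : 1 <= z * y * L * i by nra.
have st : 2 * s <= t * i.
  rewrite /t; have : 1 <= z * y * L * i * i by nra.
  nra.
have t0 : 0 <= t by rewrite /t; nra.
have ti0 : 0 <= t * i by nra.
have h1 : f * (f * t * (32 * i) + f * (4 * t * i + 2 * s)) <= f * f * (40 * (t * i)).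
  rewrite (_ : f * (f * t * (32 * i) + f * (4 * t * i + 2 * s)) = f * f * (36 * (t * i) + 2 * s)); last by ring.
  by rewrite ler_wpM2l //; [nra|lra].
apply: (le_trans h1).
have h2 : y * L <= 2 * (l ^+ 2) ^+ D.
  have : y * L <= y * (2 * l) by rewrite ler_wpM2l //; lra.
  move: hxl; rewrite -/y; lra.
rewrite (_ : f * f * (40 * (t * i)) = (5120 * (f * f * z) * s * i ^+ 2) * (y * L)); last by rewrite /t; ring.
rewrite (_ : 10240 * (f * f * z) * s * (l ^+ 2) ^+ D * i ^+ 2 = (5120 * (f * f * z) * s * i ^+ 2) * (2 * (l ^+ 2) ^+ D)); last by ring.
have c0 : 0 <= 5120%:R :> R by exact: ler0n.
have w0 : 0 <= f * f * z by nra.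
have e0 : 0 <= i ^+ 2 by exact: sqr_ge0.
exact: (ler_wpM2l (mulr_ge0 (mulr_ge0 (mulr_ge0 c0 w0) s0) e0) h2).
Qed.

(** [cerr ^ 2 = 16 ^ 18] covers the constants [16 ^ 2], [16 ^ 11], [136] and [49] of the error
    bound, each taken to the power [D], and the lower bound [1 / 16] of
    [ln (2 + ln (1 / al)) ^ 4]. *)
Definition cerr : R := 16 ^+ 9.

Lemma error_scale_pow d (al : R) : (0 < d)%N -> 0 < al -> al < 2^-1 ->
  error_scale d al ^+ (2 * (d + d)) = al ^- 2 * d%:R ^+ (d + d) * ((d%:R + ln al^-1) ^+ 2) ^+ (d + d) *
    (ln (2 + ln al^-1) ^+ 4) ^+ (d + d).
Proof.
move=> d0 a0 a1; rewrite /error_scale !exprMn.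
have -> : (al `^ (- (2 * d%:R)^-1)) ^+ (2 * (d + d)) = al ^- 2.
  rewrite -powR_mulrn ?powR_ge0 // -powRrM.
  have -> : - (2 * d%:R)^-1 * (2 * (d + d))%:R = - (2%:R : R).
    by rewrite natrM natrD; field; rewrite pnatr_eq0 -lt0n.
  by rewrite powRN powR_mulrn // ltW.
have -> : Num.sqrt (d%:R : R) ^+ (2 * (d + d)) = d%:R ^+ (d + d) by rewrite exprM sqr_sqrtr.
by rewrite -?exprM -?exprD; congr (_ * _ * _ ^+ _ * _ ^+ _); lia.
Qed.

Lemma err_combine (t x q sg y l z i : R) : 0 <= t -> t <= x -> 0 <= q -> 0 <= sg -> sg <= y -> 0 <= l -> l <= z ->
  0 <= i -> t * q * sg * l * i <= x * q * y * z * i.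
Proof.
move=> t0 tx q0 s0 sy l0 lz i0; apply: ler_wpM2r => //; apply: ler_pM => //; first by rewrite !mulr_ge0.
by apply: ler_pM => //; [rewrite mulr_ge0|apply: ler_wpM2r].
Qed.

Lemma err_scale d lam kap (al : R) : (0 < d)%N -> 0 < al -> al < 2^-1 ->
  least (fun k => 1 <= 2 ^+ k * al) lam -> least (fun k => lam + 5 <= pexp ^ k)%N kap ->
  err (d + d) lam (2 * kap + 1) al <= (cerr * error_scale d al) ^+ (2 * (d + d)).
Proof.
move=> d0 a0 a1 hl hk; have ES := error_scale_pow d0 a0 a1; move: ES; set D := (d + d)%N => ES.
have D1 : (1 < D)%N by rewrite /D; lia.
apply: (le_trans (err_bound a0 a1 D1 hk)).
rewrite [X in _ <= X]exprMn ES.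
have hlam := lam_le a0 a1 hl.
have i1 : 1 <= al^-1 by rewrite invf_ge1 //; lra.
have ln0 := ln_ge0 i1; set u := ln al^-1 in hlam ln0 *.
have d1 : 1 <= d%:R :> R by rewrite ler1n.
have hl7 : (lam + 5)%:R <= 7 * (d%:R + u) by rewrite natrD; lra.
have hq : (16^-1 : R) <= ln (2 + u) ^+ 4.
  have : 4 / 7 <= ln (2 + u) by apply: (le_trans (ln2_ge R)); rewrite ler_ln ?posrE; lra.
  move=> h; apply: (@le_trans _ _ ((4 / 7) ^+ 4)); first by lra.
  by apply: lerXn2r; rewrite ?nnegrE //; lra.
have E1 : (10240 : R) <= (16 ^+ 2) ^+ D.
  apply: (@le_trans _ _ ((16 ^+ 2) ^+ 2)); first by lra.
  by apply: ler_weXn2l => //; lra.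
have E2 : sigma R D <= (136 ^+ D) * d%:R ^+ D.
  have e : (68 * D)%:R = 136 * d%:R :> R by rewrite natrM /D natrD; lra.
  by rewrite /sigma e exprMn.
have E3 : ((lam + 5)%:R ^+ 2) ^+ D <= (49 : R) ^+ D * ((d%:R + u) ^+ 2) ^+ D.
  have v0 : 0 <= d%:R + u by lra.
  rewrite -exprMn; apply: lerXn2r; rewrite ?nnegrE.
  - by apply: exprn_ge0; exact: ler0n.
  - by apply: mulr_ge0; [exact: ler0n|exact: exprn_ge0].
  have : 0 <= (lam + 5)%:R :> R by exact: ler0n.
  move: ((lam + 5)%:R : R) (d%:R + u) hl7 v0 => q v; clear=> *; rewrite !expr2; nra.
have E4 : (16^-1 : R) ^+ D <= (ln (2 + u) ^+ 4) ^+ D.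
  by apply: lerXn2r; rewrite ?nnegrE //; lra.
have E5 : (16 ^+ 2) ^+ D * (16 ^+ 11) ^+ D * 136 ^+ D * 49 ^+ D <= cerr ^+ (2 * D) * (16^-1) ^+ D.
  have n0 (k : nat) : (0 : R) <= k%:R by exact: ler0n.
  rewrite exprM -!exprMn; apply: lerXn2r; rewrite ?nnegrE.
  - by apply: mulr_ge0; [apply: mulr_ge0; [apply: mulr_ge0; apply: exprn_ge0|]|]; exact: n0.
  - by apply: mulr_ge0; [apply: exprn_ge0; apply: exprn_ge0; exact: n0|rewrite invr_ge0; exact: n0].
  have -> : cerr ^+ 2 = 16 ^+ 2 * 16 ^+ 11 * (16 ^+ 4 * 16) by rewrite /cerr -exprM -exprSr -!exprD.
  have h16 : (16 : R) != 0 by rewrite pnatr_eq0.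
  rewrite -[X in _ <= X]mulrA (mulfK h16).
  have : (0 : R) <= 16 ^+ 2 * 16 ^+ 11 by apply: mulr_ge0; apply: exprn_ge0; exact: ler0n.
  move: (16 ^+ 2 * 16 ^+ 11 : R) => g g0; rewrite -[X in X <= _]mulrA.
  by apply: (ler_wpM2l g0); lra.
set B := ((d%:R + u) ^+ 2) ^+ D in E3 *; set C := d%:R ^+ D in E2 *; set i := al ^- 2.
have B0 : 0 <= B by apply: exprn_ge0; apply: exprn_ge0; lra.
have C0 : 0 <= C by apply: exprn_ge0; lra.
have i0 : 0 <= i by rewrite invr_ge0 exprn_ge0 // ltW.
apply: (@le_trans _ _ (((16 ^+ 2) ^+ D * (16 ^+ 11) ^+ D * 136 ^+ D * 49 ^+ D) * (C * B * i))).
  rewrite (_ : _ * (C * B * i) = (16 ^+ 2) ^+ D * (16 ^+ 11) ^+ D * (136 ^+ D * C) * (49 ^+ D * B) * i); last by ring.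
  have n0 (k : nat) : (0 : R) <= k%:R by exact: ler0n.
  apply: (err_combine (n0 _) E1 _ _ E2 _ E3 i0); last 2 first.
  - by apply: exprn_ge0; exact: n0.
  - by apply: exprn_ge0; apply: exprn_ge0; exact: n0.
  by apply: exprn_ge0; apply: exprn_ge0; exact: n0.
apply: (@le_trans _ _ (cerr ^+ (2 * D) * (16^-1) ^+ D * (C * B * i))).
  by apply: ler_wpM2r E5; apply: mulr_ge0 i0; exact: mulr_ge0.
rewrite (_ : cerr ^+ (2 * D) * (16^-1) ^+ D * (C * B * i) = cerr ^+ (2 * D) * (i * C * B * (16^-1) ^+ D)); last by ring.
apply: ler_wpM2l; first by apply: exprn_ge0; apply: exprn_ge0; exact: ler0n.
by apply: ler_wpM2l E4; apply: mulr_ge0 B0; exact: mulr_ge0.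
Qed.

Lemma norm2_le n (x mu : 'rV[R]_n) D (c : R) : (0 < D)%N -> 0 <= c ->
  sq n (fun j => coord x j - coord mu j) ^+ D <= c ^+ (2 * D) -> norm2 (x - mu) <= c.
Proof.
move=> D0 c0 h; rewrite /norm2.
have -> : \sum_(j < n) (x - mu) ord0 j ^+ 2 = sq n (fun j => coord x j - coord mu j).
  by apply: eq_bigr => j _; rewrite !mxE !coordE expr2.
rewrite -(@ler_pXn2r _ (2 * D)) ?nnegrE ?sqrtr_ge0 //; last by rewrite muln_gt0.
rewrite [X in X <= _]exprM sqr_sqrtr //; exact: sq_ge0.
Qed.

End error.

(** * The theorem *)

Import HBNNSimple.

(* [f] is not assumed to be measurable: the probability of success of the program
   need not be a measurable function of the sample. *)
Lemma ge_indic_integral d (U : measurableType d) (R : realType) (P : probability U R) (Ev : set U) (f : U -> R) :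
  measurable Ev -> (forall o, 0 <= f o) -> (forall o, Ev o -> 1 <= f o) -> (P Ev <= \int[P]_o (f o)%:E)%E.
Proof.
move=> mE f0 f1; rewrite ge0_integralTE; last by move=> o; rewrite lee_fin.
have -> : P Ev = sintegral P (indic_nnsfun R mE) by rewrite sintegral_indic // setIT.
apply: ereal_sup_ubound => /=; exists (indic_nnsfun R mE) => // o /=.
have -> : mindic R mE o = \1_Ev o by [].
rewrite lee_fin indicE; case: (boolP (o \in Ev)) => [/set_mem h|_]; [exact: f1|exact: f0].
Qed.

Section scale.
Variable R : realType.

(** Six of the seven powers of [1 / al > 2] are worth the factor 64 of the block size. *)
Lemma sample_scale_ge n d (al tau : R) : (0 < n)%N -> (0 < d)%N -> 0 < al < 2^-1 ->
  64 * (n%:R ^+ (4 * d) * log_inv tau) / al <= sample_scale n d al tau.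
Proof.
move=> n0 d0 /andP[a0 a1]; have l := log_inv_ge tau; rewrite /sample_scale.
have f1 : 1 <= (d`!)%:R ^+ 2 :> R by rewrite exprn_ege1 // ler1n fact_gt0.
have n1 : 1 <= n%:R ^+ (4 * d) :> R by rewrite exprn_ege1 // ler1n.
have i2 : 2 <= al^-1 by rewrite -[2]invrK lef_pV2 ?posrE // ltW.
rewrite -exprVn; set i := al^-1 in i2 *; set y := n%:R ^+ _ in n1 *; set w := log_inv tau in l *; set f := _ ^+ 2 in f1 *.
have i6 : 64 <= i ^+ 6.
  by apply: (@le_trans _ _ (2 ^+ 6)); [lra|apply: lerXn2r; rewrite ?nnegrE //; lra].
have yw0 : 0 <= y * w by nra.
rewrite exprS mulrA -[f * y * w]mulrA.
have i0 : 0 <= i by lra.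
have h1 : y * w * i <= f * (y * w) * i by apply: ler_wpM2r => //; rewrite ler_peMl.
have h2 : 0 <= y * w * i by exact: mulr_ge0.
apply: (@le_trans _ _ (i ^+ 6 * (y * w * i))).
  have -> : 64 * y * w * i = 64 * (y * w * i) by ring.
  by rewrite ler_wpM2r.
rewrite (_ : f * (y * w) * (i * i ^+ 6) = i ^+ 6 * (f * (y * w) * i)); last by ring.
by apply: ler_wpM2l h1; rewrite exprn_ge0.
Qed.

(** [ln 4 >= 8 / 7 >= 1], so [G] blocks with [G >= log_inv tau] give failure probability at most
    [tau]. *)
Lemma log_inv_pow (tau : R) G : 0 < tau -> log_inv tau <= G%:R -> (4^-1) ^+ G <= tau.
Proof.
move=> t0 h; have l2 := ln2_ge R.
have m0 : 0 < Num.max 2 tau^-1 by rewrite lt_max ltr0Sn.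
have l4 : ln ((4 : R) ^+ G) = 2 * ln 2 * G%:R.
  rewrite lnXn // -[_ *+ G]mulr_natr; congr (_ * _).
  have -> : (4 : R) = 2 * 2 by ring.
  by rewrite lnM ?posrE //; ring.
have hm : Num.max 2 tau^-1 <= 4 ^+ G.
  rewrite -ler_ln ?posrE ?exprn_gt0 // l4; apply: (le_trans h).
  by have : 0 <= G%:R :> R by []; nra.
rewrite exprVn -[tau]invrK lef_pV2 ?posrE ?exprn_gt0 ?invr_gt0 //.
by apply: le_trans hm; rewrite le_max lexx orbT.
Qed.

Lemma error_scale_ge0 d (al : R) : 0 < al -> al < 2^-1 -> 0 <= error_scale d al.
Proof.
move=> a0 a1; rewrite /error_scale; apply: mulr_ge0; last exact: sqr_ge0.
apply: mulr_ge0; first by rewrite mulr_ge0 ?powR_ge0 ?sqrtr_ge0.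
by apply: addr_ge0 => //; apply: ln_ge0; rewrite invf_ge1 //; lra.
Qed.

Lemma run_ok n d (al tau : R) N (T : seq 'rV[R]_n) w c1 k :
  (forall n d al tau N An, adm c1 n d al tau N An ->
    (thc (Xbound n d N An) cAll + 40 * (N * n + N + N + 3))%:R <= time_base n d al tau ^+ (k * d)) ->
  (0 < n)%N -> (0 < d)%N -> 0 < al < 2^-1 -> 16 / al <= N%:R -> N%:R <= c1 * sample_scale n d al tau -> size T = N ->
  exists t L, [/\ returns (program 21 cAll) d al tau T w t L, t%:R <= time_base n d al tau ^+ (k * d),
    (size L)%:R <= 16 / al &
    forall S0 mu, good_data n (d + d) N al (fun i => coord (nth 0 T i)) S0 (coord mu) ->
      exists2 x, x \in L & norm2 (x - mu) <= cerr R * error_scale d al].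
Proof.
move=> hk n0 d0 a h16 hN sT; have /andP[a0 a1] := a; rewrite -sT in h16.
have [lam [An [kap [t [L [[hl hA hkp] [h1 h2 h3 h4]]]]]]] := algorithm_ok tau w n0 d0 a0 a1 h16.
exists t, L; split=> //.
  apply: le_trans (hk n d al tau N An _); first by rewrite ler_nat -sT.
  by split=> //; exact: An_le a0 a1 hA.
move=> S0 mu hgd; rewrite -sT in hgd; have [x xL hx] := h4 S0 mu hgd; exists x => //.
have D0 : (0 < d + d)%N by rewrite addn_gt0 d0.
apply: (norm2_le D0); first by apply: mulr_ge0; [apply: exprn_ge0; exact: ler0n|exact: error_scale_ge0].
exact: le_trans hx (err_scale d0 a0 a1 hl hkp).
Qed.

End scale.

Theorem theorem3p1 (R : realType) :
  exists (prog : cmd) (c0 c_list c_err : R),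
    [/\ 0 < c0, 0 < c_list & 0 < c_err] /\
    forall c1 : R, exists k : nat,
    forall (n d : nat) (alpha tau : R) (N : nat),
      (0 < n)%N -> (0 < d)%N -> 0 < alpha < 2^-1 -> 0 < tau ->
      c0 * sample_scale n d alpha tau <= N%:R <= c1 * sample_scale n d alpha tau ->
      (* running time and size of the list, for every input and all coins *)
      (forall (T : seq 'rV[R]_n) (w : nat -> bool), size T = N ->
         exists (t : nat) (L : seq 'rV[R]_n),
           [/\ returns prog d alpha tau T w t L,
               t%:R <= time_base n d alpha tau ^+ (k * d)
             & (size L)%:R <= c_list / alpha]) /\
      (* accuracy: [X] are the good samples, [T] is the corrupted input *)
      (forall (dO : measure_display) (Omega : measurableType dO)
              (P : probability Omega R) (mu : 'rV[R]_n) (m : nat)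
              (X : 'I_m -> Omega -> 'rV[R]_n) (T : Omega -> seq 'rV[R]_n) (b : nat),
         gaussian_samples P mu X ->
         2 * alpha * N%:R <= m%:R ->
         (forall o, size (T o) = N /\
            exists bad : seq 'rV[R]_n,
              perm_eq (T o) ([seq X i o | i : 'I_m] ++ bad)) ->
         time_base n d alpha tau ^+ (k * d) <= b%:R ->
         ((1 - tau)%:E <=
           \int[P]_o (coin_prob prog d alpha tau (T o) b
             (fun L => exists2 x, x \in L &
                         norm2 (x - mu) <= c_err * error_scale d alpha))%:E)%E).
Proof.
exists (program 21 cAll), 28, 16, (cerr R); split.
  by split; [exact: ltr0Sn|exact: ltr0Sn|apply: exprn_gt0; exact: ltr0Sn].
move=> c1; have [k hk] := time_bound c1; exists k => n d alpha tau N n0 d0 ha t0 /andP[hN1 hN2].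
have /andP[a0 a1] := ha; have hS := sample_scale_ge tau n0 d0 ha; have hl := log_inv_ge tau.
have n1 : 1 <= n%:R ^+ (4 * d) :> R by rewrite exprn_ege1 // ler1n.
set y := n%:R ^+ (4 * d) in n1 hS.
have hN3 : 28 * (64 * (y * log_inv tau) / alpha) <= N%:R.
  by apply: le_trans hN1; apply: ler_wpM2l hS; exact: ler0n.
have hyl : 4 / 7 <= y * log_inv tau by nra.
have h16 : 16 / alpha <= N%:R.
  apply: le_trans hN3; have : 0 < alpha^-1 by rewrite invr_gt0.
  move: (alpha^-1) (y * log_inv tau) hyl => i z hz i0; nra.
have ok T w (sT : size T = N) := run_ok w hk n0 d0 ha h16 hN2 sT.
split=> [T w sT|dO Omega P mu m X T b hX hm hT hb].
  by have [t [L [h1 h2 h3 _]]] := ok T w sT; exists t, L.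
pose G := (Num.truncn (log_inv tau)).+1.
have G1 : log_inv tau <= G%:R by apply: ltW; exact: truncnS_gt.
have G2 : G%:R <= log_inv tau + 1.
  by rewrite /G -natr1 lerD2r truncn_le; lra.
(* There are at least [2 alpha N >= 3584 y log_inv tau] samples and [64 G y] are needed, where [G <=
   log_inv tau + 1 <= (11 / 4) log_inv tau] because [log_inv tau >= 4 / 7]. *)
have hGm : (G * (64 * n ^ (d + d + (d + d))) <= m)%N.
  have e4 : (d + d + (d + d) = 4 * d)%N by clear; lia.
  have eG : (G * (64 * n ^ (4 * d)))%:R = G%:R * (64 * y) :> R by rewrite natrM natrM natrX.
  rewrite e4 -(@ler_nat R) eG; apply: le_trans hm.
  have a2 : 0 <= 2 * alpha by apply: mulr_ge0; [exact: ler0n|exact: ltW].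
  apply: le_trans (ler_wpM2l a2 hN3).
  rewrite (_ : 2 * alpha * (28 * (64 * (y * log_inv tau) / alpha)) = 3584 * (y * log_inv tau)); last by field; rewrite gt_eqF.
  have y0 : 0 <= y by apply: le_trans n1; exact: ler01.
  have h1 : G%:R * y <= (log_inv tau + 1) * y by rewrite ler_wpM2r.
  have h2 : 0 <= (log_inv tau - 4 / 7) * y by apply: mulr_ge0 y0; rewrite subr_ge0.
  move: (G%:R : R) (log_inv tau) (y) h1 h2 y0 => g l z; clear=> *; nra.
have D0 : (0 < d + d)%N by rewrite addn_gt0 d0.
have [Ev mEv [hEv hgood]] := good_samples n0 D0 (ltn0Sn _) a0 hX hm hGm hT.
apply: (@le_trans _ _ (P Ev)).
  by apply: le_trans hEv; rewrite lee_fin lerD2l lerN2; exact: log_inv_pow.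
apply: ge_indic_integral => // o; first by rewrite /coin_prob divr_ge0 ?exprn_ge0.
move=> ho; have [S0 hS0] := hgood o ho; have [sT _] := hT o.
(* On the good event the run succeeds whatever the coins, so all tuples of [b] coins are counted and
   the inner probability is 1. *)
rewrite /coin_prob (_ : [set w | _]%SET = [set: b.-tuple bool]%SET).
  by rewrite cardsT card_tuple card_bool natrX divff // expf_neq0 // pnatr_eq0.
apply/setP => w; rewrite !inE; apply/asboolP.
have [t [L [h1 _ _ h4]]] := ok (T o) (nth false w) sT.
by exists t, L; split=> //; exact: h4 hS0.
Qed.
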